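(* Let $2\le k\le n-1$ and $f=f_{k,n}$. Let $\Theta=\{\theta\in\mathbb R^n:\ \theta\text{ is }f\text{-admissible and }\theta_1=0\}$. Then the map $\theta\mapsto \mathrm{Meas}(f,\theta)$ is a homeomorphism $\Theta\xrightarrow{\sim}\mathrm{Crit}^{>0}_{f_{k,n}}$, and $\mathrm{Crit}^{>0}_{f_{k,n}}\cong\mathbb R_{>0}^{\,n-1}$. Moreover the Zariski closure of $\mathrm{Crit}^{>0}_{f_{k,n}}$ in $\mathrm{Gr}(k,n)$ has complex dimension $n-1$. For $k=1$ or $k=n$, $\mathrm{Crit}^{>0}_{f_{k,n}}$ is a single point.
   Context: Notation: $[n]=\{1,\dots,n\}$. $\mathrm{Gr}(k,n)$ is the Grassmannian of $k$-dimensional subspaces of $\mathbb C^n$; a point is the row span of a full-rank $k\times n$ matrix, and its Plücker coordinates $(\Delta_I)_{I\in\binom{[n]}{k}}$ (the maximal minors) are defined up to a common nonzero scalar. $\mathrm{Gr}_{\ge0}(k,n)$ is the set of points whose Plücker coordinates can be chosen all real and $\ge0$. Bounded affine permutations: a $(k,n)$-bounded affine permutation is a bijection $f:\mathbb Z\to\mathbb Z$ with $f(j+n)=f(j)+n$ and $j\le f(j)\le j+n$ for all $j$, and $\sum_{j=1}^n(f(j)-j)=kn$. $f$ is loopless if $f(p)>p$ for all $p$. $\bar f\in S_n$ is defined by $\bar f(p)\equiv f(p)\pmod n$. $f_{k,n}(p)=p+k$ for all $p$. The length $\ell(f)$ is the number of pairs $(s,t)\in[n]\times\mathbb Z$ with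 $s<t$ and $f(s)>f(t)$. Reduced graphs: a planar bipartite graph $G$ embedded in a disk, vertices colored black/white with edges joining different colors, with boundary vertices $b_1,\dots,b_n$ on the boundary circle in clockwise order, all black of degree 1 (all other vertices interior); we assume $G$ has an almost perfect matching (a set of edges using every interior vertex exactly once and some subset of boundary vertices), every connected component contains a boundary vertex, and every interior vertex of degree 1 is adjacent to a boundary vertex. A strand is a path turning maximally right at black vertices and maximally left at white vertices. If the strand starting at $b_p$ ends at $b_{p'}$, $f_G(p)$ is the integer in $\{p+1,\dots,p+n\}$ congruent to $p'$ mod $n$, extended by $f_G(p+n)=f_G(p)+n$; all almost perfect matchings use the same number $k$ of boundary vertices and $f_G$ is a loopless $(k,n)$-bounded affine permutation. $G$ is reduced if it has exactly $k(n-k)+1-\ell(f_G)$ faces; $\mathcal G_{\rm red}(f)$ denotes the (nonempty, for loopless $f$) set of reduced graphs with $f_G=f$. An edge $e$ is labeled by $\{p,q\}$ if the two strands through $e$ end at $b_p$ and $b_q$. For $\mathrm{wt}:E(G)\to\mathbb C$, $\Delta_I(G,\mathrm{wt})=\sum_{A}\prod_{e\in A}\mathrm{wt}(e)$, the sum over almost perfect matchings $A$ whose set of used boundary indices $\{p: b_p\text{ used by }A\}$ equals $I$; when these are not all zero, $\mathrm{Meas}(G,\mathrm{wt})\in\mathrm{Gr}(k,n)$ is the point with Plücker coordinates $(\Delta_I(G,\mathrm{wt}))_I$. Strand diagram and admissibility: place $b_1,\dots,b_n$ clockwise on a circle, and points $p^-$ just before and $p^+$ just after $b_p$ in clockwise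 order. For loopless $f$, the reduced strand diagram $D_f$ consists of the straight arrows $S_p:s^+\to p^-$, $p\in[n]$, where $s=\bar f^{-1}(p)$. Distinct $p,q\in[n]$ form an $f$-crossing if $S_p$ and $S_q$ intersect. $\theta\in\mathbb R^n$ is $f$-admissible if $\theta_p<\theta_q<\theta_p+\pi$ whenever $1\le p<q\le n$ form an $f$-crossing. Critical weights: for $G\in\mathcal G_{\rm red}(f)$, $\mathrm{wt}_\theta(e)=\sin(\theta_q-\theta_p)$ if $e$ is labeled by $\{p,q\}$, $p<q$, and $e$ is not incident to a boundary vertex, and $\mathrm{wt}_\theta(e)=1$ if $e$ is incident to a boundary vertex. For $f$-admissible $\theta$, $\mathrm{Meas}(G,\mathrm{wt}_\theta)$ is defined, lies in $\mathrm{Gr}_{\ge0}(k,n)$, and does not depend on $G\in\mathcal G_{\rm red}(f)$; it is denoted $\mathrm{Meas}(f,\theta)$. The critical cell is $\mathrm{Crit}^{>0}_f=\{\mathrm{Meas}(f,\theta):\theta\ f\text{-admissible}\}$. *)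

(* Defs.v *)
From HB Require Import structures.
From mathcomp Require Import all_boot all_order all_algebra all_fingroup.
From mathcomp Require Import finmap.
From mathcomp Require Import boolp classical_sets cardinality reals.
From mathcomp Require Import trigo.
From mathcomp Require Import complex.

Set Implicit Arguments.
Unset Strict Implicit.
Unset Printing Implicit Defensive.

Import Order.TTheory GRing.Theory Num.Theory.
Local Open Scope ring_scope.

(* Conventions.  Indices are 0-based: p : 'I_n stands for the paper's       *)
(* index p+1 in [n].  A Pluecker vector is a function {set 'I_n} -> field;  *)
(* only the entries indexed by k-subsets are used as coordinates.           *)

Definition fkn (k : nat) : int -> int := fun j => j + k%:Z.

Definition aff_length (n : nat) (f : int -> int) : nat :=
  (#|` fset_set [set st : int * int |
        ([/\ 1 <= st.1, st.1 <= n%:Z, st.1 < st.2 & f st.2 < f st.1])%R] |)%N.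

(* positions on the circle, clockwise: p^- = 3p, b_p = 3p+1, p^+ = 3p+2 *)
Definition pos_minus (p : nat) : nat := 3 * p.
Definition pos_plus (p : nat) : nat := 3 * p + 2.

(* two straight chords {a,b} and {c,d} (four distinct points on a circle)
   intersect iff their endpoints interleave *)
Definition chords_cross (a b c d : nat) : bool :=
  let lo := minn a b in let hi := maxn a b in
  (((lo < c) && (c < hi)) != ((lo < d) && (d < hi)))%N.

(* S_p is the arrow s^+ -> p^- where bar f(s) = p, i.e. f(s) = p mod n *)
Definition f_crossing (n : nat) (f : int -> int) (p q : 'I_n) : Prop :=
  p != q /\
  exists s t : 'I_n,
    (f (s.+1)%:Z = (p.+1)%:Z %[mod n%:Z])%Z /\
    (f (t.+1)%:Z = (q.+1)%:Z %[mod n%:Z])%Z /\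
    chords_cross (pos_plus s) (pos_minus p) (pos_plus t) (pos_minus q).

Definition admissible (R : realType) (n : nat) (f : int -> int)
    (theta : 'I_n -> R) : Prop :=
  forall p q : 'I_n, (p < q)%N -> f_crossing f p q ->
    theta p < theta q /\ theta q < theta p + pi.

(* A graph embedded in the disk, given combinatorially by darts (half
   edges): [alpha] exchanges the two darts of an edge, [sigma] is the
   clockwise rotation of darts around their common vertex [tail],
   [black] is the colouring and [bnd p] is the boundary vertex b_p. *)
Record diskgraph (n : nat) := DiskGraph {
  dart : finType;
  vert : finType;
  alpha : {perm dart};
  sigma : {perm dart};
  tail : dart -> vert;
  black : pred vert;
  bnd : 'I_n -> vert
}.
Arguments dart {n} d : rename.
Arguments vert {n} d : rename.
Arguments alpha {n} d : rename.
Arguments sigma {n} d : rename.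
Arguments tail {n} d _ : rename.
Arguments black {n} d : rename.
Arguments bnd {n} d _ : rename.

Section DiskGraphDefs.
Variables (n : nat) (G : diskgraph n).

Definition is_bnd (v : vert G) : bool := [exists p, bnd G p == v].

Definition adjG : rel (vert G) :=
  fun v w => [exists d, (tail G d == v) && (tail G (alpha G d) == w)].

(* extended rotation system: G together with the boundary circle, whose
   arcs are darts inr (p, true) (from b_p towards b_{p+1}) and
   inr (p, false) (from b_p towards b_{p-1}) *)
Definition ext_dart := (dart G + ('I_n * bool))%type.

Definition ext_alpha (x : ext_dart) : ext_dart :=
  match x with
  | inl d => inl (alpha G d)
  | inr (p, true) => inr (ordS p, false)
  | inr (p, false) => inr (ord_pred p, true)
  end.

(* clockwise at b_p : arc to b_{p+1}, then the edge of G, then arc to b_{p-1} *)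
Definition ext_sigma (x : ext_dart) : ext_dart :=
  match x with
  | inl d => match [pick p | bnd G p == tail G d] with
             | Some p => inr (p, false)
             | None => inl (sigma G d)
             end
  | inr (p, false) => inr (p, true)
  | inr (p, true) => match [pick d | tail G d == bnd G p] with
                     | Some d => inl d
                     | None => inr (p, false)
                     end
  end.

Definition ext_face_perm (x : ext_dart) : ext_dart := ext_sigma (ext_alpha x).

(* faces of G in the disk = faces of (G + circle) on the sphere, minus the
   outer face *)
Definition disk_faces : nat := (fcard ext_face_perm predT).-1.

(* almost perfect matchings, as alpha-closed sets of darts *)
Definition is_apm (A : {set dart G}) : bool :=
  [forall d, (d \in A) == (alpha G d \in A)] &&
  [forall v, ~~ is_bnd v ==> (#|[set d in A | tail G d == v]| == 1)%N] &&
  [forall p, (#|[set d in A | tail G d == bnd G p]| <= 1)%N].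

Definition used_bnd (A : {set dart G}) : {set 'I_n} :=
  [set p | [exists d in A, tail G d == bnd G p]].

Definition wf_diskgraph : Prop :=
  [/\ (forall d, alpha G (alpha G d) = d /\ alpha G d != d),
      (forall d, tail G (sigma G d) = tail G d),
      (forall d d', tail G d = tail G d' -> fconnect (sigma G) d d'),
      (forall d, black G (tail G d) != black G (tail G (alpha G d))) &
      injective (bnd G)]
  /\ [/\ (forall p, black G (bnd G p)),
      (forall p, exists d, forall d', tail G d' = bnd G p <-> d' = d),
      (forall v, exists p, connect adjG v (bnd G p)),
      (forall v, ~~ is_bnd v -> #|[set d | tail G d == v]| = 1%N ->
         exists d, tail G d = v /\ is_bnd (tail G (alpha G d))) &
      (exists A, is_apm A)]
  (* genus 0 (Euler's formula) for G together with the boundary circle *)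
  /\ (#|vert G|%:Z - ((#|dart G| %/ 2)%N + n)%:Z
         + (fcard ext_face_perm predT)%:Z = 2)%R.

(* strands: turn maximally right (counterclockwise neighbour) at black
   vertices and maximally left (clockwise neighbour) at white vertices *)
Definition strand_next (d : dart G) : dart G :=
  let e := alpha G d in
  if black G (tail G e) then (sigma G)^-1%g e else sigma G e.

Definition strand_end (d : dart G) (q : 'I_n) : Prop :=
  exists m, tail G (alpha G (iter m strand_next d)) = bnd G q /\
    forall m', (m' < m)%N ->
      ~~ is_bnd (tail G (alpha G (iter m' strand_next d))).

Definition strand_perm_is (f : int -> int) : Prop :=
  forall p (d : dart G), tail G d = bnd G p ->
    (exists q, strand_end d q) /\
    forall q, strand_end d q -> (f (p.+1)%:Z = (q.+1)%:Z %[mod n%:Z])%Z.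

Definition Delta (F : pzRingType) (wt : dart G -> F) (I : {set 'I_n}) : F :=
  \sum_(A : {set dart G} | is_apm A && (used_bnd A == I))
     \prod_(d in A | black G (tail G d)) wt d.

Definition crit_weight (R : realType) (theta : 'I_n -> R)
    (wt : dart G -> R) : Prop :=
  forall d,
    (is_bnd (tail G d) || is_bnd (tail G (alpha G d)) -> wt d = 1) /\
    (~~ is_bnd (tail G d) -> ~~ is_bnd (tail G (alpha G d)) ->
      forall p q, strand_end d p -> strand_end (alpha G d) q ->
        wt d = (if (p <= q)%N then sin (theta q - theta p)
                else sin (theta p - theta q))).

End DiskGraphDefs.
Arguments crit_weight {n} G {R} theta wt.
Arguments Delta {n} G {F} wt I.

Definition reduced_for (n k : nat) (f : int -> int) (G : diskgraph n) : Prop :=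
  wf_diskgraph G /\ strand_perm_is G f /\
  ((disk_faces G)%:Z = (k * (n - k))%N%:Z + 1 - (aff_length n f)%:Z)%R.

Definition IsMeas (R : realType) (n k : nat) (f : int -> int)
    (theta : 'I_n -> R) (P : {set 'I_n} -> R) : Prop :=
  (exists I, P I != 0) /\
  exists G : diskgraph n, reduced_for k f G /\
    exists wt, crit_weight G theta wt /\ P = Delta G wt.

Definition Crit (R : realType) (n k : nat) (f : int -> int) :
    set ({set 'I_n} -> R) :=
  [set P | exists theta, admissible f theta /\ IsMeas k f theta P].

Definition toC (R : realType) (n : nat) (P : {set 'I_n} -> R) :
    {set 'I_n} -> R[i] := fun I => (P I)%:C%C.

Definition projeq (R : realType) (n : nat) (P Q : {set 'I_n} -> R[i]) : Prop :=
  exists c : R[i], c != 0 /\ forall I, Q I = c * P I.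

Definition cabs2 (R : realType) (z : R[i]) : R :=
  (complex.Re z) ^+ 2 + (complex.Im z) ^+ 2.

(* chordal (Fubini-Study sine) distance on projective space; the topology of
   Gr(k,n) is the subspace topology of the Pluecker embedding *)
Definition pdist (R : realType) (n : nat) (P Q : {set 'I_n} -> R[i]) : R :=
  let ip := \sum_I P I * (conjc (Q I)) in
  let nP := \sum_I cabs2 (P I) in
  let nQ := \sum_I cabs2 (Q I) in
  Num.sqrt (1 - cabs2 ip / (nP * nQ)).

(* F : ('I_m -> R) -> Pluecker vectors (a relation, since Meas is defined
   only up to the choice of a reduced graph) is a homeomorphism from the
   domain D onto the set S of points of Gr(k,n) *)
Definition gr_homeo (R : realType) (m n : nat) (D : set ('I_m -> R))
    (F : ('I_m -> R) -> ({set 'I_n} -> R) -> Prop)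
    (S : set ({set 'I_n} -> R)) : Prop :=
  [/\ forall x, D x -> exists P, F x P,
      forall x P, D x -> F x P -> S P,
      forall P, S P -> exists x P', [/\ D x, F x P' & projeq (toC P) (toC P')],
      forall x x' P P', D x -> D x' -> F x P -> F x' P' ->
        projeq (toC P) (toC P') -> x = x' &
      (forall x e, D x -> 0 < e -> exists2 dl, 0 < dl &
         forall x' P P', D x' -> F x P -> F x' P' ->
           (forall i, `|x i - x' i| < dl) -> pdist (toC P) (toC P') < e) /\
      (forall x e, D x -> 0 < e -> exists2 dl, 0 < dl &
         forall x' P P', D x' -> F x P -> F x' P' ->
           pdist (toC P) (toC P') < dl -> forall i, `|x i - x' i| < e)].

Definition ksubsets (n k : nat) : {set {set 'I_n}} := [set I : {set 'I_n} | #|I| == k].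

(* the Pluecker coordinates x_J (J a set of k-subsets) are algebraically
   independent on S: no nonzero homogeneous polynomial (coefficient
   function c on the monomials of degree d in the variables x_J) with
   complex coefficients vanishes on S *)
Definition zar_indep (R : realType) (n : nat) (S : set ({set 'I_n} -> R))
    (J : {set {set 'I_n}}) : Prop :=
  forall (d : nat) (c : {ffun {ffun {set 'I_n} -> 'I_d.+1} -> R[i]}),
    (forall mon, c mon != 0 ->
       ((\sum_I (mon I : nat))%N == d) &&
       [forall I, ((mon I : nat) != 0%N) ==> (I \in J)]) ->
    (forall P, S P ->
       \sum_mon c mon * \prod_I (toC P I) ^+ (mon I : nat) = 0) ->
    c = 0.

(* the Zariski closure of S in Gr(k,n) (a projective variety in the
   Pluecker space P^{binom n k - 1}) has complex dimension dim:
   dim + 1 = Krull dimension of C[x_I]/I(S) = the maximal number of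
   coordinates algebraically independent modulo I(S) *)
Definition zariski_closure_dim (R : realType) (n k : nat)
    (S : set ({set 'I_n} -> R)) (dim : nat) : Prop :=
  (exists J : {set {set 'I_n}}, [/\ J \subset ksubsets n k, #|J| = dim.+1 & zar_indep S J]) /\
  (forall J : {set {set 'I_n}}, J \subset ksubsets n k -> zar_indep S J -> (#|J| <= dim.+1)%N).

(* Main.v *)
Require Import Defs.
From HB Require Import structures.
From mathcomp Require Import all_boot all_order all_algebra all_fingroup.
From mathcomp Require Import finmap.
From mathcomp Require Import boolp classical_sets cardinality reals.
From mathcomp Require Import topology normedtype sequences derive realfun exp trigo.
From mathcomp Require Import complex.
From mathcomp Require Import zify ring lra.
Import numFieldNormedType.Exports.
Import Order.TTheory GRing.Theory Num.Theory.
Local Open Scope ring_scope.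
Set Implicit Arguments.
Unset Strict Implicit.
Unset Printing Implicit Defensive.

(** On a disk graph a divergence-free flow is the gradient of a function on the
    faces.  Applied to flows built from the strand labels, together with the face
    count of a reduced graph, this shows that at every interior vertex exactly
    one edge, read from black to white, carries a smaller label than its reverse.
    These edges form a matching [M0]; giving them the sign -1 is a Kasteleyn
    signature, so that the boundary measurements are the maximal minors of a matrix
    built from solutions of the signed vertex equations at black vertices.  For critical weights the
    exponential of the height function of [ln sin (t - theta)] is such a solution for
    every [t].  Hence, up to scaling, [Delta_I] is the absolute value of the
    determinant of the coefficients of the polynomials
    [\prod_(1 <= j < k) (cos theta_(r+j) - sin theta_(r+j) X)], [r] in [I], whatever
    the reduced graph.

    When [I] is a cyclic interval this determinant is a product of sines.  Moving
    [theta] to [theta'] changes the logarithms of these [n] coordinates by amounts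
    whose pairing with [theta' - theta] is a sum of nonnegative triangle energies,
    vanishing only for a translation.  This gives injectivity, continuity of the
    inverse, and algebraic independence of the [n] interval coordinates.
    Conversely, the squares of all coordinates are trigonometric polynomials in
    [n - 1] angles, and comparing dimensions leaves no room for [n + 1]
    independent ones. *)

(** * Flows on planar graphs *)

(** A drawing is given by permutations of darts alone, so no separation argument for curves is at
    hand. The topology is drawn from two numbers, the Euler characteristic and the face count,
    through linear algebra over the rationals and through sums of local inequalities that turn out
    to be equalities. A second obstacle is that nothing in the definition forbids closed strands, so
    labels are not known to exist. The local analysis is made for any labelling that follows the
    turning rule; closed strands receive an arbitrary label, and varying this label excludes them.
    The ranks [1] and [n] are treated apart by counting degrees: for [k = n] a strand ends where it
    starts, so the two labels of a boundary edge agree, and for [k = 1] the critical weights need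
    not be positive. Nonemptiness requires one reduced graph for each [k], and the grid provides
    it. *)

Section Exactness.
Variables (K : fieldType) (E V F : finType).
Variables (s t : E -> V) (l r : E -> F).
Hypothesis orth : forall v f,
  \sum_e ((t e == v)%:R - (s e == v)%:R) * ((l e == f)%:R - (r e == f)%:R) = 0 :> K.
Hypothesis connV : forall g : V -> K, (forall e, g (t e) = g (s e)) ->
  forall u v, g u = g v.
Hypothesis connF : forall g : F -> K, (forall e, g (l e) = g (r e)) ->
  forall u v, g u = g v.
Variables (v0 : V) (f0 : F).

Definition incmx (T : finType) (a b : E -> T) : 'M[K]_(#|T|, #|E|) :=
  \matrix_(i, j) ((a (enum_val j) == enum_val i)%:R - (b (enum_val j) == enum_val i)%:R).

Lemma mul_incmx (T : finType) (a b : E -> T) (g : 'rV[K]_#|T|) j :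
  (g *m incmx a b) 0 j = g 0 (enum_rank (a (enum_val j))) - g 0 (enum_rank (b (enum_val j))).
Proof.
rewrite mxE.
under eq_bigr do rewrite mxE mulrBr.
rewrite sumrB; congr (_ - _).
- rewrite (bigD1 (enum_rank (a (enum_val j)))) //= enum_rankK eqxx mulr1 big1 ?addr0 //.
  move=> i ne; case: eqP => [h|_]; last by rewrite mulr0.
  by move: ne; rewrite h enum_valK eqxx.
- rewrite (bigD1 (enum_rank (b (enum_val j)))) //= enum_rankK eqxx mulr1 big1 ?addr0 //.
  move=> i ne; case: eqP => [h|_]; last by rewrite mulr0.
  by move: ne; rewrite h enum_valK eqxx.
Qed.

(** By [conn] the left kernel contains the constant rows only, so exactly one dimension is lost. *)
Lemma rank_incmx (T : finType) (a b : E -> T) (x0 : T) :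
  (forall g : T -> K, (forall e, g (a e) = g (b e)) -> forall u v, g u = g v) ->
  \rank (incmx a b) = #|T|.-1.
Proof.
move=> conn.
have T0 : (0 < #|T|)%N by apply/card_gt0P; exists x0.
have rk : (\rank (kermx (incmx a b)) = 1)%N.
  have -> : \rank (kermx (incmx a b)) = \rank (const_mx 1 : 'rV[K]_#|T|).
    apply: eqmx_rank; apply/andP; split; last first.
      apply/sub_kermxP/rowP => j; rewrite mul_incmx !mxE subrr //.
    apply/rV_subP => g /sub_kermxP g0.
    have cst : forall u v : T, g 0 (enum_rank u) = g 0 (enum_rank v).
      apply: (conn (fun u => g 0 (enum_rank u))) => e.
      move/rowP/(_ (enum_rank e)): g0; rewrite mul_incmx mxE enum_rankK.
      by move/eqP; rewrite subr_eq0 => /eqP.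
    have -> : g = g 0 (enum_rank x0) *: const_mx 1.
      apply/rowP => i; rewrite !mxE mulr1 -[i in LHS]enum_valK; exact: cst.
    by rewrite scalemx_sub.
  rewrite rank_rV; case: eqP => // /rowP/(_ (enum_rank x0)).
  by rewrite !mxE => /eqP; rewrite oner_eq0.
move: (mxrank_ker (incmx a b)); rewrite rk => h.
have := rank_leq_row (incmx a b).
by move: (\rank _) T0 h => rr; lia.
Qed.

Lemma incmx_orth : incmx l r *m (incmx t s)^T = 0.
Proof.
apply/matrixP => i j; rewrite !mxE -[RHS](orth (enum_val j) (enum_val i)).
rewrite (reindex (@enum_rank E)) /=; last by exists enum_val => x _; rewrite ?enum_rankK ?enum_valK.
by apply: eq_bigr => e _; rewrite !mxE enum_rankK mulrC.
Qed.

(** The face rows span a space of dimension [#|F| - 1] inside the cycle space, which has dimension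
    [#|E| - #|V| + 1]. This is Euler's inequality for arbitrary genus; it later bounds the faces of
    the grid from above. *)
Lemma euler_le : (#|V| + #|F| <= #|E| + 2)%N.
Proof.
have /mxrankS : (incmx l r <= kermx (incmx t s)^T)%MS.
  by apply/sub_kermxP; exact: incmx_orth.
rewrite mxrank_ker mxrank_tr (rank_incmx v0) // (rank_incmx f0) //.
have := rank_leq_col (incmx t s); rewrite (rank_incmx v0) //.
lia.
Qed.

(** Equality in Euler's formula turns the inclusion behind [euler_le] into an equality of subspaces:
    every circulation is a combination of face boundaries, and its coefficients form the
    potential. *)
Lemma flow_potential : (#|V| + #|F| = #|E| + 2)%N ->
  forall w : E -> K,
  (forall v, \sum_e w e * ((t e == v)%:R - (s e == v)%:R) = 0) ->
  exists n : F -> K, forall e, w e = n (l e) - n (r e).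
Proof.
move=> eul w w0.
have sub : (incmx l r <= kermx (incmx t s)^T)%MS.
  by apply/sub_kermxP; exact: incmx_orth.
have V0 : (0 < #|V|)%N by apply/card_gt0P; exists v0.
have F0 : (0 < #|F|)%N by apply/card_gt0P; exists f0.
have : (kermx (incmx t s)^T <= incmx l r)%MS.
  have [_] := mxrank_leqif_sup sub.
  move=> <-; rewrite mxrank_ker mxrank_tr (rank_incmx v0) // (rank_incmx f0) //.
  apply/eqP; lia.
move=> sub'.
have : ((\row_j w (enum_val j)) <= incmx l r)%MS.
  apply: submx_trans sub'; apply/sub_kermxP/rowP => i; rewrite !mxE.
  rewrite -[RHS](w0 (enum_val i)).
  rewrite (reindex (@enum_rank E)) /=; last by exists enum_val => x _; rewrite ?enum_rankK ?enum_valK.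
  by apply: eq_bigr => e _; rewrite !mxE enum_rankK.
move=> /submxP[g hg].
exists (fun f => g 0 (enum_rank f)) => e.
move/rowP: hg => /(_ (enum_rank e)).
by rewrite mul_incmx mxE enum_rankK.
Qed.

End Exactness.

(** [wf_diskgraph] without Euler's formula, so that the structural facts apply to a graph whose
    faces are still to be counted, such as the grid. *)
Definition planar_prewf n (G : diskgraph n) : Prop :=
  [/\ (forall d, alpha G (alpha G d) = d /\ alpha G d != d),
      (forall d, tail G (sigma G d) = tail G d),
      (forall d d', tail G d = tail G d' -> fconnect (sigma G) d d'),
      (forall d, black G (tail G d) != black G (tail G (alpha G d))) &
      injective (bnd G)]
  /\ [/\ (forall p, black G (bnd G p)),
      (forall p, exists d, forall d', tail G d' = bnd G p <-> d' = d),
      (forall v, exists p, connect (@adjG n G) v (bnd G p)),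
      (forall v, ~~ is_bnd v -> #|[set d | tail G d == v]| = 1%N ->
         exists d, tail G d = v /\ is_bnd (tail G (alpha G d))) &
      (exists A, @is_apm n G A)].

Lemma wf_prewf n (G : diskgraph n) : wf_diskgraph G -> planar_prewf G.
Proof. by case=> ? [? _]. Qed.

Section Disk.
Variables (n : nat) (G : diskgraph n).
Hypothesis wf : planar_prewf G.
Notation al := (alpha G).
Notation sg := (sigma G).
Notation tl := (tail G).
Notation bk := (black G).
Notation bd := (bnd G).

Lemma alphaK d : al (al d) = d.
Proof. by case: wf => [[/(_ d)[]]]. Qed.
Lemma tail_sigma d : tl (sg d) = tl d.
Proof. by case: wf => [[_ /(_ d)]]. Qed.
Lemma sigma_conn d d' : tl d = tl d' -> fconnect sg d d'.
Proof. by case: wf => [[_ _ H _ _] _]; exact: H. Qed.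
Lemma black_head d : bk (tl (al d)) = ~~ bk (tl d).
Proof. by case: wf => [[_ _ _ /(_ d) H _] _]; move: H; case: (bk _); case: (bk _). Qed.
Lemma bnd_inj : injective bd.
Proof. by case: wf => [[_ _ _ _ H] _]. Qed.
Lemma black_bnd p : bk (bd p).
Proof. by case: wf => [_ [H _ _ _ _]]. Qed.
Lemma alpha_inj : injective al.
Proof. exact: perm_inj. Qed.

Definition bdart (p : 'I_n) : dart G :=
  projT1 (cid (let: conj _ (And5 _ H _ _ _) := wf in H p)).
Lemma bdartP p d : tl d = bd p <-> d = bdart p.
Proof. by rewrite /bdart; case: cid => /= x; apply. Qed.
Lemma tail_bdart p : tl (bdart p) = bd p.
Proof. exact/bdartP. Qed.
Lemma bdart_eq p d : tl d = bd p -> d = bdart p.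
Proof. by move/bdartP. Qed.
Lemma bdart_inj : injective bdart.
Proof. by move=> p q h; apply: bnd_inj; rewrite -!tail_bdart h. Qed.

Lemma is_bnd_bnd p : is_bnd (bd p).
Proof. by apply/existsP; exists p. Qed.
Lemma is_bndP v : is_bnd v -> exists p, v = bd p.
Proof. by case/existsP => p /eqP <-; exists p. Qed.
Lemma bnd_black v : is_bnd v -> bk v.
Proof. by case/is_bndP => p ->; apply: black_bnd. Qed.
Lemma white_int v : ~~ bk v -> ~~ is_bnd v.
Proof. by apply: contra; apply: bnd_black. Qed.
Lemma tail_sigmaV d : tl (sg^-1%g d) = tl d.
Proof. by rewrite -{2}(permKV sg d) tail_sigma. Qed.

Definition ext_tail (x : ext_dart G) : vert G :=
  match x with inl d => tl d | inr (p, _) => bd p end.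

Lemma ext_alphaK (x : ext_dart G) : ext_alpha (ext_alpha x) = x.
Proof.
by case: x => [d|[p []]] /=; rewrite ?alphaK ?ordSK ?ord_predK.
Qed.

Lemma ext_sigma_int d : ~~ is_bnd (tl d) -> ext_sigma (inl d) = inl (sg d).
Proof.
move=> h /=; case: pickP => // p hp; case/negP: h; apply/existsP; exists p; exact: hp.
Qed.
Lemma ext_sigma_bdart p : ext_sigma (inl (bdart p)) = inr (p, false) :> ext_dart G.
Proof.
rewrite /=; case: pickP => [q /eqP|/(_ p)]; rewrite tail_bdart ?eqxx //.
by move/bnd_inj => ->.
Qed.
Lemma ext_sigma_t p : ext_sigma (inr (p, true)) = inl (bdart p) :> ext_dart G.
Proof.
rewrite /=; case: pickP => [d /eqP/bdart_eq -> //|/(_ (bdart p))].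
by rewrite tail_bdart eqxx.
Qed.

Lemma ext_tail_sigma x : ext_tail (ext_sigma x) = ext_tail x.
Proof.
case: x => [d|[p []]] //; last by rewrite ext_sigma_t /= tail_bdart.
have [/is_bndP[p hp]|h] := boolP (is_bnd (tl d)).
  by rewrite (bdart_eq hp) ext_sigma_bdart /= tail_bdart.
by rewrite ext_sigma_int //= tail_sigma.
Qed.

Lemma ext_sigma_inj : injective (@ext_sigma n G).
Proof.
have int_inl d x : ~~ is_bnd (tl d) -> ext_sigma (inl d) = ext_sigma x -> inl d = x.
  move=> h; have : ~~ is_bnd (ext_tail (ext_sigma (inl d))) by rewrite ext_tail_sigma.
  rewrite ext_sigma_int // => hx e.
  case: x e => [d'|[p b]] e.
    have h' : ~~ is_bnd (tl d') by move: hx; rewrite e ext_tail_sigma.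
    by move: e; rewrite ext_sigma_int // => -[/perm_inj ->].
  by move: hx; rewrite e ext_tail_sigma /= is_bnd_bnd.
have dec x : (exists2 d, x = inl d & ~~ is_bnd (tl d)) \/ (exists p, [\/ x = inl (bdart p), x = inr (p, true) | x = inr (p, false)]).
  case: x => [d|[p []]]; last 2 first.
  - by right; exists p; constructor 2.
  - by right; exists p; constructor 3.
  have [/is_bndP[p hp]|h] := boolP (is_bnd (tl d)); last by left; exists d.
  by right; exists p; constructor 1; rewrite (bdart_eq hp).
move=> x y.
case: (dec x) => [[d -> h]|[p px]]; first exact: int_inl.
case: (dec y) => [[d -> h] /esym e|[q qy]]; first by apply/esym/(int_inl _ _ h).
have ef r : ext_sigma (inr (r, false)) = inr (r, true) :> ext_dart G by [].
by case: px => ->; case: qy => ->; rewrite ?ext_sigma_bdart ?ext_sigma_t ?ef //;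
  first [by move=> [->] | by move=> [/bdart_inj ->]].
Qed.

Lemma ext_alpha_inj : injective (@ext_alpha n G).
Proof. exact: can_inj ext_alphaK. Qed.

Lemma ext_face_inj : injective (@ext_face_perm n G).
Proof. by move=> x y /ext_sigma_inj /ext_alpha_inj. Qed.

Lemma ext_face_sym : connect_sym (frel (@ext_face_perm n G)).
Proof. exact: fconnect_sym ext_face_inj. Qed.

Lemma ext_face_tail x : ext_tail (ext_face_perm x) = ext_tail (ext_alpha x).
Proof. exact: ext_tail_sigma. Qed.

Hypothesis n0 : (0 < n)%N.
Let p0 : 'I_n := Ordinal n0.

(** One dart for each edge, which orients it: the black end of an edge of [G], the clockwise
    direction of an arc of the circle. *)
Definition disk_edge : finType := ({d : dart G | bk (tl d)} + 'I_n)%type.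
Definition edge_dart (e : disk_edge) : ext_dart G :=
  match e with inl d => inl (val d) | inr p => inr (p, true) end.
Definition face_type : finType := {x : ext_dart G | froots (@ext_face_perm n G) x}.
Definition face_of (x : ext_dart G) : face_type :=
  exist _ (froot (@ext_face_perm n G) x) (roots_root ext_face_sym x).

Lemma face_ofE x y : (face_of x == face_of y) = fconnect (@ext_face_perm n G) x y.
Proof. by rewrite -(root_connect ext_face_sym) -val_eqE. Qed.

Lemma face_of_perm x : face_of (ext_face_perm x) = face_of x.
Proof. by apply/eqP; rewrite face_ofE ext_face_sym fconnect1. Qed.

Lemma face_of_sigma x : face_of (ext_sigma x) = face_of (ext_alpha x).
Proof. by rewrite -[RHS]face_of_perm /ext_face_perm ext_alphaK. Qed.

Lemma card_black_darts : #|{: {d : dart G | bk (tl d)}}| = (#|dart G| %/ 2)%N.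
Proof.
rewrite card_sig -(cardC [pred d | bk (tl d)]).
have -> : #|[predC [pred d | bk (tl d)]]| = #|[pred d | bk (tl d)]|.
  rewrite -(fintype.card_image alpha_inj [pred d | bk (tl d)]).
  apply: eq_card => d; rewrite !inE; apply/idP/fintype.imageP => [h|[x /= h ->]].
    by exists (al d); rewrite ?alphaK // inE /= black_head.
  by rewrite black_head negbK.
by rewrite addnn -muln2 mulnK.
Qed.

Lemma sum_black_half (K : nmodType) (h : dart G -> K) :
  \sum_(d | bk (tl d)) (h d + h (al d)) = \sum_d h d.
Proof.
rewrite big_split /= [RHS](bigID (fun d => bk (tl d))) /=; congr (_ + _).
rewrite [RHS](reindex_inj alpha_inj) /=; apply: eq_bigl => d.
by rewrite black_head negbK.
Qed.

Lemma sum_ext_all (K : nmodType) (h : ext_dart G -> K) :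
  \sum_(e : disk_edge) (h (edge_dart e) + h (ext_alpha (edge_dart e))) = \sum_x h x.
Proof.
rewrite big_sumType /= [RHS]big_sumType; congr (_ + _).
- rewrite -(sum_black_half (fun d => h (inl d))).
  exact: (esym (big_sub [pred d | bk (tl d)] (fun d => h (inl d) + h (inl (al d))))).
- rewrite [RHS](eq_bigr (fun i => h (inr (i.1, i.2)))); last by case.
  rewrite -(pair_bigA _ (fun p b => h (inr (p, b)))) /=.
  under [RHS]eq_bigr do rewrite big_bool /=.
  rewrite !big_split /=; congr (_ + _).
  by rewrite [RHS](reindex_inj (@ordS_inj n)).
Qed.

Lemma sum_ext_half (K : pzRingType) (a b : ext_dart G -> K) :
  \sum_(e : disk_edge) (a (ext_alpha (edge_dart e)) - a (edge_dart e)) *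
      (b (edge_dart e) - b (ext_alpha (edge_dart e)))
  = \sum_x (a (ext_alpha x) - a x) * b x.
Proof.
rewrite -(sum_ext_all (fun x => (a (ext_alpha x) - a x) * b x)).
by apply: eq_bigr => e _; rewrite ext_alphaK mulrBr -[in RHS](opprB (a (ext_alpha _))) mulNr.
Qed.

(** Written over darts, the sum runs around the face [f] and adds head minus tail. The face
    permutation sends a dart to one that starts at its head, so the sum telescopes. *)
Lemma disk_orth (K : fieldType) (v : vert G) (f : face_type) :
  \sum_(e : disk_edge) ((ext_tail (ext_alpha (edge_dart e)) == v)%:R - (ext_tail (edge_dart e) == v)%:R) *
     ((face_of (edge_dart e) == f)%:R - (face_of (ext_alpha (edge_dart e)) == f)%:R) = 0 :> K.
Proof.
rewrite (sum_ext_half (fun x => (ext_tail x == v)%:R) (fun x => (face_of x == f)%:R)).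
under eq_bigr do rewrite mulrBl.
rewrite sumrB; apply/eqP; rewrite subr_eq0; apply/eqP.
rewrite [RHS](reindex_inj ext_face_inj); apply: eq_bigr => x _.
by rewrite ext_face_tail face_of_perm.
Qed.

Lemma ord_cycle_ind (P : 'I_n -> Prop) : P p0 -> (forall p, P p -> P (ordS p)) -> forall p, P p.
Proof.
move=> h0 hS [i hi]; elim: i hi => [|i IH] hi.
  by have -> : Ordinal hi = p0 by apply: val_inj.
have hi' : (i < n)%N by apply: ltn_trans hi.
have -> : Ordinal hi = ordS (Ordinal hi') by apply: val_inj; rewrite /= modn_small.
exact: hS.
Qed.

Lemma vert_ind (P : vert G -> Prop) : (forall p, P (bd p)) ->
  (forall d, P (tl (al d)) -> P (tl d)) -> forall v, P v.
Proof.
move=> hb hs v; case: wf => _ [_ _ /(_ v)[p]] + _ _.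
case/connectP => s; elim: s v => [|w s IH] v /= => [_ <- //|/andP[]].
case/existsP => d /andP[/eqP <- /eqP hw] hp hl; apply: hs; rewrite hw; exact: IH.
Qed.

Lemma edge_dart_cases (x : ext_dart G) : exists e : disk_edge, x = edge_dart e \/ x = ext_alpha (edge_dart e).
Proof.
case: x => [d|[p []]].
- have [h|h] := boolP (bk (tl d)); first by exists (inl (exist _ d h)); left.
  have h' : bk (tl (al d)) by rewrite black_head.
  by exists (inl (exist _ (al d) h')); right; rewrite /= alphaK.
- by exists (inr p); left.
- by exists (inr (ord_pred p)); right; rewrite /= ord_predK.
Qed.

Lemma disk_connV (K : fieldType) (g : vert G -> K) :
  (forall e : disk_edge, g (ext_tail (ext_alpha (edge_dart e))) = g (ext_tail (edge_dart e))) ->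
  forall u v, g u = g v.
Proof.
move=> h.
have h' x : g (ext_tail (ext_alpha x)) = g (ext_tail x).
  by case: (edge_dart_cases x) => e [->|->]; rewrite ?ext_alphaK h.
suff c v : g v = g (bd p0) by move=> u v; rewrite !c.
elim/vert_ind: v => [|d <-]; last by rewrite -(h' (inl d)).
elim/ord_cycle_ind => // p <-; exact: (h' (inr (p, true))).
Qed.

(** Read on darts, such a function is invariant under [ext_alpha], hence under [ext_sigma]. It is
    therefore constant around each vertex, and the graph together with the circle is connected. *)
Lemma disk_connF (K : fieldType) (g : face_type -> K) :
  (forall e : disk_edge, g (face_of (edge_dart e)) = g (face_of (ext_alpha (edge_dart e)))) ->
  forall u v, g u = g v.
Proof.
move=> h; pose m x := g (face_of x).
have ma x : m (ext_alpha x) = m x.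
  by case: (edge_dart_cases x) => e [->|->]; rewrite ?ext_alphaK /m h.
have ms x : m (ext_sigma x) = m x by rewrite /m face_of_sigma -/(m _) ma.
have mft p : m (inr (p, true)) = m (inr (p, false)) := ms (inr (p, false)).
have mb p : m (inr (p, true)) = m (inr (p0, true)).
  elim/ord_cycle_ind: p => // p <-.
  by rewrite mft -(ma (inr (p, true))).
suff c v : forall x, ext_tail x = v -> m x = m (inr (p0, true)).
  have face_ofK f : face_of (val f) = f.
    by apply: val_inj => /=; apply/eqP; apply: (valP f).
  by move=> u v; rewrite -(face_ofK u) -(face_ofK v) -!/(m _) !(c _ _ erefl).
have mbd p : m (inl (bdart p)) = m (inr (p0, true)).
  by rewrite -(ext_sigma_t p) ms mb.
elim/vert_ind: v => [p|d IH] x hx.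
  case: x hx => [d /= /bdart_eq -> //|[q []]] /= /bnd_inj ->; first exact: mb.
  by rewrite -mft mb.
have hd : m (inl d) = m (inr (p0, true)) by rewrite -ma IH.
have [/is_bndP[p hp]|hb] := boolP (is_bnd (tl d)).
  case: x hx => [d' /=|[q []] /=]; rewrite hp; first by move/bdart_eq ->.
    by rewrite mb.
  by rewrite -mft mb.
case: x hx => [d' /= hx|[q b] /= hx]; last by move: hb; rewrite -hx is_bnd_bnd.
rewrite -hd; have /iter_findex <- := sigma_conn (esym hx).
elim: (findex _ _ _) => // j IHj; rewrite /= -IHj -(ms (inl (iter j sg d))) ext_sigma_int //.
suff -> : tl (iter j sg d) = tl d by [].
by elim: (j) => //= i <-; rewrite tail_sigma.
Qed.

Lemma card_face_type : #|face_type| = fcard (@ext_face_perm n G) predT.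
Proof. by rewrite card_sig; apply: eq_card => x; rewrite !inE andbT. Qed.

Lemma card_disk_edge : #|disk_edge| = (#|dart G| %/ 2 + n)%N.
Proof. by rewrite card_sum card_black_darts card_ord. Qed.

Lemma disk_euler_le :
  (#|vert G| + fcard (@ext_face_perm n G) predT <= #|dart G| %/ 2 + n + 2)%N.
Proof.
rewrite -card_face_type -card_disk_edge.
exact: (@euler_le rat _ _ _ _ _ _ _ (@disk_orth _) (@disk_connV _) (@disk_connF _)
  (bd p0) (face_of (inr (p0, true)))).
Qed.

(** The flow need not balance at the boundary vertices, so its boundary flux is first routed along
    the circle. Then [nu d] is the height of the face of [d], and [Phi p] that of the face touching
    the arc between [b_(p-1)] and [b_p]. *)
Lemma flow_height (K : fieldType) (w : dart G -> K) :
  (#|vert G| + fcard (@ext_face_perm n G) predT = #|dart G| %/ 2 + n + 2)%N ->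
  (forall d, w (al d) = - w d) ->
  (forall v, ~~ is_bnd v -> \sum_(d | tl d == v) w d = 0) ->
  exists (nu : dart G -> K) (Phi : 'I_n -> K),
  [/\ forall d, ~~ is_bnd (tl (al d)) -> nu (sg (al d)) = nu d,
      forall p, nu (al (bdart p)) = Phi p,
      forall p, nu (bdart p) = Phi (ordS p) &
      forall d, nu d - nu (al d) = w d].
Proof.
rewrite -card_face_type -card_disk_edge => eul wa w0.
have tot : \sum_p w (bdart p) = 0.
  have : \sum_d w d = 0.
    rewrite -sum_black_half big1 // => d _; by rewrite wa subrr.
  rewrite (partition_big tl predT) //= (bigID (@is_bnd n G)) /= addrC big1; last first.
    by move=> v; apply: w0.
  rewrite add0r => tot0; rewrite -[RHS]tot0 (reindex_omap bd (fun v => [pick p | bd p == v])) /=; last first.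
    by move=> v /is_bndP[p ->]; case: pickP => [q /eqP/bnd_inj -> //|/(_ p)]; rewrite eqxx.
  apply: eq_big => [p|p _].
    rewrite is_bnd_bnd /=; case: pickP => [q /eqP/bnd_inj ->|/(_ p)]; rewrite eqxx //.
  by rewrite (big_pred1 (bdart p)) // => d /=; apply/eqP/eqP => [/bdart_eq|->]; rewrite ?tail_bdart.
(* The arc leaving [b_p] carries minus the flux sent into [G] at the boundary vertices up to [p].
   Since the total flux [tot] vanishes, this stays consistent where the circle closes up. *)
pose u (p : 'I_n) := - \sum_(i < n | (i <= p)%N) w (bdart i).
have uS p : u p - u (ord_pred p) = - w (bdart p).
  rewrite /u -opprD; congr (- _); case: p => [[|p] hp] /=.
    have -> : (((0 + n).-1 %% n)%N) = n.-1 by rewrite add0n modn_small // prednK.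
    rewrite [X in _ - X](eq_bigl xpredT); last by move=> i /=; have := ltn_ord i; lia.
    rewrite tot subr0 (big_pred1 (Ordinal hp)) // => i /=.
    by rewrite leqn0 -(inj_eq val_inj).
  have -> : (((p.+1 + n).-1 %% n)%N) = p by rewrite addSn /= modnDr modn_small // ltnW.
  rewrite (bigD1 (Ordinal hp)) //= [X in _ + X - _](eq_bigl (fun i : 'I_n => (i <= p)%N)) ?addrK //.
  by move=> i /=; rewrite -(inj_eq val_inj) /=; lia.
pose wx (x : ext_dart G) := match x with inl d => w d | inr (p, true) => u p | inr (p, false) => - u (ord_pred p) end.
have wxa x : wx (ext_alpha x) = - wx x.
  by case: x => [d|[p []]] /=; rewrite ?wa ?ordSK ?opprK.
have div v : \sum_(e : disk_edge) wx (edge_dart e) *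
   ((ext_tail (ext_alpha (edge_dart e)) == v)%:R - (ext_tail (edge_dart e) == v)%:R) = 0.
  transitivity (- \sum_x wx x * (ext_tail x == v)%:R).
    rewrite -sum_ext_all -sumrN; apply: eq_bigr => e _; rewrite wxa mulrBr; ring.
  apply/eqP; rewrite oppr_eq0; apply/eqP.
  rewrite big_sumType /=.
  have -> : \sum_i w i * (tl i == v)%:R = \sum_(d | tl d == v) w d.
    rewrite [RHS]big_mkcond /=; apply: eq_bigr => d _; case: ifP; rewrite ?mulr1 ?mulr0 //.
  rewrite [X in _ + X](eq_bigr (fun i => wx (inr (i.1, i.2)) * (bd i.1 == v)%:R)); last by case.
  rewrite -(pair_bigA _ (fun p b => wx (inr (p, b)) * (bd p == v)%:R)) /=.
  under [X in _ + X]eq_bigr do rewrite big_bool /= -mulrDl uS.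
  have [/is_bndP[q ->]|hv] := boolP (is_bnd v).
    rewrite (big_pred1 (bdart q)); last first.
      by move=> d /=; apply/eqP/eqP => [/bdart_eq|->]; rewrite ?tail_bdart.
    rewrite (bigD1 q) //= eqxx mulr1 big1 ?addr0 ?addrN // => p hp.
    by rewrite (inj_eq bnd_inj) (negbTE hp) mulr0.
  rewrite w0 // add0r big1 // => p _; case: eqP => [h|_]; last by rewrite mulr0.
  by move: hv; rewrite -h is_bnd_bnd.
have [nn hn] := flow_potential (@disk_orth _) (@disk_connV _) (@disk_connF _)
  (bd p0) (face_of (inr (p0, true))) eul div.
have hn' x : wx x = nn (face_of x) - nn (face_of (ext_alpha x)).
  case: (edge_dart_cases x) => e [->|->]; first exact: hn.
  by rewrite ext_alphaK wxa hn opprB.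
exists (fun d => nn (face_of (inl d))), (fun p => nn (face_of (inr (p, false)))); split.
- by move=> d hd; rewrite -(face_of_perm (inl d)) -ext_sigma_int.
- by move=> p; rewrite -(face_of_perm (inl (al (bdart p)))) /ext_face_perm
    [ext_alpha _]/= alphaK ext_sigma_bdart.
- by move=> p; rewrite -(face_of_perm (inr (ordS p, false))) /ext_face_perm
    [ext_alpha _]/= ordSK ext_sigma_t.
- by move=> d; rewrite -(hn' (inl d)).
Qed.

End Disk.

(** * Strand labels and the reference matching *)

Section RotCount.
Variables (n k : nat).
Hypothesis n0 : (0 < n)%N.

Definition rot_ord (p : 'I_n) : 'I_n := Ordinal (ltn_pmod (p + k) n0).

Lemma rot_ord_inj : injective rot_ord.
Proof.
move=> p q /(congr1 val) /= /eqP; rewrite eqn_modDr => /eqP.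
by rewrite !modn_small // => /val_inj.
Qed.

Lemma rot_ordE (p : 'I_n) : (k <= n)%N ->
  rot_ord p = (if (p + k < n)%N then p + k else p + k - n)%N :> nat.
Proof.
move=> kn; rewrite /=; case: ifP => h; first by rewrite modn_small.
have := ltn_ord p => pn.
rewrite -{1}(subnK (_ : n <= p + k)%N) ?modnDr ?modn_small //; lia.
Qed.

(** The line [p + q = h] splits an [h] by [k] rectangle of lattice points: the first sum counts the
    points below the line for each [p], the second the others for each [q]. *)
Lemma sum_minn h : (\sum_(p < h) minn k (h - p) + \sum_(q < k) minn h q = k * h)%N.
Proof.
elim: h => [|h IH]; first by rewrite big_ord0 big1 ?muln0 // => q _; rewrite min0n.
rewrite big_ord_recl /= subn0 mulnS -IH.
have -> : (\sum_(q < k) minn h.+1 q = \sum_(q < k) minn h q + (k - h.+1))%N.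
  elim: (k) => [|j IHj]; first by rewrite !big_ord0.
  rewrite !big_ord_recr /= IHj; move: (\sum_(_ < _) _)%N => S; lia.
rewrite (eq_bigr (fun i : 'I_h => minn k (h - i))); last by move=> i _; rewrite /bump /= add1n subSS.
move: (\sum_(_ < _) _)%N (\sum_(_ < _) _)%N => S T; lia.
Qed.

Lemma sum_interval (p m : nat) : (m <= n)%N ->
  \sum_(i < n) ((p <= i) && (i < m))%N%:R = (m - p)%N%:R :> rat.
Proof.
move=> mn; rewrite -natr_sum; congr (_%:R).
rewrite -(big_mkord xpredT (fun i => ((p <= i) && (i < m))%N : nat)).
rewrite (big_cat_nat (n := m)) //= [X in (_ + X)%N]big_nat_cond [X in (_ + X)%N]big1 ?addn0; last first.
  by move=> i; rewrite andbT => /andP[h _]; rewrite [(i < m)%N]ltnNge h andbF.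
have [pm|/ltnW mp] := leqP p m; last first.
  rewrite big_nat_cond big1; first by apply/esym/eqP; rewrite subn_eq0.
  by move=> i; rewrite andbT => /= h; rewrite leqNgt (leq_trans h mp).
rewrite (big_cat_nat (n := p)) //= big_nat_cond big1 ?add0n; last first.
  by move=> i; rewrite andbT => /= h; rewrite leqNgt h.
rewrite -[(m - p)%N]muln1 -sum_nat_const_nat; apply: eq_big_nat => i /andP[-> ->] //.
Qed.

(** The boundary term of [label_count]. [Phi a] is the boundary height of the flow that marks the
    labels below [a]; at each boundary point the height where one strand ends is compared with the
    height where another starts, each taken for the label of its own strand. *)
Lemma rot_count (Phi : 'I_n -> 'I_n -> rat) : (k < n)%N ->
  (forall a p, Phi a (ordS p) - Phi a p = (rot_ord p < a)%N%:R - (p < a)%N%:R) ->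
  \sum_p (Phi p (ordS p) - Phi (rot_ord p) p) = k%:R - (k * (n - k))%N%:R.
Proof.
move=> kn hPhi; have kn' := ltnW kn.
pose D (a i : 'I_n) : rat := (rot_ord i < a)%N%:R - (i < a)%N%:R.
pose p0 : 'I_n := Ordinal n0.
have E a (q : 'I_n) : Phi a q = Phi a p0 + \sum_(i : 'I_n) (i < q)%N%:R * D a i.
  case: q => q; elim: q => [|q IH] hq.
    rewrite big1 ?addr0 => [|i _]; last by rewrite mul0r.
    by congr (Phi a _); apply: val_inj.
  have hq' := ltnW hq.
  have -> : Ordinal hq = ordS (Ordinal hq') by apply: val_inj; rewrite /= modn_small.
  rewrite -[LHS](subrK (Phi a (Ordinal hq'))) hPhi IH -/(D a _) addrCA; congr (_ + _).
  rewrite (bigD1 (Ordinal hq')) //= ltnn mul0r add0r.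
  rewrite [RHS](bigD1 (Ordinal hq')) //= modn_small // ltnSn mul1r; congr (_ + _).
  apply: eq_bigr => i hi; congr (_%:R * _).
  by move: hi; rewrite -(inj_eq val_inj) /=; lia.
have -> : \sum_p (Phi p (ordS p) - Phi (rot_ord p) p) =
  \sum_p ((rot_ord p < p)%N%:R + \sum_(i : 'I_n) ((i < rot_ord p)%N%:R - (i < p)%N%:R) * D (rot_ord p) i).
  transitivity (\sum_p (((rot_ord p < p)%N%:R + Phi p p) - Phi (rot_ord p) p)).
    apply: eq_bigr => p _; congr (_ - _).
    by rewrite -[LHS](subrK (Phi p p)) hPhi ltnn subr0.
  rewrite sumrB big_split /= [X in _ + X - _](reindex_inj rot_ord_inj) /= -addrA -sumrB [RHS]big_split /=; congr (_ + _).
  apply: eq_bigr => p _; rewrite [Phi _ (rot_ord p)]E [Phi _ p]E.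
  rewrite opprD addrACA subrr add0r -sumrB.
  by apply: eq_bigr => i _; rewrite mulrBl.
rewrite big_split /=; congr (_ + _).
  transitivity (\sum_(i < n) ((n - k <= i) && (i < n))%N%:R : rat).
    apply: eq_bigr => i _; congr ((nat_of_bool _)%:R).
    have := ltn_ord i; have := rot_ordE i kn'.
    rewrite /=; case: ifP => h -> hi; rewrite ?hi; lia.
  by rewrite sum_interval // subKn.
(* For fixed [p] the inner sum is minus the number of indices in one interval; the two cases are
   whether [p + k] wraps around. *)
transitivity (- \sum_(p < n) (if (p < n - k)%N then (minn k (n - k - p))%N%:R else (minn (n - k) (p - (n - k)))%N%:R) : rat).
  rewrite -sumrN; apply: eq_bigr => p _.
  have rp := rot_ordE p kn'; have pn := ltn_ord p.
  case: ifP => hp.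
    have e : minn k (n - k - p) = (minn (p + k) (n - k) - p)%N by lia.
    rewrite e -sum_interval; last by lia.
    rewrite -sumrN; apply: eq_bigr => i _; rewrite /D.
    have hi := ltn_ord i; have ri : ((i + k) %% n = if (i + k < n)%N then i + k else i + k - n)%N := rot_ordE i kn'.
    have rp' : ((p + k) %% n = p + k)%N by rewrite modn_small //; lia.
    rewrite /= rp' ri.
    set fi := if (i + k < n)%N then _ else _.
    have e1 : ((p <= i) && (i < minn (p + k) (n - k)))%N = [&& (i < p + k), ~~ (i < p) & ~~ (fi < p + k)]%N.
      by rewrite /fi; clear ri rp rp'; case: ifP => h; lia.
    have e2 : ((i < p) ==> (i < p + k))%N by lia.
    move: e2; rewrite e1; case: (i < p)%N; case: (i < p + k)%N; case: (fi < p + k)%N => //= _;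
      by rewrite ?subrr ?subr0 ?sub0r ?mulr0 ?mul0r ?mul1r ?oppr0.
  have e' : minn (n - k) (p - (n - k)) = (p - maxn (p + k - n) (n - k))%N by lia.
  rewrite e' -sum_interval; last by lia.
  rewrite -sumrN; apply: eq_bigr => i _; rewrite /D.
  have hi := ltn_ord i; have ri : ((i + k) %% n = if (i + k < n)%N then i + k else i + k - n)%N := rot_ordE i kn'.
  have rp' : ((p + k) %% n = p + k - n)%N.
    by move: rp; rewrite /=; case: ifP => // h; lia.
  rewrite /= rp' ri.
  set fi := if (i + k < n)%N then _ else _.
  have e1 : ((maxn (p + k - n) (n - k) <= i) && (i < p))%N = [&& (i < p), ~~ (i < p + k - n) & (fi < p + k - n)]%N.
    by rewrite /fi; clear ri rp rp'; case: ifP => h; lia.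
  have e2 : ((i < p + k - n) ==> (i < p))%N by lia.
  move: e2; rewrite e1; case: (i < p)%N; case: (i < p + k - n)%N; case: (fi < p + k - n)%N => //= _;
    by rewrite ?subrr ?subr0 ?sub0r ?mulr0 ?mul0r ?mul1r ?mulr1 ?oppr0.
congr (- _).
have [h hn] : exists h, n = (h + k)%N by exists (n - k)%N; rewrite subnK.
rewrite (eq_bigr (fun p : 'I_n => (if (p < n - k) then minn k (n - k - p) else minn (n - k) (p - (n - k)))%N%:R)); last by move=> p _; case: ifP.
rewrite -natr_sum; congr (_%:R).
rewrite -(big_mkord xpredT (fun p => if (p < n - k)%N then minn k (n - k - p)%N else minn (n - k)%N (p - (n - k))%N)).
rewrite hn addnK big_mkord big_split_ord /=.
rewrite -[RHS]sum_minn; congr (_ + _)%N; apply: eq_bigr => i _; first by rewrite ltn_ord.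
by rewrite ltnNge leq_addr /= addKn.
Qed.
End RotCount.

Section Labels.
Variables (n k : nat) (G : diskgraph n).
Hypothesis wf : planar_prewf G.
Hypothesis n0 : (0 < n)%N.
Hypothesis k0 : (0 < k)%N.
Hypothesis kn : (k < n)%N.
Hypothesis eul : (#|vert G| + fcard (@ext_face_perm n G) predT = #|dart G| %/ 2 + n + 2)%N.
Hypothesis faces : (fcard (@ext_face_perm n G) predT = k * (n - k) + 2)%N.
Notation al := (alpha G).
Notation sg := (sigma G).
Notation tl := (tail G).
Notation bk := (black G).
Notation bd := (bnd G).
Notation bdart := (bdart wf).
Notation rot := (rot_ord k n0).

Variable lab : dart G -> 'I_n.
Hypothesis labE : forall d p, tl (al d) = bd p -> lab d = p.
Hypothesis labN : forall d, ~~ is_bnd (tl (al d)) -> lab (strand_next d) = lab d.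
Hypothesis labB : forall p, lab (bdart p) = rot p.

Lemma lab_alpha_bdart p : lab (al (bdart p)) = p.
Proof. by apply: labE; rewrite alphaK // tail_bdart. Qed.

Lemma lab_white d : ~~ bk (tl d) -> lab (sg d) = lab (al d).
Proof.
move=> h; have hb := white_int wf h.
by rewrite -(@labN (al d)) ?alphaK // /strand_next alphaK // (negbTE h).
Qed.

Lemma lab_black d : bk (tl d) -> ~~ is_bnd (tl d) -> lab (al (sg d)) = lab d.
Proof.
move=> h hb; rewrite -(@labN (al (sg d))) ?alphaK // ?tail_sigma //.
by rewrite /strand_next alphaK // tail_sigma // h permK.
Qed.

Lemma rot_neq p : rot p != p.
Proof.
apply/negP => /eqP /(congr1 (fun x : 'I_n => x : nat)); rewrite rot_ordE ?(ltnW kn) //.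
have := ltn_ord p; case: ifP => h; move: k0 kn h; clear; lia.
Qed.

Lemma bdart_no_tie p : lab (bdart p) != lab (al (bdart p)).
Proof. by rewrite labB lab_alpha_bdart rot_neq. Qed.

(** The turning rule matches the strands entering [v] with those leaving it, one rotation step
    apart, and keeps their labels. *)
Lemma int_sum_lab (K : zmodType) (g : 'I_n -> K) v : ~~ is_bnd v ->
  \sum_(d | tl d == v) g (lab d) = \sum_(d | tl d == v) g (lab (al d)).
Proof.
move=> hv; have [hb|hw] := boolP (bk v).
- rewrite [RHS](reindex_inj (@perm_inj _ sg)) /=.
  apply: eq_big => [d|d /eqP hd]; first by rewrite tail_sigma.
  by rewrite lab_black // hd.
- rewrite [LHS](reindex_inj (@perm_inj _ sg)) /=.
  apply: eq_big => [d|d]; rewrite tail_sigma // => /eqP hd.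
  by rewrite lab_white // hd.
Qed.

Lemma lab_height (K : fieldType) (g : 'I_n -> K) :
  exists (nu : dart G -> K) (Phi : 'I_n -> K),
  [/\ forall d, ~~ is_bnd (tl (al d)) -> nu (sg (al d)) = nu d,
      forall p, nu (al (bdart p)) = Phi p,
      forall p, nu (bdart p) = Phi (ordS p) &
      forall d, nu d - nu (al d) = g (lab d) - g (lab (al d))].
Proof.
apply: (@flow_height _ _ wf n0 _ (fun d => g (lab d) - g (lab (al d)))) => //.
- by move=> d; rewrite alphaK // opprB.
- by move=> v hv; rewrite sumrB int_sum_lab // subrr.
Qed.

Lemma strand_next_tail d : tl (strand_next d) = tl (al d).
Proof. by rewrite /strand_next; case: ifP => _; rewrite ?tail_sigmaV ?tail_sigma. Qed.

Lemma strand_next_inj : injective (@strand_next n G).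
Proof.
move=> d d' h; have := congr1 tl h; rewrite !strand_next_tail => ht.
move: h; rewrite /strand_next ht; case: ifP => _ /perm_inj /perm_inj //.
Qed.

Lemma strand_next_bdart p : strand_next (al (bdart p)) = bdart p.
Proof. by apply: bdart_eq; rewrite strand_next_tail alphaK // tail_bdart. Qed.

Lemma big_bnd (K : nmodType) (h : dart G -> K) :
  \sum_(d | is_bnd (tl d)) h d = \sum_p h (bdart p).
Proof.
rewrite (reindex_omap bdart (fun d => [pick p | bdart p == d])) /=; last first.
  move=> d /is_bndP[p /(bdart_eq wf) ->]; case: pickP => [q /eqP /= ->//|/(_ p)]; by rewrite eqxx.
apply: eq_bigl => p; rewrite tail_bdart is_bnd_bnd /=.
by case: pickP => [q /eqP/bdart_inj ->|/(_ p)]; rewrite eqxx.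
Qed.

Lemma big_head_bnd (K : nmodType) (h : dart G -> K) :
  \sum_(d | is_bnd (tl (al d))) h d = \sum_p h (al (bdart p)).
Proof.
rewrite (reindex_inj (@perm_inj _ al)) /= -(big_bnd (fun d => h (al d))).
by apply: eq_bigl => d; rewrite alphaK.
Qed.

(** Each strand is followed with the height of the flow marking the labels below its own label. Its
    jumps add up, edge by edge, to the comparisons on the left. The heights also telescope along the
    strand, since [bef] at the next dart is [aft] at the present one, so closed strands contribute
    nothing and only the boundary term of [rot_count] remains. *)
Lemma label_count :
  \sum_(d | bk (tl d)) ((lab d < lab (al d))%N%:R - (lab (al d) < lab d)%N%:R)
  = k%:R - (k * (n - k))%N%:R :> rat.
Proof.
have /choice[nu /choice[Phi H]] := fun a : 'I_n => lab_height (fun x : 'I_n => (x < a)%N%:R : rat).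
pose bef a d := if bk (tl d) then nu a (al d) else nu a d.
pose aft a d := if bk (tl d) then nu a d else nu a (al d).
have step a d : ~~ is_bnd (tl (al d)) -> bef a (strand_next d) = aft a d.
  move=> hd; rewrite /bef /aft strand_next_tail black_head //.
  have [h1 _ _ _] := H a.
  have [hb|hw] := boolP (bk (tl d)) => /=.
    by rewrite /strand_next black_head // hb /= h1.
  have hn : ~~ is_bnd (tl (al (al (strand_next d)))) by rewrite alphaK // strand_next_tail.
  rewrite -(h1 _ hn) alphaK // /strand_next black_head // (negbTE hw) /= permKV //.
have S1 : \sum_d (aft (lab d) d - bef (lab d) d) = 
  \sum_(d | bk (tl d)) ((lab d < lab (al d))%N%:R - (lab (al d) < lab d)%N%:R).
  rewrite -sum_black_half //; apply: eq_bigr => d hd.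
  rewrite /aft /bef black_head // hd /= alphaK //.
  have [_ _ _ h4] := H (lab d); have [_ _ _ h4'] := H (lab (al d)).
  by rewrite h4 h4' !ltnn sub0r subr0 addrC.
rewrite -S1 sumrB.
rewrite [X in _ - X](reindex_inj strand_next_inj) /= -sumrB.
rewrite (bigID (fun d => is_bnd (tl (al d)))) /= [X in _ + X]big1 ?addr0; last first.
  by move=> d hd; rewrite labN // step // subrr.
rewrite (big_head_bnd (fun i => aft (lab i) i - bef (lab (strand_next i)) (strand_next i))).
rewrite -(@rot_count n k n0 Phi) //.
  apply: eq_bigr => p _; rewrite strand_next_bdart lab_alpha_bdart labB /aft /bef alphaK //.
  rewrite tail_bdart black_bnd // black_head // tail_bdart black_bnd //=.
  by have [_ _ -> _] := H p; have [_ -> _ _] := H (rot p).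
move=> a p; have [_ h2 h3 h4] := H a.
by rewrite -(h2 p) -(h3 p) h4 labB lab_alpha_bdart.
Qed.

(** A condition on the edge, as both directions of reading agree ([M0_alpha]). For increasing angles
    it singles out the edges whose black dart [d] has a negative
    [sin (theta (lab d) - theta (lab (al d)))]. *)
Definition M0 (d : dart G) : bool :=
  if bk (tl d) then (lab d < lab (al d))%N else (lab (al d) < lab d)%N.
Definition tie (d : dart G) : bool := lab d == lab (al d).

Lemma M0_alpha d : M0 (al d) = M0 d.
Proof. by rewrite /M0 black_head // alphaK //; case: (bk _). Qed.
Lemma tie_alpha d : tie (al d) = tie d.
Proof. by rewrite /tie alphaK // eq_sym. Qed.

Lemma dart_at v : exists d, tl d = v.
Proof. by elim/(vert_ind wf): v => [p|d _]; [exists (bdart p); rewrite tail_bdart|exists d]. Qed.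

(** A leaf would hang on some [b_p]; the strand starting at [b_p] would turn back there and end
    where it began, against [rot_neq]. *)
Lemma int_deg_ge2 v : ~~ is_bnd v -> (1 < #|[set d | tl d == v]|)%N.
Proof.
move=> hv; have [d0 hd0] := dart_at v.
rewrite ltn_neqAle; apply/andP; split; last by apply/card_gt0P; exists d0; rewrite inE hd0.
apply/eqP => c1; case: wf => _ [_ _ _ /(_ v hv (esym c1))[d [hd /is_bndP[p hp]]] _].
have eqd d' : tl d' = v -> d' = d.
  move=> hd'; move/esym/eqP/cards1P: c1 => [x hx].
  have : d' \in [set d | tl d == v] by rewrite inE hd'.
  have : d \in [set d | tl d == v] by rewrite inE hd.
  by rewrite hx !inE => /eqP-> /eqP->.
have e := bdart_eq wf hp.
have := @labN (bdart p); rewrite -e alphaK // hd => /(_ hv).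
rewrite {1}/strand_next alphaK // e labB.
have -> : (if bk (tl d) then sg^-1%g d else sg d) = d.
  by apply: eqd; case: ifP => _; rewrite ?tail_sigmaV ?tail_sigma.
by rewrite (labE hp) => /esym/eqP; rewrite (negbTE (rot_neq _)).
Qed.

Definition nM v := (\sum_(d | tl d == v) M0 d)%N.
Definition nT v := (\sum_(d | tl d == v) tie d)%N.

(** Without a dart of [M0] all label differences at [v] have the same weak sign, while by
    [int_sum_lab] they add up to zero. *)
Lemma nM0_tie v : ~~ is_bnd v -> nM v = 0%N -> forall d, tl d = v -> tie d.
Proof.
move=> hv /eqP; rewrite sum_nat_eq0 => /forallP h.
have hM d : tl d = v -> M0 d = false.
  by move=> hd; have := h d; rewrite hd eqxx /=; case: (M0 d).
have /eqP := int_sum_lab (fun x : 'I_n => (x : nat)%:R : int) hv.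
rewrite -!natr_sum !natz eqz_nat => /eqP hs.
have [hb|hw] := boolP (bk v).
- have le d : tl d == v -> (lab (al d) <= lab d ?= iff (lab (al d) == lab d))%N.
    by move=> /eqP hd; apply/leqif_eq; have := hM d hd; rewrite /M0 hd hb => /negbT; rewrite -leqNgt.
  have [_] := leqif_sum le; rewrite -hs eqxx => /esym/forallP H d hd.
  by have := H d; rewrite hd eqxx /= /tie eq_sym.
- have le d : tl d == v -> (lab d <= lab (al d) ?= iff (lab d == lab (al d)))%N.
    by move=> /eqP hd; apply/leqif_eq; have := hM d hd; rewrite /M0 hd (negbTE hw) => /negbT; rewrite -leqNgt.
  have [_] := leqif_sum le; rewrite -hs eqxx => /esym/forallP H d hd.
  by have := H d; rewrite hd eqxx.
Qed.

(** The local inequality whose equality case is wanted. The factor [2] balances one edge of [M0]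
    against a vertex without any, where all darts are ties and there are at least two of them. *)
Lemma nMT_ge v : ~~ is_bnd v -> (2 <= 2 * nM v + nT v)%N.
Proof.
move=> hv; case: (posnP (nM v)) => [h|]; last by lia.
have ht := nM0_tie hv h; have := int_deg_ge2 hv.
rewrite -sum1_card /nT (eq_bigl (fun d => tl d == v)) => [|d]; last by rewrite inE.
by rewrite [X in (_ <= _ + X)%N](eq_bigr (fun=> 1)%N) => [|d /eqP/ht -> //]; lia.
Qed.

Lemma M0_bdart p : M0 (bdart p) = (n - k <= p)%N.
Proof.
rewrite /M0 tail_bdart black_bnd // labB lab_alpha_bdart rot_ordE ?(ltnW kn) //.
have := ltn_ord p; move: kn k0; clear; case: ifP; lia.
Qed.

Lemma sum_M0_bdart : (\sum_p M0 (bdart p) = k)%N.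
Proof.
transitivity (\sum_(p < n) ((n - k <= p) && (p < n)))%N.
  by apply: eq_bigr => p _; rewrite M0_bdart ltn_ord andbT.
apply/eqP; rewrite -(eqr_nat rat) natr_sum sum_interval // subKn ?eqxx //; exact: ltnW.
Qed.

Lemma sum_int_MT : (\sum_(v | ~~ is_bnd v) (2 * nM v + nT v) + 2 * k
   = 2 * (2 * \sum_(d | bk (tl d)) M0 d + \sum_(d | bk (tl d)) tie d))%N.
Proof.
have part (h : dart G -> bool) : (forall d, h (al d) = h d) ->
   (\sum_(v | ~~ is_bnd v) \sum_(d | tl d == v) h d + \sum_p h (bdart p) = 2 * \sum_(d | bk (tl d)) h d)%N.
  move=> ha; rewrite mul2n -addnn -big_split /=.
  have -> : (\sum_(d | bk (tl d)) (h d + h d) = \sum_d h d)%N.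
    by rewrite -(sum_black_half wf (fun d => h d : nat)); apply: eq_bigr => d _; rewrite ha.
  rewrite -(big_bnd (fun d => h d : nat)) [RHS](bigID (fun d => is_bnd (tl d))) /= addnC; congr addn.
  rewrite [RHS](partition_big tl (fun v => ~~ is_bnd v)) //=; apply: eq_bigr => v hv.
  by apply: eq_bigl => d; case: eqP => [->|]; rewrite ?hv ?andbF.
rewrite big_split /= -big_distrr /=.
have := part M0 M0_alpha; have := part tie tie_alpha.
rewrite [X in (_ + X = _)%N -> _]big1 ?addn0; last by move=> p _; rewrite /tie (negbTE (bdart_no_tie p)).
rewrite -/(nT _) -/(nM _).
rewrite sum_M0_bdart.
rewrite /nM /nT; lia.
Qed.

Lemma card_int : (#|[pred v : vert G | ~~ is_bnd v]| + n = #|vert G|)%N.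
Proof.
have h : #|[pred v : vert G | is_bnd v]| = n.
  rewrite -[RHS]card_ord -(fintype.card_image (bnd_inj wf) predT); apply: eq_card => v; rewrite !inE.
  apply/idP/fintype.imageP => [/is_bndP[p ->]|[p _ ->]]; [by exists p|exact: is_bnd_bnd].
rewrite addnC -(cardC [pred v : vert G | is_bnd v]) h; congr addn; exact: eq_card.
Qed.

Lemma card_black_sum : (\sum_(d | bk (tl d)) 1 = #|dart G| %/ 2)%N.
Proof. by rewrite -(card_black_darts wf) card_sig sum1_card; apply: eq_card. Qed.

(** [label_count], Euler's formula and the face count bound the sum of the left-hand sides by twice
    the number of interior vertices, so [nMT_ge] is nowhere strict. *)
Lemma nMT_eq v : ~~ is_bnd v -> (2 * nM v + nT v = 2)%N.
Proof.
move=> hv.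
have E : (\sum_(v | ~~ is_bnd v) (2 * nM v + nT v) <= \sum_(v : vert G | ~~ is_bnd v) 2)%N.
  rewrite sum_nat_const; have := card_int; have := sum_int_MT.
  have := label_count.
  rewrite sumrB -!natr_sum.
  have <- : (\sum_(d | bk (tl d)) M0 d = \sum_(d | bk (tl d)) (lab d < lab (al d)))%N.
    by apply: eq_bigr => d hd; rewrite /M0 hd.
  have e3 : (\sum_(d | bk (tl d)) M0 d + \sum_(d | bk (tl d)) (lab (al d) < lab d) + \sum_(d | bk (tl d)) tie d = #|dart G| %/ 2)%N.
    rewrite -card_black_sum -!big_split /=; apply: eq_bigr => d hd; rewrite /M0 /tie hd -(inj_eq val_inj).
    by case: ltngtP.
  move=> /eqP; rewrite subr_eq addrAC eq_sym subr_eq -!natrD eqr_nat => /eqP e4.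
  move=> e5 e6.
  move: e3 e4 e5 e6 eul; rewrite faces.
  set a := (\sum_(d | _) M0 d)%N; set b := (\sum_(d | _) (_ < _))%N; set c := (\sum_(d | _) tie d)%N.
  set s := (\sum_(v | _) _)%N; set q := #|[pred v | _]|; set r := (_ %/ 2)%N; set t := (k * (n - k))%N.
  clearbody a b c s q r t; clear; lia.
have le i : ~~ is_bnd i -> (2 <= 2 * nM i + nT i ?= iff (2 * nM i + nT i == 2))%N.
  by move=> hi; split; [exact: nMT_ge|rewrite eq_sym].
have [h1 h2] := leqif_sum le.
move: h2; rewrite eqn_leq h1 E /= => /esym/forallP/(_ v).
by rewrite hv => /eqP.
Qed.

(** A tie at an interior vertex forces [nM = 0] there, and then all its darts are ties. Ties would
    thus spread along every path to the boundary, where [bdart_no_tie] forbids them. *)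
Lemma lab_neq d : lab d != lab (al d).
Proof.
suff H v d' : tl d' = v -> ~~ tie d' by exact: (H _ d erefl).
elim/(vert_ind wf): v d' => {d} [p d /(bdart_eq wf) ->|d IH d' hd']; first exact: bdart_no_tie.
have [/is_bndP[p hp]|hv] := boolP (is_bnd (tl d)).
  by move: hd'; rewrite hp => /(bdart_eq wf) ->; exact: bdart_no_tie.
apply/negP => ht; have := nMT_eq hv.
have t0 : (0 < nT (tl d))%N.
  rewrite lt0n sum_nat_eq0; apply/negP => /forallP/(_ d').
  by rewrite hd' eqxx ht.
move=> h2; have h0 : nM (tl d) = 0%N by move: t0 h2; clear; lia.
have := IH (al d) erefl; rewrite tie_alpha => /negP; apply.
exact: (nM0_tie hv h0 erefl).
Qed.

Lemma nM1 v : ~~ is_bnd v -> nM v = 1%N.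
Proof.
move=> hv; have := nMT_eq hv.
have -> : nT v = 0%N by apply: big1 => d _; rewrite /tie (negbTE (lab_neq d)).
lia.
Qed.

Lemma M0_uniq v : ~~ is_bnd v -> exists2 m, tl m = v /\ M0 m & forall d, tl d = v -> M0 d -> d = m.
Proof.
move=> hv; have := nM1 hv; rewrite /nM -big_mkcondr sum1_card => h.
have /card1P[m hm] : #|[pred d | (tl d == v) && M0 d]| == 1%N.
  by rewrite -h; apply/eqP; apply: eq_card => d; rewrite !inE.
exists m; first by have := hm m; rewrite !inE eqxx => /andP[/eqP].
by move=> d hd hM; have := hm d; rewrite !inE hd eqxx hM => /esym/eqP.
Qed.

(** The edges of [M0] are counted from both ends: one at each white and at each interior black
    vertex, and [k] at the boundary. *)
Lemma card_white_black :
  (#|[pred v : vert G | ~~ bk v]| = #|[pred v : vert G | bk v && ~~ is_bnd v]| + k)%N.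
Proof.
rewrite -!sum1_card /=.
rewrite (eq_bigr nM) => [|v /(white_int wf)/nM1 -> //].
rewrite [in RHS](eq_bigr nM) => [|v /andP[_] /nM1 -> //].
have -> : (\sum_(v | ~~ bk v) nM v = \sum_(d | ~~ bk (tl d)) M0 d)%N.
  rewrite [RHS](partition_big tl (fun v => ~~ bk v)) //=; apply: eq_bigr => v hv.
  by apply: eq_bigl => d; case: eqP => [->|]; rewrite ?hv ?andbF.
have -> : (\sum_(v | bk v && ~~ is_bnd v) nM v = \sum_(d | bk (tl d) && ~~ is_bnd (tl d)) M0 d)%N.
  rewrite [RHS](partition_big tl (fun v => bk v && ~~ is_bnd v)) //=; apply: eq_bigr => v hv.
  by apply: eq_bigl => d; case: eqP => [->|]; rewrite ?hv ?andbF.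
rewrite -[in RHS]sum_M0_bdart -(big_bnd (fun d => M0 d : nat)).
rewrite (reindex_inj (@perm_inj _ al)) /=.
rewrite (eq_bigl (fun d => bk (tl d))) => [|d]; last by rewrite black_head // negbK.
rewrite (eq_bigr (fun d => M0 d : nat)) => [|d _]; last by rewrite M0_alpha.
rewrite (bigID (fun d => is_bnd (tl d))) /= addnC; congr addn.
apply: eq_bigl => d; apply: andb_idl; exact: bnd_black.
Qed.

Definition up (d : dart G) : bool := (lab (al d) < lab d)%N.

Lemma up_alpha d : up (al d) = ~~ up d.
Proof.
have := lab_neq d; rewrite /up alphaK // -(inj_eq val_inj) /=.
by case: ltngtP.
Qed.

Lemma M0_up d : M0 d = if bk (tl d) then ~~ up d else up d.
Proof. by rewrite /M0 -up_alpha /up alphaK. Qed.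

(* the oriented angle of an edge, measured in the cyclic group of labels; the
   angles at an interior vertex add up to one full turn *)
Definition turn (d : dart G) : nat :=
  if bk (tl d) then (if M0 d then lab d + n - lab (al d) else lab d - lab (al d))%N
  else (if M0 d then lab (al d) + n - lab d else lab (al d) - lab d)%N.

Lemma turn_alpha d : turn (al d) = turn d.
Proof. by rewrite /turn M0_alpha black_head // alphaK //; case: (bk _). Qed.

Lemma turn_gt0 d : (0 < turn d)%N.
Proof.
have := lab_neq d; rewrite /turn M0_up /up -(inj_eq val_inj) /=.
have := ltn_ord (lab d); have := ltn_ord (lab (al d)).
by move=> h1 h2 h3; case: (bk _); case: (ltngtP (lab (al d)) (lab d)) => /= h4; move: h1 h2 h3 h4; clear; lia.
Qed.

Lemma sum_turn v : ~~ is_bnd v -> (\sum_(d | tl d == v) turn d = n)%N.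
Proof.
move=> hv; apply/eqP; rewrite -(eqr_nat rat) natr_sum; apply/eqP.
have e1 := int_sum_lab (fun x : 'I_n => (x : nat)%:R : rat) hv.
have e2 : \sum_(d | tl d == v) (M0 d : nat)%:R = 1 :> rat by rewrite -natr_sum -/(nM v) nM1.
have [hb|hw] := boolP (bk v).
- rewrite (eq_bigr (fun d => (lab d)%:R - (lab (al d))%:R + n%:R * (M0 d)%:R : rat)).
    by rewrite big_split /= sumrB e1 subrr add0r -mulr_sumr e2 mulr1.
  move=> d /eqP hd; rewrite /turn hd hb.
  have := ltn_ord (lab (al d)); rewrite M0_up hd hb /up.
  case: (ltnP (lab (al d)) (lab d)) => /= h1 h2; rewrite ?mulr1 ?mulr0 ?addr0.
    by rewrite natrB // ltnW.
  by rewrite natrB ?natrD; [ring|move: h2; clear; lia].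
- rewrite (eq_bigr (fun d => (lab (al d))%:R - (lab d)%:R + n%:R * (M0 d)%:R : rat)).
    by rewrite big_split /= sumrB e1 subrr add0r -mulr_sumr e2 mulr1.
  move=> d /eqP hd; rewrite /turn hd (negbTE hw).
  have := ltn_ord (lab d); rewrite M0_up hd (negbTE hw) /up.
  case: (ltnP (lab (al d)) (lab d)) => /= h1 h2; rewrite ?mulr1 ?mulr0 ?addr0.
    by rewrite natrB ?natrD; [ring|move: h2; clear; lia].
  by rewrite natrB.
Qed.

(** The angles at the vertex are positive with sum [n], so two of them that fill the full turn leave
    no room for a third edge. *)
Lemma turn_pair d d' : tl d = tl d' -> ~~ is_bnd (tl d) -> d != d' ->
  (turn d + turn d' <= n)%N /\
  (turn d + turn d' = n -> forall e, tl e = tl d -> e = d \/ e = d').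
Proof.
move=> ht hv ne; have := sum_turn hv.
rewrite (bigD1 d) //= (bigD1 d') /=; last by rewrite ht eqxx eq_sym.
set S := (\sum_(i | _) _)%N => h; split; first by lia.
move=> h2 e he; have [->|hd] := eqVneq e d; first by left.
have [->|hd'] := eqVneq e d'; first by right.
have : S = 0%N by lia.
move/eqP; rewrite sum_nat_eq0 => /forallP/(_ e).
by rewrite he eqxx hd hd' /= => /eqP h0; have := turn_gt0 e; rewrite h0.
Qed.

Definition fperm (d : dart G) := sg (al d).

Lemma lab_fperm d : ~~ is_bnd (tl (al d)) ->
  if bk (tl d) then lab (fperm d) = lab d else lab (al (fperm d)) = lab (al d).
Proof.
move=> hd; rewrite /fperm; case: ifP => hb.
  by rewrite lab_white ?alphaK // black_head // hb.
by rewrite lab_black // black_head // hb.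
Qed.

(** When two consecutive edges of a face point the same way, the bound of [turn_pair] on their two
    angles says that neither label can grow; if both stay equal, the angles fill the full turn and
    the vertex has degree two. *)
Lemma face_corner d : ~~ is_bnd (tl (al d)) -> up (fperm d) = up d ->
  [/\ (lab (fperm d) <= lab d)%N, (lab (al (fperm d)) <= lab (al d))%N &
    lab (fperm d) = lab d -> lab (al (fperm d)) = lab (al d) ->
    forall e, tl e = tl (al d) -> e = al d \/ e = fperm d].
Proof.
move=> hd hu.
have tf : tl (fperm d) = tl (al d) by rewrite /fperm tail_sigma.
have ne : al d != fperm d.
  by apply/eqP => h; move: hu; rewrite -h up_alpha; case: (up d).
have [le eq] := turn_pair (esym tf) hd ne.
move: le eq (lab_fperm hd); rewrite turn_alpha /turn !M0_up tf black_head // hu.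
have l1 := ltn_ord (lab d); have l2 := ltn_ord (lab (al d)).
have l3 := ltn_ord (lab (fperm d)); have l4 := ltn_ord (lab (al (fperm d))).
have := hu; rewrite /up.
case: (bk (tl d)) => /=; case: (ltnP (lab (al d)) (lab d)) => h1; case: (ltnP (lab (al (fperm d))) (lab (fperm d))) => // h2 _ /= le eq e1; rewrite e1 in h1 h2 le eq *.
all: split=> //; [move: h1 h2 le l1 l2 l3 l4; clear; lia|move=> E1 E2; apply: eq; rewrite ?E1 ?E2; move: h1 h2 le l1 l2 l3 l4; rewrite ?E1 ?E2; clear; lia].
Qed.
Lemma fperm_inj : injective fperm.
Proof. by move=> d d' /perm_inj /perm_inj. Qed.

(** Around such a face the labels never increase, so they are constant, and every vertex of the face
    has degree two with both edges on the face. The face would then contain everything connected to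
    it, including a boundary vertex, which [H] excludes. *)
Lemma no_mono_face d0 (b : bool) :
  ~ (forall d, fconnect fperm d0 d -> ~~ is_bnd (tl (al d)) /\ up d = b).
Proof.
move=> H.
have conn d : fconnect fperm d0 d -> fconnect fperm d0 (fperm d).
  by move=> h; apply: connect_trans h (fconnect1 _ _).
have C d : fconnect fperm d0 d -> [/\ (lab (fperm d) <= lab d)%N, (lab (al (fperm d)) <= lab (al d))%N &
    lab (fperm d) = lab d -> lab (al (fperm d)) = lab (al d) ->
    forall e, tl e = tl (al d) -> e = al d \/ e = fperm d].
  by move=> h; have [h1 h2] := H d h; apply: face_corner => //; have [_ ->] := H _ (conn d h).
have shift (F : dart G -> nat) : (\sum_(d | fconnect fperm d0 d) F (fperm d) = \sum_(d | fconnect fperm d0 d) F d)%N.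
  rewrite [RHS](reindex_inj fperm_inj) /=; apply: eq_bigl => d.
  by rewrite -same_fconnect1_r //; apply: fperm_inj.
have eqF (F : dart G -> nat) : (forall d, fconnect fperm d0 d -> (F (fperm d) <= F d)%N) ->
   forall d, fconnect fperm d0 d -> F (fperm d) = F d.
  move=> le d hd.
  have le' e : fconnect fperm d0 e -> (F (fperm e) <= F e ?= iff (F (fperm e) == F e))%N.
    by move=> he; apply/leqif_eq/le.
  have [_] := leqif_sum le'; rewrite shift eqxx => /esym/forallP/(_ d).
  by rewrite hd /= => /eqP.
have E1 : forall d, fconnect fperm d0 d -> lab (fperm d) = lab d.
  by move=> d hd; apply: val_inj; apply: (eqF (fun d => lab d : nat)) => // e /C[].
have E2 : forall d, fconnect fperm d0 d -> lab (al (fperm d)) = lab (al d).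
  by move=> d hd; apply: val_inj; apply: (eqF (fun d => lab (al d) : nat)) => // e /C[].
have pred d : fconnect fperm d0 d -> exists2 d', fconnect fperm d0 d' & d = fperm d'.
  move=> hd; exists (finv fperm d); last by rewrite (f_finv fperm_inj).
  apply: connect_trans hd _; rewrite (fconnect_sym fperm_inj).
  by rewrite -{2}(f_finv fperm_inj d) fconnect1.
suff Q v : forall d, fconnect fperm d0 d -> tl d <> v by apply: (Q _ d0).
elim/(vert_ind wf): v => [p d hd e|e IH d hd he].
  have [d' hd' ed] := pred d hd; have [] := H d' hd'.
  have -> : tl (al d') = bd p by rewrite -e ed /fperm tail_sigma.
  by rewrite is_bnd_bnd.
have [d' hd' ed] := pred d hd; have [_ _ /(_ (E1 _ hd') (E2 _ hd')) P] := C d' hd'.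
have ht : tl d = tl (al d') by rewrite ed /fperm tail_sigma.
case: (P e); first by rewrite -he.
- by move=> ee; apply: (IH d' hd'); rewrite ee alphaK.
- by rewrite -ed => ee; apply: (IH _ (conn _ hd)); rewrite ee /fperm tail_sigma.
Qed.

(* A face minimizing or maximizing the two heights of [z] and of the labels would
   be bounded by edges of one direction only. *)
Lemma up_acyclic (z : dart G -> rat) :
  (forall d, z (al d) = - z d) ->
  (forall v, ~~ is_bnd v -> \sum_(d | tl d == v) z d = 0) ->
  (forall p, z (bdart p) = 0) ->
  (forall d, 0 < z d -> up d) -> forall d, z d = 0.
Proof.
move=> za z0 zb zup.
have [nu [Phi [nf nb1 nb2 nz]]] := flow_height wf n0 eul za z0.
have [nl [Psi [lf _ _ lz]]] := lab_height (fun x : 'I_n => (x : nat)%:R : rat).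
pose c := Phi (Ordinal n0).
have Pc p : Phi p = c.
  move: p; apply: (@ord_cycle_ind n n0 (fun p => Phi p = c)) => // p <-.
  by apply/eqP; rewrite -(nb1 p) -(nb2 p) -subr_eq0 nz zb.
suff main (s : rat) (b : bool) : s = (if b then 1 else -1) -> forall d, s * (nu d - c) <= 0.
  have nuc d : nu d = c.
    have := main 1 true erefl d; have := main (-1) false erefl d.
    rewrite mul1r subr_le0 mulN1r oppr_le0 subr_ge0 => h1 h2; by apply/le_anti/andP.
  by move=> d; rewrite -nz !nuc subrr.
move=> sE d1; rewrite leNgt; apply/negP => h1.
case: (@arg_maxP _ _ _ d1 predT (fun d => s * (nu d - c)) isT) => dm _ hm.
pose N := [pred d | s * (nu d - c) == s * (nu dm - c)].
have Nm : N dm by rewrite /N /= eqxx.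
case: (@arg_maxP _ _ _ dm N (fun d => s * nl d) Nm) => d0 /eqP N0 h0.
have pos : 0 < s * (nu dm - c) by apply: lt_le_trans h1 (hm d1 isT).
have int d : N d -> ~~ is_bnd (tl (al d)).
  move=> /eqP hN; apply/negP => /is_bndP[p /(bdart_eq wf) hp].
  by move: pos; rewrite -hN -(alphaK wf d) hp nb1 Pc subrr mulr0 ltxx.
have R d : fconnect fperm d0 d -> N d /\ nl d = nl d0.
  move=> /iter_findex <-; elim: (findex _ _ _) => [|i [IH1 IH2]]; first by split => //=; apply/eqP.
  have hi := int _ IH1; split; last by rewrite /= /fperm lf.
  by rewrite /N /= /fperm nf.
apply: (@no_mono_face d0 b) => d /R[hN hl]; split; first exact: int.
have s0 : s != 0 by rewrite sE; case: (b).
have gtup : 0 < s * ((lab d)%:R - (lab (al d))%:R) -> up d = b.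
  rewrite sE /up; case: (b); rewrite ?mul1r ?mulN1r ?opprB subr_gt0 ltr_nat //.
  by move=> h; apply/negbTE; rewrite -leqNgt ltnW.
have lne : s * ((lab d)%:R - (lab (al d))%:R) != 0.
  rewrite mulf_neq0 // subr_eq0 eqr_nat; have := lab_neq d; by rewrite -(inj_eq val_inj).
have [e|ne] := eqVneq (s * (nu (al d) - c)) (s * (nu dm - c)).
  apply: gtup; rewrite lt_def lne /= -lz mulrBr subr_ge0 hl.
  by apply: h0; rewrite /N /= e.
have hz : 0 < s * z d.
  rewrite -nz; have := hm (al d) isT; move: ne; rewrite -(eqP hN) => ne le.
  have : s * (nu (al d) - c) < s * (nu d - c) by rewrite lt_def eq_sym ne.
  by rewrite -subr_gt0 -mulrBr opprB addrA subrK.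
move: hz; rewrite sE; case: (b); rewrite ?mul1r ?mulN1r; first exact: zup.
by rewrite -za => /zup; rewrite up_alpha; case: (up d).
Qed.
Definition int_black : {set vert G} := [set v | bk v && ~~ is_bnd v].
Notation m := #|int_black|.

(** Numbering of the black vertices, interior ones first. The [special] indices are the boundary
    vertices that [M0] leaves free; the other indices are paired by [M0] with the white vertices,
    through [wx]. *)
Definition blv (x : 'I_(m + n)) : vert G :=
  match fintype.split x with inl j => enum_val j | inr p => bd p end.
Definition special (x : 'I_(m + n)) : bool :=
  match fintype.split x with inl _ => false | inr p => (p < n - k)%N end.

Lemma blv_l j : blv (lshift n j) = enum_val j.
Proof. by rewrite /blv (unsplitK (inl j)). Qed.
Lemma blv_r p : blv (rshift m p) = bd p.
Proof. by rewrite /blv (unsplitK (inr p)). Qed.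
Lemma special_l j : special (lshift n j) = false.
Proof. by rewrite /special (unsplitK (inl j)). Qed.
Lemma special_r p : special (rshift m p) = (p < n - k)%N.
Proof. by rewrite /special (unsplitK (inr p)). Qed.

Lemma int_blackP (j : 'I_m) : bk (enum_val j) /\ ~~ is_bnd (enum_val j).
Proof. by have := enum_valP j; rewrite inE => /andP. Qed.

Lemma blv_inj : injective blv.
Proof.
move=> x y; rewrite -(splitK x) -(splitK y).
case: (fintype.split x) => a; case: (fintype.split y) => b; rewrite /unsplit ?blv_l ?blv_r.
- by move/enum_val_inj ->.
- by move=> h; have [_] := int_blackP a; rewrite h is_bnd_bnd.
- by move=> h; have [_] := int_blackP b; rewrite -h is_bnd_bnd.
- by move/(bnd_inj wf) ->.
Qed.

Lemma blv_black x : bk (blv x).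
Proof.
rewrite -(splitK x); case: (fintype.split x) => a; rewrite /unsplit ?blv_l ?blv_r.
  by have [] := int_blackP a.
exact: black_bnd.
Qed.

Lemma blv_surj v : bk v -> exists x, blv x = v.
Proof.
move=> hb; have [/is_bndP[p ->]|hv] := boolP (is_bnd v); first by exists (rshift m p); rewrite blv_r.
have hin : v \in int_black by rewrite inE hb.
by exists (lshift n (enum_rank_in hin v)); rewrite blv_l enum_rankK_in.
Qed.

Lemma blv_bnd x : is_bnd (blv x) -> exists p, x = rshift m p.
Proof.
rewrite -(splitK x); case: (fintype.split x) => a; rewrite /unsplit ?blv_l ?blv_r.
  by have [_ /negbTE ->] := int_blackP a.
by move=> _; exists a.
Qed.

Definition mdart (x : 'I_(m + n)) : dart G :=
  odflt (bdart (Ordinal n0)) [pick d | (tl d == blv x) && M0 d].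
Definition wx (x : 'I_(m + n)) : vert G := tl (al (mdart x)).

Lemma mdartP x : ~~ special x ->
  [/\ tl (mdart x) = blv x, M0 (mdart x) & forall d, tl d = blv x -> M0 d -> d = mdart x].
Proof.
move=> hx.
have [e [e1 e2] e3] : exists2 e, tl e = blv x /\ M0 e & forall d, tl d = blv x -> M0 d -> d = e.
  have [/blv_bnd [p hp]|hv] := boolP (is_bnd (blv x)); last exact: M0_uniq.
  move: hx; rewrite hp special_r -leqNgt => hpk.
  exists (bdart p); first by rewrite tail_bdart blv_r M0_bdart.
  by move=> d; rewrite blv_r => /(bdart_eq wf) ->.
rewrite /mdart; case: pickP => [d /andP[/eqP h1 h2]|/(_ e)]; last by rewrite e1 e2 eqxx.
by split=> //= d' h1' h2'; rewrite (e3 d') // (e3 d).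
Qed.

Lemma wx_white x : ~~ special x -> ~~ bk (wx x).
Proof. by move=> /mdartP[h _ _]; rewrite /wx black_head // negbK h blv_black. Qed.

Lemma wx_M0 x d : ~~ special x -> tl d = wx x -> M0 d -> d = al (mdart x).
Proof.
move=> hx hd hM; have [m1 [m2 m3] m4] := M0_uniq (white_int wf (wx_white hx)).
have [h1 h2 _] := mdartP hx.
by rewrite (m4 d) // (m4 (al (mdart x))) // M0_alpha.
Qed.

Lemma wx_inj x y : ~~ special x -> ~~ special y -> wx x = wx y -> x = y.
Proof.
move=> hx hy e; apply: blv_inj.
have [hx1 hx2 _] := mdartP hx; have [hy1 hy2 _] := mdartP hy.
rewrite -hx1 -hy1; congr tl; apply: (@perm_inj _ al); apply: (wx_M0 hy); rewrite ?M0_alpha //.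
Qed.

Lemma wx_surj v : ~~ bk v -> exists2 x, ~~ special x & wx x = v.
Proof.
move=> hv; have [d [d1 d2] d3] := M0_uniq (white_int wf hv).
have hb : bk (tl (al d)) by rewrite black_head // d1.
have [x hx] := blv_surj hb; exists x.
  move: hx; rewrite -(splitK x); case: (fintype.split x) => a; rewrite /unsplit ?special_l ?special_r //.
  rewrite blv_r -leqNgt => h; have := M0_bdart a; rewrite -(bdart_eq wf (esym h)) M0_alpha d2.
  by move=> <-.
have hs : ~~ special x.
  move: hx; rewrite -(splitK x); case: (fintype.split x) => a; rewrite /unsplit ?special_l ?special_r //.
  rewrite blv_r -leqNgt => h; have := M0_bdart a; rewrite -(bdart_eq wf (esym h)) M0_alpha d2.
  by move=> <-.
have [h1 h2 h3] := mdartP hs.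
by rewrite /wx -(h3 (al d)) ?alphaK ?M0_alpha.
Qed.

(** Turning around [v], the height falls by one on passing [d], stays there until [d'], and returns
    on passing [d']. Hence one value of the height accompanies a whole path of the flow. *)
Lemma flow_through (nu z : dart G -> rat) (v : vert G) (d d' : dart G) :
  (forall e, ~~ is_bnd (tl (al e)) -> nu (sg (al e)) = nu e) ->
  (forall e, nu e - nu (al e) = z e) ->
  ~~ is_bnd v -> tl d = v -> tl d' = v -> z d = 1 -> z d' = -1 ->
  (forall e, tl e = v -> e != d -> e != d' -> z e = 0) ->
  nu d = nu (al d').
Proof.
move=> nf nz hv hd hd' zd zd' z0.
have st e : tl e = v -> nu (sg e) = nu e - z e.
  move=> he; rewrite -{1}(alphaK wf e) nf; last by rewrite alphaK // he.
  by rewrite -nz opprB addrC subrK.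
have key j : nu d' = nu d - 1 \/ nu (iter j.+1 sg d) = nu d - 1.
  elim: j => [|j [IH|IH]]; [by right; rewrite /= st // zd|by left|].
  have te : tl (iter j.+1 sg d) = v by elim: (j.+1) => //= i IHi; rewrite tail_sigma.
  have [e|ne] := eqVneq (iter j.+1 sg d) d'; first by left; rewrite -e.
  right; rewrite iterS st // IH z0 ?subr0 //.
  apply/eqP => e; move: IH; rewrite e => /eqP; rewrite -subr_eq0 opprB addrC subrK.
  by rewrite oner_eq0.
have : fconnect sg d d' by apply: sigma_conn => //; rewrite hd.
move=> /iter_findex; case: (findex _ _ _) => [/= e|j e].
  by move: zd; rewrite e zd' => /eqP; rewrite eqNr oner_eq0.
have : nu d' = nu d - 1 by case: (key j) => //; rewrite e.
move=> h; have := nz d'; rewrite zd' h => /eqP; rewrite subr_eq => /eqP e2.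
by apply: (addIr (-1)); rewrite e2 addrC.
Qed.
Definition bix (v : vert G) : 'I_(m + n) := odflt (rshift m (Ordinal n0)) [pick x | blv x == v].
Lemma bixK v : bk v -> blv (bix v) = v.
Proof.
move=> /blv_surj[x hx]; rewrite /bix; case: pickP => [y /eqP //|/(_ x)].
by rewrite hx eqxx.
Qed.
Lemma specialP x : special x -> exists2 p : 'I_n, x = rshift m p & (p < n - k)%N.
Proof.
rewrite -(splitK x); case: (fintype.split x) => p; rewrite /unsplit ?special_l ?special_r //.
by move=> h; exists p.
Qed.

Record nested (I : {set 'I_n}) (tau : 'I_n -> 'I_n) : Prop := Nested {
  nest_fix : forall p : 'I_n, (p < n - k)%N -> p \notin I -> tau p = p;
  nest_in : forall p : 'I_n, (p < n - k)%N -> p \in I -> (n - k <= tau p)%N /\ tau p \notin I;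
  nest_inj : forall p q : 'I_n, (p < n - k)%N -> (q < n - k)%N -> tau p = tau q -> p = q;
  nest_onto : forall q : 'I_n, q \notin I -> exists2 p : 'I_n, (p < n - k)%N & tau p = q;
  nest_level : forall p : 'I_n, (p < n - k)%N -> p \in I ->
    #|[set q : 'I_n in I | (q < n - k)%N && (q <= p)%N]| = #|[set c : 'I_n | [&& (n - k <= c)%N, c \notin I & (tau p <= c)%N]]| }.

(** * Kasteleyn signs *)

Section OneMatching.
Variables (A : {set dart G}) (tau : 'I_n -> 'I_n).
Hypothesis hA : is_apm A.
Hypothesis nst : nested (used_bnd A) tau.

Lemma apm_al d : (al d \in A) = (d \in A).
Proof. by move: hA => /andP[/andP[/forallP/(_ d)/eqP -> _] _]. Qed.

Lemma apm_int v : ~~ is_bnd v ->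
  exists2 d, tl d = v /\ d \in A & forall d', tl d' = v -> d' \in A -> d' = d.
Proof.
move=> hv; move: hA => /andP[/andP[_ /forallP/(_ v)]] /implyP/(_ hv) /cards1P[d hd] _.
have hin e : (e \in A) && (tl e == v) = (e == d) 
  by rewrite -[RHS]finset.in_set1 -hd inE.
exists d; first by have := hin d; rewrite eqxx => /andP[? /eqP].
by move=> d' h1 h2; apply/eqP; rewrite -hin h1 h2 eqxx.
Qed.

Lemma apm_used p : (p \in used_bnd A) = (bdart p \in A).
Proof.
rewrite inE; apply/existsP/idP => [[d /andP[hd /eqP/(bdart_eq wf) <-]] //|h].
by exists (bdart p); rewrite h tail_bdart eqxx.
Qed.

Lemma apm_uniq d d' : tl d = tl d' -> d \in A -> d' \in A -> d = d'.
Proof.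
move=> ht h h'; have [/is_bndP[p hp]|hv] := boolP (is_bnd (tl d)).
  by rewrite (bdart_eq wf hp) (bdart_eq wf (etrans (esym ht) hp)).
by have [e _ he] := apm_int hv; rewrite (he d) // (he d').
Qed.

Definition adart (v : vert G) : dart G := odflt (bdart (Ordinal n0)) [pick d | (tl d == v) && (d \in A)].
Lemma adartP v : ~~ is_bnd v -> tl (adart v) = v /\ adart v \in A.
Proof.
move=> /apm_int[d [h1 h2] _]; rewrite /adart; case: pickP => [e /andP[/eqP]//|/(_ d)].
by rewrite h1 h2 eqxx.
Qed.

Definition cdart (x : 'I_(m + n)) : dart G :=
  if special x then bdart (Ordinal n0) else al (adart (wx x)).
Lemma cdartP x : ~~ special x -> [/\ cdart x \in A, bk (tl (cdart x)) & tl (al (cdart x)) = wx x].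
Proof.
move=> hx; rewrite /cdart (negbTE hx).
have [h1 h2] := adartP (white_int wf (wx_white hx)).
by rewrite apm_al alphaK // black_head // h1 wx_white.
Qed.

Definition tauX (x : 'I_(m + n)) : 'I_(m + n) :=
  match fintype.split x with inl _ => x | inr p => rshift m (tau p) end.
Lemma tauX_r p : tauX (rshift m p) = rshift m (tau p).
Proof. by rewrite /tauX (unsplitK (inr p)). Qed.

(** One step along [M0] from black to white, one step back along [A]. The orbits are the components
    of [A + M0], where [tau] closes up the open paths. *)
Definition sfun (x : 'I_(m + n)) : 'I_(m + n) :=
  if special x then tauX x else bix (tl (cdart x)).

Lemma sfun_sp (p : 'I_n) : (p < n - k)%N -> sfun (rshift m p) = rshift m (tau p).
Proof. by move=> h; rewrite /sfun special_r h tauX_r. Qed.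
Lemma sfun_ns x : ~~ special x -> blv (sfun x) = tl (cdart x).
Proof. by move=> h; rewrite /sfun (negbTE h) bixK //; case: (cdartP h). Qed.

Lemma tau_notin (p : 'I_n) : (p < n - k)%N -> tau p \notin used_bnd A.
Proof.
move=> h; have [hp|hp] := boolP (p \in used_bnd A); first by case: (nest_in nst h hp).
by rewrite (nest_fix nst).
Qed.

Lemma sfun_inj : injective sfun.
Proof.
have mixed x (p : 'I_n) : ~~ special x -> (p < n - k)%N -> sfun x = rshift m (tau p) -> False.
  move=> hx hp /(congr1 blv); rewrite sfun_ns // blv_r => /(bdart_eq wf) e.
  have [h _ _] := cdartP hx; move: (tau_notin hp); rewrite apm_used -e h //.
move=> x y; have [hx|hx] := boolP (special x); have [hy|hy] := boolP (special y).
- case/specialP: hx hy => p -> hp /specialP[q -> hq]; rewrite !sfun_sp // => /rshift_inj /(nest_inj nst) -> //.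
- by case/specialP: hx => p -> hp; rewrite sfun_sp // => /esym /mixed [].
- by case/specialP: hy => p -> hp; rewrite sfun_sp // => /mixed [].
- move=> /(congr1 blv); rewrite !sfun_ns // => e.
  have [a1 _ c1] := cdartP hx; have [a2 _ c2] := cdartP hy.
  by apply: wx_inj => //; rewrite -c1 -c2 (apm_uniq e a1 a2).
Qed.

Definition sperm := perm sfun_inj.

Definition zA (d : dart G) : rat := (if bk (tl d) then 1 else -1) * ((d \in A)%:R - (M0 d)%:R).

Lemma zA_al d : zA (al d) = - zA d.
Proof. by rewrite /zA apm_al M0_alpha black_head //; case: (bk _); rewrite ?mul1r ?mulN1r ?opprK. Qed.

Lemma zA_div v : ~~ is_bnd v -> \sum_(d | tl d == v) zA d = 0.
Proof.
move=> hv; rewrite (eq_bigr (fun d => (if bk v then 1 else -1) * ((d \in A)%:R - (M0 d)%:R))); last first.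
  by move=> d /eqP <-.
rewrite -mulr_sumr sumrB.
have -> : \sum_(d | tl d == v) (M0 d)%:R = 1 :> rat by rewrite -natr_sum -/(nM v) nM1.
have [d [h1 h2] h3] := apm_int hv.
rewrite (bigD1 d) ?h1 //= h2 big1 ?addr0 ?subrr ?mulr0 // => e /andP[/eqP h4 h5].
by case: (boolP (e \in A)) => // /(h3 _ h4) h6; rewrite h6 eqxx in h5.
Qed.

(* The potential of A - M0 labels each path of A + M0 by its level. *)
Lemma level_exists : exists lev : 'I_(m + n) -> rat,
  (forall x, lev (sfun x) = lev x) /\
  (forall p q : 'I_n, (p < n - k)%N -> (q < n - k)%N -> p \in used_bnd A -> q \in used_bnd A ->
     lev (rshift m p) = lev (rshift m q) -> p = q).
Proof.
have [nu [Phi [nf nb1 nb2 nz]]] := flow_height wf n0 eul zA_al zA_div.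
set I := used_bnd A.
have nstI : nested I tau := nst.
have apmI p : (p \in I) = (bdart p \in A) := apm_used p.
clearbody I.
have PhiS p : Phi (ordS p) = Phi p + ((p \in I)%:R - (n - k <= p)%N%:R).
  apply/eqP; rewrite addrC -subr_eq -(nb1 p) -(nb2 p) nz /zA tail_bdart black_bnd // mul1r.
  by rewrite apmI M0_bdart.
pose p0 := Ordinal n0.
have cnt (p : 'I_n) : Phi p = Phi p0 + \sum_(q < n | (q < p)%N) ((q \in I)%:R - (n - k <= q)%N%:R).
  case: p; elim=> [|p IH] hp.
    by rewrite big1 ?addr0 //; congr Phi; apply: val_inj.
  have hp' := ltnW hp.
  have -> : Ordinal hp = ordS (Ordinal hp') by apply: val_inj; rewrite /= modn_small.
  rewrite PhiS IH -addrA; congr (_ + _); rewrite addrC [RHS](bigD1 (Ordinal hp')) /=; last by rewrite modn_small.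
  congr (_ + _); apply: eq_bigl => i; rewrite -(inj_eq val_inj) /= modn_small //; lia.
(* The heights at the two ends of a path, each as a count of boundary vertices; [nest_level] makes
   them equal. *)
have cntS (p : 'I_n) : (p < n - k)%N -> p \in I ->
  Phi (ordS p) = Phi p0 + #|[set q : 'I_n in I | (q < n - k)%N && (q <= p)%N]|%:R.
  move=> hp hI; rewrite PhiS hI leqNgt hp subr0 cnt -addrA; congr (_ + _).
  rewrite -sum1_card natr_sum /= [RHS](bigD1 p) /=; last by rewrite inE hI hp leqnn.
  rewrite addrC; congr (_ + _).
  rewrite big_mkcond [RHS]big_mkcond /=; apply: eq_bigr => i _.
  rewrite inE -(inj_eq val_inj) /=.
  have -> : ((i \in I) && ((i < n - k) && (i <= p)) && (i != p :> nat) = (i \in I) && (i < p))%N by lia.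
  case: (ltnP i p) => h; rewrite ?andbF ?andbT //.
  have -> : (n - k <= i)%N = false by move: h hp; clear; lia.
  by rewrite subr0; case: (i \in I).
have cntc (c : 'I_n) : (n - k <= c)%N -> c \notin I ->
  Phi c = Phi p0 + #|[set c' : 'I_n | [&& (n - k <= c')%N, c' \notin I & (c <= c')%N]]|%:R.
  move=> hc hI; rewrite cnt; congr (_ + _).
  have tot : \sum_(q < n) ((q \in I)%:R - (n - k <= q)%N%:R) = 0 :> rat.
    pose pl := ord_pred p0.
    have e : ordS pl = p0 by rewrite ord_predK.
    have /eqP := PhiS pl; rewrite e (cnt pl) -addrA -subr_eq0 opprD addrA subrr add0r oppr_eq0 => /eqP h.
    rewrite -[RHS]h (bigD1 pl) //= addrC; congr (_ + _).
    apply: eq_bigl => i; rewrite -(inj_eq val_inj) /= add0n modn_small ?prednK //.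
    have := ltn_ord i; lia.
  apply/eqP; rewrite -subr_eq0 -[X in _ == X]tot [in X in _ == X](bigID (fun q : 'I_n => (q < c)%N)) /=; apply/eqP.
  congr (_ + _); rewrite -sum1_card natr_sum -sumrN [LHS]big_mkcond [RHS]big_mkcond /=; apply: eq_bigr => i _.
  rewrite inE -leqNgt; case: (leqP c i) => h; rewrite ?andbF //.
  have -> : (n - k <= i)%N by apply: leq_trans h.
  by rewrite andbT /=; case: (i \in I); rewrite /= ?subrr ?sub0r.
pose lev x := if special x then match fintype.split x with inr p => Phi (ordS p) | _ => 0 end else nu (al (mdart x)).
have levs (p : 'I_n) : (p < n - k)%N -> lev (rshift m p) = Phi (ordS p).
  by move=> h; rewrite /lev special_r h (unsplitK (inr p)).
exists lev; split; last first.
  move=> p q hp hq pI qI; rewrite !levs // !cntS // => /addrI /eqP; rewrite eqr_nat => /eqP e.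
  wlog le : p q hp hq pI qI e / (p <= q)%N.
    by move=> H; case: (leqP p q) => [|/ltnW] h; [apply: H|apply/esym/H].
  have /subset_cardP : #|[set q' : 'I_n in I | (q' < n - k)%N && (q' <= p)%N]| = #|[set q' : 'I_n in I | (q' < n - k)%N && (q' <= q)%N]| by [].
  move=> H; apply/val_inj/anti_leq; rewrite le /=.
  have : q \in [set q' : 'I_n in I | (q' < n - k)%N && (q' <= p)%N].
    have /H -> : [set q' : 'I_n in I | (q' < n - k)%N && (q' <= p)%N] \subset [set q' : 'I_n in I | (q' < n - k)%N && (q' <= q)%N].
      apply/fintype.subsetP => i; rewrite !inE => /and3P[-> -> h] /=; exact: leq_trans le.
    by rewrite inE qI hq leqnn.
  by rewrite inE => /and3P[].
move=> x; have [/specialP[p -> hp]|hx] := boolP (special x).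
  rewrite sfun_sp //; have [pI|pI] := boolP (p \in I); last by rewrite (nest_fix nstI).
  have [t1 t2] := nest_in nstI hp pI.
  rewrite (levs p hp) (cntS p hp pI) (nest_level nstI hp pI) -(cntc _ t1 t2) /lev special_r ltnNge t1 /=.
  have ns : ~~ special (rshift m (tau p)) by rewrite special_r -leqNgt.
  have [e1 _ _] := mdartP ns; move: e1; rewrite blv_r => /(bdart_eq wf) ->.
  exact: nb1.
have [c1 c2 c3] := cdartP hx; have [m1 m2 m3] := mdartP hx.
have hw := wx_white hx; have hwi := white_int wf hw.
have [e|ne] := eqVneq (cdart x) (mdart x).
  by have -> : sfun x = x by apply: blv_inj; rewrite sfun_ns // e.
have mA : mdart x \notin A.
  apply: contra ne => h; apply/eqP/alpha_inj; apply: apm_uniq; rewrite ?apm_al //.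
have cM : ~~ M0 (cdart x).
  apply: contra ne => h; apply/eqP/alpha_inj; apply: (wx_M0 hx) => //; by rewrite M0_alpha.
have zc : zA (cdart x) = 1 by rewrite /zA c2 c1 (negbTE cM) subr0 mulr1.
have zm : zA (mdart x) = -1 by rewrite /zA m1 blv_black (negbTE mA) m2 sub0r mul1r.
have z0 v e : ~~ is_bnd v -> tl e = v -> e \notin A -> ~~ M0 e -> zA e = 0.
  by move=> _ _ h1 h2; rewrite /zA (negbTE h1) (negbTE h2) subrr mulr0.
have lw : nu (al (mdart x)) = nu (cdart x).
  rewrite -(alphaK wf (cdart x)); apply: (flow_through nf nz hwi) => //.
  - by rewrite zA_al zm opprK.
  - by rewrite zA_al zc.
  - move=> e he n1 n2; apply: (z0 _ _ hwi) => //.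
      by apply: contra n2 => h; apply/eqP/apm_uniq; rewrite ?apm_al // he c3.
    by apply: contra n1 => h; apply/eqP/(wx_M0 hx).
have -> : lev x = nu (cdart x) by rewrite -lw /lev (negbTE hx).
have hy : blv (sfun x) = tl (cdart x) by rewrite sfun_ns.
have [sy|sy] := boolP (special (sfun x)).
  case/specialP: (sy) => p ep hp; rewrite ep levs // -nb2; congr nu; apply/esym/bdart_eq.
  by rewrite -hy ep blv_r.
have [y1 y2 y3] := mdartP sy.
have nec : cdart x != mdart (sfun x) by apply: contra cM => /eqP ->.
have [/blv_bnd[p ep]|hyi] := boolP (is_bnd (blv (sfun x))).
  case/negP: nec; rewrite (bdart_eq wf (etrans (esym hy) (etrans (congr1 blv ep) (blv_r p)))).
  by rewrite -(bdart_eq wf (etrans y1 (etrans (congr1 blv ep) (blv_r p)))).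
rewrite /lev (negbTE sy); apply/esym/(flow_through nf nz hyi) => //.
- have yA : mdart (sfun x) \notin A.
    by apply: contra nec => h; apply/eqP/apm_uniq; rewrite // y1 hy.
  by rewrite /zA y1 blv_black (negbTE yA) y2 sub0r mul1r.
- move=> e he n1 n2; apply: (z0 _ _ hyi) => //.
    by apply: contra n1 => h; apply/eqP/apm_uniq; rewrite // he hy.
  by apply: contra n2 => h; apply/eqP/y3.
Qed.

Lemma sum_tail_eq (a : dart G) v : \sum_(d | tl d == v) (a == d)%:R = (tl a == v)%:R :> rat.
Proof.
have [h|h] := eqVneq (tl a) v.
  rewrite (bigD1 a) /=; last by rewrite h.
  by rewrite eqxx big1 ?addr0 // => d /andP[_]; rewrite eq_sym => /negbTE ->.
by rewrite big1 // => d /eqP hd; case: eqP => // e; move: h; rewrite e hd eqxx.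
Qed.

Lemma sum_head_eq (a : dart G) v : \sum_(d | tl d == v) (a == al d)%:R = (tl (al a) == v)%:R :> rat.
Proof.
rewrite -sum_tail_eq; apply: eq_bigr => d _; congr (nat_of_bool _)%:R.
by rewrite -(inj_eq (@perm_inj _ al)) alphaK.
Qed.

(** Such an orbit is a cycle alternating between [A] and [M0]. Traversed in its direction each edge
    outside the intersection satisfies [up], so the circulation along the cycle vanishes by
    [up_acyclic]: the cycle is a single common edge. *)
Lemma orbit_fixed x : (forall y, y \in porbit sperm x -> ~~ special y) ->
  sfun x = x /\ M0 (cdart x).
Proof.
move=> H.
pose h d : rat := \sum_(y in porbit sperm x) ((cdart y == d)%:R - (mdart y == d)%:R).
pose z d := h d - h (al d).
have hw d : ~~ bk (tl d) -> h d = 0.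
  move=> hd; apply: big1 => y /H hy; have [_ c2 _] := cdartP hy; have [m1 _ _] := mdartP hy.
  case: eqP => [e|_]; first by rewrite e (negbTE hd) in c2.
  by case: eqP => [e|_]; rewrite ?subrr //; move: hd; rewrite -e m1 blv_black.
have zdiv v : \sum_(d | tl d == v) z d = 0.
  rewrite sumrB /h exchange_big [X in _ - X]exchange_big /= -sumrB.
  rewrite (eq_bigr (fun y => (blv (sfun y) == v)%:R - (blv y == v)%:R)); last first.
    move=> y /H hy; have [_ _ c3] := cdartP hy; have [m1 _ _] := mdartP hy.
    by rewrite !sumrB !sum_tail_eq !sum_head_eq -sfun_ns // m1 c3 -/(wx y) subrr subr0.
  rewrite sumrB; apply/eqP; rewrite subr_eq0; apply/eqP.
  rewrite [RHS](reindex_inj (@perm_inj _ sperm)) /=.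
  apply: eq_big => [y|y _]; last by rewrite permE.
  have e : porbit sperm (sperm y) = porbit sperm y by have := porbit_perm sperm 1 y; rewrite expg1.
  by rewrite !(porbit_sym _ _ x) e.
have zup d : 0 < z d -> up d.
  rewrite /z; have [hb|hd] := boolP (bk (tl d)).
    rewrite [X in _ - X]hw ?subr0; last by rewrite black_head // hb.
    have := M0_up d; rewrite hb; case: (up d) => //= hM; rewrite ltNge /h sumr_le0 // => y /H hy.
    have [_ _ c3] := cdartP hy; have [_ _ m3] := mdartP hy.
    case: eqP => [e|_]; last by rewrite subr_le0 ler0n.
    have -> : mdart y = d; last by rewrite eqxx subrr.
    by apply: alpha_inj; apply/esym/(wx_M0 hy); rewrite ?M0_alpha // -e.
  rewrite (hw d) // sub0r oppr_gt0.
  have := M0_up d; rewrite (negbTE hd) => <-; apply: contraLR => hM.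
  rewrite -leNgt /h sumr_ge0 // => y /H hy; have [_ m2 _] := mdartP hy.
  case: (mdart y =P al d) => [e|_]; last by rewrite subr0 ler0n.
  by move: hM; rewrite -M0_alpha -e m2.
have z0 d : z d = 0.
  apply: up_acyclic => //; first by move=> e; rewrite /z alphaK // opprB.
  by move=> p; rewrite -(zdiv (bd p)) (big_pred1 (bdart p)) // => e /=; apply/eqP/eqP => [/(bdart_eq wf)|->]; rewrite ?tail_bdart.
have hx : ~~ special x by apply: H; apply: porbit_id.
have [c1 c2 c3] := cdartP hx; have [m1 m2 m3] := mdartP hx.
have hM : M0 (cdart x).
  apply/negPn/negP => hM; have := z0 (cdart x); rewrite /z [X in _ - X]hw ?subr0; last by rewrite black_head // c2.
  apply/eqP; rewrite gt_eqF // /h (bigD1 x) ?porbit_id //= eqxx.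
  have -> : mdart x == cdart x = false by apply/negbTE; apply: contra hM => /eqP <-.
  rewrite subr0 ltr_wpDr ?ltr01 // sumr_ge0 // => y /andP[/H hy _].
  have [_ m2' _] := mdartP hy.
  case: (mdart y =P cdart x) => [e|_]; last by rewrite subr0 ler0n.
  by move: hM; rewrite -e m2'.
split=> //; apply: blv_inj; rewrite sfun_ns // -m1; congr tl.
by apply: alpha_inj; apply: (wx_M0 hx); rewrite ?M0_alpha.
Qed.

Lemma fixed_orbit x y : sfun x = x -> y \in porbit sperm x -> y = x.
Proof.
move=> hx /porbitP[i ->]; rewrite permX; elim: i => //= i ->.
by rewrite permE.
Qed.

Lemma fixed_M0 x : ~~ special x -> (sfun x == x) = M0 (cdart x).
Proof.
move=> hx; apply/eqP/idP => [h|hM].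
  by case: (@orbit_fixed x) => // y /(fixed_orbit h) ->.
have [c1 c2 c3] := cdartP hx; have [m1 m2 m3] := mdartP hx.
apply: blv_inj; rewrite sfun_ns // -m1; congr tl.
by apply: alpha_inj; apply: (wx_M0 hx); rewrite ?M0_alpha.
Qed.

Lemma card_special : #|[set x | special x]| = (n - k)%N.
Proof.
have -> : [set x | special x] = [set rshift m p | p : 'I_n & (p < n - k)%N].
  apply/setP => x; rewrite inE; apply/idP/imsetP => [/specialP[p -> h]|[p]].
    by exists p; rewrite ?inE.
  by rewrite inE => h ->; rewrite special_r.
rewrite card_imset; last exact: rshift_inj.
have := sum_interval 0 (leq_subr k n); rewrite -natr_sum => /eqP; rewrite eqr_nat subn0 => /eqP {2}<-.
rewrite -sum1_card big_mkcond /=; apply: eq_bigr => i _; rewrite inE; by case: ifP.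
Qed.

(** Distinct special vertices lie in distinct orbits, because their levels differ or they are fixed.
    An orbit without special vertices is a fixed point, that is an edge common to [A] and [M0]. *)
Lemma card_porbits : #|porbits sperm| = (n - k + \sum_(x | ~~ special x) M0 (cdart x))%N.
Proof.
pose T := [set x | special x || (sfun x == x)].
have [lev [lev1 lev2]] := level_exists.
have levo x y : y \in porbit sperm x -> lev y = lev x.
  by move=> /porbitP[i ->]; rewrite permX; elim: i => //= i <-; rewrite permE lev1.
have -> : porbits sperm = porbit sperm @: T.
  apply/setP => P; apply/imsetP/imsetP => -[x hx ->]; last by exists x.
  have [/existsP[y /andP[h1 h2]]|/existsPn hn] := boolP [exists y, (y \in porbit sperm x) && special y].
    by exists y; rewrite ?inE ?h2 //; apply/eqP; rewrite eq_porbit_mem porbit_sym.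
  exists x => //; rewrite inE.
  by have [|->] := @orbit_fixed x; rewrite ?eqxx ?orbT // => y hy; have := hn y; rewrite hy.
rewrite card_in_imset; last first.
  move=> x y; rewrite !inE => hx hy /eqP; rewrite eq_porbit_mem => hxy.
  have [/eqP fy|fy] := boolP (sfun y == y); first exact: fixed_orbit hxy.
  have [/eqP fx|fx] := boolP (sfun x == x).
    by apply/esym/(fixed_orbit fx); rewrite porbit_sym.
  move: hx hy; rewrite (negbTE fx) (negbTE fy) !orbF => /specialP[p ep hp] /specialP[q eq hq].
  rewrite ep eq; congr rshift; apply: lev2 => //.
  - by apply/negPn/negP => hI; move: fx; rewrite ep sfun_sp // (nest_fix nst) // eqxx.
  - by apply/negPn/negP => hI; move: fy; rewrite eq sfun_sp // (nest_fix nst) // eqxx.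
  - by rewrite -ep -eq; apply: levo.
rewrite -card_special -(cardsID [set x | special x] T); congr addn.
  by apply: eq_card => x; rewrite !inE; case: (special x); rewrite ?andbF ?andbT.
rewrite -sum1_card big_mkcond [RHS]big_mkcond /=; apply: eq_bigr => x _.
rewrite !inE; case: (boolP (special x)) => //= hx; rewrite fixed_M0 //; by case: (M0 _).
Qed.

(** The parity of a permutation is that of its degree minus its number of orbits. By [card_porbits]
    the part depending on [A] is the number of edges shared with [M0], which the signs on [M0]
    cancel. *)
Lemma sign_matching (R : pzRingType) :
  (-1) ^+ sperm * \prod_(x | ~~ special x) (-1) ^+ M0 (cdart x) = (-1) ^+ (m + k) :> R.
Proof.
rewrite -expr_sum -exprD -signr_odd -[RHS]signr_odd; congr (_ ^+ (nat_of_bool _)).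
rewrite !oddD /odd_perm card_ord card_porbits !oddD oddb (oddB (ltnW kn)).
by case: (odd m); case: (odd n); case: (odd k); case: (odd _).
Qed.
End OneMatching.

Lemma nested_notin I tau (p : 'I_n) : nested I tau -> (p < n - k)%N -> tau p \notin I.
Proof.
move=> nst h; have [hp|hp] := boolP (p \in I); first by case: (nest_in nst h hp).
by rewrite (nest_fix nst).
Qed.

Section Kasteleyn.
Variables (R : comPzRingType) (wt : dart G -> R).
Variables (I : {set 'I_n}) (tau : 'I_n -> 'I_n).
Hypothesis nst : nested I tau.
Let p0 := Ordinal n0.

(** Rows stand for white vertices and special indices, columns for black vertices, and the sum over
    darts in [kast_mx] takes care of multiple edges. In a special row the fixed dart [bdart p0] only
    serves to let the unit entry occur once in that sum. *)
Definition kast_entry (x x' : 'I_(m + n)) (d : dart G) : R :=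
  if special x then ((x' == tauX tau x) && (d == bdart p0))%:R
  else ((tl d == blv x') && (tl (al d) == wx x))%:R * ((-1) ^+ M0 d * wt d).

Definition kast_mx : 'M[R]_(m + n) := \matrix_(x, x') \sum_d kast_entry x x' d.

(** The index of a term that can be nonzero when the determinant and the sums in its entries are
    both expanded. For each [I] these pairs correspond to the matchings with boundary [I], through
    [pair_match]. *)
Definition good_pair (s : 'S_(m + n)) (g : {ffun 'I_(m + n) -> dart G}) : bool :=
  [forall x, if special x then (s x == tauX tau x) && (g x == bdart p0)
             else (tl (g x) == blv (s x)) && (tl (al (g x)) == wx x)].

Definition pair_match (g : {ffun 'I_(m + n) -> dart G}) : {set dart G} :=
  [set d | [exists x, ~~ special x && ((d == g x) || (d == al (g x)))]].

Lemma good_sp s g p : good_pair s g -> special (rshift m p) ->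
  s (rshift m p) = rshift m (tau p) /\ g (rshift m p) = bdart p0.
Proof. by move=> /forallP/(_ (rshift m p)) + h; rewrite h tauX_r => /andP[/eqP -> /eqP ->]. Qed.

Lemma good_ns s g x : good_pair s g -> ~~ special x -> tl (g x) = blv (s x) /\ tl (al (g x)) = wx x.
Proof. by move=> /forallP/(_ x) + h; rewrite (negbTE h) => /andP[/eqP -> /eqP ->]. Qed.

Lemma mem_pair_match s g d : good_pair s g -> bk (tl d) ->
  reflect (exists2 x, ~~ special x & d = g x) (d \in pair_match g).
Proof.
move=> hg hd; rewrite inE; apply: (iffP existsP) => [[x /andP[hx /orP[/eqP->|/eqP e]]]|[x hx ->]].
- by exists x.
- by have [_ h2] := good_ns hg hx; move: (wx_white hx); rewrite -h2 -e hd.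
- by exists x; rewrite hx eqxx.
Qed.

Lemma pair_match_al g d : (al d \in pair_match g) = (d \in pair_match g).
Proof.
rewrite !inE; apply: eq_existsb => x; congr (_ && _).
rewrite (inj_eq (@perm_inj _ al)) orbC; congr (_ || _).
by apply/eqP/eqP => [<-|->]; rewrite alphaK.
Qed.

Lemma used_pair_match s g : good_pair s g -> used_bnd (pair_match g) = I.
Proof.
move=> hg; apply/setP => p.
have -> : (p \in used_bnd (pair_match g)) = (bdart p \in pair_match g).
  rewrite inE; apply/existsP/idP => [[d /andP[hd /eqP/(bdart_eq wf) <-]] //|h].
  by exists (bdart p); rewrite h tail_bdart eqxx.
have hb : bk (tl (bdart p)) by rewrite tail_bdart black_bnd.
apply/(mem_pair_match hg hb)/idP => [[x hx e]|pI].
  apply/negPn/negP => /(nest_onto nst)[q hq eq].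
  have sq : special (rshift m q) by rewrite special_r.
  have [h1 _] := good_sp hg sq; have [h2 _] := good_ns hg hx.
  have : s (rshift m q) = s x by apply: blv_inj; rewrite h1 eq blv_r -h2 -e tail_bdart.
  by move=> /perm_inj e'; move: hx; rewrite -e' sq.
pose x := (s^-1)%g (rshift m p).
have sx : s x = rshift m p by rewrite permKV.
have hx : ~~ special x.
  apply/negP => sp; case/specialP: (sp) => q eq hq.
  have sq : special (rshift m q) by rewrite special_r.
  have [h1 _] := good_sp hg sq; move: sx; rewrite eq h1 => /rshift_inj e.
  by have := nested_notin nst hq; rewrite e pI.
exists x => //; apply/esym/bdart_eq; have [-> _] := good_ns hg hx; by rewrite sx blv_r.
Qed.

Lemma apm_pair_match s g : good_pair s g -> is_apm (pair_match g).
Proof.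
move=> hg; have uniq d d' : bk (tl d) -> tl d = tl d' -> d \in pair_match g -> d' \in pair_match g -> d = d'.
  move=> hb ht /(mem_pair_match hg hb)[x hx e]; rewrite ht in hb => /(mem_pair_match hg hb)[y hy e'].
  have [h1 _] := good_ns hg hx; have [h2 _] := good_ns hg hy.
  have /perm_inj exy : s x = s y by apply: blv_inj; rewrite -h1 -h2 -e -e'.
  by rewrite e e' exy.
apply/andP; split; first apply/andP; first split.
- by apply/forallP => d; rewrite pair_match_al.
- apply/forallP => v; apply/implyP => hv; apply/cards1P.
  have [hb|hw] := boolP (bk v).
    have [y hy] := blv_surj hb; pose x := (s^-1)%g y; have sx : s x = y by rewrite permKV.
    have hx : ~~ special x.
      apply/negP => /specialP[q eq hq]; have sq : special (rshift m q) by rewrite special_r.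
      have [h1 _] := good_sp hg sq; move: sx hv; rewrite -hy eq h1 => <-.
      by rewrite blv_r is_bnd_bnd.
    have [h1 h2] := good_ns hg hx; rewrite sx hy in h1.
    have gin : g x \in pair_match g by apply/(mem_pair_match hg); [rewrite h1|exists x].
    exists (g x); apply/setP => d; rewrite !inE -/(d \in pair_match g).
    apply/andP/eqP => [[h3 /eqP h4]|->]; last by rewrite h1 eqxx; split=> //; move: gin; rewrite inE.
    by apply: uniq; rewrite ?h4 ?h1 // inE.
  have [x hx ex] := wx_surj hw; have [h1 h2] := good_ns hg hx.
  exists (al (g x)); apply/setP => d; rewrite !inE.
  apply/andP/eqP => [[/existsP[y /andP[hy /orP[/eqP e|/eqP e]]] /eqP h4]|->].
  + by have [h5 _] := good_ns hg hy; move: hw; rewrite -h4 e h5 blv_black.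
  + have [_ h5] := good_ns hg hy; rewrite e; congr (al (g _)); apply: wx_inj => //.
    by rewrite -h5 -e h4.
  + by split; [apply/existsP; exists x; rewrite hx eqxx orbT|rewrite h2 ex].
- apply/forallP => p; rewrite leqNgt; apply/negP => /card_gt1P[d [d' [h1 h2]]].
  move: h1 h2; rewrite finset.in_set [in X in _ -> X]finset.in_set => /andP[h1 /eqP h2] /andP[h3 /eqP h4].
  by rewrite (bdart_eq wf h2) (bdart_eq wf h4) eqxx.
Qed.

Section Canonical.
Variables (A : {set dart G}).
Hypotheses (hA : is_apm A) (hI : used_bnd A = I).
Let nstA : nested (used_bnd A) tau.
Proof. by rewrite hI. Qed.
Let sA := sperm hA nstA.
Let gA := [ffun x => cdart A x].

Lemma good_canonical : good_pair sA gA.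
Proof.
apply/forallP => x; rewrite permE ffunE; have [hx|hx] := boolP (special x).
  by rewrite /sfun /cdart hx !eqxx.
have [c1 c2 c3] := cdartP hA hx.
by rewrite (sfun_ns tau hA hx) c3 !eqxx.
Qed.

Lemma pair_match_canonical : pair_match gA = A.
Proof.
apply/setP => d; wlog hb : d / bk (tl d).
  move=> H; have [|hd] := boolP (bk (tl d)); first exact: H.
  by rewrite -pair_match_al -(apm_al hA) H // black_head.
apply/(mem_pair_match good_canonical hb)/idP => [[x hx ->]|dA].
  by rewrite ffunE; case: (cdartP hA hx).
have [|x hx ex] := @wx_surj (tl (al d)); first by rewrite black_head // negbK.
exists x => //; rewrite ffunE; have [c1 c2 c3] := cdartP hA hx.
by apply: alpha_inj; apply: (apm_uniq hA); rewrite ?(apm_al hA) // c3.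
Qed.

Lemma good_uniq s g : good_pair s g -> pair_match g = A -> s = sA /\ g = gA.
Proof.
move=> hg eA.
have eg x : g x = cdart A x.
  have [hx|hx] := boolP (special x).
    by case/specialP: (hx) => p ep hp; rewrite /cdart hx ep; rewrite ep in hx; case: (good_sp hg hx).
  have [h1 h2] := good_ns hg hx; have [c1 c2 c3] := cdartP hA hx.
  apply: alpha_inj; apply: (apm_uniq hA); rewrite ?(apm_al hA) //; first by rewrite h2 c3.
  by rewrite -eA; apply/(mem_pair_match hg); [rewrite h1 blv_black|exists x].
split; last by apply/ffunP => x; rewrite ffunE.
apply/permP => x; rewrite permE; have [hx|hx] := boolP (special x).
  by case/specialP: (hx) => p ep hp; rewrite ep in hx *; case: (good_sp hg hx) => -> _; rewrite sfun_sp.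
apply: blv_inj; rewrite (sfun_ns tau hA hx) -eg; by case: (good_ns hg hx).
Qed.

Lemma prod_canonical : \prod_(x | ~~ special x) wt (cdart A x) = \prod_(d in A | bk (tl d)) wt d.
Proof.
pose h' d := odflt (rshift m p0) [pick x | ~~ special x && (wx x == tl (al d))].
have h'P d : bk (tl d) -> ~~ special (h' d) /\ wx (h' d) = tl (al d).
  move=> hd; have [|x hx ex] := @wx_surj (tl (al d)); first by rewrite black_head // negbK.
  rewrite /h'; case: pickP => [y /andP[h1 /eqP h2] //|/(_ x)]; by rewrite hx ex eqxx.
rewrite [RHS](reindex_onto (cdart A) h') /=; last first.
  move=> d /andP[dA hd]; have [h1 h2] := h'P d hd; have [c1 c2 c3] := cdartP hA h1.
  by apply: alpha_inj; apply: (apm_uniq hA); rewrite ?(apm_al hA) // c3.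
apply: eq_bigl => x; have [hx|hx] /= := boolP (special x).
  apply/esym/negP => /andP[/andP[_ hb] /eqP e]; have [h1 _] := h'P _ hb; move: h1; by rewrite e hx.
have [c1 c2 c3] := cdartP hA hx; rewrite c1 c2 /=; apply/esym/eqP.
by have [h1 h2] := h'P _ c2; apply: wx_inj => //; rewrite h2.
Qed.
End Canonical.

(** Only good pairs survive in the expansion, each matching with boundary [I] comes from exactly one
    of them, and [sign_matching] gives all of them the same sign. *)
Lemma kast_det : \det kast_mx = (-1) ^+ (m + k) * Delta G wt I.
Proof.
rewrite /determinant.
under eq_bigr => s _ do (under eq_bigr do rewrite mxE); rewrite /=.
under eq_bigr => s _ do rewrite bigA_distr_bigA /= mulr_sumr.
rewrite pair_bigA /=.
rewrite (bigID (fun sg => good_pair sg.1 sg.2)) /= [X in _ + X]big1 ?addr0; last first.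
  move=> [s g] /= /forallPn[x hx]; rewrite (bigD1 x) //= [kast_entry _ _ _](_ : _ = 0) ?mul0r ?mulr0 //.
  move: hx; rewrite /kast_entry; case: ifP => _ /negbTE ->; by rewrite ?mul0r.
rewrite (partition_big (fun sg : 'S_(m + n) * {ffun 'I_(m + n) -> dart G} => pair_match sg.2) (fun A => is_apm A && (used_bnd A == I))) /=; last first.
  by move=> [s g] /= hg; rewrite (apm_pair_match hg) (used_pair_match hg) eqxx.
rewrite /Delta mulr_sumr; apply: eq_bigr => A /andP[hA /eqP hI].
have nstA : nested (used_bnd A) tau by rewrite hI.
rewrite (big_pred1 (sperm hA nstA, [ffun x => cdart A x])); last first.
  move=> [s g] /=; apply/andP/eqP => [[h1 /eqP h2]|[-> ->]].
    by have [-> ->] := good_uniq hA hI h1 h2; congr (_, _); apply/permP => x; rewrite !permE.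
  split; last by rewrite (pair_match_canonical hA hI).
  by have := good_canonical hA hI; congr (good_pair _ _); apply/permP => x; rewrite !permE.
rewrite /= -(prod_canonical hA) -(sign_matching hA nstA) -mulrA; congr (_ * _).
rewrite -big_split /= (bigID special) /= big1 ?mul1r; last first.
  move=> x hx; rewrite /kast_entry hx permE ffunE /cdart hx /sfun hx !eqxx //.
apply: eq_bigr => x hx; rewrite /kast_entry (negbTE hx) permE ffunE.
have [c1 c2 c3] := cdartP hA hx.
by rewrite (sfun_ns tau hA hx) c3 !eqxx mul1r.
Qed.
End Kasteleyn.

Section MeasFormula.
Variables (R : fieldType) (wt : dart G -> R) (y : 'I_n -> vert G -> R).
Definition kast_wt (d : dart G) : R := (-1) ^+ M0 d * wt d.
Hypothesis hol : forall (p : 'I_n) v, bk v -> ~~ is_bnd v -> \sum_(d | tl d == v) kast_wt d * y p (tl (al d)) = 0.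

Definition bnd_val (p q : 'I_n) : R := kast_wt (bdart q) * y p (tl (al (bdart q))).
Definition meas_mx (tau : 'I_n -> 'I_n) : 'M[R]_n :=
  \matrix_(p, q) if (p < n - k)%N then (q == tau p)%:R else bnd_val p q.
(** Unit rows at the special indices, then the solutions [y p] placed on the white rows. By [hol]
    the product with the Kasteleyn matrix vanishes on the columns of interior black vertices, and
    boundary values remain. *)
Definition bot_mx : 'M[R]_(n, m + n) :=
  \matrix_(p, x) if (p < n - k)%N then (x == rshift m p)%:R
                 else if special x then 0 else y p (wx x).

Lemma bot_mul (tau : 'I_n -> 'I_n) : bot_mx *m kast_mx wt tau = row_mx 0 (meas_mx tau).
Proof.
apply/matrixP => p x'; rewrite mxE.
have [hp|hp] := ltnP p (n - k).
  rewrite (bigD1 (rshift m p)) //= mxE hp eqxx mul1r big1 ?addr0; last first.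
    by move=> x hx; rewrite mxE hp (negbTE hx) mul0r.
  have sp : special (rshift m p) by rewrite special_r.
  rewrite mxE (bigD1 (bdart (Ordinal n0))) //= big1 ?addr0; last first.
    by move=> d hd; rewrite /kast_entry sp (negbTE hd) andbF.
  rewrite /kast_entry sp eqxx andbT tauX_r -(splitK x'); case: (fintype.split x') => a; rewrite /unsplit.
    by rewrite row_mxEl mxE eq_lrshift.
  by rewrite row_mxEr mxE hp eq_rshift.
have -> : \sum_x bot_mx p x * kast_mx wt tau x x' = \sum_(d | tl d == blv x') kast_wt d * y p (tl (al d)).
  transitivity (\sum_(x | ~~ special x) \sum_(d | (tl d == blv x') && (tl (al d) == wx x)) kast_wt d * y p (tl (al d))).
    rewrite [LHS](bigID special) /= big1 ?add0r; last by move=> x hx; rewrite mxE ltnNge hp hx mul0r.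
    apply: eq_bigr => x hx; rewrite mxE ltnNge hp /= (negbTE hx) mxE mulr_sumr [RHS]big_mkcond /=.
    apply: eq_bigr => d _; rewrite /kast_entry (negbTE hx); case: ifP => [/andP[_ /eqP ->]|_]; rewrite ?mul0r ?mulr0 //.
    by rewrite mul1r mulrC.
  rewrite (exchange_big_dep (fun d => tl d == blv x')) /=; last by move=> x d _ /andP[].
  apply: eq_bigr => d hd; have hb : bk (tl d) by rewrite (eqP hd) blv_black.
  have [|x hx ex] := @wx_surj (tl (al d)); first by rewrite black_head // negbK.
  rewrite (big_pred1 x) // => x2 /=; rewrite hd /= -ex; apply/andP/eqP => [[h1 /eqP /wx_inj -> //]|->].
  by rewrite hx eqxx.
rewrite -(splitK x'); case: (fintype.split x') => a; rewrite /unsplit.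
  by have [h1 h2] := int_blackP a; rewrite row_mxEl mxE blv_l hol.
rewrite row_mxEr mxE ltnNge hp /= blv_r (big_pred1 (bdart a)) //.
by move=> d /=; apply/eqP/eqP => [/(bdart_eq wf)|->]; rewrite ?tail_bdart.
Qed.

Lemma complete_unitmx (r q : nat) (A : 'M[R]_(q, r + q)) : row_free A ->
  exists B : 'M[R]_(r, r + q), col_mx B A \in unitmx.
Proof.
move=> fA.
have e : \rank (A^C)%MS = r by rewrite mxrank_compl (eqP fA) addnK.
have : exists B : 'M[R]_(\rank (A^C)%MS, r + q), (B :=: A^C)%MS by exists (row_base (A^C)%MS); exact: eq_row_base.
rewrite e => -[B hB]; exists B.
rewrite -row_full_unit -sub1mx.
have := addsmx_compl_full A; rewrite -sub1mx => h; apply: submx_trans h _.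
by rewrite addsmxC -addsmxE addsmxS // hB.
Qed.

(** Completed by rows [T] to an invertible matrix, [bot_mx] makes the product with the Kasteleyn
    matrix block triangular. The other diagonal block is the same for all [tau], as special rows
    vanish on interior columns, so it enters the constant. *)
Lemma meas_formula_mx : (exists2 tau, exists I, nested I tau & \det (meas_mx tau) != 0) ->
  exists c : R, forall I tau, nested I tau -> Delta G wt I = c * \det (meas_mx tau).
Proof.
move=> [tau0 _ h0].
have fb : row_free bot_mx.
  apply/row_freeP; exists (kast_mx wt tau0 *m (col_mx 0 (invmx (meas_mx tau0)))).
  rewrite mulmxA bot_mul mul_row_col mul0mx add0r mulmxV // unitmxE unitfE //.
have [T hT] := complete_unitmx fb.
exists ((-1) ^+ (m + k) * ((\det (col_mx T bot_mx))^-1 * \det (lsubmx (T *m kast_mx wt tau0)))) => I tau nst.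
have hD : \det (col_mx T bot_mx) != 0 by rewrite -unitfE -unitmxE.
have e1 : \det (col_mx T bot_mx) * \det (kast_mx wt tau) = \det (lsubmx (T *m kast_mx wt tau)) * \det (meas_mx tau).
  rewrite -det_mulmx mul_col_mx bot_mul -[T *m _]hsubmxK -block_mxEv det_ublock.
  by rewrite row_mxKl.
have -> : lsubmx (T *m kast_mx wt tau0) = lsubmx (T *m kast_mx wt tau).
  apply/matrixP => i j; rewrite !mxE; apply: eq_bigr => x _; congr (_ * _); rewrite !mxE; apply: eq_bigr => d _.
  rewrite /kast_entry; case: ifP => // /specialP[p -> _]; by rewrite !tauX_r !eq_lrshift.
rewrite -!mulrA -e1 mulrA.
rewrite -mulrA mulKf // (kast_det wt nst) mulrA -exprD addnn -signr_odd odd_double mul1r //.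
Qed.
End MeasFormula.
End Labels.

(** * Nested pairings and complementary minors *)

Section Rank.
Variables (T : finType) (le : rel T).
Hypotheses (le_refl : reflexive le) (le_trans : transitive le) (le_anti : antisymmetric le) (le_total : total le).
Definition rank (C : {set T}) (x : T) := #|[set y in C | le y x]|.

Lemma rank_inj (C : {set T}) x y : x \in C -> y \in C -> rank C x = rank C y -> x = y.
Proof.
move=> hx hy e; wlog lxy : x y hx hy e / le x y.
  by move=> H; case/orP: (le_total x y) => [/H|/H h]; [apply|apply/esym/h].
have : [set z in C | le z x] = [set z in C | le z y].
  apply/eqP; rewrite eqEcard -/(rank C x) -/(rank C y) e leqnn andbT.
  by apply/fintype.subsetP => z; rewrite !inE => /andP[-> /le_trans]; apply.
move/setP/(_ y); rewrite !inE hy le_refl /= => lyx.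
by apply: le_anti; rewrite lxy lyx.
Qed.

Lemma rank_onto (C : {set T}) i : (0 < i <= #|C|)%N -> exists2 x, x \in C & rank C x = i.
Proof.
move=> /andP[i0 iC].
have hr x : x \in C -> (0 < rank C x <= #|C|)%N.
  move=> hx; apply/andP; split; first by apply/card_gt0P; exists x; rewrite !inE hx le_refl.
  by apply/subset_leq_card/fintype.subsetP => z; rewrite !inE => /andP[].
pose r x : 'I_#|C|.+1 := inord (rank C x).
have rE x : x \in C -> r x = rank C x :> nat by move=> /hr /andP[_ h]; rewrite inordK.
have im : r @: C = [set~ ord0].
  apply/eqP; rewrite eqEcard; apply/andP; split.
    apply/fintype.subsetP => _ /imsetP[x hx ->]; rewrite !inE -val_eqE /= rE //.
    by case/andP: (hr x hx); case: (rank C x).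
  rewrite cardsC1 card_ord /= card_in_imset // => x y hx hy /(congr1 val) /=.
  by rewrite !rE //; apply: rank_inj.
have : inord i \in r @: C by rewrite im !inE -val_eqE /= inordK // -lt0n.
by case/imsetP => x hx /(congr1 val) /=; rewrite rE // inordK // => ->; exists x.
Qed.
End Rank.

Lemma card_ge (n k : nat) : (k <= n)%N -> #|[set p : 'I_n | (n - k <= p)%N]| = k.
Proof.
move=> kn; apply/eqP; rewrite -(eqr_nat rat) -sum1_card natr_sum big_mkcond /=.
rewrite (eq_bigr (fun i : 'I_n => ((n - k <= i) && (i < n))%N%:R)) ?sum_interval ?subKn //.
by move=> i _; rewrite inE ltn_ord andbT; case: (_ <= _)%N.
Qed.

(** Since [#|I| = k], as many of the first [n - k] indices are in [I] as are missing among the last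
    [k]. Elements of equal rank are paired, the first set ranked upwards and the second
    downwards. *)
Lemma nested_exists (n k : nat) (I : {set 'I_n}) : (k <= n)%N -> #|I| = k ->
  exists tau, nested k I tau.
Proof.
move=> kn cI.
pose A := [set p : 'I_n in I | (p < n - k)%N].
pose C := [set p : 'I_n | (n - k <= p)%N && (p \notin I)].
have AC : #|A| = #|C|.
  have e1 : A = I :\: [set p : 'I_n | (n - k <= p)%N] by apply/setP => p; rewrite !inE -ltnNge andbC.
  have e2 : C = [set p : 'I_n | (n - k <= p)%N] :\: I by apply/setP => p; rewrite !inE andbC.
  by rewrite e1 e2 !cardsD cI card_ge // finset.setIC.
pose leN : rel 'I_n := fun p q => (p <= q)%N.
pose geN : rel 'I_n := fun p q => (q <= p)%N.
have [leR leT leA leTo] : [/\ reflexive leN, transitive leN, antisymmetric leN & total leN].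
  split=> [x|y x z|x y h|x y]; rewrite /leN ?leqnn ?leq_total //; first exact: leq_trans.
  by apply/val_inj/eqP; rewrite eqn_leq.
have [geR geT geA geTo] : [/\ reflexive geN, transitive geN, antisymmetric geN & total geN].
  split=> [x|y x z|x y h|x y]; rewrite /geN ?leqnn ?leq_total //.
    by move=> h1 h2; apply: leq_trans h1.
  by apply/val_inj/eqP; rewrite eqn_leq andbC.
have rA p : p \in A -> (0 < rank leN A p <= #|A|)%N.
  move=> hp; apply/andP; split; first by apply/card_gt0P; exists p; rewrite inE hp /leN leqnn.
  by apply/subset_leq_card/fintype.subsetP => z; rewrite !inE => /andP[].
have H p : exists c, if p \in A then c \in C /\ rank geN C c = rank leN A p else c = p.
  have [hp|hp] := boolP (p \in A); last by exists p.
  have := rA p hp; rewrite AC => /(rank_onto geR geT geA geTo)[c c1 c2]; by exists c.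
have {H} [tau tauP] := choice H.
have tauA p : p \in A -> tau p \in C /\ rank geN C (tau p) = rank leN A p by move=> h; have := tauP p; rewrite h.
have tauN p : p \notin A -> tau p = p by move=> h; have := tauP p; rewrite (negbTE h).
have inA (p : 'I_n) : (p < n - k)%N -> (p \in A) = (p \in I) by move=> h; rewrite inE h andbT.
exists tau; split.
- by move=> p h hp; rewrite tauN // inA.
- by move=> p h hp; have [|+ _] := tauA p; rewrite ?inA // inE => /andP.
- move=> p q hp hq e; have [pA|pA] := boolP (p \in A); have [qA|qA] := boolP (q \in A).
  + apply: (rank_inj leR leT leA leTo pA qA).
    by have [_ <-] := tauA p pA; have [_ <-] := tauA q qA; rewrite e.
  + have [] := tauA p pA; rewrite e tauN // inE => /andP[h _]; move: h; rewrite leqNgt hq //.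
  + have [] := tauA q qA; rewrite -e tauN // inE => /andP[h _]; move: h; rewrite leqNgt hp //.
  + by move: e; rewrite !tauN.
- move=> q hq; have [h|h] := ltnP q (n - k); first by exists q => //; rewrite tauN // inA.
  have qC : q \in C by rewrite inE h.
  have rC : (0 < rank geN C q <= #|C|)%N.
    apply/andP; split; first by apply/card_gt0P; exists q; rewrite inE qC /geN leqnn.
    by apply/subset_leq_card/fintype.subsetP => z; rewrite inE => /andP[].
  rewrite -AC in rC; have [p pA pr] := rank_onto leR leT leA leTo rC.
  exists p; first by move: pA; rewrite inE => /andP[].
  have [t1 t2] := tauA p pA; apply: (rank_inj geR geT geA geTo t1 qC).
  by rewrite t2.
- move=> p h hp; have [|t1 t2] := tauA p; first by rewrite inA.
  have -> : [set q : 'I_n in I | (q < n - k)%N && (q <= p)%N] = [set y in A | leN y p].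
    by apply/setP => q; rewrite !inE andbA.
  rewrite -/(rank leN A p) -t2; apply: eq_card => c; rewrite !inE /geN andbA //.
Qed.

(** Expansion along the unit rows. The sign is that of the column permutation which puts [tau] first
    and [phi] next, hence it is the same for all [u]. *)
Lemma det_complement_rows (R : comPzRingType) (n k : nat) (tau : 'I_n -> 'I_n) (phi rho : 'I_k -> 'I_n) : (k <= n)%N -> (forall i, rho i = n - k + i :> nat)%N -> injective phi ->
  (forall p q : 'I_n, (p < n - k)%N -> (q < n - k)%N -> tau p = tau q -> p = q) ->
  (forall (p : 'I_n) j, (p < n - k)%N -> tau p != phi j) ->
  exists b : bool, forall u : 'I_n -> 'I_n -> R, \det (\matrix_(p, q) if (p < n - k)%N then (q == tau p)%:R else u p q)
    = (-1) ^+ b * \det (\matrix_(i, j) u (rho i) (phi j)).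
Proof.
move=> kn; have [a na] : exists a, n = (a + k)%N by exists (n - k)%N; rewrite subnK.
subst n; rewrite addnK => hrho phiI tauI tauphi.
have erho i : rho i = rshift a i by apply: val_inj; rewrite /= hrho.
pose s (p : 'I_(a + k)) := match fintype.split p with inl i => tau (lshift k i) | inr j => phi j end.
have sl i : s (lshift k i) = tau (lshift k i) by rewrite /s (unsplitK (inl i)).
have sr j : s (rshift a j) = phi j by rewrite /s (unsplitK (inr j)).
have sI : injective s.
  move=> x y; rewrite -(splitK x) -(splitK y); case: (fintype.split x) => i; case: (fintype.split y) => j; rewrite /unsplit ?sl ?sr.
  - by apply: tauI => /=.
  - by move=> e; have := tauphi (lshift k i) j (ltn_ord i); rewrite e eqxx.
  - by move=> e; have := tauphi (lshift k j) i (ltn_ord j); rewrite e eqxx.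
  - by move/phiI ->.
exists (perm sI : bool) => u.
set M := \matrix_(p, q) _; set D := \matrix_(i, j) _.
have : col_perm (perm sI) M = block_mx 1%:M 0 (\matrix_(i, j) u (rshift a i) (tau (lshift k j))) D.
  apply/matrixP => p q; rewrite mxE mxE permE -(splitK p) -(splitK q).
  case: (fintype.split p) => i; case: (fintype.split q) => j; rewrite /unsplit ?sl ?sr.
  - rewrite [RHS]block_mxEul [RHS]mxE /= ltn_ord eq_sym; congr (nat_of_bool _)%:R.
    by apply/eqP/eqP => [/tauI h|-> //]; apply: (@lshift_inj a k); apply: h => /=.
  - rewrite [RHS]block_mxEur [RHS]mxE /= ltn_ord eq_sym (negbTE (tauphi _ _ _)) //=.
  - by rewrite [RHS]block_mxEdl [RHS]mxE /= ltnNge leq_addr.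
  - by rewrite [RHS]block_mxEdr [RHS]mxE /= ltnNge leq_addr /= erho.
move/(congr1 determinant); rewrite det_lblock det1 mul1r col_permE det_mulmx det_perm odd_permV => <-.
by rewrite mulrC -mulrA -expr2 sqrr_sign mulr1.
Qed.

(** * Strand labels of a reduced graph *)

Lemma aff_length_fkn (n k : nat) : aff_length n (fkn k) = 0%N.
Proof.
rewrite /aff_length.
have -> : [set st : int * int | [/\ 1 <= st.1, st.1 <= n%:Z, st.1 < st.2 & fkn k st.2 < fkn k st.1]]%classic = classical_sets.set0.
  by apply/seteqP; split => // -[s t] /= [_ _ h]; rewrite /fkn ltrD2r => /(lt_trans h); rewrite ltxx.
by rewrite fset_set0 cardfs0.
Qed.

Lemma fkn_mod (n k : nat) (n0 : (0 < n)%N) (p q : 'I_n) :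
  (fkn k (p.+1)%:Z = (q.+1)%:Z %[mod n%:Z])%Z -> q = rot_ord k n0 p.
Proof.
rewrite /fkn -PoszD !modz_nat => -[h]; apply: val_inj => /=.
move: h => /eqP; rewrite addSn -addn1 -[q.+1]addn1 eqn_modDr => /eqP ->.
by rewrite modn_small.
Qed.

Lemma fkn_mod_rot (n k : nat) (n0 : (0 < n)%N) (p : 'I_n) :
  (fkn k (p.+1)%:Z = ((rot_ord k n0 p).+1)%:Z %[mod n%:Z])%Z.
Proof.
rewrite /fkn -PoszD !modz_nat; congr Posz => /=.
by rewrite addSn -addn1 -[X in _ = X %[mod _]]addn1; apply/eqP; rewrite eqn_modDr modn_mod.
Qed.

Section StrandEnds.
Variables (n : nat) (G : diskgraph n).
Hypothesis wf : planar_prewf G.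
Notation al := (alpha G).
Notation tl := (tail G).

Lemma strand_end_uniq (d : dart G) p q : strand_end d p -> strand_end d q -> p = q :> 'I_n.
Proof.
move=> [m [hm hm']] [m2 [h2 h2']]; apply: (bnd_inj wf).
case: (ltngtP m m2) => h; last by rewrite -hm -h2 h.
- by have := h2' _ h; rewrite hm is_bnd_bnd.
- by have := hm' _ h; rewrite h2 is_bnd_bnd.
Qed.

Lemma strand_end0 (d : dart G) p : tl (al d) = bnd G p -> strand_end d p.
Proof. by move=> h; exists 0%N. Qed.

Lemma strand_end_next (d : dart G) p : ~~ is_bnd (tl (al d)) -> strand_end (strand_next d) p <-> strand_end d p.
Proof.
move=> hd; split=> -[m [h h']].
  exists m.+1; rewrite iterSr; split=> // -[|m'] //; rewrite ltnS iterSr; exact: h'.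
case: m h h' => [/= h|m]; first by rewrite h is_bnd_bnd in hd.
rewrite iterSr => h h'; exists m; split=> // m' hm'; have := h' m'.+1 hm'; by rewrite iterSr.
Qed.

(** A strand that never reaches the boundary receives the default [c]. This is compatible with
    [strand_next], so the analysis of labels applies for every value of [c]. *)
Definition strand_label (c : 'I_n) (d : dart G) : 'I_n :=
  if pselect (exists p, strand_end d p) is left h then projT1 (cid h) else c.

Lemma strand_labelE c (d : dart G) p : strand_end d p -> strand_label c d = p.
Proof.
move=> h; rewrite /strand_label; case: pselect => [h'|[]]; last by exists p.
by case: cid => q /= hq; apply: strand_end_uniq hq h.
Qed.

Lemma strand_labelN c (d : dart G) : ~ (exists p, strand_end d p) -> strand_label c d = c.
Proof. by rewrite /strand_label; case: pselect. Qed.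

Lemma strand_label_next c (d : dart G) : ~~ is_bnd (tl (al d)) -> strand_label c (strand_next d) = strand_label c d.
Proof.
move=> hd; have [[p hp]|h] := pselect (exists p, strand_end d p).
  by rewrite (strand_labelE c hp) (@strand_labelE _ _ p) //; apply/strand_end_next.
by rewrite !strand_labelN // => -[p] /strand_end_next; move/(_ hd) => hp; apply: h; exists p.
Qed.

End StrandEnds.

Section Reduced.
Variables (n k : nat) (G : diskgraph n).
Hypothesis n0 : (0 < n)%N.
Hypothesis red : reduced_for k (fkn k) G.

Lemma reduced_prewf : planar_prewf G.
Proof. by case: red => /wf_prewf. Qed.

Lemma fcard_gt0 : (0 < fcard (@ext_face_perm n G) predT)%N.
Proof.
rewrite -(card_face_type G); apply/card_gt0P.
by exists (face_of reduced_prewf (inr (Ordinal n0, true))).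
Qed.

Lemma reduced_faces : (fcard (@ext_face_perm n G) predT = k * (n - k) + 2)%N.
Proof.
case: red => _ [_]; rewrite /disk_faces aff_length_fkn; have := fcard_gt0.
move: (fcard _ _) (k * (n - k))%N => a b; lia.
Qed.

Lemma reduced_euler : (#|vert G| + fcard (@ext_face_perm n G) predT = #|dart G| %/ 2 + n + 2)%N.
Proof.
case: red => -[_ [_]] + _; move: (fcard _ _) (#|dart G| %/ 2)%N #|vert G| => a b c; lia.
Qed.

Hypothesis k0 : (0 < k)%N.
Hypothesis kn : (k < n)%N.
Let wf := reduced_prewf.

Let labB c p : strand_label c (bdart wf p) = rot_ord k n0 p.
Proof.
case: red => _ [/(_ p (bdart wf p) (tail_bdart wf p)) [[q hq] h] _].
by rewrite (strand_labelE wf c hq); apply: fkn_mod; apply: h.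
Qed.

Let lab_tie c d : strand_label c d != strand_label c (alpha G d).
Proof.
apply: (lab_neq (wf := wf) (n0 := n0) k0 kn reduced_euler reduced_faces (lab := strand_label c)); last exact: labB.
  by move=> e p h; apply: strand_labelE => //; apply: strand_end0.
by move=> e h; apply: strand_label_next.
Qed.

(** If the strand through [d] never ended, choosing the default equal to the end of the reverse
    strand, or arbitrarily when that one does not end either, would produce a tie. *)
Lemma strand_end_exists (d : dart G) : exists p, strand_end d p.
Proof.
apply: contrapT => h.
have [[p hp]|h'] := pselect (exists p, strand_end (alpha G d) p).
  by have := lab_tie p d; rewrite (strand_labelN _ h) (strand_labelE wf _ hp) eqxx.
by have := lab_tie (Ordinal n0) d; rewrite !strand_labelN // eqxx.
Qed.

Definition label (d : dart G) : 'I_n := projT1 (cid (strand_end_exists d)).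
Lemma labelP (d : dart G) : strand_end d (label d).
Proof. by rewrite /label; case: cid. Qed.
Lemma label_bnd (d : dart G) p : tail G (alpha G d) = bnd G p -> label d = p.
Proof. by move=> h; apply: (strand_end_uniq wf (labelP d)); apply: strand_end0. Qed.
Lemma label_next (d : dart G) : ~~ is_bnd (tail G (alpha G d)) -> label (strand_next d) = label d.
Proof.
move=> h; apply: (strand_end_uniq wf (labelP _)); apply/strand_end_next => //; exact: labelP.
Qed.
Lemma label_bdart p : label (bdart wf p) = rot_ord k n0 p.
Proof. by rewrite -(labB p); apply/esym/strand_labelE => //; apply: labelP. Qed.
End Reduced.

Section ApmCount.
Variables (n k : nat) (G : diskgraph n).
Hypothesis wf : planar_prewf G.
Notation al := (alpha G).
Notation tl := (tail G).
Notation bk := (black G).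

(** The edges of [A] are counted from their white and from their black ends. Comparison with
    [card_white_black] shows that every matching uses [k] boundary vertices. *)
Lemma apm_card (A : {set dart G}) : is_apm A ->
  (#|[pred v : vert G | ~~ bk v]| = #|[pred v : vert G | bk v && ~~ is_bnd v]| + #|used_bnd A|)%N.
Proof.
move=> hA; pose nA v := (\sum_(d | tl d == v) (d \in A))%N.
have nA1 v : ~~ is_bnd v -> 1%N = nA v.
  move=> hv; have [d [d1 d2] d3] := apm_int hA hv.
  rewrite /nA (bigD1 d) ?d1 //= d2 big1 // => e /andP[/eqP he hne].
  by case hE: (e \in A) => //; rewrite (d3 e he hE) eqxx in hne.
rewrite -!sum1_card /=.
rewrite (eq_bigr nA) => [|v /(white_int wf)/nA1 -> //].
rewrite [X in (X + _)%N](eq_bigr nA) => [|v /andP[_] /nA1 -> //].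
have -> : (\sum_(v | ~~ bk v) nA v = \sum_(d | ~~ bk (tl d)) (d \in A))%N.
  rewrite [RHS](partition_big tl (fun v => ~~ bk v)) //=; apply: eq_bigr => v hv.
  by apply: eq_bigl => d; case: eqP => [->|]; rewrite ?hv ?andbF.
have -> : (\sum_(v | bk v && ~~ is_bnd v) nA v = \sum_(d | bk (tl d) && ~~ is_bnd (tl d)) (d \in A))%N.
  rewrite [RHS](partition_big tl (fun v => bk v && ~~ is_bnd v)) //=; apply: eq_bigr => v hv.
  by apply: eq_bigl => d; case: eqP => [->|]; rewrite ?hv ?andbF.
have -> : (\sum_(i in used_bnd A) 1 = \sum_(d | is_bnd (tl d)) (d \in A))%N.
  rewrite (big_bnd wf (fun d => (d \in A) : nat)) big_mkcond /=; apply: eq_bigr => p _.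
  by rewrite (apm_used wf); case: (_ \in _).
rewrite (reindex_inj (@perm_inj _ al)) /=.
rewrite (eq_bigl (fun d => bk (tl d))) => [|d]; last by rewrite black_head // negbK.
rewrite (eq_bigr (fun d => (d \in A) : nat)) => [|d _]; last by rewrite (apm_al hA).
rewrite (bigID (fun d => is_bnd (tl d))) /= addnC; congr addn.
apply: eq_bigl => d; apply: andb_idl; exact: bnd_black.
Qed.
End ApmCount.

Lemma Delta_ge0 (R : realFieldType) n (G : diskgraph n) (wt : dart G -> R) I :
  (forall d, 0 <= wt d) -> 0 <= Delta G wt I.
Proof. by move=> h; apply: sumr_ge0 => A _; apply: prodr_ge0 => d _. Qed.

Lemma Delta_gt0 (R : realFieldType) n (G : diskgraph n) (wt : dart G -> R) :
  wf_diskgraph G -> (forall d, 0 < wt d) -> exists I, 0 < Delta G wt I.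
Proof.
case=> _ [[_ _ _ _ [A hA]] _] h; exists (used_bnd A).
rewrite /Delta (bigD1 A) ?hA ?eqxx //=; apply: ltr_pwDl; first by apply: prodr_gt0.
by apply: sumr_ge0 => B _; apply: prodr_ge0 => d _; apply: ltW.
Qed.

Section ReducedMeas.
Variables (n k : nat) (G : diskgraph n).
Hypothesis n0 : (0 < n)%N.
Hypothesis red : reduced_for k (fkn k) G.
Hypothesis k0 : (0 < k)%N.
Hypothesis kn : (k < n)%N.
Notation wf := (reduced_prewf red).
Notation lab := (label n0 red k0 kn).
Notation al := (alpha G).
Notation tl := (tail G).
Notation bk := (black G).

Lemma apm_used_card (A : {set dart G}) : is_apm A -> #|used_bnd A| = k.
Proof.
move=> /(apm_card wf); rewrite (card_white_black (wf := wf) (n0 := n0) k0 kn (reduced_euler n0 red) (reduced_faces n0 red) (lab := lab)).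
- by move/addnI.
- exact: label_bnd.
- exact: label_next.
- exact: label_bdart.
Qed.

Lemma Delta_card (R : pzRingType) (wt : dart G -> R) (I : {set 'I_n}) : #|I| != k -> Delta G wt I = 0.
Proof.
move=> hI; rewrite /Delta big_pred0 // => A; apply/negbTE/negP => /andP[/apm_used_card h /eqP e].
by rewrite -e h eqxx in hI.
Qed.

Section Signed.
Variable R : fieldType.

Definition bnd_mx (wt : dart G -> R) (y : 'I_k -> vert G -> R) (phi : 'I_k -> 'I_n) : 'M[R]_k :=
  \matrix_(i, j) (kast_wt lab wt (bdart wf (phi j)) * y i (tl (al (bdart wf (phi j))))).

(** The sign [b] is chosen before the weights and the solutions, so that two weightings of the same
    graph can be compared coordinate by coordinate; [rank1_Delta] relies on this order. *)
Lemma meas_formula : exists b : ('I_k -> 'I_n) -> bool,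
  forall (wt : dart G -> R) (y : 'I_k -> vert G -> R),
  (forall i v, bk v -> ~~ is_bnd v -> \sum_(d | tl d == v) kast_wt lab wt d * y i (tl (al d)) = 0) ->
  (exists2 phi, injective phi & \det (bnd_mx wt y phi) != 0) ->
  exists c, forall phi, injective phi ->
    Delta G wt (phi @: [set: 'I_k]) = c * ((-1) ^+ b phi * \det (bnd_mx wt y phi)).
Proof.
have lt_rho (i : 'I_k) : (n - k + i < n)%N by have := ltn_ord i; lia.
pose rho i := Ordinal (lt_rho i).
have H phi : exists tb : ('I_n -> 'I_n) * bool, injective phi ->
    nested k (phi @: [set: 'I_k]) tb.1 /\ forall u : 'I_n -> 'I_n -> R,
      \det (\matrix_(p, q) if (p < n - k)%N then (q == tb.1 p)%:R else u p q)
      = (-1) ^+ tb.2 * \det (\matrix_(i, j) u (rho i) (phi j)).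
  have [phiI|h] := pselect (injective phi); last by exists (id, true) => /h.
  have [tau nst] : exists tau, nested k (phi @: [set: 'I_k]) tau.
    by apply: nested_exists; rewrite ?(ltnW kn) // card_imset // cardsT card_ord.
  have tphi (p : 'I_n) j : (p < n - k)%N -> tau p != phi j.
    move=> hp; apply/eqP => e; have := nested_notin nst hp; rewrite e => /negP; apply.
    by apply/imsetP; exists j.
  have [b hb] := det_complement_rows R (ltnW kn) (fun i => erefl : rho i = n - k + i :> nat)%N phiI (nest_inj nst) tphi.
  by exists (tau, b).
have {H} [tb tbP] := choice H.
exists (fun phi => (tb phi).2) => wt y hol [phi0 phi0I det0].
pose y' (p : 'I_n) v := if insub (p - (n - k))%N is Some i then y i v else 0.
have y'E i v : y' (rho i) v = y i v by rewrite /y' /= addKn valK.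
have E phi : injective phi -> \det (meas_mx k wf lab wt y' (tb phi).1) = (-1) ^+ (tb phi).2 * \det (bnd_mx wt y phi).
  move=> /tbP[_ ->]; congr (_ * \det _); apply/matrixP => i j; rewrite !mxE /bnd_val y'E //.
have hol' p v : bk v -> ~~ is_bnd v -> \sum_(d | tl d == v) kast_wt lab wt d * y' p (tl (al d)) = 0.
  move=> hb hv; rewrite /y'; case: insubP => [i _ _|_]; first exact: hol.
  by apply: big1 => d _; rewrite mulr0.
have nz : exists2 tau, exists I, nested k I tau & \det (meas_mx k wf lab wt y' tau) != 0.
  exists (tb phi0).1; first by exists (phi0 @: [set: 'I_k]); case: (tbP _ phi0I).
  by rewrite E // mulf_eq0 signr_eq0.
have [c hc] := meas_formula_mx k0 kn (reduced_euler n0 red) (reduced_faces n0 red)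
  (@label_bnd _ _ _ n0 red k0 kn) (@label_next _ _ _ n0 red k0 kn) (@label_bdart _ _ _ n0 red k0 kn) hol' nz.
by exists c => phi phiI; rewrite -E //; apply: hc; case: (tbP _ phiI).
Qed.
End Signed.

(** Positive weights make every coordinate nonnegative, so absolute values replace the signs; one
    coordinate is positive, so the constant is not zero. *)
Lemma meas_formula_pos (R : realFieldType) (wt : dart G -> R) (y : 'I_k -> vert G -> R) :
  (forall d, 0 < wt d) ->
  (forall i v, bk v -> ~~ is_bnd v -> \sum_(d | tl d == v) kast_wt lab wt d * y i (tl (al d)) = 0) ->
  (exists2 phi, injective phi & \det (bnd_mx wt y phi) != 0) ->
  exists2 c, 0 < c & forall phi, injective phi ->
    Delta G wt (phi @: [set: 'I_k]) = c * `|\det (bnd_mx wt y phi)|.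
Proof.
move=> wt0 hol nz; have [b /(_ wt y hol nz)[c hc]] := meas_formula R.
have E phi : injective phi -> Delta G wt (phi @: [set: 'I_k]) = `|c| * `|\det (bnd_mx wt y phi)|.
  move=> h; rewrite -[LHS]ger0_norm ?Delta_ge0 // => [|d]; last exact: ltW.
  by rewrite hc // !normrM normr_sign mul1r.
exists `|c| => //; rewrite normr_gt0; apply/eqP => c0.
have [I hI] := Delta_gt0 (proj1 red) wt0.
have cI : #|I| = k by apply/eqP; apply: contraTT hI => h; rewrite Delta_card // ltxx.
have [phi phiI eI] : exists2 phi : 'I_k -> 'I_n, injective phi & I = phi @: [set: 'I_k].
  exists (fun i => enum_val (cast_ord (esym cI) i)) => [i j /enum_val_inj /cast_ord_inj //|].
  apply/setP => p; apply/idP/imsetP => [hp|[i _ ->]]; last exact: enum_valP.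
  by exists (cast_ord cI (enum_rank_in hp p)); rewrite // cast_ordK enum_rankK_in.
by move: hI; rewrite eI E // c0 normr0 mul0r ltxx.
Qed.
End ReducedMeas.

Lemma expR_ln_cross (R : realType) (a b u v : R) : 0 < u -> 0 < v ->
  a - b = ln u - ln v -> expR a * v = expR b * u.
Proof.
move=> u0 v0 h; have -> : a = b + (ln u - ln v) by rewrite -h addrC subrK.
by rewrite expRD expRB !lnK ?posrE // mulrA mulfVK ?gt_eqF.
Qed.

(** * Boundary measurements of critical weights *)

Section CritMeas.
Variables (n k : nat) (G : diskgraph n).
Hypothesis n0 : (0 < n)%N.
Hypothesis red : reduced_for k (fkn k) G.
Hypothesis k0 : (0 < k)%N.
Hypothesis kn : (k < n)%N.
Notation wf := (reduced_prewf red).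
Notation lab := (label n0 red k0 kn).
Notation al := (alpha G).
Notation sg := (sigma G).
Notation tl := (tail G).
Notation bk := (black G).
Variables (R : realType) (theta : 'I_n -> R) (wt : dart G -> R).
Hypothesis crit : crit_weight G theta wt.

Let labE := (@label_bnd _ _ _ n0 red k0 kn).
Let labN := (@label_next _ _ _ n0 red k0 kn).
Let labB := (@label_bdart _ _ _ n0 red k0 kn).
Let eul := reduced_euler n0 red.
Let faces := reduced_faces n0 red.

Lemma label_neq d : lab d != lab (al d).
Proof. exact: (lab_neq k0 kn eul faces labE labN labB). Qed.

(** The sign on [M0] undoes the ordering of the two labels in the critical weight and leaves the
    antisymmetric sine, free of case distinctions. *)
Lemma crit_kast d : bk (tl d) -> ~~ is_bnd (tl d) ->
  kast_wt lab wt d = sin (theta (lab d) - theta (lab (al d))).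
Proof.
move=> hb hd; have hw : ~~ is_bnd (tl (al d)) by apply: (white_int wf); rewrite (black_head wf) negbK.
rewrite /kast_wt /M0 hb.
rewrite ((crit d).2 hd hw _ _ (labelP n0 red k0 kn d) (labelP n0 red k0 kn (al d))).
have := label_neq d; rewrite -(inj_eq val_inj) /=.
by case: ltngtP => //= _ _; rewrite ?expr1 ?mulN1r ?expr0 ?mul1r // -sinN opprB.
Qed.

Lemma crit_bnd p : wt (bdart wf p) = 1.
Proof. by apply: (crit _).1; rewrite tail_bdart is_bnd_bnd. Qed.

Lemma crit_gt0 : (forall p q : 'I_n, (p < q)%N -> theta p < theta q < theta p + pi) -> forall d, 0 < wt d.
Proof.
move=> inc d; have [h|] := boolP (is_bnd (tl d) || is_bnd (tl (al d))); first by rewrite (crit d).1.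
rewrite negb_or => /andP[h1 h2].
rewrite ((crit d).2 h1 h2 _ _ (labelP n0 red k0 kn d) (labelP n0 red k0 kn (al d))).
have := label_neq d; rewrite -(inj_eq val_inj) /=; case: ltngtP => // h _; apply: sin_gt0_pi;
  by rewrite subr_gt0 ltrBlDl inc.
Qed.

(* [y w = exp (nu d) / sin (t - theta (lab d))] for any dart [d] at [w], where [nu]
   is the height function of the flow [ln sin (t - theta)]; the equation at a black
   vertex is a telescoping sum of three-term sine identities. *)
Lemma crit_hol (t : R) : (forall p, 0 < sin (t - theta p)) ->
  exists (y : vert G -> R) (C : R), [/\ 0 < C,
    forall v, bk v -> ~~ is_bnd v -> \sum_(d | tl d == v) kast_wt lab wt d * y (tl (al d)) = 0 &
    forall q, y (tl (al (bdart wf q))) = C * \prod_(j < k.-1) sin (t - theta (rot_ord j.+1 n0 q))].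
Proof.
move=> s0; pose s p := sin (t - theta p); pose c p := cos (t - theta p).
have s0' p : 0 < s p by exact: s0.
have sn0 p : s p != 0 by rewrite gt_eqF.
have [nu [Phi [nu1 nu2 nu3 nu4]]] := lab_height wf n0 eul labN (fun p => ln (s p)).
pose u d := expR (nu d).
have u4 d : u d * s (lab (al d)) = u (al d) * s (lab d) by apply: expR_ln_cross (nu4 d).
have /choice[dv dvP] := fun v => dart_at wf v.
pose y v := u (dv v) / s (lab (dv v)).
have yE d : ~~ bk (tl d) -> y (tl d) = u d / s (lab d).
  move=> hd; rewrite /y; have := dvP (tl d); move: (dv _) => e he.
  have : fconnect sg d e by apply: (sigma_conn wf); rewrite he.
  move=> /iter_findex <-; elim: (findex _ _ _) => {e he} // i IH; rewrite iterS.
  set e := iter i sg d; have te : tl e = tl d by rewrite /e; elim: (i) => //= j; rewrite (tail_sigma wf).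
  rewrite -{}IH -/e.
  have we : ~~ bk (tl e) by rewrite te.
  have -> : u (sg e) = u (al e) by rewrite /u -(nu1 (al e)) ?(alphaK wf) // (white_int wf).
  rewrite (lab_white wf labN we).
  by apply/eqP; rewrite eqr_div // mulrC -mulrC u4 // mulrC.
have yA d : bk (tl d) -> y (tl (al d)) = u d / s (lab d).
  move=> hd; rewrite yE ?(black_head wf) ?negbK // -(alphaK wf (al d)).
  by apply/eqP; rewrite (alphaK wf) eqr_div // u4.
pose Y p := expR (Phi p) / s p.
(* Passing to the next boundary vertex exchanges the factor at [p + 1] for the one at [p + k]; the
   window product [P] obeys the same recursion. *)
have YS p : Y (ordS p) * s (ordS p) = Y p * s (rot_ord k n0 p).
  rewrite /Y !mulfVK // -nu3 -nu2 -/(u _) -/(u _).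
  have := u4 (bdart wf p); rewrite labB (lab_alpha_bdart wf labE) => h.
  by apply: (mulIf (sn0 p)); rewrite h mulrAC mulfVK.
have Ybd q : y (tl (al (bdart wf q))) = Y q.
  rewrite yE; last by rewrite (black_head wf) tail_bdart (black_bnd wf).
  by rewrite /Y (lab_alpha_bdart wf labE) -nu2.
pose P q := \prod_(j < k.-1) s (rot_ord j.+1 n0 q).
have P0 q : 0 < P q by apply: prodr_gt0.
pose p0 := Ordinal n0.
have YP q : Y q = Y p0 / P p0 * P q.
  apply: (@ord_cycle_ind n n0 (fun q => Y q = Y p0 / P p0 * P q)) q => [|q IH]; first by rewrite mulfVK // gt_eqF.
  apply: (mulIf (sn0 (ordS q))); rewrite YS IH; move: (Y p0 / P p0) => c0.
  rewrite -!mulrA; congr (_ * _).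
  have -> : rot_ord k n0 q = rot_ord k.-1.+1 n0 q by rewrite prednK.
  transitivity (\prod_(j < k.-1.+1) s (rot_ord j.+1 n0 q)); first by rewrite big_ord_recr.
  have -> : ordS q = rot_ord 1 n0 q by apply: val_inj; rewrite /= addn1.
  rewrite big_ord_recl mulrC; congr (_ * _); apply: eq_bigr => j _.
  by congr s; apply: val_inj; rewrite /= modnDml -addnA add1n.
exists y, (Y p0 / P p0); split.
- by rewrite divr_gt0 // divr_gt0 // expR_gt0.
- move=> v hb hv.
  pose F d := u (al d) * s (lab d).
  have FS d : tl d = v -> F (sg d) = F d.
    move=> hd; have bd : bk (tl d) by rewrite hd.
    have nd : ~~ is_bnd (tl d) by rewrite hd.
    rewrite /F -u4 (lab_black wf labN bd nd) /u -(nu1 (al d)) ?(alphaK wf) //.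
  have Fc d e : tl d = v -> tl e = v -> F d = F e.
    move=> hd he; have : fconnect sg d e by apply: (sigma_conn wf); rewrite hd.
    move=> /iter_findex <-; elim: (findex _ _ _) => // i ->; rewrite iterS FS //.
    by elim: (i) => //= j; rewrite (tail_sigma wf).
  have [d0 hd0] := dart_at wf v.
  have E d : tl d == v -> kast_wt lab wt d * y (tl (al d)) = F d0 * (c (lab d) / s (lab d) - c (lab (al d)) / s (lab (al d))).
    move=> /eqP hd; rewrite crit_kast ?hd // yA ?hd // (Fc d0 d) // /F -u4.
    have -> : theta (lab d) - theta (lab (al d)) = (t - theta (lab (al d))) - (t - theta (lab d)).
      by ring.
    rewrite sinB -/(s _) -/(s _) -/(c _) -/(c _); have := sn0 (lab d); have := sn0 (lab (al d)).
    by move: (s _) (s _) (c _) (c _) (u d) => s1 s2 c1 c2 u1 h1 h2; field; rewrite h1 h2.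
  rewrite (eq_bigr _ E) -mulr_sumr sumrB (int_sum_lab wf labN (fun p => c p / s p) hv) subrr mulr0 //.
- by move=> q; rewrite Ybd YP.
Qed.
End CritMeas.

(** * Determinants of products of consecutive linear factors *)

Section CritPoly.
Variables (R : fieldType) (n k : nat).
Hypothesis n0 : (0 < n)%N.
Variable x : 'I_n -> R.

(** With [x] the cotangent of the angles, the product of sines found in [crit_hol] is, up to nonzero
    factors, the value of this polynomial at the cotangent of [t]. *)
Definition crit_poly (r : 'I_n) : {poly R} := \prod_(j < k.-1) ((x (rot_ord j.+1 n0 r))%:P - 'X).
Definition crit_mx (phi : 'I_k -> 'I_n) : 'M[R]_k := \matrix_(i, j) (crit_poly (phi j))`_i.

Lemma size_crit_poly r : (0 < k)%N -> (size (crit_poly r) <= k)%N.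
Proof.
move=> k0; have -> : crit_poly r = \prod_(j < k.-1) ((-1) *: ('X - (x (rot_ord j.+1 n0 r))%:P)).
  by apply: eq_bigr => j _; rewrite scaleN1r opprB.
rewrite scaler_prod -[k in leqRHS](prednK k0).
apply: leq_trans (size_scale_leq _ _) _.
by rewrite size_prod_XsubC size_tuple card_ord || rewrite size_prod_XsubC /index_enum -enumT size_enum_ord.
Qed.

Lemma horner_crit_poly r X : (crit_poly r).[X] = \prod_(j < k.-1) (x (rot_ord j.+1 n0 r) - X).
Proof. by rewrite horner_prod; apply: eq_bigr => j _; rewrite !hornerE. Qed.

(** Evaluation is multiplication by a Vandermonde matrix, so the nodes contribute a factor common to
    all column sets. *)
Lemma det_crit_eval (X : 'I_k -> R) (phi : 'I_k -> 'I_n) : (0 < k)%N ->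
  \det (\matrix_(i, j) (crit_poly (phi j)).[X i])
  = (\prod_(i < k) \prod_(j < k | (i < j)%N) (X j - X i)) * \det (crit_mx phi).
Proof.
move=> k0; have -> : \matrix_(i, j) (crit_poly (phi j)).[X i] = (Vandermonde k (\row_i X i))^T *m crit_mx phi.
  apply/matrixP => i j; rewrite !mxE (horner_coef_wide _ (size_crit_poly _ k0)).
  by apply: eq_bigr => a _; rewrite !mxE mulrC.
rewrite det_mulmx det_tr det_Vandermonde; congr (_ * _).
by apply: eq_bigr => i _; apply: eq_bigr => j _; rewrite !mxE.
Qed.

Definition carc (p : 'I_n) (c : 'I_k) : 'I_n := rot_ord c n0 p.

Lemma rot_ord_neq (p : 'I_n) i j : (i < j)%N -> (j < i + n)%N -> rot_ord i n0 p != rot_ord j n0 p.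
Proof.
move=> ij jn; apply/eqP => /(congr1 val) /= /eqP; rewrite eqn_modDl => /eqP h.
have : ((j - i) %% n = 0)%N.
  by have := @eqn_mod_dvd n j i (ltnW ij); rewrite h eqxx => /esym /eqP.
rewrite modn_small; lia.
Qed.

Lemma carc_inj p : (k <= n)%N -> injective (carc p).
Proof.
move=> kn i j; case: (ltngtP i j) => [ij|ij|/val_inj //] /eqP.
- by rewrite (negbTE (rot_ord_neq _ ij _)) //; have := ltn_ord j; lia.
- by rewrite eq_sym (negbTE (rot_ord_neq _ ij _)) //; have := ltn_ord i; lia.
Qed.

(** With the nodes on the arc itself the evaluation matrix is triangular, because the polynomial of
    index [p + j] has its roots at the [k - 1] points that follow [p + j]. *)
Lemma det_crit_arc p : (0 < k)%N ->
  (\prod_(i < k) \prod_(j < k | (i < j)%N) (x (carc p j) - x (carc p i))) * \det (crit_mx (carc p))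
  = \prod_(c < k) \prod_(j < k.-1) (x (rot_ord (c + j.+1) n0 p) - x (rot_ord c n0 p)).
Proof.
move=> k0; rewrite -(det_crit_eval (fun i => x (carc p i))) // -det_tr det_trig.
  apply: eq_bigr => c _; rewrite !mxE horner_crit_poly; apply: eq_bigr => j _.
  by congr (x _ - _); apply: val_inj; rewrite /= modnDml addnA.
apply/is_trig_mxP => i j ij; rewrite !mxE horner_crit_poly.
have h : (j - i.+1 < k.-1)%N by have := ltn_ord j; lia.
rewrite (bigD1 (Ordinal h)) //= [X in X * _](_ : _ = 0) ?mul0r //.
apply/eqP; rewrite subr_eq0; apply/eqP; congr x; apply: val_inj; rewrite /= modnDml.
by congr (_ %% n)%N; lia.
Qed.

Lemma det_crit_arc_neq0 p : (0 < k)%N -> (k <= n)%N -> injective x -> \det (crit_mx (carc p)) != 0.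
Proof.
move=> k0 kn xI; have := det_crit_arc p k0; case: eqP => // ->; rewrite mulr0 => /esym/eqP.
rewrite prodf_seq_eq0 => /hasP[c _ /=]; rewrite prodf_seq_eq0 => /hasP[j _ /=].
rewrite subr_eq0 (inj_eq xI) eq_sym (negbTE (rot_ord_neq _ _ _)) //.
  by rewrite -addSnnS leq_addr.
by have := ltn_ord j; have := ltn_ord c; lia.
Qed.
End CritPoly.

Lemma det_scale (R : comPzRingType) k (a b : 'I_k -> R) (M : 'I_k -> 'I_k -> R) :
  \det (\matrix_(i, j) (a i * b j * M i j)) = (\prod_i a i) * (\prod_j b j) * \det (\matrix_(i, j) M i j).
Proof.
have -> : \matrix_(i, j) (a i * b j * M i j) = diag_mx (\row_i a i) *m (\matrix_(i, j) M i j) *m diag_mx (\row_j b j).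
  by apply/matrixP => i j; rewrite mul_mx_diag mul_diag_mx !mxE mulrAC.
rewrite !det_mulmx !det_diag mulrAC; congr (_ * _ * _); by apply: eq_bigr => i _; rewrite mxE.
Qed.

Lemma cot_inj (R : realType) (a b : R) : 0 < a < pi -> 0 < b < pi ->
  cos a / sin a = cos b / sin b -> a = b.
Proof.
wlog ab : a b / a <= b.
  by move=> H ha hb e; case: (leP a b) => h; [apply: H|apply/esym/H => //; apply: ltW].
move=> /andP[a0 ap] /andP[b0 bp] /eqP.
have sa : 0 < sin a by rewrite sin_gt0_pi // a0.
have sb : 0 < sin b by rewrite sin_gt0_pi // b0.
rewrite eqr_div ?lt0r_neq0 // => /eqP e.
have : sin (b - a) = 0 by rewrite sinB -e mulrC subrr.
move: ab; rewrite le_eqVlt => /orP[/eqP //|ab] h.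
have : 0 < sin (b - a) by rewrite sin_gt0_pi // subr_gt0 ab; lra.
by rewrite h ltxx.
Qed.

Definition increasing_arc (R : realType) n (theta : 'I_n -> R) :=
  forall p q : 'I_n, (p < q)%N -> theta p < theta q < theta p + pi.

Section FormMx.
Variables (R : realType) (n k : nat).
Hypothesis n0 : (0 < n)%N.
Variables (theta : 'I_n -> R) (s : R).

(** Homogeneous version of [crit_poly]: cosine and sine replace the cotangent, which is infinite at
    [theta p = s]. This occurs for [s = 0] and the normalization [theta_1 = 0], the case used for
    continuity and for the upper bound on the dimension. *)
Definition form_poly (r : 'I_n) : {poly R} :=
  \prod_(j < k.-1) ((cos (theta (rot_ord j.+1 n0 r) - s))%:P - (sin (theta (rot_ord j.+1 n0 r) - s)) *: 'X).
Definition form_mx (phi : 'I_k -> 'I_n) : 'M[R]_k := \matrix_(i, j) (form_poly (phi j))`_i.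

Lemma size_form_poly r : (0 < k)%N -> (size (form_poly r) <= k)%N.
Proof.
move=> k0; rewrite -[k in leqRHS](prednK k0) /form_poly.
elim: (k.-1) => [|m IH]; first by rewrite big_ord0 size_poly1.
rewrite big_ord_recr /=; apply: leq_trans (size_polyMleq _ _) _.
set q := _ - _; have : (size q <= 2)%N.
  rewrite /q (leq_trans (size_polyD _ _)) // geq_max size_polyN (leq_trans (size_polyC_leq1 _)) //=.
  by rewrite (leq_trans (size_scale_leq _ _)) // size_polyX.
move: IH; move: (size _) (size q) => a b; lia.
Qed.

Lemma horner_form_poly r X : (form_poly r).[X] =
  \prod_(j < k.-1) (cos (theta (rot_ord j.+1 n0 r) - s) - sin (theta (rot_ord j.+1 n0 r) - s) * X).
Proof. by rewrite horner_prod; apply: eq_bigr => j _; rewrite !hornerE. Qed.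

Lemma det_form_eval (X : 'I_k -> R) (phi : 'I_k -> 'I_n) : (0 < k)%N ->
  \det (\matrix_(i, j) (form_poly (phi j)).[X i])
  = (\prod_(i < k) \prod_(j < k | (i < j)%N) (X j - X i)) * \det (form_mx phi).
Proof.
move=> k0; have -> : \matrix_(i, j) (form_poly (phi j)).[X i] = (Vandermonde k (\row_i X i))^T *m form_mx phi.
  apply/matrixP => i j; rewrite !mxE (horner_coef_wide _ (size_form_poly _ k0)).
  by apply: eq_bigr => a _; rewrite !mxE mulrC.
rewrite det_mulmx det_tr det_Vandermonde; congr (_ * _).
by apply: eq_bigr => i _; apply: eq_bigr => j _; rewrite !mxE.
Qed.

Hypothesis sP : forall p, s < theta p < s + pi.
Let sig p := sin (theta p - s).
Let x p := cos (theta p - s) / sin (theta p - s).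

Lemma form_sin_gt0 p : 0 < sin (theta p - s).
Proof. by rewrite sin_gt0_pi // subr_gt0 ltrBlDl sP. Qed.

Lemma det_form_crit (phi : 'I_k -> 'I_n) : \det (form_mx phi) =
  (\prod_c \prod_(j < k.-1) sig (rot_ord j.+1 n0 (phi c))) * \det (crit_mx n0 x phi).
Proof.
have E r : form_poly r = (\prod_(j < k.-1) sig (rot_ord j.+1 n0 r)) *: crit_poly k n0 x r.
  rewrite -scaler_prod; apply: eq_bigr => j _; rewrite scalerBr; congr (_ - _).
  by rewrite -mul_polyC -polyCM /x mulrCA divff ?mulr1 // gt_eqF // form_sin_gt0.
have -> : form_mx phi = \matrix_(i, j) (1 * (\prod_(j' < k.-1) sig (rot_ord j'.+1 n0 (phi j))) * (crit_poly k n0 x (phi j))`_i).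
  by apply/matrixP => i j; rewrite !mxE E coefZ mul1r.
by rewrite det_scale big1_eq mul1r.
Qed.

Lemma cot_theta_inj : increasing_arc theta -> injective x.
Proof.
move=> inc p q /cot_inj e; apply: val_inj.
have /addIr : theta p - s = theta q - s by apply: e; rewrite subr_gt0 ltrBlDl sP.
by move=> h; case: (ltngtP p q) => // /inc; rewrite h ltxx.
Qed.
End FormMx.

Section CritFormula.
Variables (n k : nat) (G : diskgraph n).
Hypothesis n0 : (0 < n)%N.
Hypothesis red : reduced_for k (fkn k) G.
Hypothesis k0 : (0 < k)%N.
Hypothesis kn : (k < n)%N.
Variables (R : realType) (theta : 'I_n -> R) (wt : dart G -> R).
Hypothesis crit : crit_weight G theta wt.
Hypothesis inc : increasing_arc theta.

Lemma crit_form_formula (s : R) : (forall p, s <= theta p < s + pi) ->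
  exists2 C, 0 < C & forall phi : 'I_k -> 'I_n, injective phi ->
  Delta G wt (phi @: [set: 'I_k]) = C * `|\det (form_mx n0 theta s phi)|.
Proof.
move=> sP; have pn : (n.-1 < n)%N by rewrite prednK.
pose M := theta (Ordinal pn).
have Mge p : theta p <= M.
  have [h|h] := ltnP p n.-1; first by have /andP[/ltW] := inc (h : (p < Ordinal pn)%N).
  rewrite /M (_ : Ordinal pn = p) //; apply: val_inj => /=; have := ltn_ord p; lia.
have Ms : M < s + pi by have /andP[] := sP (Ordinal pn).
have sM : s <= M by have /andP[] := sP (Ordinal pn).
(* Slightly below [s], with all angles still below [s' + pi]; this makes the inequalities strict
   even if some [theta p] equals [s]. *)
pose s' := (M + s - pi) / 2.
have s's : s' < s by rewrite /s'; lra.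
have Ms' : M < s' + pi by rewrite /s'; lra.
(* [k] distinct parameters above all angles and below [s' + pi], so every [sin (t i - theta p)] is
   positive. *)
pose t (i : 'I_k) : R := M + (s' + pi - M) * ((i.+1)%:R / (k.+1)%:R).
have tP i : M < t i < s' + pi.
  have k1 : 0 < (k.+1)%:R :> R by rewrite ltr0n.
  have h1 : 0 < (i.+1)%:R / (k.+1)%:R :> R by rewrite divr_gt0 // ltr0n.
  have h2 : (i.+1)%:R / (k.+1)%:R < 1 :> R by rewrite ltr_pdivrMr // mul1r ltr_nat ltnS ltn_ord.
  have h0 : 0 < s' + pi - M by rewrite subr_gt0.
  rewrite /t ltrDl mulr_gt0 //= -ltrBrDl -[ltRHS]mulr1 ltr_pM2l //.
have tI : injective t.
  move=> i j /addrI /mulfI h; have /h /mulIf h' : s' + pi - M != 0 by rewrite subr_eq0 gt_eqF.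
  by apply: val_inj; have /h' /eqP : (k.+1)%:R^-1 != 0 :> R; rewrite ?invr_eq0 ?pnatr_eq0 // eqr_nat => /eqP[].
have stp i p : 0 < sin (t i - theta p).
  have /andP[h1 h2] := tP i; rewrite sin_gt0_pi // subr_gt0 (le_lt_trans (Mge p) h1) /= ltrBlDl.
  apply: lt_trans h2 _; rewrite ltrD2r; have /andP[h _] := sP p; exact: lt_le_trans h.
have /choice[y /choice[C H]] := fun i => crit_hol n0 red k0 kn crit (stp i).
(* Used at [r = s'], where cotangents are finite, to find a nonzero minor, and at [r = s] for the
   formula itself. *)
have dE r : s' <= r -> (forall p, r <= theta p) -> exists2 K, 0 < K & forall phi,
    `|\det (bnd_mx n0 red k0 kn wt y phi)| = K * `|\det (form_mx n0 theta r phi)|.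
  move=> s'r rP.
  have tr i : 0 < t i - r < pi.
    have /andP[h1 h2] := tP i; have hM := rP (Ordinal pn); rewrite -/M in hM; lra.
  have st0 i : 0 < sin (t i - r) by rewrite sin_gt0_pi // tr.
  pose X i := cos (t i - r) / sin (t i - r).
  have XI : injective X by move=> i j /cot_inj e; apply: tI; apply: (addIr (- r)); apply: e; exact: tr.
  have sE i p : sin (t i - theta p) = sin (t i - r) * (cos (theta p - r) - sin (theta p - r) * X i).
    have -> : t i - theta p = (t i - r) - (theta p - r) by ring.
    rewrite sinB /X; have := st0 i.
    by move: (sin _) (cos _) (cos _) (sin _) => a b c d a0; field; rewrite !gt_eqF.
  pose a i := C i * sin (t i - r) ^+ k.-1.
  have a0 i : 0 < a i by rewrite mulr_gt0 ?exprn_gt0 //; case: (H i).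
  pose b q : R := (-1) ^+ M0 (label n0 red k0 kn) (bdart (reduced_prewf red) q).
  have E phi : bnd_mx n0 red k0 kn wt y phi = \matrix_(i, j) (a i * b (phi j) * (form_poly k n0 theta r (phi j)).[X i]).
    apply/matrixP => i j; rewrite !mxE horner_form_poly; case: (H i) => _ _ ->.
    under eq_bigr => j' _ do rewrite sE.
    rewrite !big_split /= prodr_const card_ord /kast_wt (crit_bnd red crit) /a /b mulr1; ring.
  exists `|(\prod_i a i) * (\prod_(i < k) \prod_(j < k | (i < j)%N) (X j - X i))|.
    rewrite normr_gt0 mulf_neq0 //; first by rewrite gt_eqF // prodr_gt0.
    apply/prodf_neq0 => i _; apply/prodf_neq0 => j ij; rewrite subr_eq0 (inj_eq XI).
    by apply: contraTN ij => /eqP ->; rewrite ltnn.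
  move=> phi; rewrite E det_scale det_form_eval // !normrM.
  have -> : `|\prod_j b (phi j)| = 1.
    by rewrite normr_prod big1 // => c _; rewrite /b normr_sign.
  by ring.
have hol i v : black G v -> ~~ is_bnd v -> \sum_(d | tail G d == v) kast_wt (label n0 red k0 kn) wt d * y i (tail G (alpha G d)) = 0.
  by case: (H i) => _ h _; exact: h.
have sP' p : s' < theta p < s' + pi.
  by have /andP[h1 h2] := sP p; rewrite (lt_le_trans s's h1) (le_lt_trans (Mge p) Ms').
have nd : exists2 phi : 'I_k -> 'I_n, injective phi & \det (bnd_mx n0 red k0 kn wt y phi) != 0.
  exists (carc n0 (Ordinal n0)); first exact/carc_inj/ltnW.
  have [|K K0 hK] := dE s' (lexx _); first by move=> p; apply: ltW; case/andP: (sP' p).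
  rewrite -normr_gt0 hK mulr_gt0 // normr_gt0 det_form_crit // mulf_neq0 //.
    apply/prodf_neq0 => c _; apply/prodf_neq0 => j _; rewrite gt_eqF //; exact: form_sin_gt0.
  by apply: det_crit_arc_neq0 => //; [exact: ltnW|exact: cot_theta_inj].
have [c c0 hc] := meas_formula_pos (crit_gt0 n0 red k0 kn crit inc) hol nd.
have [|K K0 hK] := dE s (ltW s's); first by move=> p; case/andP: (sP p).
by exists (c * K) => [|phi phiI]; rewrite ?mulr_gt0 // hc // hK mulrA.
Qed.

Definition chord (a b : 'I_n) : R := `|sin (theta a - theta b)|.

Lemma prod_pairs (f : 'I_k -> R) :
  \prod_(i < k) \prod_(j < k | (i < j)%N) (f i * f j) = \prod_(i < k) f i ^+ k.-1.
Proof.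
under eq_bigr do rewrite big_split /=.
rewrite big_split /=.
have -> : \prod_(i < k) \prod_(j < k | (i < j)%N) f j = \prod_(i < k) \prod_(j < k | (j < i)%N) f i.
  by rewrite (exchange_big_dep xpredT).
rewrite -big_split /=; apply: eq_bigr => i _.
have -> : f i ^+ k.-1 = \prod_(j < k | j != i) f i.
  by rewrite prodr_const; congr (_ ^+ _); rewrite (eq_card (B := predC1 i)) // cardC1 card_ord.
rewrite [RHS](bigID (fun j : 'I_k => (i < j)%N)) /=; congr (_ * _); apply: eq_bigl => j.
  by rewrite -(inj_eq val_inj) /=; case: ltngtP.
by rewrite -(inj_eq val_inj) /=; case: ltngtP.
Qed.

(** A difference of cotangents is a sine divided by two sines measured from [s]. These extra factors
    occur to the same powers on both sides and cancel. *)
Lemma crit_arc_formula : exists2 C, 0 < C & forall q,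
  Delta G wt (carc n0 q @: [set: 'I_k]) * \prod_(i < k) \prod_(j < k | (i < j)%N) chord (carc n0 q i) (carc n0 q j)
  = C * \prod_(c < k) \prod_(j < k.-1) chord (rot_ord c n0 q) (rot_ord (c + j.+1) n0 q).
Proof.
have pn : (n.-1 < n)%N by rewrite prednK.
pose M := theta (Ordinal pn).
have Mge p : theta p <= M.
  have [h|h] := ltnP p n.-1; first by have /andP[/ltW] := inc (h : (p < Ordinal pn)%N).
  rewrite /M (_ : Ordinal pn = p) //; apply: val_inj => /=; have := ltn_ord p; lia.
pose m := theta (Ordinal n0).
have mle p : m <= theta p.
  have [h|h] := posnP p; last by have /andP[/ltW] := inc (h : (Ordinal n0 < p)%N).
  by rewrite /m (_ : Ordinal n0 = p) //; apply: val_inj.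
have Mm : M < m + pi.
  have [h|h] := posnP n.-1; last by have /andP[] := inc (h : (Ordinal n0 < Ordinal pn)%N).
  rewrite /M (_ : Ordinal pn = Ordinal n0); last exact: val_inj.
  by rewrite -/m ltrDl pi_gt0.
(* Centres the angles in the half-turn that begins at [s], so that all of them lie strictly
   inside. *)
pose s := (M + m - pi) / 2.
have sP p : s < theta p < s + pi by have := Mge p; have := mle p; rewrite /s; move: Mm; lra.
have sP' p : s <= theta p < s + pi by case/andP: (sP p) => /ltW -> ->.
have [C C0 hC] := crit_form_formula sP'; exists C => // q.
rewrite hC; last exact/carc_inj/ltnW.
rewrite -mulrA; congr (_ * _); rewrite det_form_crit // normrM.
set x := fun p => _ / _; pose sig p := sin (theta p - s).
have s0 p : 0 < sig p by exact: form_sin_gt0.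
have xE a b : chord a b = sig a * sig b * `|x b - x a|.
  have -> : x b - x a = sin (theta a - theta b) / (sig a * sig b).
    have -> : theta a - theta b = (theta a - s) - (theta b - s) by ring.
    rewrite sinB /x -/(sig a) -/(sig b); have := s0 a; have := s0 b.
    by move: (sig a) (sig b) (cos _) (cos _) => u v c d u0 v0; field; rewrite !gt_eqF.
  rewrite normrM normfV [X in _ / X]gtr0_norm ?mulr_gt0 //.
  by rewrite mulrCA mulfV ?mulr1 // gt_eqF // mulr_gt0.
have hL : \prod_(i < k) \prod_(j < k | (i < j)%N) chord (carc n0 q i) (carc n0 q j) =
    (\prod_(i < k) sig (carc n0 q i) ^+ k.-1) * `|\prod_(i < k) \prod_(j < k | (i < j)%N) (x (carc n0 q j) - x (carc n0 q i))|.
  rewrite -prod_pairs normr_prod -big_split; apply: eq_bigr => i _.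
  by rewrite normr_prod -big_split; apply: eq_bigr => j _; exact: xE.
have hR : \prod_(c < k) \prod_(j < k.-1) chord (rot_ord c n0 q) (rot_ord (c + j.+1) n0 q) =
    (\prod_(i < k) sig (carc n0 q i) ^+ k.-1) * (\prod_(c < k) \prod_(j < k.-1) sig (rot_ord j.+1 n0 (carc n0 q c)))
    * `|\prod_(c < k) \prod_(j < k.-1) (x (rot_ord (c + j.+1) n0 q) - x (rot_ord c n0 q))|.
  rewrite normr_prod -!big_split; apply: eq_bigr => c _.
  have -> : sig (carc n0 q c) ^+ k.-1 = \prod_(j < k.-1) sig (carc n0 q c) by rewrite prodr_const card_ord.
  rewrite normr_prod -!big_split; apply: eq_bigr => j _ /=; rewrite xE; congr (_ * sig _ * _).
  by apply: val_inj; rewrite /= modnDml addnA.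
have W0 : 0 <= \prod_(c < k) \prod_(j < k.-1) sin (theta (rot_ord j.+1 n0 (carc n0 q c)) - s).
  by apply: prodr_ge0 => c _; apply: prodr_ge0 => j _; apply: ltW; exact: s0.
by rewrite hL hR -(det_crit_arc n0 x q k0) (ger0_norm W0) normrM /sig; ring.
Qed.
End CritFormula.

(** * The extreme ranks *)

Section FullRank.
Variables (n : nat) (G : diskgraph n).
Hypothesis n0 : (0 < n)%N.
Hypothesis red : reduced_for n (fkn n) G.
Notation wf := (reduced_prewf red).
Notation al := (alpha G).
Notation tl := (tail G).
Notation bk := (black G).

Let deg v := (\sum_(d | tl d == v) 1)%N.

(** For [k = n] the Euler and face counts give as many edges as interior vertices, so the interior
    degrees sum to twice that number minus [n]. This forces at least [n] interior leaves; each is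
    the neighbour of a boundary vertex, so all these neighbours are leaves. *)
Lemma leaf_bdart p : deg (tl (al (bdart wf p))) = 1%N.
Proof.
have deg_gt0 v : (0 < deg v)%N.
  by have [d hd] := dart_at wf v; rewrite /deg (bigD1 d) ?hd ?eqxx.
pose L := [set v | ~~ is_bnd v && (deg v == 1)%N].
pose im := [set tl (al (bdart wf p)) | p in [set: 'I_n]].
have Lim : L \subset im.
  apply/fintype.subsetP => v; rewrite inE => /andP[hv /eqP d1].
  case: red => -[_ [[_ _ _ leaf _] _]] _.
  have /(leaf v hv)[d [hd /is_bndP[q hq]]] : #|[set d | tl d == v]| = 1%N.
    by rewrite -sum1_card -[RHS]d1; apply: eq_bigl => d; rewrite inE.
  apply/imsetP; exists q => //.
  by rewrite -(bdart_eq wf hq) (alphaK wf).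
have deg_sum : (\sum_(v | ~~ is_bnd v) deg v + n = 2 * (#|dart G| %/ 2))%N.
  have -> : (\sum_(v | ~~ is_bnd v) deg v = \sum_(d | ~~ is_bnd (tl d)) 1)%N.
    rewrite [RHS](partition_big tl (fun v => ~~ is_bnd v)) //=; apply: eq_bigr => v hv.
    by apply: eq_bigl => d; case: eqP => [->|]; rewrite ?hv ?andbF.
  have bn : (\sum_(d : dart G | is_bnd (tl d)) 1 = n)%N by rewrite (big_bnd wf) sum1_card card_ord.
  rewrite -[X in (_ + X)%N]bn addnC -(bigID (fun d => is_bnd (tl d)) xpredT (fun _ => 1%N)) /=.
  rewrite -(sum_black_half wf (fun _ => 1%N)) sum_nat_const mulnC; congr (_ * _)%N.
  by rewrite -(card_black_darts wf) card_sig; apply: eq_card.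
have cint := card_int wf.
have eul := reduced_euler n0 red; have faces := reduced_faces n0 red.
have nL : (n <= #|L|)%N.
  have h : (\sum_(v : vert G | ~~ is_bnd v) 2 <= \sum_(v | ~~ is_bnd v) (deg v + (deg v == 1%N)))%N.
    by apply: leq_sum => v _; have := deg_gt0 v; case: (deg v) => [|[|m]].
  have s2 : (\sum_(v : vert G | ~~ is_bnd v) 2 = 2 * #|[pred v : vert G | ~~ is_bnd v]|)%N.
    by rewrite sum_nat_const mulnC.
  move: h; rewrite big_split /= s2 -big_mkcondr /= sum1_card.
  have -> : #|[pred v | ~~ is_bnd v & deg v == 1%N]| = #|L| by apply: eq_card => v; rewrite !inE.
  rewrite subnn muln0 in faces; rewrite faces in eul.
  move: cint eul deg_sum; clear.
  move: (\sum_(_ | _) _)%N #|L| #|vert G| #|[pred v | _]| (#|dart G| %/ 2)%N => a b c d e; lia.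
have /eqP eL : L == im.
  rewrite eqEcard Lim (leq_trans _ nL) // (leq_trans (leq_imset_card _ _)) //.
  by rewrite cardsT card_ord.
have : tl (al (bdart wf p)) \in L by rewrite eL; apply/imsetP; exists p.
by rewrite inE => /andP[_ /eqP].
Qed.

(** Each neighbour of a boundary vertex is a leaf and can only be matched by its boundary edge, so
    every matching uses the whole boundary. *)
Lemma Delta_full (R : pzRingType) (wt : dart G -> R) I : I != [set: 'I_n] -> Delta G wt I = 0.
Proof.
move=> hI; rewrite /Delta big_pred0 // => A; apply/negbTE/negP => /andP[hA /eqP uA].
case/eqP: hI; apply/setP => p; rewrite -uA finset.in_setT (apm_used wf).
have hw : ~~ is_bnd (tl (al (bdart wf p))).
  by apply: (white_int wf); rewrite (black_head wf) tail_bdart (black_bnd wf).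
have [d [d1 d2] _] := apm_int hA hw.
suff : d = al (bdart wf p) by move=> e; rewrite -(apm_al hA) -e.
have := leaf_bdart p; rewrite /deg (bigD1 (al (bdart wf p))) //= => /eqP.
rewrite eqSS sum_nat_eq0 => /forallP/(_ d); rewrite d1 eqxx /=.
by case: eqP.
Qed.
End FullRank.

Section RankOne.
Variables (n : nat) (G : diskgraph n).
Hypothesis n0 : (0 < n)%N.
Hypothesis red : reduced_for 1 (fkn 1) G.
Hypothesis n1 : (1 < n)%N.
Notation k0 := (isT : (0 < 1)%N).
Notation wf := (reduced_prewf red).
Notation lab := (label n0 red k0 n1).
Notation al := (alpha G).
Notation sg := (sigma G).
Notation tl := (tail G).
Notation bk := (black G).
Let labE := (@label_bnd _ _ _ n0 red k0 n1).
Let labN := (@label_next _ _ _ n0 red k0 n1).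
Let labB := (@label_bdart _ _ _ n0 red k0 n1).
Let eul := reduced_euler n0 red.
Let faces := reduced_faces n0 red.

(** For [k = 1] the counts give the interior black vertices total degree twice their number, and
    none has degree below two. The two edges of such a vertex then carry the same pair of labels, in
    opposite order. *)
Lemma rank1_black (v : vert G) : bk v -> ~~ is_bnd v ->
  exists d d', [/\ tl d = v /\ tl d' = v, d != d', lab (al d') = lab d, lab (al d) = lab d' &
    forall e, tl e = v -> e = d \/ e = d'].
Proof.
move=> hb hv; pose deg v := (\sum_(d | tl d == v) 1)%N.
have degE u : deg u = #|[set d | tl d == u]| by rewrite -sum1_card; apply: eq_bigl => d; rewrite inE.
have deg_ge2 u : ~~ is_bnd u -> (2 <= deg u)%N.
  by move=> hu; rewrite degE (int_deg_ge2 k0 n1 labE labN labB hu).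
have deg2 : deg v = 2%N.
  have h : (\sum_(u | bk u && ~~ is_bnd u) deg u + n = #|dart G| %/ 2)%N.
    rewrite -(card_black_darts wf) card_sig -sum1_card (bigID (fun d => is_bnd (tl d))) /= addnC.
    have -> : (\sum_(i | bk (tl i) && is_bnd (tl i)) 1 = n)%N.
      rewrite (eq_bigl (fun d => is_bnd (tl d))) ?(big_bnd wf) ?sum1_card ?card_ord // => d.
      by apply: andb_idl; exact: (bnd_black wf).
    congr (_ + _)%N; rewrite [RHS](partition_big tl (fun v => bk v && ~~ is_bnd v)) //=.
    by apply: eq_bigr => u hu; apply: eq_bigl => d; rewrite inE; case: eqP => [->|]; rewrite ?hu ?andbF.
  have cw := card_white_black k0 n1 eul faces labE labN labB.
  have cint := card_int wf.
  have eW : #|[pred v : vert G | ~~ is_bnd v]| = (#|[pred v : vert G | bk v && ~~ is_bnd v]| + #|[pred v : vert G | ~~ bk v]|)%N.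
    rewrite -!sum1_card /= (bigID bk) /=; congr (_ + _)%N.
      by apply: eq_bigl => u; rewrite andbC.
    by apply: eq_bigl => u; apply: andb_idl; exact: (white_int wf).
  have s2 : (\sum_(u : vert G | bk u && ~~ is_bnd u) 2 = 2 * #|[pred v : vert G | bk v && ~~ is_bnd v]|)%N.
    by rewrite sum_nat_const mulnC.
  have le2 : (\sum_(u : vert G | bk u && ~~ is_bnd u) 2 <= \sum_(u | bk u && ~~ is_bnd u) deg u)%N.
    by apply: leq_sum => u /andP[_]; exact: deg_ge2.
  have : (\sum_(u : vert G | bk u && ~~ is_bnd u) 2 == \sum_(u | bk u && ~~ is_bnd u) deg u)%N.
    move: n1 faces eul h cw cint eW s2 le2; clear.
    move: (fcard _ _) (\sum_(_ | _) deg _)%N (\sum_(_ | _) 2)%N #|vert G| (#|dart G| %/ 2)%N; move: #|_| #|_| #|_|.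
    lia.
  rewrite (bigD1 v) ?hb //= [X in _ == X](bigD1 v) ?hb //= => /eqP e.
  apply/eqP; rewrite eqn_leq deg_ge2 // andbT.
  have : (\sum_(u | (bk u && ~~ is_bnd u) && (u != v)) 2 <= \sum_(u | (bk u && ~~ is_bnd u) && (u != v)) deg u)%N.
    by apply: leq_sum => u /andP[/andP[_ hu] _]; exact: deg_ge2.
  move: e; clear; move: (\sum_(_ | _) deg _)%N (\sum_(_ | _) 2)%N (deg v) => a b c; lia.
have [d0 hd0] := dart_at wf v.
have hs : tl (sg d0) = v by rewrite (tail_sigma wf).
have allE (Q : pred (dart G)) : (forall e, tl e = v -> Q e -> Q (sg e)) -> Q d0 -> forall e, tl e = v -> Q e.
  move=> hQ h0 e he; have : fconnect sg d0 e by apply: (sigma_conn wf); rewrite hd0.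
  move=> /iter_findex <-; elim: (findex _ _ _) => // i IH; rewrite iterS hQ //.
  by elim: (i) => //= j; rewrite (tail_sigma wf).
have ne : d0 != sg d0.
  apply/eqP => e0; have : (deg v <= 1)%N; last by rewrite deg2.
  rewrite degE -(cards1 d0) subset_leq_card //; apply/fintype.subsetP => e; rewrite !inE => /eqP he.
  by apply: (allE (pred1 d0)) => //= e' _ /eqP ->; rewrite -e0.
have dset : [set d0; sg d0] = [set d | tl d == v].
  apply/eqP; rewrite eqEcard -degE deg2 cards2 ne andbT.
  by apply/fintype.subsetP => e; rewrite !inE => /orP[] /eqP ->; apply/eqP.
have two e : tl e = v -> e = d0 \/ e = sg d0.
  move=> he; have : e \in [set d | tl d == v] by rewrite inE he.
  by rewrite -dset !inE => /orP[/eqP|/eqP]; [left|right].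
have ss : sg (sg d0) = d0.
  have t2 : tl (sg (sg d0)) = v by rewrite !(tail_sigma wf).
  by case: (two _ t2) => // /perm_inj e; rewrite e eqxx in ne.
exists d0, (sg d0); split=> //.
  by rewrite (lab_black wf labN) ?hd0.
by rewrite -{1}ss (lab_black wf labN) ?hs.
Qed.

(** Since the two edges at a black vertex carry opposite signed weights, the constant function
    solves the vertex equations, both for [wt] and for the weight [one]. The critical weights may
    fail to be positive here; the comparison with [one], which is positive, settles the signs of all
    coordinates at once. *)
Lemma rank1_Delta (R : realType) (theta : 'I_n -> R) (wt : dart G -> R) : crit_weight G theta wt ->
  exists c : R, forall I, Delta G wt I = c * (#|I| == 1%N)%:R.
Proof.
move=> crit; have [b hb] := meas_formula n0 red k0 n1 R.
pose one := fun _ : dart G => 1 : R.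
pose y := fun (_ : 'I_1) (_ : vert G) => 1 : R.
have hol1 i v : bk v -> ~~ is_bnd v -> \sum_(d | tl d == v) kast_wt lab one d * y i (tl (al d)) = 0.
  move=> hv hv'; have [d [d' [[e1 e2] ne l1 l2 two]]] := rank1_black hv hv'.
  rewrite (bigD1 d) ?e1 //= (bigD1 d') /=; last by rewrite e2 eqxx eq_sym.
  rewrite big1 => [|e /andP[/andP[/eqP he h1] h2]]; last by case: (two e he) h1 h2 => ->; rewrite eqxx.
  have := label_neq n0 red k0 n1 d; rewrite /kast_wt /M0 e1 e2 hv l1 l2 -(inj_eq val_inj) /=.
  by rewrite /y /one !mulr1 addr0; case: ltngtP => // _ _; rewrite expr0 expr1 ?subrr ?addNr.
have hol2 i v : bk v -> ~~ is_bnd v -> \sum_(d | tl d == v) kast_wt lab wt d * y i (tl (al d)) = 0.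
  move=> hv hv'; have [d [d' [[e1 e2] ne l1 l2 two]]] := rank1_black hv hv'.
  rewrite (bigD1 d) ?e1 //= (bigD1 d') /=; last by rewrite e2 eqxx eq_sym.
  rewrite big1 => [|e /andP[/andP[/eqP he h1] h2]]; last by case: (two e he) h1 h2 => ->; rewrite eqxx.
  rewrite !(crit_kast n0 red k0 n1 crit) ?e1 ?e2 //.
  by rewrite /y !mulr1 addr0 l1 -l2 -[X in _ + X]opprK -sinN opprB subrr.
have bE (w : dart G -> R) phi : (forall p, w (bdart wf p) = 1) ->
    \det (bnd_mx n0 red k0 n1 w y phi) = (-1) ^+ M0 lab (bdart wf (phi ord0)).
  by move=> h; rewrite det_mx11 mxE /kast_wt h /y !mulr1.
have nz w : (forall p, w (bdart wf p) = 1) -> exists2 phi, injective phi & \det (bnd_mx n0 red k0 n1 w y phi) != 0.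
  move=> h; exists (fun _ : 'I_1 => Ordinal n0); last by rewrite bE // signr_eq0.
  by move=> i j _; rewrite !ord1.
have wt1 p : wt (bdart wf p) = 1 by exact: (crit_bnd red crit).
have [c hc] := hb wt y hol2 (nz wt wt1).
have [c1 hc1] := hb one y hol1 (nz one (fun _ => erefl)).
exists (c * `|c1| / c1) => I.
have [cI|cI] := eqVneq #|I| 1%N; last by rewrite mulr0 (Delta_card n0 red k0 n1).
have /cards1P[p ->] : #|I| == 1%N by rewrite cI.
have -> : [set p] = (fun _ : 'I_1 => p) @: [set: 'I_1].
  by apply/setP => q; rewrite !inE; apply/eqP/imsetP => [->|[i _ ->] //]; exists ord0.
have phiI : injective (fun _ : 'I_1 => p) by move=> i j _; rewrite !ord1.
have c1n : c1 != 0.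
  have [J hJ] : exists J, 0 < Delta G one J by apply: Delta_gt0 => [|d]; [case: red|exact: ltr01].
  apply: contraTneq hJ => e; have [cJ|cJ] := eqVneq #|J| 1%N; last by rewrite (Delta_card n0 red k0 n1) // ltxx.
  have /cards1P[q ->] : #|J| == 1%N by rewrite cJ.
  have -> : [set q] = (fun _ : 'I_1 => q) @: [set: 'I_1].
    by apply/setP => q'; rewrite !inE; apply/eqP/imsetP => [->|[i _ ->] //]; exists ord0.
  by rewrite hc1 ?e ?mul0r ?ltxx // => i j _; rewrite !ord1.
rewrite hc // bE // mulr1.
have := hc1 _ phiI; rewrite bE // => e1.
have : `|Delta G one ((fun _ : 'I_1 => p) @: [set: 'I_1])| = `|c1| by rewrite e1 !normrM !normr_sign !mulr1.
rewrite ger0_norm ?Delta_ge0 // e1 => <-.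
by rewrite -mulrA [c1 * _]mulrC mulfK.
Qed.
End RankOne.

(** * A reduced grid graph *)

Section Grid.
Variables (n k : nat).
Hypotheses (k0 : (0 < k)%N) (kn : (k <= n)%N).
Notation a := (n - k)%N.
Let n0 : (0 < n)%N := leq_trans k0 kn.

(** Cell [(i, j)] has a white and a black vertex joined by [GN]. [GR] reaches the white vertex from
    the preceding cell in [j], or from a boundary vertex when [j = 0], and [GT] goes from the black
    vertex to the white vertex of cell [(i + 1, j)]. The boolean is true at the black end. Codes in
    natural numbers reduce the verifications to case analysis and linear arithmetic. *)
Inductive gkind := GN | GR | GT.
Definition graw := (gkind * bool * (nat * nat))%type.
Definition gdart : finType := (('I_a.+1 * 'I_k + 'I_a * 'I_k + 'I_a * 'I_k) * bool)%type.
Definition gcode (d : gdart) : graw :=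
  match d with
  | (inl (inl (i, j)), b) => (GN, b, (i : nat, j : nat))
  | (inl (inr (i, j)), b) => (GR, b, (i : nat, j : nat))
  | (inr (i, j), b) => (GT, b, (i : nat, j : nat))
  end.
Definition gvalid (c : graw) : bool :=
  match c with
  | (GN, b, (i, j)) => (i <= a)%N && (j < k)%N
  | (_, b, (i, j)) => (i < a)%N && (j < k)%N
  end.
Definition gd0 : gdart := (inl (inl (ord0, Ordinal k0)), true).
Definition gmk (c : graw) : gdart :=
  match c with
  | (GN, b, (i, j)) => (inl (inl (insubd ord0 i, insubd (Ordinal k0) j)), b)
  | (GR, b, (i, j)) => if insub i is Some i' then (inl (inr (i', insubd (Ordinal k0) j)), b) else gd0
  | (GT, b, (i, j)) => if insub i is Some i' then (inr (i', insubd (Ordinal k0) j), b) else gd0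
  end.
Lemma gcode_valid d : gvalid (gcode d).
Proof. by case: d => [[[[i j]|[i j]]|[i j]] b] /=; rewrite ?ltn_ord // -ltnS ltn_ord. Qed.
Lemma gmkK c : gvalid c -> gcode (gmk c) = c.
Proof.
by case: c => [[[] b] [i j]] /= /andP[hi hj]; rewrite ?(insubT (fun m => m < a)%N hi) /= ?val_insubd ?ltnS ?hi ?hj.
Qed.
Lemma gcode_inj : injective gcode.
Proof.
move=> [[[[i j]|[i j]]|[i j]] b] [[[[i' j']|[i' j']]|[i' j']] b'] //= [-> /val_inj -> /val_inj -> //].
Qed.
Inductive gvkind := VW | VB | VL.
Definition gvert : finType := ('I_a.+1 * 'I_k + 'I_a.+1 * 'I_k + 'I_a)%type.
Definition gvcode (v : gvert) : gvkind * (nat * nat) :=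
  match v with
  | inl (inl (i, j)) => (VW, (i : nat, j : nat))
  | inl (inr (i, j)) => (VB, (i : nat, j : nat))
  | inr i => (VL, (i : nat, 0%N))
  end.
Definition gvvalid (c : gvkind * (nat * nat)) : bool :=
  match c with
  | (VL, (i, j)) => (i < a)%N && (j == 0%N)
  | (_, (i, j)) => (i <= a)%N && (j < k)%N
  end.
Definition gvmk (c : gvkind * (nat * nat)) : gvert :=
  match c with
  | (VW, (i, j)) => inl (inl (insubd ord0 i, insubd (Ordinal k0) j))
  | (VB, (i, j)) => inl (inr (insubd ord0 i, insubd (Ordinal k0) j))
  | (VL, (i, j)) => if insub i is Some i' then inr i' else inl (inl (ord0, Ordinal k0))
  end.
Lemma gvcode_valid d : gvvalid (gvcode d).
Proof. by case: d => [[[i j]|[i j]]|i] /=; rewrite ?ltn_ord // -ltnS ltn_ord. Qed.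
Lemma gvmkK c : gvvalid c -> gvcode (gvmk c) = c.
Proof.
case: c => [[] [i j]] /= /andP[hi hj]; rewrite ?val_insubd ?ltnS ?hi ?hj //.
by rewrite (insubT (fun m => m < a)%N hi) /= (eqP hj).
Qed.
Lemma gvcode_inj : injective gvcode.
Proof.
move=> [[[i j]|[i j]]|i] [[[i' j']|[i' j']]|i'] //= [/val_inj ->] // /val_inj -> //.
Qed.

Definition calpha (c : graw) : graw := let: (t, b, p) := c in (t, ~~ b, p).
Definition ctail (c : graw) : gvkind * (nat * nat) :=
  match c with
  | (GT, false, (i, j)) => (VW, (i.+1, j))
  | (_, false, p) => (VW, p)
  | (GR, true, (i, j)) => if j is j'.+1 then (VB, (i, j')) else (VL, (i, 0%N))
  | (_, true, p) => (VB, p)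
  end.
Definition csigma (c : graw) : graw :=
  match c with
  | (GT, false, (i, j)) => if (i.+1 < a)%N then (GR, false, (i.+1, j)) else (GN, false, (i.+1, j))
  | (GR, false, p) => (GN, false, p)
  | (GN, false, (i, j)) => if i is i'.+1 then (GT, false, (i', j))
                           else if (0 < a)%N then (GR, false, (i, j)) else (GN, false, (i, j))
  | (GN, true, (i, j)) => if (i < a)%N then (GT, true, (i, j)) else (GN, true, (i, j))
  | (GT, true, (i, j)) => if (j.+1 < k)%N then (GR, true, (i, j.+1)) else (GN, true, (i, j))
  | (GR, true, (i, j)) => if j is j'.+1 then (GN, true, (i, j')) else (GR, true, (i, j))
  end.
Definition csigmaV (c : graw) : graw :=
  match c with
  | (GT, false, (i, j)) => (GN, false, (i.+1, j))
  | (GR, false, (i, j)) => if i is i'.+1 then (GT, false, (i', j)) else (GN, false, (i, j))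
  | (GN, false, (i, j)) => if (i < a)%N then (GR, false, (i, j))
                           else if i is i'.+1 then (GT, false, (i', j)) else (GN, false, (i, j))
  | (GN, true, (i, j)) => if (i < a)%N then if (j.+1 < k)%N then (GR, true, (i, j.+1)) else (GT, true, (i, j))
                          else (GN, true, (i, j))
  | (GT, true, p) => (GN, true, p)
  | (GR, true, (i, j)) => if j is j'.+1 then (GT, true, (i, j')) else (GR, true, (i, j))
  end.
(** Closed form of the strand labels. It is invariant along strands by [clabel_white] and
    [clabel_black], hence equal to the index where the strand ends. *)
Definition clabel (c : graw) : nat :=
  match c with
  | (GR, true, (i, j)) => i + k
  | (GN, false, (i, j)) => if (i < a)%N then i + k else a + j
  | (GN, true, (i, j)) => j
  | (GT, false, (i, j)) => j
  | (GR, false, (i, j)) => i + j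
  | (GT, true, (i, j)) => i.+1 + j
  end%N.
(* [None] stands for the face touching the boundary between b_n and b_1 *)
Definition cface (i j : nat) : option (nat * nat) := if (0 < i)%N && (j < k)%N then Some (i, j) else None.
(** An invariant of faces ([crho_int]) with enough values to tell the faces apart, which gives the
    lower bound on their number. *)
Definition crho (c : graw) : option (nat * nat) :=
  match c with
  | (GR, true, (i, j)) => cface i.+1 j
  | (GR, false, (i, j)) => cface i j
  | (GT, true, (i, j)) => cface i.+1 j
  | (GT, false, (i, j)) => cface i.+1 j.+1
  | (GN, true, (i, j)) => cface i j.+1
  | (GN, false, (i, j)) => if (i < a)%N then cface i.+1 j else cface i j
  end.
Definition cbnd (p : nat) : gvkind * (nat * nat) := if (p < a)%N then (VL, (p, 0%N)) else (VB, (a, p - a))%N.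
Definition cbdart (p : nat) : graw := if (p < a)%N then (GR, true, (p, 0%N)) else (GN, true, (a, p - a))%N.
Definition cblack (v : gvkind * (nat * nat)) : bool := if v is (VW, _) then false else true.
Definition cint (v : gvkind * (nat * nat)) : bool :=
  match v with (VW, _) => true | (VB, (i, _)) => (i < a)%N | (VL, _) => false end.

Ltac csolve := repeat match goal with
  | |- context [if ?b then _ else _] => case: (boolP b) => /= ?
  | |- context [match ?m with 0 => _ | S _ => _ end] => destruct m => /=
  end.
Ltac cfin := try done; try lia; try (by do ?[congr pair]; lia); try (exfalso; lia).

Lemma csigma_valid c : gvalid c -> gvalid (csigma c).
Proof. case: c => [[[] []] [i j]] /=; csolve; lia. Qed.
Lemma csigmaK c : gvalid c -> csigmaV (csigma c) = c.
Proof. case: c => [[[] []] [i j]] /=; csolve => //; move=> /= ?; csolve => //; cfin. Qed.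
Lemma ctail_valid c : gvalid c -> gvvalid (ctail c).
Proof. case: c => [[[] []] [i j]] /=; csolve; lia. Qed.
Lemma ctail_sigma c : gvalid c -> ctail (csigma c) = ctail c.
Proof. case: c => [[[] []] [i j]] /=; csolve => //=; csolve; cfin. Qed.
Lemma calpha_valid c : gvalid c -> gvalid (calpha c).
Proof. by case: c => [[[] []] [i j]]. Qed.
Ltac ceq := repeat match goal with
  | |- (_, _) = (_, _) => congr pair
  | |- Some _ = Some _ => congr Some
  end.
Ltac cgo := csolve; try done; try (exfalso; lia); ceq; try done; lia.
(** All degrees are at most three, so two rotation steps suffice. *)
Lemma ctail_conn c c' : gvalid c -> gvalid c' -> ctail c = ctail c' ->
  [\/ c' = c, c' = csigma c | c' = csigma (csigma c)].
Proof.
case: c => [[[] []] [i j]]; case: c' => [[[] []] [i' j']] /= h1 h2;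
  try (destruct j); try (destruct j'); try done; case=> *; subst;
  rewrite /=; csolve; first [by exfalso; lia | by apply: Or31; cgo | by apply: Or32; cgo | by apply: Or33; cgo].
Qed.
Lemma ctail_color c : gvalid c -> cblack (ctail c) = c.1.2.
Proof. by case: c => [[[] []] [i []]]. Qed.
Lemma clabel_white c : gvalid c -> c.1.2 = false -> clabel (csigma c) = clabel (calpha c).
Proof. case: c => [[[] []] [i j]] //= h _; csolve => //=; csolve; lia. Qed.
Lemma clabel_black c : gvalid c -> c.1.2 = true -> cint (ctail c) -> clabel (calpha (csigma c)) = clabel c.
Proof. case: c => [[[] []] [i j]] //= h _; csolve => //=; csolve; lia. Qed.
Lemma crho_int c : gvalid c -> cint (ctail (calpha c)) -> crho (csigma (calpha c)) = crho c.
Proof. case: c => [[[] []] [i j]] //=; csolve => //= *; rewrite /cface; cgo. Qed.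
Lemma cbnd_valid p : (p < n)%N -> gvvalid (cbnd p).
Proof. rewrite /cbnd => h; csolve => //=; lia. Qed.
Lemma cbdart_valid p : (p < n)%N -> gvalid (cbdart p).
Proof. rewrite /cbdart => h; csolve => //=; lia. Qed.
Lemma cbdart_tail p : ctail (cbdart p) = cbnd p.
Proof. by rewrite /cbdart /cbnd; csolve. Qed.
Lemma cbnd_inj p q : (p < n)%N -> (q < n)%N -> cbnd p = cbnd q -> p = q.
Proof. rewrite /cbnd => h1 h2; csolve => //= -[]; lia. Qed.
Lemma cbnd_tail c p : gvalid c -> ctail c = cbnd p -> c = cbdart p.
Proof.
rewrite /cbnd /cbdart; case: c => [[[] []] [i j]] /= h1; try (destruct j); csolve => //= -[] *; subst; cgo.
Qed.
Lemma cint_bnd p : cint (cbnd p) = false.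
Proof. rewrite /cbnd; csolve => //=; lia. Qed.
Lemma cint_dichotomy v : gvvalid v -> ~~ cint v -> exists2 p, (p < n)%N & v = cbnd p.
Proof.
case: v => [[] [i j]] //= h1 h2; [exists (a + j)%N|exists i]; rewrite /cbnd; cgo.
Qed.
Lemma clabel_bdart p : (p < n)%N -> clabel (cbdart p) = ((p + k) %% n)%N.
Proof.
move=> h; rewrite /cbdart; case: ifP => h' /=; first by rewrite modn_small //; lia.
have -> : (p + k = (p - a) + n)%N by lia.
rewrite modnDr modn_small //; lia.
Qed.
Lemma clabel_alpha_bdart p : (p < n)%N -> clabel (calpha (cbdart p)) = p.
Proof. move=> h; rewrite /cbdart; case: ifP => h' /=; csolve; lia. Qed.
Definition galphaf (d : gdart) : gdart := (d.1, ~~ d.2).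
Lemma galphaE d : gcode (galphaf d) = calpha (gcode d).
Proof. by case: d => [[[[i j]|[i j]]|[i j]] b]. Qed.
Lemma galpha_inj : injective galphaf.
Proof. by move=> [d b] [d' b'] [-> /negb_inj ->]. Qed.
Definition gsigmaf (d : gdart) : gdart := gmk (csigma (gcode d)).
Lemma gsigmaE d : gcode (gsigmaf d) = csigma (gcode d).
Proof. by rewrite gmkK // csigma_valid // gcode_valid. Qed.
Lemma gsigma_inj : injective gsigmaf.
Proof.
move=> d d' /(congr1 gcode); rewrite !gsigmaE => /(congr1 csigmaV).
by rewrite !csigmaK ?gcode_valid // => /gcode_inj.
Qed.
Definition gtail (d : gdart) : gvert := gvmk (ctail (gcode d)).
Lemma gtailE d : gvcode (gtail d) = ctail (gcode d).
Proof. by rewrite gvmkK // ctail_valid // gcode_valid. Qed.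
Definition gbnd (p : 'I_n) : gvert := gvmk (cbnd p).
Lemma gbndE p : gvcode (gbnd p) = cbnd p.
Proof. by rewrite gvmkK // cbnd_valid. Qed.

Definition grid : diskgraph n :=
  {| dart := gdart; vert := gvert; alpha := perm galpha_inj; sigma := perm gsigma_inj;
     tail := gtail; black := fun v => cblack (gvcode v); bnd := gbnd |}.

Lemma al_code d : gcode (alpha grid d) = calpha (gcode d).
Proof. by rewrite permE galphaE. Qed.
Lemma sg_code d : gcode (sigma grid d) = csigma (gcode d).
Proof. by rewrite permE gsigmaE. Qed.
Lemma tl_code d : gvcode (tail grid d) = ctail (gcode d).
Proof. exact: gtailE. Qed.
Lemma bd_code p : gvcode (bnd grid p) = cbnd p.
Proof. exact: gbndE. Qed.
Lemma bk_code d : black grid (tail grid d) = (gcode d).1.2.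
Proof. by rewrite /= gtailE ctail_color // gcode_valid. Qed.
Lemma is_bnd_code (v : vert grid) : is_bnd v = ~~ cint (gvcode v).
Proof.
apply/existsP/idP => [[p /eqP <-]|h]; first by rewrite bd_code cint_bnd.
have [p pn e] := cint_dichotomy (gvcode_valid v) h.
by exists (Ordinal pn); apply/eqP/gvcode_inj; rewrite bd_code.
Qed.
Lemma tl_mk c : gvalid c -> gvcode (tail grid (gmk c)) = ctail c.
Proof. by move=> h; rewrite tl_code gmkK. Qed.
Lemma al_mk c : gvalid c -> alpha grid (gmk c) = gmk (calpha c).
Proof. by move=> h; apply: gcode_inj; rewrite al_code !gmkK // calpha_valid. Qed.

Definition gbdart (p : 'I_n) : dart grid := gmk (cbdart p).

Lemma grid_adj (c : graw) : gvalid c -> adjG (gvmk (ctail c) : vert grid) (gvmk (ctail (calpha c))).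
Proof.
move=> h; apply/existsP; exists (gmk c); rewrite al_mk //; apply/andP; split; apply/eqP/gvcode_inj;
  by rewrite tl_mk ?calpha_valid // gvmkK ?ctail_valid ?calpha_valid.
Qed.

Lemma grid_conn (v : vert grid) : exists p, connect (@adjG n grid) v (bnd grid p).
Proof.
have mkE (w : vert grid) : gvmk (gvcode w) = w by apply: gvcode_inj; rewrite gvmkK ?gvcode_valid.
have B m i j : (i + m = a)%N -> (j < k)%N -> exists p, connect (@adjG n grid) (gvmk (VB, (i, j))) (bnd grid p).
  elim: m i => [|m IH] i hi hj.
    have pn : (a + j < n)%N by lia.
    exists (Ordinal pn); rewrite (_ : bnd grid _ = gvmk (VB, (i, j))) ?connect0 //.
    by apply: gvcode_inj; rewrite bd_code gvmkK /= ?hj ?andbT; last lia; rewrite /cbnd /= -hi addn0 ltnNge leq_addr /= addKn.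
  have [||p hp] := IH i.+1; [lia|by []|]; exists p; apply: connect_trans hp.
  have h1 : gvalid (GT, true, (i, j)) by rewrite /= hj andbT; lia.
  have h2 : gvalid (GN, false, (i.+1, j)) by rewrite /= hj andbT; lia.
  exact: connect_trans (connect1 (grid_adj h1)) (connect1 (grid_adj h2)).
rewrite -(mkE v); have := gvcode_valid v; case: (gvcode v) => [[] [i j]] hv.
- have /andP[hi hj] := hv; have [||p hp] := B (a - i)%N i j; [lia|by []|].
  exists p; apply: connect_trans hp; apply: connect1.
  have h : gvalid (GN, false, (i, j)) by rewrite /= hi hj.
  exact: (grid_adj h).
- by have /andP[hi hj] := hv; apply: (B (a - i)%N) => //; lia.
- have /andP[hi /eqP ->] := hv; have [||p hp] := B (a - i)%N i 0%N; [lia|by []|].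
  exists p; apply: connect_trans hp.
  have h1 : gvalid (GR, true, (i, 0%N)) by rewrite /= hi k0.
  have h2 : gvalid (GN, false, (i, 0%N)) by rewrite /= k0 andbT ltnW.
  exact: connect_trans (connect1 (grid_adj h1)) (connect1 (grid_adj h2)).
Qed.

Definition grid_matching : {set dart grid} := [set d | if gcode d is (GN, _, _) then true else false].

Lemma grid_apm : is_apm grid_matching.
Proof.
have N2 v d d' : gvcode (tail grid d) = v -> gvcode (tail grid d') = v ->
    d \in grid_matching -> d' \in grid_matching -> d = d'.
  move=> <- + hd hd'; rewrite !tl_code => e; apply: gcode_inj; move: hd hd' e; rewrite !inE.
  by case: (gcode d) => [[[] []] [i j]]; case: (gcode d') => [[[] []] [i' j']] //= _ _ [-> ->].
apply/andP; split; [apply/andP; split|].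
- by apply/forallP => d; rewrite !inE al_code; case: (gcode d) => [[[] b] [i j]].
- apply/forallP => v; apply/implyP; rewrite is_bnd_code negbK => hv.
  have [d dA dv] : exists2 d, d \in grid_matching & tail grid d = v.
    have := gvcode_valid v; case e: (gvcode v) hv => [[] [i j]] // h1 h2.
      exists (gmk (GN, false, (i, j))); first by rewrite inE gmkK.
      by apply: gvcode_inj; rewrite tl_mk.
    exists (gmk (GN, true, (i, j))); first by rewrite inE gmkK.
    by apply: gvcode_inj; rewrite tl_mk.
  apply/cards1P; exists d; apply/setP => d'; rewrite !inE; apply/andP/eqP => [[h1 /eqP h2]|->].
    by apply: (N2 (gvcode v)) => //; rewrite ?h2 ?dv // inE.
  by rewrite dv eqxx; move: dA; rewrite inE.
- apply/forallP => p; apply/card_le1P => d; rewrite !inE => /andP[h1 /eqP h2] d'.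
  rewrite !inE; apply/andP/eqP => [[h3 /eqP h4]|->]; last by rewrite h1 h2.
  by apply: (N2 (cbnd p)); rewrite ?h2 ?h4 ?bd_code // inE.
Qed.

Lemma grid_prewf : planar_prewf grid.
Proof.
split; split.
- move=> d; split; first by apply: gcode_inj; rewrite !al_code; case: (gcode d) => [[t b] q] /=; rewrite negbK.
  by apply/eqP => /(congr1 gcode); rewrite al_code; case: (gcode d) => [[t []] q].
- by move=> d; apply: gvcode_inj; rewrite !tl_code sg_code ctail_sigma // gcode_valid.
- move=> d d' /(congr1 gvcode); rewrite !tl_code => /(ctail_conn (gcode_valid d) (gcode_valid d')).
  case=> e.
  + by rewrite (gcode_inj e) connect0.
  + by rewrite (_ : d' = sigma grid d) ?fconnect1 //; apply: gcode_inj; rewrite sg_code.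
  + rewrite (_ : d' = iter 2 (sigma grid) d) ?fconnect_iter //; by apply: gcode_inj; rewrite !sg_code.
- by move=> d; rewrite !bk_code al_code; case: (gcode d) => [[t []] q].
- move=> p q /(congr1 gvcode); rewrite !bd_code => /cbnd_inj e; apply: val_inj; exact: e.
- by move=> p; rewrite /= gbndE /cbnd; case: ifP.
- move=> p; exists (gbdart p) => d; split => [h|->].
    by apply: gcode_inj; rewrite gmkK ?cbdart_valid //; apply: cbnd_tail; rewrite ?gcode_valid // -tl_code h bd_code.
  by apply: gvcode_inj; rewrite bd_code tl_mk ?cbdart_valid // cbdart_tail.
- exact: grid_conn.
- move=> v; rewrite is_bnd_code negbK => hv c1.
  have big c c' : gvalid c -> gvalid c' -> c <> c' -> ctail c = gvcode v -> ctail c' = gvcode v -> False.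
    move=> h h' ne e e'; have : gmk c = gmk c'; last by move/(congr1 gcode); rewrite !gmkK.
    move/eqP/cards1P: c1 => [d hd].
    have inS (x : graw) : gvalid x -> ctail x = gvcode v -> gmk x = d.
      move=> hx ex; apply/eqP; rewrite -finset.in_set1 -hd inE; apply/eqP/gvcode_inj; by rewrite tl_mk.
    by rewrite (inS c) // (inS c').
  have := gvcode_valid v; case e: (gvcode v) hv => [[] [i j]] // h1 h2; last first.
    by case: (big (GN, true, (i, j)) (GT, true, (i, j))) => //=; move: h1 h2 => /=; lia.
  move: h2 => /andP[hi hj].
  have [ia|ia] := ltnP i a.
    by case: (big (GN, false, (i, j)) (GR, false, (i, j))) => //=; rewrite ?ia ?hj ?(ltnW ia).
  have hN : gvalid (GN, false, (i, j)) by rewrite /= hi hj.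
  exists (gmk (GN, false, (i, j))); split; first by apply: gvcode_inj; rewrite tl_mk.
  by rewrite is_bnd_code al_mk // tl_mk //= -leqNgt.
- by exists grid_matching; apply: grid_apm.
Qed.
Notation gwf := grid_prewf.

Lemma gbdartE p : bdart gwf p = gbdart p.
Proof.
apply/esym/bdart_eq; apply: gvcode_inj.
by rewrite bd_code tl_mk ?cbdart_valid // cbdart_tail.
Qed.
Lemma bdart_code p : gcode (bdart gwf p) = cbdart p.
Proof. by rewrite gbdartE gmkK // cbdart_valid. Qed.

Definition grid_rho (x : ext_dart grid) : option (option (nat * nat)) :=
  match x with
  | inl d => Some (crho (gcode d))
  | inr (p, false) => Some (if (p < a)%N then cface p 0 else cface a (p - a))
  | inr (p, true) => None
  end.

Lemma grid_rho_face x : grid_rho (ext_face_perm x) = grid_rho x.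
Proof.
case: x => [d|[p []]]; rewrite /ext_face_perm.
- have [/is_bndP[q hq]|h] := boolP (is_bnd (tail grid (alpha grid d))).
    have e := bdart_eq gwf hq; rewrite [ext_alpha _]/= e (ext_sigma_bdart gwf) /=; congr Some.
    have -> : gcode d = calpha (cbdart q).
      by rewrite -bdart_code -e al_code; case: (gcode d) => [[t b] r] /=; rewrite negbK.
    by rewrite /cbdart; case: ifP => hq' //=; rewrite ltnn.
  rewrite [ext_alpha _]/= (ext_sigma_int h) /= sg_code al_code crho_int ?gcode_valid //.
  by move: h; rewrite is_bnd_code negbK tl_code al_code.
- by [].
- rewrite [ext_alpha _]/= (ext_sigma_t gwf) /= bdart_code; congr Some.
  have -> : (ord_pred p : nat) = (if p == 0%N :> nat then n.-1 else p.-1).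
    rewrite /=; have := ltn_ord p; case: (p : nat) => [|m] /= hm; first by rewrite add0n modn_small // prednK.
      by rewrite modnDr modn_small // ltnW.
  have := ltn_ord p; rewrite /cbdart /cface; case: (p : nat) => [|m] /= hm; csolve => //=; rewrite /cface; csolve => //; try (exfalso; lia); ceq; lia.
Qed.

Lemma grid_faces_ge : (a * k + 2 <= fcard (@ext_face_perm n grid) predT)%N.
Proof.
have rhoE x y : face_of gwf x = face_of gwf y -> grid_rho x = grid_rho y.
  move/eqP; rewrite face_ofE => /iter_findex <-; elim: (findex _ _ _) => //= i ->.
  by rewrite grid_rho_face.
pose h (c : option (option ('I_a * 'I_k))) := match c with
  | None => face_of gwf (inr (Ordinal n0, true))
  | Some None => face_of gwf (inr (Ordinal n0, false))
  | Some (Some (i, j)) => face_of gwf (inl (gmk (GR, true, (i : nat, j : nat))))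
  end.
have hr c x : h c = face_of gwf x -> grid_rho x = match c with None => None | Some None => Some None
    | Some (Some (i, j)) => Some (Some (i.+1 : nat, j : nat)) end.
  case: c => [[[i j]|]|] /rhoE <-; last by [].
    have v : gvalid (GR, true, (i : nat, j : nat)) by rewrite /= !ltn_ord.
    by rewrite /grid_rho (gmkK v) /= /cface /= ltn_ord.
  by rewrite /= /cface; case: (posnP a) => [->|].
suff hI : injective h.
  by have := leq_card h hI; rewrite card_face_type !card_option card_prod !card_ord addn2.
move=> c c' e.
have ex : exists x, h c = face_of gwf x by case: (c) => [[[i j]|]|]; eexists; reflexivity.
have [x hx] := ex; have := hr _ _ hx; rewrite e in hx; rewrite (hr _ _ hx).
case: c c' {e ex hx} => [[[i j]|]|] [[[i' j']|]|] //=; try discriminate.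
by case=> /val_inj -> /val_inj ->.
Qed.

Lemma grid_cards : #|vert grid| = (2 * (a.+1 * k) + a)%N /\ #|dart grid| = (2 * (a.+1 * k + a * k + a * k))%N.
Proof.
by split; rewrite /= ?card_sum ?card_prod ?card_sum ?card_prod ?card_bool ?card_ord ?mul2n ?addnn ?muln2.
Qed.

(** The invariant [grid_rho] exhibits this many faces, and Euler's inequality [disk_euler_le] allows
    no more. Equality then also yields Euler's formula. *)
Lemma grid_faces : (fcard (@ext_face_perm n grid) predT = a * k + 2)%N.
Proof.
have := disk_euler_le gwf n0; have := grid_faces_ge; have [-> ->] := grid_cards.
rewrite mulKn //; move: (fcard _ _) => F; rewrite (mulSn a k); move: (a * k)%N => m; lia.
Qed.

Lemma grid_wf : wf_diskgraph grid.
Proof.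
have [h1 h2] := grid_prewf; split=> //; split=> //.
rewrite grid_faces; have [-> ->] := grid_cards; rewrite mulKn // (mulSn a k); move: (a * k)%N => m; lia.
Qed.

Lemma grid_label_next (d : dart grid) : ~~ is_bnd (tail grid (alpha grid d)) ->
  clabel (gcode (strand_next d)) = clabel (gcode d).
Proof.
rewrite is_bnd_code negbK => h.
rewrite /strand_next bk_code; set e := alpha grid d.
have de : d = alpha grid e by rewrite /e (alphaK gwf).
rewrite de; case hb : (gcode e).1.2.
  have ce : e = sigma grid ((sigma grid)^-1%g e) by rewrite permKV.
  rewrite {2}ce al_code sg_code clabel_black ?gcode_valid //.
    by rewrite -ctail_color ?gcode_valid // -ctail_sigma ?gcode_valid // -sg_code -ce ctail_color ?gcode_valid.
  by rewrite -ctail_sigma ?gcode_valid // -sg_code -ce -tl_code.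
by rewrite sg_code al_code clabel_white // gcode_valid.
Qed.

(** [strand_next] is a permutation that sends the reverse of [bdart p] to [bdart p]. Going around
    this orbit from [bdart p] thus reaches a dart pointing to the boundary. *)
Lemma grid_strand_exists p : exists q, strand_end (bdart gwf p) q.
Proof.
have c : fconnect (@strand_next n grid) (bdart gwf p) (alpha grid (bdart gwf p)).
  rewrite (fconnect_sym (@strand_next_inj n grid gwf)).
  by apply: connect_trans (fconnect1 _ _) _; rewrite strand_next_bdart // connect0.
pose Q m := is_bnd (tail grid (alpha grid (iter m (@strand_next n grid) (bdart gwf p)))).
have exQ : exists m, Q m.
  by exists (findex (@strand_next n grid) (bdart gwf p) (alpha grid (bdart gwf p)));
    rewrite /Q iter_findex // (alphaK gwf) tail_bdart is_bnd_bnd.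
have [m hm mmin] := find_ex_minn exQ.
have [q hq] := is_bndP hm; exists q, m; split=> // m' hm'.
by apply/negP => /mmin; rewrite leqNgt hm'.
Qed.

Lemma grid_strand_label (d : dart grid) (q : 'I_n) : strand_end d q -> q = clabel (gcode d) :> nat.
Proof.
case=> m [hm hm'].
have E j : (j <= m)%N -> clabel (gcode (iter j (@strand_next n grid) d)) = clabel (gcode d).
  elim: j => [//|j IH hj]; rewrite iterS grid_label_next; first exact: IH (ltnW hj).
  exact: hm'.
rewrite -(E m) // -[in RHS](alphaK gwf (iter m _ d)) (bdart_eq gwf hm) al_code bdart_code.
by rewrite clabel_alpha_bdart.
Qed.

Lemma grid_reduced : reduced_for k (fkn k) grid.
Proof.
split; first exact: grid_wf.
split; last by rewrite /disk_faces grid_faces aff_length_fkn addn2 /= mulnC; lia.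
move=> p d hd; rewrite (bdart_eq gwf hd); split; first exact: grid_strand_exists.
move=> q hq; have -> : q = rot_ord k n0 p; last exact: fkn_mod_rot.
by apply: val_inj; rewrite [LHS](grid_strand_label hq) bdart_code clabel_bdart.
Qed.
End Grid.

Lemma crit_weight_exists (R : realType) n (n0 : (0 < n)%N) (G : diskgraph n) (theta : 'I_n -> R) :
  planar_prewf G -> exists wt, crit_weight G theta wt.
Proof.
move=> wf; pose lab := @strand_label n G (Ordinal n0).
exists (fun d => if is_bnd (tail G d) || is_bnd (tail G (alpha G d)) then 1 else
  let p := lab d in let q := lab (alpha G d) in
  if (p <= q)%N then sin (theta q - theta p) else sin (theta p - theta q)) => d.
split=> [-> //|h1 h2 p q hp hq]; rewrite (negbTE h1) (negbTE h2) /= /lab.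
by rewrite (strand_labelE wf _ hp) (strand_labelE wf _ hq).
Qed.

(** * Convexity of the log-sine energy of a triangle *)

Lemma is_derive_lnsin (R : realType) (a x t : R) : 0 < sin (a + t * x) ->
  is_derive t 1 (fun t => x * ln (sin (a + t * x))) (x ^+ 2 * (cos (a + t * x) / sin (a + t * x))).
Proof.
move=> h.
have e1 : is_derive t 1 (fun t => a + t * x) x.
  apply: is_derive_eq; rewrite /GRing.scale /=; ring.
have e2 : is_derive t 1 (fun t => sin (a + t * x)) (cos (a + t * x) * x).
  exact: (@is_derive1_comp R (@sin R) (fun t => a + t * x) t _ _ (is_derive_sin _) e1).
have e3 : is_derive t 1 (fun t => ln (sin (a + t * x))) ((sin (a + t * x))^-1 * (cos (a + t * x) * x)).
  exact: (@is_derive1_comp _ (@ln R) (fun t => sin (a + t * x)) _ _ _ (is_derive1_ln h) e2).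
apply: is_derive_eq.
rewrite /GRing.scale /=; ring.
Qed.

(** The numerator is the form of the law of cosines for sides [x * sb] and [y * sa] enclosing the
    angle sum, which shows positivity. *)
Lemma cot_form (R : fieldType) (sa ca sb cb x y : R) :
  sa ^+ 2 + ca ^+ 2 = 1 -> sb ^+ 2 + cb ^+ 2 = 1 ->
  let sC := sa * cb + ca * sb in let cC := ca * cb - sa * sb in
  sa != 0 -> sb != 0 -> sC != 0 ->
  x ^+ 2 * (ca / sa) + y ^+ 2 * (cb / sb) - (x + y) ^+ 2 * (cC / sC)
  = (x ^+ 2 * sb ^+ 2 + y ^+ 2 * sa ^+ 2 - 2 * x * y * sa * sb * cC) / (sa * sb * sC).
Proof.
move=> h1 h2 sC cC a0 b0 c0.
have e1 : ca * sC - cC * sa = sb by rewrite -[RHS]mulr1 -h1 /sC /cC; ring.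
have e2 : cb * sC - cC * sb = sa by rewrite -[RHS]mulr1 -h2 /sC /cC; ring.
have -> : x ^+ 2 * sb ^+ 2 + y ^+ 2 * sa ^+ 2 - 2 * x * y * sa * sb * cC =
   x ^+ 2 * sb * (ca * sC - cC * sa) + y ^+ 2 * sa * (cb * sC - cC * sb) - 2 * x * y * sa * sb * cC.
  by rewrite e1 e2; ring.
by field; rewrite a0 b0 c0.
Qed.

(** Completing the square in either variable leaves the other one with the factor
    [sin (A + B) ^+ 2]; one sine is then bounded by [1]. *)
Lemma cot_form_ge (R : realType) (A B x y : R) : 0 < A -> 0 < B -> A + B < pi ->
  let D := x ^+ 2 * (cos A / sin A) + y ^+ 2 * (cos B / sin B) - (x + y) ^+ 2 * (cos (A + B) / sin (A + B)) in
  x ^+ 2 * (sin B * sin (A + B)) <= D /\ y ^+ 2 * (sin A * sin (A + B)) <= D.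
Proof.
move=> A0 B0 ABp D.
have a0 : 0 < sin A by rewrite sin_gt0_pi // A0; lra.
have b0 : 0 < sin B by rewrite sin_gt0_pi // B0; lra.
have c0 : 0 < sin (A + B) by rewrite sin_gt0_pi // ABp andbT addr_gt0.
have s1 (u : R) : sin u ^+ 2 + cos u ^+ 2 = 1 by rewrite addrC cos2Dsin2.
have DE : D = (x ^+ 2 * sin B ^+ 2 + y ^+ 2 * sin A ^+ 2 - 2 * x * y * sin A * sin B * cos (A + B)) / (sin A * sin B * sin (A + B)).
  rewrite /D sinD cosD cot_form ?s1 ?gt_eqF // -sinD //.
have p0 : 0 < sin A * sin B * sin (A + B) by rewrite !mulr_gt0.
have a1 : sin A <= 1 by exact: sin_le1.
have b1 : sin B <= 1 by exact: sin_le1.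
have cE : cos (A + B) ^+ 2 = 1 - sin (A + B) ^+ 2 by rewrite -(s1 (A + B)); ring.
split; rewrite DE ler_pdivlMr //; move: a0 b0 c0 a1 b1 cE;
  move: (sin A) (sin B) (sin (A + B)) (cos (A + B)) => a b c e a0 b0 c0 a1 b1 cE.
- apply: (@le_trans _ _ (x ^+ 2 * b ^+ 2 * c ^+ 2)).
    rewrite -subr_ge0 (_ : _ - _ = x ^+ 2 * b ^+ 2 * c ^+ 2 * (1 - a)); last by ring.
    by rewrite -!exprMn mulr_ge0 ?sqr_ge0 ?subr_ge0.
  rewrite -subr_ge0 (_ : _ - _ = (y * a - x * b * e) ^+ 2 + x ^+ 2 * b ^+ 2 * (1 - e ^+ 2 - c ^+ 2)); last by ring.
  by rewrite cE (_ : 1 - (1 - c ^+ 2) - c ^+ 2 = 0) ?mulr0 ?addr0 ?sqr_ge0 //; ring.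
- apply: (@le_trans _ _ (y ^+ 2 * a ^+ 2 * c ^+ 2)).
    rewrite -subr_ge0 (_ : _ - _ = y ^+ 2 * a ^+ 2 * c ^+ 2 * (1 - b)); last by ring.
    by rewrite -!exprMn mulr_ge0 ?sqr_ge0 ?subr_ge0.
  rewrite -subr_ge0 (_ : _ - _ = (x * b - y * a * e) ^+ 2 + y ^+ 2 * a ^+ 2 * (1 - e ^+ 2 - c ^+ 2)); last by ring.
  by rewrite cE (_ : 1 - (1 - c ^+ 2) - c ^+ 2 = 0) ?mulr0 ?addr0 ?sqr_ge0 //; ring.
Qed.

Lemma sin_ge_margin (R : realType) (mu u : R) : 0 < mu -> mu <= u -> u <= pi - mu -> sin mu <= sin u.
Proof.
move=> m0 mu_u u_mu; rewrite -subr_ge0.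
have -> : sin u - sin mu = 2 * cos ((u + mu) / 2) * sin ((u - mu) / 2).
  have -> : sin u - sin mu = sin ((u + mu) / 2 + (u - mu) / 2) - sin ((u + mu) / 2 - (u - mu) / 2).
    by congr (sin _ - sin _); lra.
  by rewrite sinD sinB; ring.
rewrite !mulr_ge0 //; first by rewrite cos_ge0_pihalf //; lra.
by rewrite sin_ge0_pi //; lra.
Qed.

(* The left-hand side is the increment over [0, 1] of
   t |-> x ln sin (A + t x) + y ln sin (B + t y) - (x + y) ln sin (A + B + t (x + y)),
   whose derivative is nonnegative, and at least m^2 (x^2 + y^2) / 2 for t <= 1/2. *)
Lemma triangle_energy (R : realType) (A B : R) : 0 < A -> 0 < B -> A + B < pi ->
  exists2 kappa, 0 < kappa & forall x y, 0 < A + x -> 0 < B + y -> (A + x) + (B + y) < pi ->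
  kappa * (x ^+ 2 + y ^+ 2) <= x * (ln (sin (A + x)) - ln (sin A)) + y * (ln (sin (B + y)) - ln (sin B))
    - (x + y) * (ln (sin ((A + x) + (B + y))) - ln (sin (A + B))).
Proof.
move=> A0 B0 ABp.
(* At time [t] each distance to a degenerate position is at least [1 - t] times its initial value.
   Up to [t = 1/2] all three angles therefore keep the margin [mu] from [0] and [pi]. *)
have [mu [mu0 [hA hB hC]]] : exists mu, 0 < mu /\ [/\ mu <= A / 2, mu <= B / 2 & mu <= (pi - A - B) / 2].
  exists (Num.min (A / 2) (Num.min (B / 2) ((pi - A - B) / 2))); rewrite !lt_min !ge_min !lexx ?orbT; split=> //.
  by rewrite !divr_gt0 //=; lra.
have m0 : 0 < sin mu by rewrite sin_gt0_pi // mu0; lra.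
exists (sin mu ^+ 2 / 4); first by rewrite divr_gt0 ?exprn_gt0.
move=> x y A'0 B'0 ABp'.
pose F t := x * ln (sin (A + t * x)) + y * ln (sin (B + t * y)) - (x + y) * ln (sin (A + B + t * (x + y))).
pose D t := x ^+ 2 * (cos (A + t * x) / sin (A + t * x)) + y ^+ 2 * (cos (B + t * y) / sin (B + t * y))
  - (x + y) ^+ 2 * (cos (A + B + t * (x + y)) / sin (A + B + t * (x + y))).
have ang (t : R) : 0 <= t <= 1 -> [/\ (1 - t) * A <= A + t * x, (1 - t) * B <= B + t * y,
    (1 - t) * (pi - A - B) <= pi - (A + B + t * (x + y)), 0 < A + t * x & 0 < B + t * y /\ A + B + t * (x + y) < pi].
  move=> /andP[t0 t1]; have h1 : 0 <= t * (A + x) by rewrite mulr_ge0 // ltW.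
  have h2 : 0 <= t * (B + y) by rewrite mulr_ge0 // ltW.
  have h3 : 0 <= t * (pi - (A + x + (B + y))) by rewrite mulr_ge0 // subr_ge0 ltW.
  have h4 : 0 <= (1 - t) * A by rewrite mulr_ge0 ?subr_ge0 // ltW.
  have h5 : 0 <= (1 - t) * B by rewrite mulr_ge0 ?subr_ge0 // ltW.
  have h6 : 0 <= (1 - t) * (pi - A - B) by rewrite mulr_ge0 ?subr_ge0 //; lra.
  have cmb u v : 0 < u -> 0 < v -> 0 < (1 - t) * u + t * v.
    move=> u0 v0; have [->|tn] := eqVneq t 0; first by rewrite subr0 mul1r mul0r addr0.
    by rewrite ltr_wpDl ?mulr_ge0 ?subr_ge0 ?(ltW u0) // mulr_gt0 // lt_neqAle eq_sym tn.
  have c1 := cmb _ _ A0 A'0; have c2 := cmb _ _ B0 B'0.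
  have c3 : 0 < (1 - t) * (pi - A - B) + t * (pi - (A + x + (B + y))) by apply: cmb; lra.
  by split; [lra|lra|lra|lra|split; lra].
have sC (t : R) : A + B + t * (x + y) = (A + t * x) + (B + t * y) by ring.
have dF (t : R) : 0 <= t <= 1 -> is_derive t 1 F (D t).
  move=> /ang[_ _ _ a0 [b0 c0]].
  have c0' := c0; rewrite sC in c0'.
  have d1 : is_derive t 1 _ _ := @is_derive_lnsin R A x t ltac:(rewrite sin_gt0_pi // a0 /=; lra).
  have d2 : is_derive t 1 _ _ := @is_derive_lnsin R B y t ltac:(rewrite sin_gt0_pi // b0 /=; lra).
  have d3 : is_derive t 1 _ _ := @is_derive_lnsin R (A + B) (x + y) t ltac:(rewrite sin_gt0_pi // c0 andbT sC; lra).
  exact: is_deriveB.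
have mvt (a b : R) : 0 <= a -> a <= b -> b <= 1 -> exists2 c, a <= c <= b & F b - F a = D c * (b - a).
  move=> a0 ab b1.
  have [||c hc e] := @MVT_segment R F D a b ab.
  - by move=> t; rewrite in_itv /= => /andP[h1 h2]; apply: dF; rewrite (le_trans a0 (ltW h1)) (le_trans (ltW h2) b1).
  - apply: derivable_within_continuous => t; rewrite in_itv /= => /andP[h1 h2].
    have h : 0 <= t <= 1 by rewrite (le_trans a0 h1) (le_trans h2 b1).
    by case: (dF t h).
  - by exists c => //; move: hc; rewrite in_itv.
have Dge (t : R) : 0 <= t <= 1 -> x ^+ 2 * (sin (B + t * y) * sin (A + B + t * (x + y))) <= D t /\
    y ^+ 2 * (sin (A + t * x) * sin (A + B + t * (x + y))) <= D t.
  by move=> /ang[_ _ _ a0 [b0 c0]]; rewrite /D sC [x + y]lock -lock; apply: cot_form_ge; rewrite -?sC.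
have D0 (t : R) : 0 <= t <= 1 -> 0 <= D t.
  move=> ht; have [h _] := Dge t ht; apply: le_trans h; have [_ _ _ a0 [b0 c0]] := ang t ht.
  rewrite mulr_ge0 ?sqr_ge0 // mulr_ge0 // sin_ge0_pi //; rewrite ?(ltW b0) ?(ltW c0) ?andbT /=; move: c0; rewrite sC; lra.
have [c /andP[c0 c1] e1] := mvt 0 (1 / 2) (lexx _) ltac:(lra) ltac:(lra).
have [d /andP[d0 d1] e2] := mvt (1 / 2) 1 ltac:(lra) ltac:(lra) (lexx _).
have Dd : 0 <= D d by apply: D0; rewrite d1 andbT; lra.
have hc : 0 <= c <= 1 by rewrite c0; lra.
have Dc : sin mu ^+ 2 * (x ^+ 2 + y ^+ 2) <= 2 * D c.
  have [g1 g2] := Dge c hc; have [k1 k2 k3 k4 [k5 k6]] := ang c hc.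
  have q1 : A / 2 <= (1 - c) * A by rewrite mulrC ler_pM2r //; lra.
  have q2 : B / 2 <= (1 - c) * B by rewrite mulrC ler_pM2r //; lra.
  have q3 : (pi - A - B) / 2 <= (1 - c) * (pi - A - B) by rewrite mulrC ler_pM2r //; lra.
  have sAge : sin mu <= sin (A + c * x) by apply: sin_ge_margin => //; move: k3; rewrite sC; lra.
  have sBge : sin mu <= sin (B + c * y) by apply: sin_ge_margin => //; move: k3; rewrite sC; lra.
  have sCge : sin mu <= sin (A + B + c * (x + y)) by apply: sin_ge_margin => //; move: k3; rewrite sC; lra.
  have j1 : x ^+ 2 * sin mu ^+ 2 <= D c.
    by apply: le_trans g1; rewrite ler_wpM2l ?sqr_ge0 // expr2 ler_pM // ltW.
  have j2 : y ^+ 2 * sin mu ^+ 2 <= D c.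
    by apply: le_trans g2; rewrite ler_wpM2l ?sqr_ge0 // expr2 ler_pM // ltW.
  by rewrite mulrDr [_ * x ^+ 2]mulrC [_ * y ^+ 2]mulrC mulr2n mulrDl mul1r lerD.
have -> : x * (ln (sin (A + x)) - ln (sin A)) + y * (ln (sin (B + y)) - ln (sin B))
    - (x + y) * (ln (sin ((A + x) + (B + y))) - ln (sin (A + B))) = F 1 - F 0.
  rewrite /F !mul1r !mul0r !addr0.
  have -> : A + B + (x + y) = A + x + (B + y) by ring.
  by ring.
have -> : F 1 - F 0 = D c * (1 / 2 - 0) + D d * (1 - 1 / 2) by rewrite -e1 -e2; ring.
move: Dc Dd; lra.
Qed.

(** * Energy of interval coordinates *)

Section EnergySeq.
Variables (R : realFieldType) (n : nat) (e : nat -> R).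
Hypothesis e_anti : forall l, (0 < l < n)%N -> e (n - l) = - e l.
Hypothesis e_tri : forall a b, (0 < a)%N -> (0 < b)%N -> (a + b < n)%N -> 0 <= e a + e b - e (a + b)%N.

Definition partial_energy a := \sum_(l < a) e l.+1.
Notation E := partial_energy.

Lemma partial_energyD a m : E (a + m) = E a + \sum_(b < m) e (a + b.+1)%N.
Proof.
by rewrite /E big_split_ord; congr (_ + _); apply: eq_bigr => b _; rewrite addnS.
Qed.

Lemma partial_energy_refl a : (a < n)%N -> E (n.-1 - a) = E a.
Proof.
elim: a => [|a IH] an.
  rewrite subn0 /E big_ord0; suff h : E n.-1 = - E n.-1 by rewrite -/(E _); lra.
  rewrite {1}/E (reindex_inj rev_ord_inj) -sumrN; apply: eq_bigr => l _ /=.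
  have ln := ltn_ord l; have -> : (n.-1 - l.+1).+1 = (n - l.+1)%N by lia.
  by rewrite e_anti //; lia.
have := IH (ltnW an).
have {1}-> : (n.-1 - a = (n.-1 - a.+1).+1)%N by lia.
rewrite /E !big_ord_recr /= -/(E _) -/(E _) => h.
apply: (addIr (e (n.-1 - a.+1).+1)); rewrite h.
have -> : (n.-1 - a.+1).+1 = (n - a.+1)%N by lia.
by rewrite e_anti ?addrK //; lia.
Qed.

(** The triangle excesses are summed over [b]. By reflection the whole sum [E n.-1] vanishes and
    [E (n.-1 - a)] equals [E a]; the rest is [e a = E a - E a.-1]. *)
Lemma partial_energy_rec a : (0 < a)%N -> (a < n)%N ->
  (n.+1 - a)%:R * E a = (n.-1 - a)%:R * E a.-1 + \sum_(b < n.-1 - a) (e a + e b.+1 - e (a + b.+1)%N).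
Proof.
move=> a0 an; rewrite sumrB big_split /= sumr_const card_ord -/(E _) partial_energy_refl //.
have En : E n.-1 = 0 by rewrite -(subn0 n.-1) partial_energy_refl ?(leq_ltn_trans _ an) // /E big_ord0.
have := partial_energyD a (n.-1 - a); rewrite subnKC ?En; last by lia.
move=> /esym/eqP; rewrite addr_eq0 => /eqP eS.
have -> : E a = E a.-1 + e a by rewrite -{1}(prednK a0) /E big_ord_recr /= prednK.
have -> : \sum_(b < n.-1 - a) e (a + b.+1)%N = - (E a.-1 + e a).
  by rewrite -[in RHS](prednK a0) /E; move: eS; rewrite -{1}(prednK a0) /E big_ord_recr /= prednK // => ->; rewrite opprK.
have -> : (n.+1 - a = (n.-1 - a).+2)%N by lia.
rewrite -[(n.-1 - a).+2]addn2 natrD mulrDl -mulr_natl; ring.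
Qed.

(** The recursion shows by induction that all partial energies are nonnegative, and each single
    excess is one of its summands. *)
Lemma partial_energy_ge a b : (0 < a)%N -> (0 < b)%N -> (a + b < n)%N ->
  e a + e b - e (a + b)%N <= n.+1%:R * E a.
Proof.
have E0 c : (c < n)%N -> 0 <= E c.
  elim: c => [|c IH] cn; first by rewrite /E big_ord0.
  have h : 0 < (n.+1 - c.+1)%:R :> R by rewrite ltr0n; lia.
  rewrite -(pmulr_rge0 _ h) partial_energy_rec // addr_ge0 ?mulr_ge0 ?ler0n ?IH ?(ltnW cn) //.
  by apply: sumr_ge0 => d _; apply: e_tri => //; have := ltn_ord d; lia.
move=> a0 b0 abn; have an : (a < n)%N by lia.
apply: (@le_trans _ _ ((n.+1 - a)%:R * E a)); last first.
  by rewrite ler_wpM2r ?E0 // ler_nat leq_subr.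
rewrite partial_energy_rec //.
have hb : (b.-1 < n.-1 - a)%N by lia.
rewrite (bigD1 (Ordinal hb)) //= prednK // addrCA lerDl addr_ge0 //.
  by rewrite mulr_ge0 ?ler0n ?E0 //; lia.
by apply: sumr_ge0 => d _; apply: e_tri => //; have := ltn_ord d; lia.
Qed.
End EnergySeq.

Section CyclicSums.
Variables (R : realFieldType) (n : nat).
Hypothesis n0 : (0 < n)%N.
Notation sh := (fun l => rot_ord l n0).

Lemma shD a b i : sh a (sh b i) = sh (b + a)%N i.
Proof. by apply: val_inj; rewrite /= modnDml addnA. Qed.
Lemma sh_full i : sh n i = i.
Proof. by apply: val_inj; rewrite /= modnDr modn_small. Qed.
Lemma sh_inj l : injective (sh l).
Proof. exact: rot_ord_inj. Qed.

Variables (D : 'I_n -> 'I_n -> R).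
Hypothesis D_anti : forall i j, D j i = - D i j.
Definition cyc_energy l := \sum_i D i (sh l i).

Lemma cyc_energy_anti l : (0 < l < n)%N -> cyc_energy (n - l) = - cyc_energy l.
Proof.
move=> /andP[l0 ln]; rewrite /cyc_energy (reindex_inj (@sh_inj l)) -sumrN; apply: eq_bigr => i _.
by rewrite shD subnKC ?(ltnW ln) // sh_full D_anti.
Qed.

Lemma cyc_energy_tri a b : cyc_energy a + cyc_energy b - cyc_energy (a + b) =
  \sum_i (D i (sh a i) + D (sh a i) (sh (a + b)%N i) + D (sh (a + b)%N i) i).
Proof.
rewrite /cyc_energy [X in _ + X - _](reindex_inj (@sh_inj a)) -big_split -sumrB.
by apply: eq_bigr => i _; rewrite shD [D (sh _ i) i]D_anti.
Qed.
End CyclicSums.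

(** The inverse of one plus the sum of inverses also serves an empty index type, which has no
    minimum. *)
Lemma min_positive (R : realFieldType) (T : finType) (f : T -> R) : (forall i, 0 < f i) ->
  exists2 m, 0 < m & forall i, m <= f i.
Proof.
move=> f0; have S0 : 0 < 1 + \sum_i (f i)^-1.
  by rewrite ltr_wpDr // sumr_ge0 // => i _; rewrite invr_ge0 ltW.
exists (1 + \sum_i (f i)^-1)^-1; first by rewrite invr_gt0.
move=> i; rewrite -[leRHS]invrK lef_pV2 ?posrE ?invr_gt0 //.
rewrite (bigD1 i) //= addrCA lerDl addr_ge0 // sumr_ge0 // => j _.
by rewrite invr_ge0 ltW.
Qed.

Lemma ln_prod_gt0 (R : realType) (I : Type) (r : seq I) (P : pred I) (f : I -> R) :
  (forall i, P i -> 0 < f i) -> 0 < \prod_(i <- r | P i) f i /\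
  ln (\prod_(i <- r | P i) f i) = \sum_(i <- r | P i) ln (f i).
Proof.
move=> f0; apply: (big_rec2 (fun x y => 0 < x /\ ln x = y)); first by rewrite ltr01 ln1.
by move=> i x y Pi [x0 xy]; rewrite mulr_gt0 ?f0 // lnM ?posrE ?f0 // xy.
Qed.

Section ArcEnergy.
Variables (R : realType) (n k : nat).
Hypothesis n0 : (0 < n)%N.
Hypothesis k2 : (2 <= k)%N.
Hypothesis kn : (k < n)%N.
Notation sh := (fun l => rot_ord l n0).
Implicit Types theta : 'I_n -> R.

Definition dchord theta theta' (i j : 'I_n) : R := ln (chord theta' i j) - ln (chord theta i j).
Definition darc theta theta' (p : 'I_n) : R := theta' p - theta p.
Definition pair_energy theta theta' (i j : 'I_n) : R :=
  dchord theta theta' i j * (darc theta theta' j - darc theta theta' i).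

Lemma chordC theta i j : chord theta j i = chord theta i j.
Proof. by rewrite /chord -normrN -sinN opprB. Qed.
Lemma chordE theta (i j : 'I_n) : increasing_arc theta -> (i < j)%N -> chord theta i j = sin (theta j - theta i).
Proof.
move=> inc ij; rewrite chordC /chord ger0_norm // sin_ge0_pi //.
by have /andP[h1 h2] := inc _ _ ij; rewrite subr_ge0 ltW //= lerBlDl ltW.
Qed.
Lemma chord_gt0 theta (i j : 'I_n) : increasing_arc theta -> i != j -> 0 < chord theta i j.
Proof.
move=> inc; wlog ij : i j / (i < j)%N.
  by move=> H ne; case: (ltngtP i j) => [/H -> //|h|/val_inj /eqP]; [rewrite chordC H // eq_sym|rewrite (negbTE ne)].
move=> _; rewrite chordE // sin_gt0_pi //.
by have /andP[h1 h2] := inc _ _ ij; rewrite subr_gt0 h1 ltrBlDl.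
Qed.

Lemma pair_energy_anti theta theta' i j : pair_energy theta theta' j i = - pair_energy theta theta' i j.
Proof. by rewrite /pair_energy /dchord (chordC theta' i j) (chordC theta i j); ring. Qed.

Lemma sorted_triangle theta (i j l : 'I_n) : increasing_arc theta -> (i < j)%N -> (j < l)%N ->
  exists2 kappa, 0 < kappa & forall theta', increasing_arc theta' ->
  kappa * ((darc theta theta' j - darc theta theta' i) ^+ 2 + (darc theta theta' l - darc theta theta' j) ^+ 2)
  <= pair_energy theta theta' i j + pair_energy theta theta' j l + pair_energy theta theta' l i.
Proof.
move=> inc ij jl; have il := ltn_trans ij jl.
have /andP[ij1 ij2] := inc _ _ ij; have /andP[jl1 jl2] := inc _ _ jl; have /andP[il1 il2] := inc _ _ il.
have [||| kappa k0 hk] := @triangle_energy R (theta j - theta i) (theta l - theta j).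
- by rewrite subr_gt0.
- by rewrite subr_gt0.
- lra.
exists kappa => // theta' inc'.
have /andP[ij1' ij2'] := inc' _ _ ij; have /andP[jl1' jl2'] := inc' _ _ jl; have /andP[il1' il2'] := inc' _ _ il.
have := hk (darc theta theta' j - darc theta theta' i) (darc theta theta' l - darc theta theta' j).
rewrite /darc.
have -> : theta j - theta i + (theta' j - theta j - (theta' i - theta i)) = theta' j - theta' i by ring.
have -> : theta l - theta j + (theta' l - theta l - (theta' j - theta j)) = theta' l - theta' j by ring.
have -> : theta' j - theta' i + (theta' l - theta' j) = theta' l - theta' i by ring.
have -> : theta j - theta i + (theta l - theta j) = theta l - theta i by ring.
move=> h; apply: le_trans (h _ _ _) _; rewrite ?subr_gt0 //; first lra.
rewrite /pair_energy /dchord (chordC _ i l) !(chordC _ i l) !chordE // /darc.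
by rewrite le_eqVlt; apply/orP; left; apply/eqP; ring.
Qed.

(** The energy is cyclically symmetric, so the three points may be sorted. In the order [l < i < j]
    the difference between [l] and [j] is split at [i], which costs a factor two. *)
Lemma cyclic_triangle theta (i j l : 'I_n) : increasing_arc theta ->
  [|| (i < j < l)%N, (j < l < i)%N | (l < i < j)%N] ->
  exists2 kappa, 0 < kappa & forall theta', increasing_arc theta' ->
  kappa * (darc theta theta' l - darc theta theta' j) ^+ 2
  <= pair_energy theta theta' i j + pair_energy theta theta' j l + pair_energy theta theta' l i.
Proof.
move=> inc /or3P[] /andP[h1 h2]; have [kappa k0 hk] := sorted_triangle inc h1 h2.
- exists kappa => // theta' inc'; apply: le_trans (hk _ inc').
  by rewrite ler_pM2l // lerDr sqr_ge0.
- exists kappa => // theta' inc'; have h := hk _ inc'.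
  apply: le_trans (_ : _ <= pair_energy theta theta' j l + pair_energy theta theta' l i + pair_energy theta theta' i j) _; last by lra.
  by apply: le_trans h; rewrite ler_pM2l // lerDl sqr_ge0.
- exists (kappa / 2); first by rewrite divr_gt0.
  move=> theta' inc'; have := hk _ inc'.
  set x := darc _ _ i; set y := darc _ _ j; set z := darc _ _ l => h.
  have h' : kappa / 2 * (z - y) ^+ 2 <= kappa * ((x - z) ^+ 2 + (y - x) ^+ 2).
    rewrite -mulrA ler_pM2l //.
    have := sqr_ge0 ((x - z) - (y - x)); rewrite !expr2; nra.
  apply: (le_trans h'); apply: (le_trans h); lra.
Qed.

Definition arc_energy theta theta' := partial_energy (cyc_energy n0 (pair_energy theta theta')) k.-1.

Lemma sh_cyclic (i : 'I_n) a b : (0 < a)%N -> (0 < b)%N -> (a + b < n)%N ->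
  [|| (i < sh a i < sh (a + b)%N i)%N, (sh a i < sh (a + b)%N i < i)%N | (sh (a + b)%N i < i < sh a i)%N].
Proof.
move=> a0 b0 abn; set j := sh a i; set l := sh (a + b)%N i.
have := ltn_ord i; have an : (a <= n)%N by lia.
have ej : j = (if (i + a < n) then i + a else i + a - n)%N :> nat by rewrite /j rot_ordE.
have el : l = (if (i + (a + b) < n) then i + (a + b) else i + (a + b) - n)%N :> nat by rewrite /l rot_ordE // ltnW.
rewrite ej el; move: a0 b0 abn; clear; do 2 case: ifP; lia.
Qed.

(** [partial_energy_ge] is applied to the steps [k - 1] and [1], legitimate since [2 <= k < n]; the
    triangle with vertices [j - (k - 1)], [j] and [j + 1] controls the increment at [j]. *)
Lemma arc_energy_ge theta : increasing_arc theta -> exists2 kappa, 0 < kappa &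
  forall theta', increasing_arc theta' -> forall j,
  kappa * (darc theta theta' (sh 1 j) - darc theta theta' j) ^+ 2 <= arc_energy theta theta'.
Proof.
move=> inc.
have k1 : (0 < k.-1)%N by lia.
have k1n : (k.-1 + 1 < n)%N by lia.
have H i : exists c, 0 < c /\ forall theta', increasing_arc theta' ->
    c * (darc theta theta' (sh (k.-1 + 1)%N i) - darc theta theta' (sh k.-1 i)) ^+ 2 <=
    pair_energy theta theta' i (sh k.-1 i) + pair_energy theta theta' (sh k.-1 i) (sh (k.-1 + 1)%N i)
      + pair_energy theta theta' (sh (k.-1 + 1)%N i) i.
  by have [c c0 hc] := cyclic_triangle inc (sh_cyclic i k1 (ltnSn 0) k1n); exists c.
have [c hc] := choice H.
have [m m0 hm] := min_positive (fun i => proj1 (hc i)).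
exists (m / n.+1%:R); first by rewrite divr_gt0 // ltr0n.
move=> theta' inc' j.
have tri_ge0 a b i : (0 < a)%N -> (0 < b)%N -> (a + b < n)%N ->
    0 <= pair_energy theta theta' i (sh a i) + pair_energy theta theta' (sh a i) (sh (a + b)%N i)
      + pair_energy theta theta' (sh (a + b)%N i) i.
  move=> a0 b0 abn; have [d d0 hd] := cyclic_triangle inc (sh_cyclic i a0 b0 abn).
  by apply: le_trans (hd _ inc'); rewrite mulr_ge0 ?sqr_ge0 // ltW.
have anti := pair_energy_anti theta theta'.
have := @partial_energy_ge R n (cyc_energy n0 (pair_energy theta theta')) (fun l => cyc_energy_anti n0 anti (l := l)) _ k.-1 1 k1 isT k1n.
rewrite -/(arc_energy _ _) cyc_energy_tri // => h.
rewrite mulrAC ler_pdivrMr ?ltr0n // [leRHS]mulrC; apply: le_trans (h _); last first.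
  by move=> a b a0 b0 abn; rewrite cyc_energy_tri // sumr_ge0 // => i _; exact: tri_ge0.
pose i := sh (n - k.-1)%N j.
have ej : sh k.-1 i = j by rewrite /i shD subnK ?sh_full //; lia.
have el : sh (k.-1 + 1)%N i = sh 1 j by rewrite -shD ej.
rewrite (bigD1 i) //= ej el.
apply: (@le_trans _ _ (pair_energy theta theta' i j + pair_energy theta theta' j (sh 1 j) + pair_energy theta theta' (sh 1 j) i)).
  have := (hc i).2 _ inc'; rewrite ej el; apply: le_trans.
  by rewrite ler_wpM2r ?sqr_ge0.
by rewrite lerDl sumr_ge0 // => i' _; exact: tri_ge0.
Qed.

(** Logarithm of the coordinate of the interval that starts at [q], up to a constant common to all
    [q] (see [IsMeas_arc]). *)
Definition ln_arc theta (q : 'I_n) : R :=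
  \sum_(c < k) \sum_(j < k.-1) ln (chord theta (sh c q) (sh (c + j.+1)%N q))
  - \sum_(i < k) \sum_(j < k | (i < j)%N) ln (chord theta (carc n0 q i) (carc n0 q j)).

Lemma sum_ltn_shift (K : zmodType) (i : nat) (F : nat -> K) : (i < k)%N ->
  \sum_(j < k | (i < j)%N) F j = \sum_(l < k.-1 | (i + l.+1 < k)%N) F (i + l.+1)%N.
Proof.
move=> ik.
rewrite -(big_mkord (fun j => i < j)%N F) -(big_mkord (fun l => i + l.+1 < k)%N (fun l => F (i + l.+1)%N)).
rewrite (big_cat_nat (n := i.+1)) //= big_nat_cond big1 ?add0r; last first.
  by move=> j /andP[/andP[_ h1] h2]; move: h1; rewrite ltnS leqNgt h2.
rewrite [RHS](big_cat_nat (n := (k - i.+1)%N)) //=; last by lia.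
rewrite [X in _ = _ + X]big_nat_cond [X in _ = _ + X]big1 ?addr0; last by move=> l /andP[/andP[h1 _] h2]; lia.
rewrite -{1}[i.+1]add0n big_addn.
rewrite big_nat_cond [RHS]big_nat_cond; apply: eq_big => l; first by lia.
by move=> _; congr F; lia.
Qed.

(** After division by the Vandermonde factor, the chords of step [l + 1] that remain in the interval
    at [q] start at [q + c] with [k <= c + l + 1]. Re-indexed by the start of the chord, the angle
    differences telescope over [c] to the difference between the two ends of the chord. *)
Lemma ln_arc_pairing theta theta' :
  \sum_q (ln_arc theta' q - ln_arc theta q) * (darc theta theta' (sh k.-1 q) - darc theta theta' (sh k q))
  = - arc_energy theta theta'.
Proof.
pose b l i := darc theta theta' (sh l i).
have E q : ln_arc theta' q - ln_arc theta q =
   \sum_(l < k.-1) \sum_(c < k | (k <= c + l.+1)%N) dchord theta theta' (sh c q) (sh l.+1 (sh c q)).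
  rewrite (exchange_big_dep xpredT) //= /ln_arc.
  have -> (A B C D : R) : A - B - (C - D) = (A - C) - (B - D) by ring.
  rewrite -!sumrB; apply: eq_bigr => c _.
  have -> : \sum_(j < k | (c < j)%N) ln (chord theta' (carc n0 q c) (carc n0 q j)) - \sum_(j < k | (c < j)%N) ln (chord theta (carc n0 q c) (carc n0 q j))
     = \sum_(j < k | (c < j)%N) dchord theta theta' (sh c q) (sh j q) by rewrite -sumrB.
  rewrite (sum_ltn_shift (fun j => dchord theta theta' (sh c q) (sh j q))) //.
  rewrite -sumrB.
  have -> : \sum_(j < k.-1) (ln (chord theta' (sh c q) (sh (c + j.+1)%N q)) - ln (chord theta (sh c q) (sh (c + j.+1)%N q)))
     = \sum_(j < k.-1) dchord theta theta' (sh c q) (sh (c + j.+1)%N q) by [].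
  rewrite (bigID (fun l : 'I_k.-1 => (c + l.+1 < k)%N)) /= addrAC subrr add0r.
  apply: eq_big => [l|l _]; first by rewrite -leqNgt.
  by congr dchord; apply: val_inj; rewrite /= modnDml addnA.
under eq_bigr => q _ do rewrite E mulr_suml.
rewrite exchange_big /= /arc_energy /partial_energy -sumrN; apply: eq_bigr => l _.
under eq_bigr => q _ do rewrite mulr_suml.
rewrite exchange_big /=.
transitivity (\sum_(c < k | (k <= c + l.+1)%N) \sum_i dchord theta theta' i (sh l.+1 i) * (b (k.-1 - c)%N i - b (k.-1 - c).+1 i)).
  apply: eq_bigr => c _; rewrite [RHS](reindex_inj (@sh_inj n n0 c)); apply: eq_bigr => q _.
  rewrite /b !shD; have := ltn_ord c => ck.
  have -> : (c + (k.-1 - c) = k.-1)%N by lia.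
  by have -> : (c + (k.-1 - c).+1 = k)%N by lia.
rewrite exchange_big /= /cyc_energy -sumrN; apply: eq_bigr => i _.
rewrite -mulr_sumr /pair_energy -mulrN opprB; congr (_ * _).
rewrite (reindex_inj rev_ord_inj) /=.
have lk := ltn_ord l.
transitivity (\sum_(c < k | (c < l.+1)%N) (b c i - b c.+1 i)).
  apply: eq_big => [c|c _]; have := ltn_ord c => ck; first by lia.
  by have -> : (k.-1 - (k - c.+1) = c)%N by lia.
have lk' : (l.+1 <= k)%N by lia.
have b0 : b 0%N i = darc theta theta' i.
  by rewrite /b; congr darc; apply: val_inj; rewrite /= addn0 modn_small.
rewrite -(big_ord_widen k (fun c => b c i - b c.+1 i) lk') -b0 -/(b l.+1 i).
elim: (l.+1) => [|m IH]; first by rewrite big_ord0 subrr.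
by rewrite big_ord_recr IH /= addrA subrK.
Qed.
End ArcEnergy.

Section MeasLayer.
Variables (R : realType) (n k : nat).
Hypothesis n0 : (0 < n)%N.
Hypothesis k0 : (0 < k)%N.
Hypothesis kn : (k < n)%N.
Implicit Types (theta : 'I_n -> R) (P : {set 'I_n} -> R).

Definition carc_set (q : 'I_n) : {set 'I_n} := carc n0 q @: [set: 'I_k].

Lemma card_carc_set q : #|carc_set q| = k.
Proof. by rewrite card_imset ?cardsT ?card_ord //; exact/carc_inj/ltnW. Qed.

Lemma IsMeas_arc theta P : increasing_arc theta -> IsMeas k (fkn k) theta P ->
  exists2 C, 0 < C & forall q, P (carc_set q) = C * expR (ln_arc k n0 theta q).
Proof.
move=> inc [_ [G [red [wt [crit ->]]]]].
have [C C0 hC] := crit_arc_formula n0 red k0 kn crit inc; exists C => // q.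
have cq (i j : nat) : (i < j)%N -> (j < i + n)%N -> 0 < chord theta (rot_ord i n0 q) (rot_ord j n0 q).
  by move=> ij ji; apply: chord_gt0 => //; apply: rot_ord_neq.
have [N0 lnN] : 0 < \prod_(c < k) \prod_(j < k.-1) chord theta (rot_ord c n0 q) (rot_ord (c + j.+1) n0 q) /\
   ln (\prod_(c < k) \prod_(j < k.-1) chord theta (rot_ord c n0 q) (rot_ord (c + j.+1) n0 q)) =
   \sum_(c < k) \sum_(j < k.-1) ln (chord theta (rot_ord c n0 q) (rot_ord (c + j.+1) n0 q)).
  have inner (c : 'I_k) : 0 < \prod_(j < k.-1) chord theta (rot_ord c n0 q) (rot_ord (c + j.+1) n0 q) /\
     ln (\prod_(j < k.-1) chord theta (rot_ord c n0 q) (rot_ord (c + j.+1) n0 q)) =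
     \sum_(j < k.-1) ln (chord theta (rot_ord c n0 q) (rot_ord (c + j.+1) n0 q)).
    by apply: ln_prod_gt0 => j _; apply: cq; have := ltn_ord j; have := ltn_ord c; lia.
  have [h1 h2] := @ln_prod_gt0 R _ (index_enum 'I_k) xpredT _ (fun c _ => proj1 (inner c)).
  by split=> //; rewrite h2; apply: eq_bigr => c _; case: (inner c).
have [V0 lnV] : 0 < \prod_(i < k) \prod_(j < k | (i < j)%N) chord theta (carc n0 q i) (carc n0 q j) /\
   ln (\prod_(i < k) \prod_(j < k | (i < j)%N) chord theta (carc n0 q i) (carc n0 q j)) =
   \sum_(i < k) \sum_(j < k | (i < j)%N) ln (chord theta (carc n0 q i) (carc n0 q j)).
  have inner (i : 'I_k) : 0 < \prod_(j < k | (i < j)%N) chord theta (carc n0 q i) (carc n0 q j) /\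
     ln (\prod_(j < k | (i < j)%N) chord theta (carc n0 q i) (carc n0 q j)) =
     \sum_(j < k | (i < j)%N) ln (chord theta (carc n0 q i) (carc n0 q j)).
    by apply: ln_prod_gt0 => j ij; apply: cq => //; have := ltn_ord j; lia.
  have [h1 h2] := @ln_prod_gt0 R _ (index_enum 'I_k) xpredT _ (fun c _ => proj1 (inner c)).
  by split=> //; rewrite h2; apply: eq_bigr => c _; case: (inner c).
rewrite /ln_arc expRB -lnN -lnV !lnK ?posrE //.
by rewrite mulrA -hC mulfK // gt_eqF.
Qed.

Lemma IsMeas_form theta P (s : R) : increasing_arc theta -> (forall p, s <= theta p < s + pi) ->
  IsMeas k (fkn k) theta P ->
  exists2 C, 0 < C & forall phi : 'I_k -> 'I_n, injective phi ->
    P (phi @: [set: 'I_k]) = C * `|\det (form_mx n0 theta s phi)|.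
Proof.
move=> inc sP [_ [G [red [wt [crit ->]]]]].
exact: (crit_form_formula n0 red k0 kn crit inc sP).
Qed.

Lemma IsMeas_card theta P (I : {set 'I_n}) : IsMeas k (fkn k) theta P -> #|I| != k -> P I = 0.
Proof. move=> [_ [G [red [wt [crit ->]]]]]; exact: Delta_card. Qed.

Lemma IsMeas_exists theta : increasing_arc theta -> exists P, IsMeas k (fkn k) theta P.
Proof.
move=> inc; have red := @grid_reduced n k k0 (ltnW kn).
have [wt crit] := crit_weight_exists n0 theta (reduced_prewf red).
exists (Delta (grid k0 (ltnW kn)) wt); split.
  have [I hI] := Delta_gt0 (proj1 red) (crit_gt0 n0 red k0 kn crit inc).
  by exists I; rewrite gt_eqF.
by exists (grid k0 (ltnW kn)); split=> //; exists wt.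
Qed.
End MeasLayer.

Section ArcInverse.
Variables (R : realType) (n k : nat).
Hypothesis n0 : (0 < n)%N.
Hypothesis k2 : (2 <= k)%N.
Hypothesis kn : (k < n)%N.
Implicit Types theta : 'I_n -> R.
Notation sh := (fun l => rot_ord l n0).

(** The two shifts of [darc] cancel over the cycle, so a constant [c] added to all logarithms drops
    out: the energy does not see the projective scale. *)
Lemma arc_energy_le theta theta' (c eta B : R) : 0 <= eta -> (forall j, `|darc theta theta' j| <= B) ->
  (forall q, `|ln_arc k n0 theta' q - ln_arc k n0 theta q - c| <= eta) ->
  arc_energy k n0 theta theta' <= n%:R * (eta * (B + B)).
Proof.
move=> eta0 hB hG.
have E : arc_energy k n0 theta theta' = - \sum_q (ln_arc k n0 theta' q - ln_arc k n0 theta q - c)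
    * (darc theta theta' (sh k.-1 q) - darc theta theta' (sh k q)).
  rewrite -[LHS]opprK -(ln_arc_pairing n0 k2 kn); congr (- _).
  rewrite [RHS](eq_bigr (fun q => (ln_arc k n0 theta' q - ln_arc k n0 theta q) *
       (darc theta theta' (sh k.-1 q) - darc theta theta' (sh k q)) -
       (c * darc theta theta' (sh k.-1 q) - c * darc theta theta' (sh k q)))); last by move=> q _; ring.
  have sS l : \sum_q c * darc theta theta' (sh l q) = \sum_q c * darc theta theta' q.
    by rewrite [RHS](reindex_inj (@sh_inj n n0 l)).
  by rewrite sumrB sumrB !sS subrr subr0.
rewrite E -sumrN.
have -> : n%:R * (eta * (B + B)) = \sum_(q < n) (eta * (B + B)) by rewrite sumr_const card_ord mulr_natl.
apply: ler_sum => q _; apply: le_trans (ler_norm _) _; rewrite normrN normrM ler_pM //.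
by apply: le_trans (ler_normB _ _) _; rewrite lerD.
Qed.

Lemma darc_bound theta theta' r : 0 <= r -> theta (Ordinal n0) = 0 -> theta' (Ordinal n0) = 0 ->
  (forall j, `|darc theta theta' (sh 1 j) - darc theta theta' j| <= r) ->
  forall j, `|darc theta theta' j| <= n%:R * r.
Proof.
move=> r0 h0 h0' h; suff H m (hm : (m < n)%N) : `|darc theta theta' (Ordinal hm)| <= m%:R * r.
  move=> [m hm]; apply: le_trans (H m hm) _; rewrite ler_wpM2r // ler_nat ltnW //.
elim: m hm => [|m IH] hm.
  have -> : Ordinal hm = Ordinal n0 by apply: val_inj.
  by rewrite /darc h0 h0' subrr normr0 mul0r.
have hm' := ltnW hm.
have e : Ordinal hm = sh 1 (Ordinal hm') by apply: val_inj; rewrite /= addn1 modn_small.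
rewrite e -[X in `|X|](subrK (darc theta theta' (Ordinal hm'))).
apply: le_trans (ler_normD _ _) _; rewrite -addn1 natrD mulrDl mul1r addrC lerD //.
Qed.

Lemma increasing_arc_bound theta : increasing_arc theta -> theta (Ordinal n0) = 0 -> forall p, 0 <= theta p < pi.
Proof.
move=> inc h0 p; have [h|h] := posnP p.
  have -> : p = Ordinal n0 by apply: val_inj.
  by rewrite h0 lexx pi_gt0.
by have := inc (Ordinal n0) p h; rewrite h0 add0r => /andP[/ltW -> ->].
Qed.

(** The energy is at most linear in [eta] and at least quadratic in the increments of the angle
    changes; fixing the first angle turns bounds on increments into bounds on angles. *)
Lemma arc_inverse_cont theta (e : R) : increasing_arc theta -> theta (Ordinal n0) = 0 -> 0 < e ->
  exists2 eta, 0 < eta & forall theta' c, increasing_arc theta' -> theta' (Ordinal n0) = 0 ->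
  (forall q, `|ln_arc k n0 theta' q - ln_arc k n0 theta q - c| <= eta) -> forall i, `|theta i - theta' i| < e.
Proof.
move=> inc h0 e0; have [kappa ka0 hk] := arc_energy_ge n0 k2 kn inc.
pose r := e / n.+1%:R; have r0 : 0 < r by rewrite divr_gt0 // ltr0n.
have p0 := pi_gt0 R; have nn : 0 < n%:R :> R by rewrite ltr0n.
(* Chosen so that the upper bound on the energy is [kappa * r ^+ 2]: each increment is then at most
   [r], and [n] of them stay below [e]. *)
pose eta := kappa * r ^+ 2 / (n%:R * (pi + pi)).
have eta0 : 0 < eta.
  apply: divr_gt0; first by apply: mulr_gt0 => //; exact: exprn_gt0.
  by apply: mulr_gt0 => //; exact: addr_gt0.
exists eta => // theta' c inc' h0' hG.
have bd := increasing_arc_bound inc h0; have bd' := increasing_arc_bound inc' h0'.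
have hB j : `|darc theta theta' j| <= pi.
  by have := bd j; have := bd' j; rewrite /darc ler_norml; lra.
have En := arc_energy_le (ltW eta0) hB hG.
have dr j : `|darc theta theta' (sh 1 j) - darc theta theta' j| <= r.
  rewrite -(ler_pXn2r (n := 2)) ?nnegrE ?(ltW r0) // real_normK ?num_real //.
  rewrite -(ler_pM2l ka0); apply: le_trans (hk _ inc' j) _; apply: le_trans En _.
  have np : n%:R * (pi + pi) != 0 :> R by rewrite mulf_neq0 // gt_eqF // addr_gt0.
  by rewrite mulrCA /eta mulfVK.
have := darc_bound (ltW r0) h0 h0' dr.
move=> hd i; rewrite distrC; apply: le_lt_trans (hd i) _.
by rewrite /r mulrCA gtr_pMr // ltr_pdivrMr ?ltr0n // mul1r ltr_nat.
Qed.

Lemma arc_inverse_inj theta theta' c : increasing_arc theta -> increasing_arc theta' ->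
  theta (Ordinal n0) = 0 -> theta' (Ordinal n0) = 0 ->
  (forall q, ln_arc k n0 theta' q - ln_arc k n0 theta q = c) -> theta = theta'.
Proof.
move=> inc inc' h0 h0' hG; apply: funext => i; apply/eqP; rewrite -subr_eq0 -normr_le0.
apply/ler_addgt0Pl => e e0; rewrite addr0; have [eta eta0 he] := arc_inverse_cont inc h0 e0.
by apply: ltW; apply: (he _ c) => // q; rewrite hG subrr normr0 ltW.
Qed.
End ArcInverse.

(** * The homeomorphism *)

Section RealPdist.
Variables (R : realType) (n : nat).
Implicit Types P Q : {set 'I_n} -> R.

Lemma cabs2_real (x : R) : cabs2 (x%:C)%C = x ^+ 2.
Proof. by rewrite /cabs2 /= expr0n addr0. Qed.

Lemma pdist_real P Q : pdist (toC P) (toC Q) =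
  Num.sqrt (1 - (\sum_I P I * Q I) ^+ 2 / ((\sum_I P I ^+ 2) * (\sum_I Q I ^+ 2))).
Proof.
rewrite /pdist /toC.
have -> : \sum_I (P I)%:C%C * conjc (Q I)%:C%C = ((\sum_I P I * Q I)%:C)%C.
  rewrite rmorph_sum; apply: eq_bigr => I _; rewrite rmorphM; congr (_ * _).
  by apply/eqP; rewrite eq_complex /= oppr0 !eqxx.
rewrite cabs2_real.
by congr (Num.sqrt (1 - _ / (_ * _))); apply: eq_bigr => I _; rewrite cabs2_real.
Qed.

Lemma pdist_scale P P' Q Q' (c d : R) : 0 < c -> 0 < d -> (forall I, P' I = c * P I) -> (forall I, Q' I = d * Q I) ->
  pdist (toC P') (toC Q') = pdist (toC P) (toC Q).
Proof.
move=> c0 d0 eP eQ; rewrite !pdist_real; congr (Num.sqrt (1 - _)).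
have -> : \sum_I P' I * Q' I = c * d * \sum_I P I * Q I.
  by rewrite mulr_sumr; apply: eq_bigr => I _; rewrite eP eQ; ring.
have -> : \sum_I P' I ^+ 2 = c ^+ 2 * \sum_I P I ^+ 2.
  by rewrite mulr_sumr; apply: eq_bigr => I _; rewrite eP exprMn.
have -> : \sum_I Q' I ^+ 2 = d ^+ 2 * \sum_I Q I ^+ 2.
  by rewrite mulr_sumr; apply: eq_bigr => I _; rewrite eQ exprMn.
rewrite exprMn exprMn; move: (\sum__ _) (\sum__ _) (\sum__ _) => x y z.
have -> : c ^+ 2 * y * (d ^+ 2 * x) = (c ^+ 2 * d ^+ 2) * (y * x) by ring.
rewrite invfM mulrACA mulfV ?mul1r // mulf_neq0 // expf_neq0 // gt_eqF //.
Qed.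

Lemma sum_sqr_gt0 P (I : {set 'I_n}) : 0 < P I -> 0 < \sum_I P I ^+ 2.
Proof.
move=> h; rewrite (bigD1 I) //= ltr_wpDr ?exprn_gt0 // sumr_ge0 // => J _; exact: sqr_ge0.
Qed.

(** For unit vectors with inner product [t] in [[0, 1]] the squared distance [2 - 2t] is at most
    [2 (1 - t^2)]. Nonnegative coordinates keep [t] from being negative. *)
Lemma pdist_normalized P Q : (forall I, 0 <= P I) -> (forall I, 0 <= Q I) ->
  0 < \sum_I P I ^+ 2 -> 0 < \sum_I Q I ^+ 2 ->
  forall I, (P I / Num.sqrt (\sum_I P I ^+ 2) - Q I / Num.sqrt (\sum_I Q I ^+ 2)) ^+ 2
     <= 2 * pdist (toC P) (toC Q) ^+ 2.
Proof.
move=> P0 Q0 NP NQ I.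
set p := Num.sqrt (\sum_I P I ^+ 2); set q := Num.sqrt (\sum_I Q I ^+ 2).
have p0 : 0 < p by rewrite sqrtr_gt0.
have q0 : 0 < q by rewrite sqrtr_gt0.
have pp : \sum_I P I ^+ 2 = p ^+ 2 by rewrite sqr_sqrtr // ltW.
have qq : \sum_I Q I ^+ 2 = q ^+ 2 by rewrite sqr_sqrtr // ltW.
pose t := \sum_I (P I / p) * (Q I / q).
have tE : (\sum_I P I * Q I) ^+ 2 / ((\sum_I P I ^+ 2) * (\sum_I Q I ^+ 2)) = t ^+ 2.
  have -> : t = (\sum_I P I * Q I) / (p * q).
    by rewrite /t mulr_suml; apply: eq_bigr => J _; rewrite mulrACA invfM.
  by rewrite pp qq expr_div_n exprMn.
have t0 : 0 <= t by apply: sumr_ge0 => J _; rewrite mulr_ge0 // divr_ge0 // ltW.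
have S : \sum_J (P J / p - Q J / q) ^+ 2 = 2 - 2 * t.
  have up : \sum_J (P J / p) ^+ 2 = 1.
    under eq_bigr do rewrite expr_div_n.
    by rewrite -mulr_suml pp mulfV // expf_neq0 // gt_eqF.
  have uq : \sum_J (Q J / q) ^+ 2 = 1.
    under eq_bigr do rewrite expr_div_n.
    by rewrite -mulr_suml qq mulfV // expf_neq0 // gt_eqF.
  have -> : 2 - 2 * t = \sum_J (P J / p) ^+ 2 + \sum_J (Q J / q) ^+ 2 - 2 * t by rewrite up uq.
  rewrite /t mulr_sumr -big_split -sumrB; apply: eq_bigr => J _ /=; ring.
have t1 : t <= 1.
  have : 0 <= 2 - 2 * t by rewrite -S sumr_ge0 // => J _; exact: sqr_ge0.
  by lra.
have -> : pdist (toC P) (toC Q) ^+ 2 = 1 - t ^+ 2.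
  by rewrite pdist_real tE sqr_sqrtr // subr_ge0 expr_le1.
apply: (@le_trans _ _ (2 - 2 * t)).
  by rewrite -S (bigD1 I) //= lerDl sumr_ge0 // => J _; exact: sqr_ge0.
rewrite -subr_ge0 (_ : _ - _ = 2 * (t * (1 - t))); last by ring.
by rewrite mulr_ge0 // mulr_ge0 // subr_ge0.
Qed.

Lemma ln_close (u eta : R) : 0 < u -> 0 < eta -> exists2 d, 0 < d &
  forall u', `|u - u'| <= d -> 0 < u' /\ `|ln u' - ln u| <= eta.
Proof.
move=> u0 e0; pose x := expR (- eta).
have x0 : 0 < x by exact: expR_gt0.
have x1 : x < 1 by rewrite /x -expR0 ltr_expR oppr_lt0.
exists (u * (1 - x)); first by rewrite mulr_gt0 // subr_gt0.
move=> u'; rewrite ler_norml => /andP[h1 h2].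
have lo : u * x <= u' by move: h2; lra.
have u'0 : 0 < u' by apply: lt_le_trans lo; rewrite mulr_gt0.
have hi : u' <= u * x^-1.
  have h : 2 - x <= x^-1.
    rewrite -(ler_pM2r x0) mulVf ?gt_eqF //; have := sqr_ge0 (1 - x); rewrite expr2; nra.
  by apply: (@le_trans _ _ (u * (2 - x))); [lra|rewrite ler_pM2l].
split=> //; rewrite ler_norml; apply/andP; split.
  rewrite lerBrDl -[- eta]expRK -/x -lnM ?posrE // ler_ln ?posrE // ?mulr_gt0 //.
rewrite lerBlDl -[eta]opprK -[- (- eta)]expRK expRN -/x -lnM ?posrE ?invr_gt0 // ler_ln ?posrE ?mulr_gt0 ?invr_gt0 //.
Qed.
End RealPdist.

Section ForwardContinuity.
Local Open Scope classical_set_scope.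
Variables (R : realType) (n : nat) (theta : 'I_n -> R).

(** The neighbourhoods that [gr_homeo] quantifies over, as a filter, so that the limit rules apply
    to functions of the angles. *)
Definition sup_nbhs : set_system ('I_n -> R) :=
  [set U | exists2 d, 0 < d & forall theta', (forall i, `|theta i - theta' i| < d) -> U theta'].

Global Instance sup_nbhs_filter : Filter sup_nbhs.
Proof.
split.
- by exists 1.
- move=> U V [d d0 hU] [e e0 hV]; exists (Num.min d e); first by rewrite lt_min d0.
  move=> t h; split; [apply: hU => i|apply: hV => i]; have := h i; rewrite lt_min => /andP[] //.
- by move=> U V UV [d d0 hU]; exists d => // t /hU /UV.
Qed.

Lemma cvg_coord i : (fun t : 'I_n -> R => t i) @ sup_nbhs --> theta i.
Proof. by apply/cvgrPdist_lt => e e0; exists e => // t; apply. Qed.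

Lemma cvg_bigsum (I : Type) (r : seq I) (P : pred I) (f : I -> ('I_n -> R) -> R) (a : I -> R) :
  (forall i, P i -> f i @ sup_nbhs --> a i) ->
  (fun t => \sum_(i <- r | P i) f i t) @ sup_nbhs --> \sum_(i <- r | P i) a i.
Proof.
move=> h; elim: r => [|i r IH].
  rewrite big_nil (_ : (fun _ => _) = (fun _ => 0)); first exact: cvg_cst.
  by apply: funext => t; rewrite big_nil.
rewrite big_cons; case Pi: (P i); last first.
  by rewrite (_ : (fun _ => _) = fun t => \sum_(i <- r | P i) f i t) //; apply: funext => t; rewrite big_cons Pi.
rewrite (_ : (fun _ => _) = (f i \+ (fun t => \sum_(i <- r | P i) f i t))).
  by apply: cvgD => //; apply: h.
by apply: funext => t; rewrite big_cons Pi.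
Qed.

Lemma cvg_bigprod (I : Type) (r : seq I) (P : pred I) (f : I -> ('I_n -> R) -> R) (a : I -> R) :
  (forall i, P i -> f i @ sup_nbhs --> a i) ->
  (fun t => \prod_(i <- r | P i) f i t) @ sup_nbhs --> \prod_(i <- r | P i) a i.
Proof.
move=> h; elim: r => [|i r IH].
  rewrite big_nil (_ : (fun _ => _) = (fun _ => 1)); first exact: cvg_cst.
  by apply: funext => t; rewrite big_nil.
rewrite big_cons; case Pi: (P i); last first.
  by rewrite (_ : (fun _ => _) = fun t => \prod_(i <- r | P i) f i t) //; apply: funext => t; rewrite big_cons Pi.
rewrite (_ : (fun _ => _) = (f i \* (fun t => \prod_(i <- r | P i) f i t))).
  by apply: cvgM => //; apply: h.
by apply: funext => t; rewrite big_cons Pi.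
Qed.

Lemma cvg_det k (M : ('I_n -> R) -> 'M[R]_k) (A : 'M[R]_k) :
  (forall i j, (fun t => M t i j) @ sup_nbhs --> A i j) -> (fun t => \det (M t)) @ sup_nbhs --> \det A.
Proof.
move=> h; rewrite /determinant; apply: cvg_bigsum => s _; apply: cvgM; first exact: cvg_cst.
by apply: cvg_bigprod.
Qed.

Lemma cvg_prod_lin_coef m (c s : nat -> ('I_n -> R) -> R) (c0 s0 : nat -> R) :
  (forall j, c j @ sup_nbhs --> c0 j) -> (forall j, s j @ sup_nbhs --> s0 j) ->
  forall a, (fun t => (\prod_(j < m) ((c j t)%:P - s j t *: 'X))`_a) @ sup_nbhs -->
    (\prod_(j < m) ((c0 j)%:P - s0 j *: 'X))`_a.
Proof.
move=> hc hs; elim: m => [|m IH] a.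
  rewrite big_ord0 (_ : (fun _ => _) = (fun _ => (1%:P : {poly R})`_a)); first exact: cvg_cst.
  by apply: funext => t; rewrite big_ord0.
have E (p : {poly R}) (u v : R) : (p * (u%:P - v *: 'X))`_a = p`_a * u - v * (if a == 0%N then 0 else p`_a.-1).
  by rewrite mulrBr coefB coefMC -scalerAr coefZ coefMX.
rewrite big_ord_recr /= E.
rewrite (_ : (fun _ => _) = fun t => (\prod_(j < m) ((c j t)%:P - s j t *: 'X))`_a * c m t
    - s m t * (if a == 0%N then 0 else (\prod_(j < m) ((c j t)%:P - s j t *: 'X))`_a.-1)); last first.
  by apply: funext => t; rewrite big_ord_recr /= E.
apply: cvgB; first by apply: cvgM.
apply: cvgM => //; case: (a == 0%N) => //; exact: cvg_cst.
Qed.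

Lemma cvg_form_mx k (n0 : (0 < n)%N) (phi : 'I_k -> 'I_n) :
  (fun t => \det (form_mx n0 t 0 phi)) @ sup_nbhs --> \det (form_mx n0 theta 0 phi).
Proof.
apply: cvg_det => i j; rewrite mxE /form_poly.
rewrite (_ : (fun _ => _) = fun t => (form_poly k n0 t 0 (phi j))`_i); last by apply: funext => t; rewrite mxE.
have cv p : (fun t : 'I_n -> R => t p - 0) @ sup_nbhs --> theta p - 0.
  by apply: cvgB; [exact: cvg_coord|exact: cvg_cst].
apply: (@cvg_prod_lin_coef _ (fun j' t => cos (t (rot_ord j'.+1 n0 (phi j)) - 0)) (fun j' t => sin (t (rot_ord j'.+1 n0 (phi j)) - 0))
  (fun j' => cos (theta (rot_ord j'.+1 n0 (phi j)) - 0)) (fun j' => sin (theta (rot_ord j'.+1 n0 (phi j)) - 0))) => j'.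
  by apply: (continuous_cvg _ (@continuous_cos R _)); exact: cv.
by apply: (continuous_cvg _ (@continuous_sin R _)); exact: cv.
Qed.

(** The representative of the measurement that depends on the angles alone, taken with base angle
    [0]. *)
Definition form_val k (n0 : (0 < n)%N) (t : 'I_n -> R) (I : {set 'I_n}) : R :=
  if pselect (#|I| = k) is left h then `|\det (form_mx n0 t 0 (fun i : 'I_k => enum_val (cast_ord (esym h) i)))| else 0.

Lemma cvg_form_val k (n0 : (0 < n)%N) (I : {set 'I_n}) :
  (fun t => form_val k n0 t I) @ sup_nbhs --> form_val k n0 theta I.
Proof.
rewrite /form_val; case: pselect => h; last exact: cvg_cst.
by apply: cvg_norm; exact: cvg_form_mx.
Qed.

Lemma cvg_pdist (v : ('I_n -> R) -> {set 'I_n} -> R) :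
  (forall I, (fun t => v t I) @ sup_nbhs --> v theta I) -> 0 < \sum_I v theta I ^+ 2 ->
  forall e, 0 < e -> exists2 d, 0 < d & forall t, (forall i, `|theta i - t i| < d) ->
    pdist (toC (v theta)) (toC (v t)) < e.
Proof.
move=> cv N0 e e0.
have csq : (fun t => \sum_I v t I ^+ 2) @ sup_nbhs --> \sum_I v theta I ^+ 2.
  by apply: cvg_bigsum => I _; apply: cvgM; exact: cv.
have cip : (fun t => \sum_I v theta I * v t I) @ sup_nbhs --> \sum_I v theta I * v theta I.
  by apply: cvg_bigsum => I _; apply: cvgM => //; exact: cvg_cst.
have c1 : (fun t => 1 - (\sum_I v theta I * v t I) ^+ 2 / ((\sum_I v theta I ^+ 2) * (\sum_I v t I ^+ 2))) @ sup_nbhs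
   --> 1 - (\sum_I v theta I * v theta I) ^+ 2 / ((\sum_I v theta I ^+ 2) * (\sum_I v theta I ^+ 2)).
  apply: cvgB; first exact: cvg_cst.
  apply: cvgM; first by apply: cvgM; exact: cip.
  by apply: cvgV; [rewrite mulf_neq0 // gt_eqF|apply: cvgM => //; exact: cvg_cst].
have z : 1 - (\sum_I v theta I * v theta I) ^+ 2 / ((\sum_I v theta I ^+ 2) * (\sum_I v theta I ^+ 2)) = 0.
  have -> : \sum_I v theta I * v theta I = \sum_I v theta I ^+ 2 by [].
  by rewrite expr2 mulfV ?subrr // mulf_neq0 // gt_eqF.
rewrite z in c1; move/cvgrPdist_lt: c1 => /(_ (e ^+ 2) (exprn_gt0 _ e0))[d d0 hd].
exists d => // t ht; rewrite pdist_real.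
have := hd t ht; rewrite /= sub0r normrN => h.
rewrite -(ger0_norm (ltW e0)) -sqrtr_sqr ltr_sqrt ?exprn_gt0 //.
by apply: le_lt_trans h; exact: ler_norm.
Qed.
End ForwardContinuity.

Section Homeo.
Variables (R : realType) (n k : nat).
Hypothesis n0 : (0 < n)%N.
Implicit Types (theta : 'I_n -> R) (P : {set 'I_n} -> R).

Lemma increasing_admissible f theta : increasing_arc theta -> admissible f theta.
Proof. by move=> inc p q /inc /andP[]. Qed.

Lemma enum_ordK (I : {set 'I_n}) (h : #|I| = k) :
  injective (fun i : 'I_k => enum_val (cast_ord (esym h) i)) /\
  (fun i : 'I_k => enum_val (cast_ord (esym h) i)) @: [set: 'I_k] = I.
Proof.
split=> [i j /enum_val_inj /cast_ord_inj //|].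
apply/setP => p; apply/imsetP/idP => [[i _ ->]|hp]; first exact: enum_valP.
by exists (cast_ord h (enum_rank_in hp p)); rewrite // cast_ordK enum_rankK_in.
Qed.

Section MiddleRank.
Hypothesis k2 : (2 <= k)%N.
Hypothesis kn : (k < n)%N.
Let k0 : (0 < k)%N := ltnW k2.

Lemma crossing_next (p q : 'I_n) : q = p.+1 :> nat -> f_crossing (fkn k) p q.
Proof.
move=> qp; split; first by rewrite -(inj_eq val_inj) /= qp ltn_eqF.
pose s := rot_ord (n - k) n0 p; pose t := rot_ord (n - k) n0 q; exists s, t.
have back r : rot_ord k n0 (rot_ord (n - k) n0 r) = r by rewrite shD subnK ?sh_full // ltnW.
split; first by have := fkn_mod_rot k n0 s; rewrite {2}/s back.
split; first by have := fkn_mod_rot k n0 t; rewrite {2}/t back.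
have es := rot_ordE n0 p (leq_subr k n); have et := rot_ordE n0 q (leq_subr k n).
rewrite /chords_cross /pos_plus /pos_minus /s /t es et qp.
have := ltn_ord q; rewrite qp; move: (p : nat) => m; move: k2 kn; clear.
by move=> k2 kn mn; do 2 case: ifP => ?; lia.
Qed.

Lemma crossing_ends (p q : 'I_n) : p = 0%N :> nat -> q = n.-1 :> nat -> f_crossing (fkn k) p q.
Proof.
move=> p0 qn; split; first by rewrite -(inj_eq val_inj) /= p0 qn; lia.
pose s := rot_ord (n - k) n0 p; pose t := rot_ord (n - k) n0 q; exists s, t.
have back r : rot_ord k n0 (rot_ord (n - k) n0 r) = r by rewrite shD subnK ?sh_full // ltnW.
split; first by have := fkn_mod_rot k n0 s; rewrite {2}/s back.
split; first by have := fkn_mod_rot k n0 t; rewrite {2}/t back.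
have es := rot_ordE n0 p (leq_subr k n); have et := rot_ordE n0 q (leq_subr k n).
rewrite /chords_cross /pos_plus /pos_minus /s /t es et qn p0.
move: k2 kn; clear.
by move=> k2 kn; do 2 case: ifP => ?; lia.
Qed.

(** Crossings of successive chords give monotonicity, and the crossing of the first with the last
    bounds the total spread by [pi]; this already controls all pairs. *)
Lemma admissible_increasing theta : admissible (fkn k) theta <-> increasing_arc theta.
Proof.
split; last exact: increasing_admissible.
move=> adm.
have step (p q : 'I_n) : q = p.+1 :> nat -> theta p < theta q.
  by move=> e; have [|] := adm p q _ (crossing_next e); rewrite ?e.
have lt (p q : 'I_n) : (p < q)%N -> theta p < theta q.
  case: q => q; elim: q => // q IH hq; rewrite ltnS leq_eqVlt => /orP[/eqP e|h].
    by apply: step; rewrite /= e.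
  by apply: lt_trans (IH (ltnW hq) h) _; apply: step.
have pn : (n.-1 < n)%N by rewrite prednK.
have [_ sp] : theta (Ordinal n0) < theta (Ordinal pn) /\ theta (Ordinal pn) < theta (Ordinal n0) + pi.
  by apply: (adm (Ordinal n0) (Ordinal pn)); [rewrite /=; lia|exact: crossing_ends].
have ge0 p : theta (Ordinal n0) <= theta p.
  have [h|h] := posnP p; last exact: ltW (lt (Ordinal n0) p h).
  by rewrite (_ : p = Ordinal n0) //; exact: val_inj.
have len p : theta p <= theta (Ordinal pn).
  have [h|h] := ltnP p n.-1; first exact: ltW (lt p (Ordinal pn) h).
  by rewrite (_ : p = Ordinal pn) //; apply: val_inj => /=; have := ltn_ord p; lia.
move=> p q pq; rewrite lt //=; have := ge0 p; have := len q; lra.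
Qed.

Lemma IsMeas_val theta P : increasing_arc theta -> theta (Ordinal n0) = 0 -> IsMeas k (fkn k) theta P ->
  exists2 C, 0 < C & forall I, P I = C * form_val k n0 theta I.
Proof.
move=> inc h0 hP; have bd := increasing_arc_bound inc h0.
have [|C C0 hC] := IsMeas_form n0 k0 kn (s := 0) inc _ hP; first by move=> p; rewrite add0r.
exists C => // I; rewrite /form_val; case: pselect => h; last first.
  by rewrite mulr0; apply: (IsMeas_card n0 k0 kn hP); apply/eqP.
have [pI pE] := enum_ordK h; by rewrite -hC // pE.
Qed.

Lemma IsMeas_scale theta P P' : increasing_arc theta -> theta (Ordinal n0) = 0 ->
  IsMeas k (fkn k) theta P -> IsMeas k (fkn k) theta P' -> exists2 c, 0 < c & forall I, P' I = c * P I.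
Proof.
move=> inc h0 /(IsMeas_val inc h0)[C C0 hC] /(IsMeas_val inc h0)[C' C0' hC'].
exists (C' / C); first by rewrite divr_gt0.
by move=> I; rewrite hC hC' mulrA mulfVK // gt_eqF.
Qed.

Lemma scale_projeq P P' (c : R) : c != 0 -> (forall I, P' I = c * P I) -> projeq (toC P) (toC P').
Proof.
move=> c0 h; exists (c%:C)%C; split=> [|I]; first by rewrite eq_complex /= eqxx andbT.
by rewrite /toC h rmorphM.
Qed.

(** The real part of the complex scalar serves as factor, and one coordinate that is positive in
    both vectors fixes its sign. *)
Lemma projeq_real P P' (I0 : {set 'I_n}) : 0 < P I0 -> 0 < P' I0 -> projeq (toC P) (toC P') ->
  exists2 c, 0 < c & forall I, P' I = c * P I.
Proof.
move=> p0 p0' [c [_ hc]].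
have hr I : P' I = complex.Re c * P I /\ complex.Im c * P I = 0.
  have := hc I; rewrite /toC; case: (c) => a b /=; rewrite /GRing.mul /= => -[e1 e2].
  by rewrite mulr0 subr0 in e1; rewrite mulr0 add0r in e2; split; [exact: e1|exact: esym e2].
exists (complex.Re c); last by move=> I; case: (hr I).
by rewrite -(pmulr_lgt0 _ p0); case: (hr I0) => <-.
Qed.

Definition Theta0 : ('I_n -> R) -> Prop := fun theta => increasing_arc theta /\ theta (Ordinal n0) = 0.

Lemma carc_gt0 theta P q : increasing_arc theta -> IsMeas k (fkn k) theta P -> 0 < P (carc_set k n0 q).
Proof. by move=> inc /(IsMeas_arc n0 k0 kn inc)[C C0 ->]; rewrite mulr_gt0 ?expR_gt0. Qed.

Lemma IsMeas_ge0 theta P I : increasing_arc theta -> theta (Ordinal n0) = 0 -> IsMeas k (fkn k) theta P -> 0 <= P I.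
Proof.
move=> inc h0 /(IsMeas_val inc h0)[C C0 ->]; rewrite mulr_ge0 ?(ltW C0) // /form_val.
by case: pselect.
Qed.

Lemma Meas_inj theta theta' P P' : Theta0 theta -> Theta0 theta' -> IsMeas k (fkn k) theta P ->
  IsMeas k (fkn k) theta' P' -> projeq (toC P) (toC P') -> theta = theta'.
Proof.
move=> [inc h0] [inc' h0'] hP hP' /(projeq_real (carc_gt0 (Ordinal n0) inc hP) (carc_gt0 (Ordinal n0) inc' hP'))[c c0 hc].
have [C C0 hC] := IsMeas_arc n0 k0 kn inc hP; have [C' C0' hC'] := IsMeas_arc n0 k0 kn inc' hP'.
have hG q : ln_arc k n0 theta' q - ln_arc k n0 theta q = ln (c * C / C'); last first.
  exact: (arc_inverse_inj k2 kn inc inc' h0 h0' hG).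
have e : C' * expR (ln_arc k n0 theta' q) = c * (C * expR (ln_arc k n0 theta q)) by rewrite -hC' hc hC.
have : expR (ln_arc k n0 theta' q) = (c * C / C') * expR (ln_arc k n0 theta q).
  by apply: (mulfI (lt0r_neq0 C0')); rewrite e; field; rewrite gt_eqF.
move/(congr1 (@ln R)); rewrite lnM ?posrE ?expR_gt0 ?divr_gt0 ?mulr_gt0 // !expRK => ->.
by rewrite addrK.
Qed.

Lemma Meas_cont theta (e : R) : Theta0 theta -> 0 < e -> exists2 d, 0 < d & forall theta' P P',
  Theta0 theta' -> IsMeas k (fkn k) theta P -> IsMeas k (fkn k) theta' P' ->
  (forall i, `|theta i - theta' i| < d) -> pdist (toC P) (toC P') < e.
Proof.
move=> [inc h0] e0; have [P0 hP0] := IsMeas_exists n0 k0 kn inc.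
have [C0 C00 hC0] := IsMeas_val inc h0 hP0.
have N0 : 0 < \sum_I form_val k n0 theta I ^+ 2.
  apply: (@sum_sqr_gt0 _ _ _ (carc_set k n0 (Ordinal n0))).
  by have := carc_gt0 (Ordinal n0) inc hP0; rewrite hC0 pmulr_rgt0.
have [d d0 hd] := @cvg_pdist R n theta (fun t I => form_val k n0 t I) (fun I => @cvg_form_val R n theta k n0 I) N0 e e0.
exists d => // theta' P P' [inc' h0'] hP hP' ht.
have [C C1 hC] := IsMeas_val inc h0 hP; have [C' C1' hC'] := IsMeas_val inc' h0' hP'.
by rewrite (pdist_scale C1 C1' hC hC'); apply: hd.
Qed.

Lemma Meas_inv_cont theta (e : R) : Theta0 theta -> 0 < e -> exists2 d, 0 < d & forall theta' P P',
  Theta0 theta' -> IsMeas k (fkn k) theta P -> IsMeas k (fkn k) theta' P' ->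
  pdist (toC P) (toC P') < d -> forall i, `|theta i - theta' i| < e.
Proof.
move=> [inc h0] e0; have [P0 hP0] := IsMeas_exists n0 k0 kn inc.
have [eta eta0 heta] := arc_inverse_cont k2 kn inc h0 e0.
have N0 := sum_sqr_gt0 (carc_gt0 (Ordinal n0) inc hP0).
pose N P : R := Num.sqrt (\sum_I P I ^+ 2).
have NP0 : 0 < N P0 by rewrite sqrtr_gt0.
have u0 q : 0 < P0 (carc_set k n0 q) / N P0 by rewrite divr_gt0 // (carc_gt0 q inc hP0).
have H q : exists d, 0 < d /\ forall u', `|P0 (carc_set k n0 q) / N P0 - u'| <= d -> 0 < u' /\ `|ln u' - ln (P0 (carc_set k n0 q) / N P0)| <= eta.
  by have [d d0 hd] := ln_close (u0 q) eta0; exists d.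
have [d hd] := choice H; have [m m0 hm] := min_positive (fun q => proj1 (hd q)).
exists (m / 2); first by rewrite divr_gt0.
move=> theta' P P' [inc' h0'] hP hP' hdist.
have [c c0 hc] := IsMeas_scale inc h0 hP0 hP.
have hdist0 : pdist (toC P0) (toC P') < m / 2.
  by rewrite -(pdist_scale (P' := P) (Q' := P') (c := c) (d := 1) c0 ltr01 hc) // => I; rewrite mul1r.
have N0' := sum_sqr_gt0 (carc_gt0 (Ordinal n0) inc' hP').
have NP0' : 0 < N P' by rewrite sqrtr_gt0.
have [C C0 hC] := IsMeas_arc n0 k0 kn inc hP0; have [C' C0' hC'] := IsMeas_arc n0 k0 kn inc' hP'.
apply: (heta theta' (ln (C / N P0) - ln (C' / N P')) inc' h0') => q.
have close : `|P0 (carc_set k n0 q) / N P0 - P' (carc_set k n0 q) / N P'| <= m.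
  have := pdist_normalized (fun I => IsMeas_ge0 I inc h0 hP0) (fun I => IsMeas_ge0 I inc' h0' hP') N0 N0' (carc_set k n0 q).
  rewrite -/(N P0) -/(N P') => h.
  rewrite -(ler_pXn2r (n := 2)) ?nnegrE ?(ltW m0) // real_normK ?num_real //.
  apply: le_trans h _; have p0 : 0 <= pdist (toC P0) (toC P') by rewrite sqrtr_ge0.
  have : pdist (toC P0) (toC P') ^+ 2 <= (m / 2) ^+ 2 by rewrite ler_pXn2r ?nnegrE // ltW // divr_gt0.
  by rewrite expr_div_n; have := exprn_gt0 2 m0; lra.
have [_ ] := (hd q).2 _ (le_trans close (hm q)).
have lnE (a b d' : R) : 0 < a -> 0 < b -> ln (a * expR d' / b) = ln (a / b) + d'.
  move=> a0 b0; have -> : a * expR d' / b = (a / b) * expR d' by rewrite mulrAC.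
  have ab0 : 0 < a / b by exact: divr_gt0.
  by rewrite [LHS](@lnM R (a / b) (expR d')) ?posrE ?expR_gt0 // expRK.
rewrite hC hC' !lnE //.
congr (_ <= _); congr (`|_|); ring.
Qed.
End MiddleRank.
End Homeo.

Section HomeoMain.
Variables (R : realType) (n k : nat).
Hypothesis n0 : (0 < n)%N.
Hypothesis k2 : (2 <= k)%N.
Hypothesis kn : (k < n)%N.
Let k0 : (0 < k)%N := ltnW k2.
Implicit Types (theta : 'I_n -> R) (P : {set 'I_n} -> R).

Lemma IsMeas_shift f theta P c : IsMeas k f theta P -> IsMeas k f (fun p => theta p - c) P.
Proof.
move=> [nz [G [red [wt [crit e]]]]]; split=> //; exists G; split=> //; exists wt; split=> // d.
split; first exact: (crit d).1.
have sub (p q : 'I_n) : theta q - c - (theta p - c) = theta q - theta p by ring.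
by move=> h1 h2 p q hp hq; rewrite ((crit d).2 h1 h2 p q hp hq) !sub.
Qed.

Lemma Theta0P theta : (admissible (fkn k) theta /\ (forall i : 'I_n, val i = 0%N -> theta i = 0)) <-> Theta0 n0 theta.
Proof.
split=> -[h1 h2]; split.
- exact/(admissible_increasing n0 k2 kn).
- exact: h2.
- exact/(admissible_increasing n0 k2 kn).
- by move=> i i0; rewrite (_ : i = Ordinal n0) //; apply: val_inj.
Qed.

Lemma Crit_rep P : Crit k (fkn k) P -> exists2 theta, Theta0 n0 theta & IsMeas k (fkn k) theta P.
Proof.
move=> [theta [/(admissible_increasing n0 k2 kn) inc hP]].
exists (fun p => theta p - theta (Ordinal n0)); last exact: IsMeas_shift.
by split=> [p q pq|]; [have := inc _ _ pq; rewrite addrAC !ltrD2r|rewrite subrr].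
Qed.

Lemma Crit_homeo : gr_homeo
  [set theta : 'I_n -> R | admissible (fkn k) theta /\ (forall i : 'I_n, val i = 0%N -> theta i = 0)]%classic
  (fun theta P => IsMeas k (fkn k) theta P) (@Crit R n k (fkn k)).
Proof.
split.
- by move=> x /Theta0P[inc _]; exact: IsMeas_exists.
- by move=> x P [adm _] hP; exists x.
- move=> P /Crit_rep[theta T0 hP]; exists theta, P; split=> //; first exact/Theta0P.
  by apply: (@scale_projeq _ _ _ _ 1); rewrite ?oner_eq0 // => I; rewrite mul1r.
- by move=> x x' P P' /Theta0P D /Theta0P D'; exact: (Meas_inj k2 kn D D').
- split=> x e /Theta0P D e0.
    have [d d0 hd] := Meas_cont k2 kn D e0; exists d => // x' P P' /Theta0P D'; exact: hd.
  have [d d0 hd] := Meas_inv_cont k2 kn D e0; exists d => // x' P P' /Theta0P D'; exact: hd.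
Qed.

Lemma cvg_unif (m : nat) (I : finType) (x : 'I_m -> R) (f : I -> ('I_m -> R) -> R) :
  (forall i, (f i t @[t --> sup_nbhs x] --> f i x)%classic) ->
  forall e, 0 < e -> exists2 d, 0 < d & forall t, (forall j, `|x j - t j| < d) -> forall i, `|f i x - f i t| < e.
Proof.
move=> h e e0.
have H i : exists d, 0 < d /\ forall t, (forall j, `|x j - t j| < d) -> `|f i x - f i t| < e.
  by have /cvgrPdist_lt/(_ e e0)[d d0 hd] := h i; exists d; split=> // t; apply: hd.
have [d hd] := choice H; have [m0 mp hm] := min_positive (fun i => proj1 (hd i)).
by exists m0 => // t ht i; apply: (hd i).2 => j; apply: lt_le_trans (ht j) (hm i).
Qed.

(** The half-turn is cut into gaps proportional to the [x q] and to [1], where [1] stands for the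
    last gap, from the largest angle to [pi]. Division by this last gap inverts the map. *)
Definition gap_angle (x : 'I_n.-1 -> R) (p : 'I_n) : R :=
  \sum_(q < n.-1 | (q < p)%N) (pi * x q / (1 + \sum_j x j)).
Definition last_ord : 'I_n := rot_ord n.-1 n0 (Ordinal n0).
Lemma last_ordE : last_ord = n.-1 :> nat.
Proof. by rewrite /= add0n modn_small // prednK. Qed.
Definition lo (q : 'I_n.-1) : 'I_n := widen_ord (leq_pred n) q.
Definition angle_gap (theta : 'I_n -> R) (q : 'I_n.-1) : R :=
  (theta (rot_ord 1 n0 (lo q)) - theta (lo q)) / (pi - theta last_ord).

Lemma rot1_lo (q : 'I_n.-1) : rot_ord 1 n0 (lo q) = q.+1 :> nat.
Proof. by rewrite /= addn1 modn_small //; have := ltn_ord q; lia. Qed.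

Lemma sum_gt0 (x : 'I_n.-1 -> R) : (forall i, 0 < x i) -> 0 < 1 + \sum_j x j.
Proof. by move=> h; rewrite ltr_wpDr // sumr_ge0 // => j _; apply: ltW. Qed.

Lemma gap_angle_step x (q : 'I_n.-1) : gap_angle x (rot_ord 1 n0 (lo q)) = gap_angle x (lo q) + pi * x q / (1 + \sum_j x j).
Proof.
rewrite /gap_angle (bigD1 q) ?rot1_lo ?ltnS //= addrC; congr (_ + _); apply: eq_bigl => j.
by rewrite ltnS [RHS]ltn_neqAle andbC -(inj_eq val_inj).
Qed.

Lemma gap_angle_last x : gap_angle x last_ord = pi * (\sum_j x j) / (1 + \sum_j x j).
Proof.
rewrite /gap_angle -mulr_suml -mulr_sumr; congr (_ * _ / _); apply: eq_bigl => q.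
by rewrite last_ordE ltn_ord.
Qed.

Lemma gap_angle_lt_pi x : (forall i, 0 < x i) -> gap_angle x last_ord < pi.
Proof.
move=> h; have S0 := sum_gt0 h; rewrite gap_angle_last ltr_pdivrMr // mulrDr mulr1 ltrDr pi_gt0 //.
Qed.

Lemma gap_angle_Theta0 x : (forall i, 0 < x i) -> Theta0 n0 (gap_angle x).
Proof.
move=> h; have S0 := sum_gt0 h.
have y0 q : 0 < pi * x q / (1 + \sum_j x j) by rewrite divr_gt0 // mulr_gt0 ?pi_gt0.
split; last by rewrite /gap_angle big_pred0.
move=> p q pq; apply/andP; split.
  rewrite /gap_angle [X in _ < X](bigID (fun j : 'I_n.-1 => (j < p)%N)) /=.
  have -> : \sum_(i < n.-1 | (i < q)%N && (i < p)%N) (pi * x i / (1 + \sum_j x j)) = \sum_(i < n.-1 | (i < p)%N) (pi * x i / (1 + \sum_j x j)).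
    by apply: eq_bigl => i; apply: andb_idl => h'; exact: ltn_trans pq.
  rewrite ltrDl.
  have pl : (p < n.-1)%N by have := ltn_ord q; lia.
  rewrite (bigD1 (Ordinal pl)) /=; last by rewrite pq ltnn.
  by rewrite ltr_wpDr // sumr_ge0 // => i _; apply: ltW.
apply: (@le_lt_trans _ _ (gap_angle x last_ord)); last first.
  by apply: lt_le_trans (gap_angle_lt_pi h) _; rewrite lerDr sumr_ge0 // => i _; apply: ltW.
rewrite /gap_angle [leLHS]big_mkcond [leRHS]big_mkcond ler_sum // => i _.
by rewrite last_ordE ltn_ord; case: ifP => // _; apply: ltW.
Qed.

Lemma gap_angleK x : (forall i, 0 < x i) -> angle_gap (gap_angle x) = x.
Proof.
move=> h; have S0 := sum_gt0 h; have p0 := pi_gt0 R.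
apply: funext => q; rewrite /angle_gap gap_angle_step addrAC subrr add0r gap_angle_last.
move: S0 p0; move: (\sum_j x j) (@pi R) => S c S0 c0; field.
by rewrite (_ : c * (1 + S) - c * S = c) ?gt_eqF //; ring.
Qed.

Lemma angle_gap_gt0 theta : Theta0 n0 theta -> forall q, 0 < angle_gap theta q.
Proof.
move=> [inc h0] q; rewrite divr_gt0 //.
  rewrite subr_gt0; have : (lo q < rot_ord 1 n0 (lo q))%N by rewrite rot1_lo.
  by move=> /inc /andP[].
by rewrite subr_gt0; have /andP[] := increasing_arc_bound inc h0 last_ord.
Qed.

Lemma angle_gapK theta : Theta0 n0 theta -> gap_angle (angle_gap theta) = theta.
Proof.
move=> T0; have x0 := angle_gap_gt0 T0; have S0 := sum_gt0 x0; case: T0 => inc h0.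
have L : 0 < pi - theta last_ord.
  by rewrite subr_gt0; have /andP[] := increasing_arc_bound inc h0 last_ord.
have tel m (hm : (m < n)%N) : \sum_(q < n.-1 | (q < m)%N) (theta (rot_ord 1 n0 (lo q)) - theta (lo q)) = theta (Ordinal hm).
  elim: m hm => [|m IH] hm.
    by rewrite big_pred0 // (_ : Ordinal hm = Ordinal n0) ?h0 //; apply: val_inj.
  have pm : (m < n.-1)%N by lia.
  rewrite (bigD1 (Ordinal pm)) ?ltnS //=.
  have -> : \sum_(q < n.-1 | (q < m.+1)%N && (q != Ordinal pm)) (theta (rot_ord 1 n0 (lo q)) - theta (lo q)) = theta (Ordinal (ltnW hm)).
    rewrite -(IH (ltnW hm)); apply: eq_bigl => q; by rewrite ltnS [RHS]ltn_neqAle andbC -(inj_eq val_inj).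
  have -> : lo (Ordinal pm) = Ordinal (ltnW hm) by apply: val_inj.
  by rewrite subrK; congr theta; apply: val_inj; rewrite /= addn1 modn_small.
have S : \sum_j angle_gap theta j = theta last_ord / (pi - theta last_ord).
  rewrite /angle_gap -mulr_suml; congr (_ / _).
  have hl : (n.-1 < n)%N by rewrite prednK.
  have -> : last_ord = Ordinal hl by apply: val_inj; exact: last_ordE.
  by rewrite -tel; apply: eq_bigl => q; rewrite ltn_ord.
apply: funext => -[p hp]; rewrite /gap_angle -mulr_suml -mulr_sumr S /angle_gap -mulr_suml tel.
have p0 := pi_gt0 R; have e : 1 + theta last_ord / (pi - theta last_ord) = pi / (pi - theta last_ord).
  by move: L; move: (@pi R) (theta last_ord) => c l L; field; rewrite gt_eqF.
rewrite e; move: L p0; move: (@pi R) (theta last_ord) (theta _) => c l u L c0; field; by rewrite !gt_eqF.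
Qed.

Lemma Crit_orthant : exists g : ('I_n.-1 -> R) -> ({set 'I_n} -> R),
  gr_homeo [set x : 'I_n.-1 -> R | forall i, 0 < x i]%classic (fun x P => P = g x) (@Crit R n k (fkn k)).
Proof.
have H x : exists P, (forall i, 0 < x i) -> IsMeas k (fkn k) (gap_angle x) P.
  have [h|h] := pselect (forall i, 0 < x i); last by exists (fun _ => 0) => /h.
  by have [P hP] := IsMeas_exists n0 k0 kn (proj1 (gap_angle_Theta0 h)); exists P.
have [g gP] := choice H; exists g; split.
- by move=> x _; exists (g x).
- move=> x P x0 ->; exists (gap_angle x); split; last exact: gP.
  by apply: increasing_admissible; case: (gap_angle_Theta0 x0).
- move=> P /Crit_rep[theta T0 hP]; have x0 := angle_gap_gt0 T0.
  exists (angle_gap theta), (g (angle_gap theta)); split=> //.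
  have := gP _ x0; rewrite angle_gapK // => hg; case: (T0) => inc h0.
  have [c c0 hc] := IsMeas_scale k2 kn inc h0 hP hg.
  by apply: (scale_projeq _ hc); rewrite gt_eqF.
- move=> x x' P P' x0 x0' -> -> /(Meas_inj k2 kn (gap_angle_Theta0 x0) (gap_angle_Theta0 x0') (gP _ x0) (gP _ x0')).
  by move/(congr1 angle_gap); rewrite !gap_angleK.
- split=> x e x0 e0; have T0 := gap_angle_Theta0 x0.
    have [d d0 hd] := Meas_cont k2 kn T0 e0.
    have [d' d'0 hd'] : exists2 d', 0 < d' & forall t, (forall j, `|x j - t j| < d') -> forall p, `|gap_angle x p - gap_angle t p| < d.
      apply: (@cvg_unif _ _ _ (fun p t => gap_angle t p)) => // p.
      apply: cvg_bigsum => q _; apply: cvgM; first by apply: cvgM; [exact: cvg_cst|exact: cvg_coord].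
      apply: cvgV; first by rewrite gt_eqF // sum_gt0.
      by apply: cvgD; [exact: cvg_cst|apply: cvg_bigsum => j _; exact: cvg_coord].
    exists d' => // x' P P' x0' -> -> hx; apply: (hd (gap_angle x')) => //; try exact: gP.
      exact: gap_angle_Theta0.
    exact: hd'.
  have [d d0 hd] : exists2 d, 0 < d & forall t, (forall j, `|gap_angle x j - t j| < d) -> forall q, `|angle_gap (gap_angle x) q - angle_gap t q| < e.
    apply: (@cvg_unif _ _ _ (fun q t => angle_gap t q)) => // q.
    apply: cvgM; first by apply: cvgB; exact: cvg_coord.
    apply: cvgV; first by rewrite subr_eq0 gt_eqF // gap_angle_lt_pi.
    by apply: cvgB; [exact: cvg_cst|exact: cvg_coord].
  have [d' d'0 hd'] := Meas_inv_cont k2 kn T0 d0.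
  exists d' => // x' P P' x0' -> -> hp i.
  rewrite -{1}(gap_angleK x0) -(gap_angleK x0'); apply: hd.
  by apply: (hd' _ _ _ (gap_angle_Theta0 x0') (gP _ x0) (gP _ x0')).
Qed.
End HomeoMain.

(** * Single points for [k = n] and [k = 1] *)

Section PointCases.
Variables (R : realType) (n : nat).
Hypothesis n0 : (0 < n)%N.

Lemma Crit_full_point : (exists P, @Crit R n n (fkn n) P) /\
  (forall P Q, @Crit R n n (fkn n) P -> @Crit R n n (fkn n) Q -> projeq (toC P) (toC Q)).
Proof.
split.
  have red := @grid_reduced n n n0 (leqnn n); pose theta := fun _ : 'I_n => 0 : R.
  have [wt crit] := crit_weight_exists n0 theta (reduced_prewf red).
  exists (Delta (grid n0 (leqnn n)) wt), theta; split.
    move=> p q pq [_ [s [t [hs [ht]]]]].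
    (* For [k = n] the chord of [p] joins the two sides of [b_p], so no chords cross and every
       [theta] is admissible. *)
    have full u v : (fkn n (u : 'I_n).+1%:Z = (v : 'I_n).+1%:Z %[mod n%:Z])%Z -> u = v.
      move/(fkn_mod n0) => ->; exact/esym/sh_full.
    rewrite (full _ _ hs) (full _ _ ht) /chords_cross /pos_plus /pos_minus.
    move: pq; clear; move: (p : nat) (q : nat) => a b ab; lia.
  split; last by exists (grid n0 (leqnn n)); split=> //; exists wt.
  pose G := grid n0 (leqnn n).
  (* Here [n - k = 0], so every edge of the grid meets the boundary and has weight [1]. *)
  have w1 d : 0 < wt d.
    rewrite (crit d).1 // is_bnd_code is_bnd_code !tl_code al_code.
    by case: (gcode d) (gcode_valid d) => [[[] []] [i [|j]]] /=; rewrite ?subnn //=; lia.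
  by have [I hI] := Delta_gt0 (proj1 red) w1; exists I; rewrite gt_eqF.
move=> P Q [t1 [_ [[I hI] [G [red [wt [_ eP]]]]]]] [t2 [_ [[J hJ] [G' [red' [wt' [_ eQ]]]]]]].
have z I' : I' != [set: 'I_n] -> P I' = 0 by move=> h; rewrite eP (Delta_full n0 red).
have z' I' : I' != [set: 'I_n] -> Q I' = 0 by move=> h; rewrite eQ (Delta_full n0 red').
have eI : I = [set: 'I_n] by apply/eqP; apply: contraNT hI => /z ->.
have eJ : J = [set: 'I_n] by apply/eqP; apply: contraNT hJ => /z' ->.
rewrite eI in hI; rewrite eJ in hJ.
apply: (@scale_projeq _ _ _ _ (Q [set: 'I_n] / P [set: 'I_n])); first by rewrite mulf_neq0 ?invr_eq0.
move=> K; have [->|hK] := eqVneq K [set: 'I_n]; first by rewrite mulfVK.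
by rewrite (z _ hK) (z' _ hK) mulr0.
Qed.

Lemma increasing_arc_exists : exists theta : 'I_n -> R, increasing_arc theta.
Proof.
exists (fun p : 'I_n => (p : nat)%:R / n%:R) => p q pq.
have n0' : 0 < n%:R :> R by rewrite ltr0n.
rewrite ltr_pM2r ?invr_gt0 // ltr_nat pq /=.
apply: (@lt_le_trans _ _ 1); first by rewrite ltr_pdivrMr // mul1r ltr_nat.
have : 2 <= pi :> R by exact: pi_ge2.
have : 0 <= (p : nat)%:R / n%:R :> R by rewrite divr_ge0 // ler0n.
by lra.
Qed.

Lemma Crit_one_point : (1 < n)%N -> (exists P, @Crit R n 1 (fkn 1) P) /\
  (forall P Q, @Crit R n 1 (fkn 1) P -> @Crit R n 1 (fkn 1) Q -> projeq (toC P) (toC Q)).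
Proof.
move=> n1; split.
  have [theta inc] := increasing_arc_exists.
  have [P hP] := IsMeas_exists n0 (isT : (0 < 1)%N) n1 inc; exists P, theta; split=> //.
  exact: increasing_admissible.
move=> P Q [t1 [_ [[I hI] [G [red [wt [cr eP]]]]]]] [t2 [_ [[J hJ] [G' [red' [wt' [cr' eQ]]]]]]].
have [c hc] := rank1_Delta n0 red n1 cr; have [c' hc'] := rank1_Delta n0 red' n1 cr'.
have c0 : c != 0 by apply: contraNneq hI => c0; rewrite eP hc c0 mul0r.
have c0' : c' != 0 by apply: contraNneq hJ => c0'; rewrite eQ hc' c0' mul0r.
apply: (@scale_projeq _ _ _ _ (c' / c)); first by rewrite mulf_neq0 ?invr_eq0.
by move=> K; rewrite eP eQ hc hc' mulrA mulfVK.
Qed.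
End PointCases.

(** * Zariski dimension *)

Section SmallOrder.
Variable R : realType.
Implicit Types f g : R -> R.

(** [f t] is [O(t^p)] as [t] tends to [0] from the right. *)
Definition small (p : nat) f := exists M t0 : R, [/\ 0 <= M, 0 < t0 & forall t, 0 <= t <= t0 -> `|f t| <= M * t ^+ p].

Lemma small_ext p f g t1 : 0 < t1 -> (forall t, 0 <= t <= t1 -> f t = g t) -> small p f -> small p g.
Proof.
move=> t1p e [M [t0 [M0 t0p h]]]; exists M, (Num.min t0 t1); split=> //; first by rewrite lt_min t0p.
by move=> t /andP[t_ge]; rewrite le_min => /andP[h1 h2]; rewrite -e ?t_ge // h // t_ge.
Qed.

Lemma small_add p f g : small p f -> small p g -> small p (fun t => f t + g t).
Proof.
move=> [M [t0 [M0 t0p h]]] [N [t1 [N0 t1p h']]]; exists (M + N), (Num.min t0 t1).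
split; [exact: addr_ge0|by rewrite lt_min t0p|].
move=> t /andP[t_ge]; rewrite le_min => /andP[h1 h2].
by apply: le_trans (ler_normD _ _) _; rewrite mulrDl lerD ?h ?h' ?t_ge.
Qed.

Lemma small_scale p f c : small p f -> small p (fun t => c * f t).
Proof.
move=> [M [t0 [M0 t0p h]]]; exists (`|c| * M), t0; split=> //; first by rewrite mulr_ge0.
by move=> t ht; rewrite normrM -mulrA ler_wpM2l ?h.
Qed.

Lemma small_sum p (I : Type) (r : seq I) (P : pred I) (f : I -> R -> R) :
  (forall i, P i -> small p (f i)) -> small p (fun t => \sum_(i <- r | P i) f i t).
Proof.
move=> h; elim: r => [|i r IH].
  by exists 0, 1; split=> // t _; rewrite big_nil normr0 mul0r.
case Pi: (P i); last by apply: (small_ext ltr01 _ IH) => t _; rewrite big_cons Pi.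
by apply: (small_ext ltr01 _ (small_add (h _ Pi) IH)) => t _; rewrite big_cons Pi.
Qed.

Lemma expR_taylor (x : R) : x <= 1 / 2 -> `|expR x - 1 - x| <= 2 * x ^+ 2.
Proof.
move=> hx; have h1 : 1 + x <= expR x by exact: expR_ge1Dx.
rewrite ger0_norm; last by rewrite -addrA -opprD subr_ge0.
have h2 : 1 - x <= (expR x)^-1 by rewrite -expRN; exact: (@expR_ge1Dx R (- x)).
have p0 : 0 < 1 - x by lra.
have h3 : expR x * (1 - x) <= 1.
  by rewrite -ler_pdivlMl ?expR_gt0 // mulr1.
rewrite -(ler_pM2r p0).
have : 0 <= x ^+ 2 * (1 - 2 * x) by rewrite mulr_ge0 ?sqr_ge0 //; lra.
rewrite !expr2; nra.
Qed.

Lemma small_expR f : small 1 f -> small 2 (fun t => expR (f t) - 1 - f t).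
Proof.
move=> [M [t0 [M0 t0p h]]].
have M1 : 0 < 2 * (M + 1) by rewrite mulr_gt0 // ltr_wpDl.
exists (2 * M ^+ 2), (Num.min t0 (2 * (M + 1))^-1); split; first by rewrite mulr_ge0 ?sqr_ge0.
  by rewrite lt_min t0p invr_gt0.
move=> t /andP[t_ge]; rewrite le_min => /andP[h1 h2].
have hf : `|f t| <= M * t by rewrite -[t in leRHS]expr1 h ?t_ge.
apply: le_trans (expR_taylor _) _.
  apply: le_trans (ler_norm _) (le_trans hf _).
  have h3 : t * (2 * (M + 1)) <= 1 by rewrite -ler_pdivlMr // div1r.
  by move: h3 t_ge; lra.
rewrite -mulrA ler_wpM2l // -exprMn -[f t ^+ 2]real_normK ?num_real //.
by rewrite ler_pXn2r ?nnegrE ?mulr_ge0.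
Qed.

Lemma sin_lip (a b : R) : `|sin a - sin b| <= `|a - b|.
Proof.
wlog ab : a b / b <= a.
  move=> H; case: (leP b a) => [/H //|/ltW h]; by rewrite distrC [leRHS]distrC H.
have [|c hc ->] := @MVT_segment R (@sin R) (@cos R) b a ab.
  by apply: continuous_subspaceT => x; exact: continuous_sin.
rewrite normrM ler_piMl // ler_norml cos_geN1 cos_le1 //.
Qed.

Lemma small_ln_sin (a x : R) : sin a != 0 -> small 1 (fun t => ln `|sin (a + t * x)| - ln `|sin a|).
Proof.
move=> sa; pose u := `|sin a|; have u0 : 0 < u by rewrite normr_gt0.
have x1 : 0 < 2 * (`|x| + 1) by rewrite mulr_gt0 // ltr_wpDl.
exists (2 * `|x| / u), (u / (2 * (`|x| + 1))); split.
- by rewrite divr_ge0 ?mulr_ge0 // ltW.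
- by rewrite divr_gt0.
move=> t /andP[t0 ht]; rewrite expr1 -/u.
set u' := `|sin (a + t * x)|.
have d : `|u' - u| <= t * `|x|.
  apply: le_trans (ler_dist_dist _ _) _; apply: le_trans (sin_lip _ _) _.
  by rewrite addrAC subrr add0r normrM ger0_norm.
have tx : t * `|x| <= u / 2.
  have : t * (2 * (`|x| + 1)) <= u by rewrite -ler_pdivlMr.
  by move: t0; lra.
have u'u : u / 2 <= u' by move: d; rewrite ler_norml => /andP[]; lra.
have u'0 : 0 < u' by apply: lt_le_trans u'u; rewrite divr_gt0.
have lnle (v w : R) : 0 < v -> 0 < w -> ln v - ln w <= (v - w) / w.
  move=> v0 w0; rewrite -ln_div ?posrE //.
  have -> : v / w = 1 + (v - w) / w by field; rewrite gt_eqF.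
  apply: le_ln1Dx; rewrite -subr_gt0 opprK (_ : _ + 1 = v / w) ?divr_gt0 //.
  by field; rewrite gt_eqF.
have e : 2 * `|x| / u * t = t * `|x| / (u / 2) by field; rewrite gt_eqF.
rewrite e ler_norml; apply/andP; split.
  rewrite lerNl opprB; apply: le_trans (lnle _ _ u0 u'0) _.
  apply: le_trans (_ : t * `|x| / u' <= _).
    by rewrite ler_pM2r ?invr_gt0 // (le_trans (ler_norm _)) // distrC.
  by rewrite ler_wpM2l ?mulr_ge0 // lef_pV2 ?posrE ?divr_gt0.
apply: le_trans (lnle _ _ u'0 u0) _.
apply: le_trans (_ : t * `|x| / u <= _).
  by rewrite ler_pM2r ?invr_gt0 // (le_trans (ler_norm _)).
rewrite ler_wpM2l ?mulr_ge0 // lef_pV2 ?posrE ?divr_gt0 //; lra.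
Qed.
End SmallOrder.

Section ArcIndependence.
Variables (R : realType) (n k : nat).
Hypothesis n0 : (0 < n)%N.
Hypothesis k2 : (2 <= k)%N.
Hypothesis kn : (k < n)%N.
Implicit Types theta beta : 'I_n -> R.
Notation sh := (fun l => rot_ord l n0).

Definition move_arc theta beta (t : R) : 'I_n -> R := fun p => theta p + t * beta p.

Lemma small_ln_arc theta beta q : increasing_arc theta ->
  small 1 (fun t => ln_arc k n0 (move_arc theta beta t) q - ln_arc k n0 theta q).
Proof.
move=> inc.
have sc i j : i != j -> small 1 (fun t => ln (chord (move_arc theta beta t) i j) - ln (chord theta i j)).
  move=> ij; have h : sin (theta i - theta j) != 0 by rewrite -normr_gt0; exact: chord_gt0.
  apply: (small_ext ltr01 _ (small_ln_sin (beta i - beta j) h)) => t _.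
  by rewrite /chord /move_arc; congr (ln `|sin _| - _); ring.
have ne (i j : nat) : (i < j)%N -> (j < i + n)%N -> rot_ord i n0 q != rot_ord j n0 q by exact: rot_ord_neq.
rewrite /ln_arc.
apply: (small_ext ltr01 (f := fun t => \sum_(c < k) \sum_(j < k.-1) (ln (chord (move_arc theta beta t) (sh c q) (sh (c + j.+1)%N q)) - ln (chord theta (sh c q) (sh (c + j.+1)%N q)))
   + -1 * \sum_(i < k) \sum_(j < k | (i < j)%N) (ln (chord (move_arc theta beta t) (carc n0 q i) (carc n0 q j)) - ln (chord theta (carc n0 q i) (carc n0 q j))))) => [t _|].
  have -> (A B C D : R) : A - B - (C - D) = (A - C) - (B - D) by ring.
  rewrite mulN1r; congr (_ - _).
    by rewrite -sumrB; apply: eq_bigr => c _; rewrite -sumrB.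
  by rewrite -sumrB; apply: eq_bigr => i _; rewrite -sumrB.
apply: small_add; first apply: small_sum => c _; last apply: small_scale; try apply: small_sum => i _.
- by apply: sc; apply: ne; have := ltn_ord c; have := ltn_ord i; lia.
- by apply: small_sum => j ij; apply: sc; apply: ne => //; have := ltn_ord j; lia.
Qed.

Lemma move_arc_inc theta beta : increasing_arc theta -> exists2 t0, 0 < t0 &
  forall t, 0 <= t <= t0 -> increasing_arc (move_arc theta beta t).
Proof.
move=> inc.
pose f (pq : 'I_n * 'I_n) := if (pq.1 < pq.2)%N then Num.min (theta pq.2 - theta pq.1) (theta pq.1 + pi - theta pq.2) else 1.
have f0 pq : 0 < f pq.
  rewrite /f; case: ifP => // /inc /andP[h1 h2]; by rewrite lt_min !subr_gt0 h1.
have [m m0 hm] := min_positive f0.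
pose B := \sum_p `|beta p|; have B0 : 0 <= B by apply: sumr_ge0.
have hB p : `|beta p| <= B by rewrite /B (bigD1 p) //= lerDl sumr_ge0.
have B1 : 0 < 2 * B + 1 by rewrite ltr_wpDl // mulr_ge0.
exists (m / 2 / (2 * B + 1)); first by rewrite !divr_gt0.
move=> t /andP[t0 ht] p q pq; have := hm (p, q); rewrite /f /= pq le_min => /andP[h1 h2].
have h3 : t * (2 * B + 1) <= m / 2 by rewrite -ler_pdivlMr.
have h4 : `|t * beta p| <= t * B by rewrite normrM ger0_norm // ler_wpM2l.
have h5 : `|t * beta q| <= t * B by rewrite normrM ger0_norm // ler_wpM2l.
move: h4 h5; rewrite !ler_norml /move_arc => /andP[a1 a2] /andP[b1 b2].
rewrite mulrDr mulr1 mulrCA in h3; move: t0 m0 h1 h2 h3 a1 a2 b1 b2.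
move: (t * beta p) (t * beta q) (t * B) (@pi R) => x y z c; lra.
Qed.

Definition arc_mon theta (m : {ffun 'I_n -> nat}) : R := expR (\sum_q (m q)%:R * ln_arc k n0 theta q).

Lemma potential (a : 'I_n -> R) : \sum_q a q = 0 -> exists beta : 'I_n -> R, forall p, beta p - beta (sh 1 p) = a p.
Proof.
move=> a0; exists (fun p => - \sum_(j < n | (j < p)%N) a j) => p.
have [h|h] := ltnP p.+1 n.
  have e : sh 1 p = p.+1 :> nat by rewrite /= addn1 modn_small.
  rewrite [X in _ - - X](bigD1 p) ?e ?ltnS //= opprK [RHS](_ : _ = - 0 + a p); last by rewrite oppr0 add0r.
  rewrite addrA addrAC; congr (_ + _).
  rewrite oppr0; apply/eqP; rewrite addrC subr_eq0; apply/eqP; apply: eq_bigl => j.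
  by rewrite ltnS [RHS]ltn_neqAle andbC -(inj_eq val_inj).
have pn : p = n.-1 :> nat by have := ltn_ord p; lia.
have e : sh 1 p = 0%N :> nat by rewrite /= addn1 pn prednK // modnn.
rewrite [X in _ - - X]big_pred0; last by move=> j; rewrite e.
rewrite oppr0 subr0 -[LHS]add0r -{1}a0 (bigD1 p) //= -addrA.
rewrite [X in _ + X](_ : _ = 0) ?addr0 //; apply/eqP; rewrite subr_eq0; apply/eqP.
apply: eq_bigl => j; rewrite -(inj_eq val_inj) /= pn; have := ltn_ord j; lia.
Qed.

(* Move [theta] in the direction [beta] whose increments are the values [a q] of
   the derivatives of the relation: to first order the relation changes by
   [\sum_q a q * G q], which the energy inequality bounds away from 0 by
   a multiple of [\sum_q a q ^+ 2]. *)
Lemma arc_relation_deriv d (s : seq {ffun 'I_n -> nat}) (c : {ffun 'I_n -> nat} -> R) :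
  (forall m, m \in s -> \sum_q m q = d)%N ->
  (forall theta, increasing_arc theta -> \sum_(m <- s) c m * arc_mon theta m = 0) ->
  forall q theta, increasing_arc theta -> \sum_(m <- s) c m * (m q)%:R * arc_mon theta m = 0.
Proof.
move=> hd H q theta inc.
pose a q := \sum_(m <- s) c m * (m q)%:R * arc_mon theta m.
have sa : \sum_q a q = 0.
  transitivity (d%:R * \sum_(m <- s) c m * arc_mon theta m); last by rewrite H // mulr0.
  rewrite /a exchange_big /= mulr_sumr.
  rewrite big_seq [RHS]big_seq; apply: eq_bigr => m ms.
  rewrite -mulr_suml -mulr_sumr -natr_sum hd //; ring.
pose b p := a (sh (n - k.-1)%N p).
have sb : \sum_p b p = 0 by rewrite -[RHS]sa [RHS](reindex_inj (@sh_inj n n0 (n - k.-1))).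
have [beta hb] := potential sb.
have hba p : beta (sh k.-1 p) - beta (sh k p) = a p.
  have := hb (sh k.-1 p); rewrite /b !shD subnKC ?sh_full; last by lia.
  by rewrite (_ : k.-1 + 1 = k)%N //; lia.
apply/eqP/negPn/negP => aq; have bq : beta (sh k.-1 q) - beta (sh k q) != 0 by rewrite hba.
have [kap kap0 hk] := arc_energy_ge n0 k2 kn inc.
have [t0 t0p ht0] := move_arc_inc beta inc.
pose G t p := ln_arc k n0 (move_arc theta beta t) p - ln_arc k n0 theta p.
pose X t (m : {ffun 'I_n -> nat}) := \sum_p (m p)%:R * G t p.
have monE t m : arc_mon (move_arc theta beta t) m = arc_mon theta m * expR (X t m).
  rewrite /arc_mon -expRD -big_split; congr expR; apply: eq_bigr => p _ /=; rewrite /G; ring.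
have sX m : small 1 (X^~ m).
  by apply: small_sum => p _; apply: small_scale; exact: small_ln_arc.
have sS : small 2 (fun t => - \sum_p a p * G t p).
  apply: (small_ext t0p (f := fun t => \sum_(m <- s) (c m * arc_mon theta m) * (expR (X t m) - 1 - X t m))); last first.
    by apply: small_sum => m _; apply: small_scale; exact: small_expR.
  move=> t ht; under eq_bigr => m _ do rewrite !mulrBr mulr1.
  rewrite !sumrB; have -> : \sum_(m <- s) c m * arc_mon theta m * expR (X t m) = 0.
    by rewrite -[RHS](H _ (ht0 t ht)); apply: eq_bigr => m _; rewrite monE mulrA.
  rewrite H // subrr sub0r; congr (- _); rewrite /X /a.
  under eq_bigr => m _ do rewrite mulr_sumr.
  under [RHS]eq_bigr => p _ do rewrite mulr_suml.
  rewrite exchange_big; apply: eq_bigr => p _; apply: eq_bigr => m _ /=; ring.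
case: sS => M [t1 [M0 t1p hM]].
pose D := kap * (beta (sh k.-1 q) - beta (sh k q)) ^+ 2.
have D0 : 0 < D by rewrite mulr_gt0 // lt_neqAle sqr_ge0 andbT eq_sym sqrf_eq0.
pose t := Num.min t0 (Num.min t1 (D / (2 * (M + 1)))).
have M1 : 0 < 2 * (M + 1) by rewrite mulr_gt0 // ltr_wpDl.
have tp : 0 < t by rewrite !lt_min t0p t1p divr_gt0.
have tt0 : 0 <= t <= t0 by rewrite ltW //= ge_min lexx.
have tt1 : 0 <= t <= t1 by rewrite ltW //= !ge_min lexx orbT.
have tD : t <= D / (2 * (M + 1)) by rewrite !ge_min lexx !orbT.
have E : t * (- \sum_p a p * G t p) = arc_energy k n0 theta (move_arc theta beta t).
  rewrite -[RHS]opprK -(ln_arc_pairing n0 k2 kn) mulrN mulr_sumr; congr (- _); apply: eq_bigr => p _.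
  by rewrite -hba /G /darc /move_arc; ring.
have := hk _ (ht0 t tt0) (sh k.-1 q); rewrite shD addn1 prednK; last exact: ltnW.
rewrite -E.
have -> : darc theta (move_arc theta beta t) (sh k q) - darc theta (move_arc theta beta t) (sh k.-1 q)
   = - (t * (beta (sh k.-1 q) - beta (sh k q))) by rewrite /darc /move_arc; ring.
rewrite sqrrN exprMn mulrCA -/D [t ^+ 2 * D]mulrC expr2 mulrA [_ * t * t]mulrC ler_pM2l // => h1.
have h2 := le_trans (ler_norm _) (hM t tt1).
have := le_trans h1 h2; rewrite expr2 mulrA ler_pM2r // => h3.
have h5 : t * (2 * (M + 1)) <= D by rewrite -ler_pdivlMr.
have h4 : 0 <= M * t by rewrite mulr_ge0 // ltW.
rewrite (_ : t * _ = 2 * (M * t) + 2 * t) in h5; last by ring.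
by move: h3 h5 h4 tp; clear; move: (M * t) => w; lra.
Qed.

(** The derivative relation for [q], minus [m1 q] times the relation itself, removes the monomial
    [m1] and multiplies the coefficient of [m] by [m q - m1 q]. A [q] at which [m] and [m1] differ
    gives [c m = 0] by induction. *)
Lemma arc_mon_indep d (s : seq {ffun 'I_n -> nat}) (c : {ffun 'I_n -> nat} -> R) : uniq s ->
  (forall m, m \in s -> \sum_q m q = d)%N ->
  (forall theta, increasing_arc theta -> \sum_(m <- s) c m * arc_mon theta m = 0) ->
  (exists theta, increasing_arc theta) -> forall m, m \in s -> c m = 0.
Proof.
elim: s c => // m1 s IH c /= /andP[m1s us] hd H ex.
have cs m : m \in s -> c m = 0.
  move=> ms; have hd' m' : m' \in s -> (\sum_q m' q = d)%N by move=> h; apply: hd; rewrite inE h orbT.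
  have [q hq] : exists q, m q != m1 q.
    apply/existsP; apply: contraNT m1s; rewrite negb_exists => /forallP h.
    by rewrite (_ : m1 = m) //; apply/ffunP => q; have := h q; rewrite negbK => /eqP.
  have : c m * ((m q)%:R - (m1 q)%:R) = 0.
    apply: (IH (fun m => c m * ((m q)%:R - (m1 q)%:R))) => // theta inc.
    have r1 := arc_relation_deriv hd H q inc; have r2 := H theta inc.
    have : \sum_(m <- m1 :: s) c m * ((m q)%:R - (m1 q)%:R) * arc_mon theta m = 0.
      rewrite (eq_bigr (fun m : {ffun 'I_n -> nat} => c m * (m q)%:R * arc_mon theta m - (m1 q)%:R * (c m * arc_mon theta m))).
        by rewrite sumrB r1 -mulr_sumr r2 mulr0 subrr.
      by move=> m' _; ring.
    by rewrite big_cons subrr mulr0 mul0r add0r.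
  by move/eqP; rewrite mulf_eq0 subr_eq0 eqr_nat (negbTE hq) orbF => /eqP.
move=> m; rewrite inE => /orP[/eqP ->|]; last exact: cs.
have [theta inc] := ex; have := H theta inc; rewrite big_cons big_seq big1 ?addr0 => [/eqP|m' /cs ->]; last by rewrite mul0r.
by rewrite mulf_eq0 [X in _ || X]gt_eqF ?expR_gt0 // orbF => /eqP.
Qed.
End ArcIndependence.

Lemma big_inj_support (T : Type) (idx : T) (op : Monoid.com_law idx) (A B : finType) (h : A -> B) (F : B -> T) :
  injective h -> (forall b, b \notin h @: [set: A] -> F b = idx) ->
  \big[op/idx]_b F b = \big[op/idx]_a F (h a).
Proof.
move=> hi hF; rewrite (bigID (mem (h @: [set: A]))) /= [X in op _ X]big1 ?Monoid.mulm1 //.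
rewrite [LHS]big_imset /=; last by move=> p q _ _; exact: hi.
by apply: eq_bigl => q; rewrite finset.in_setT.
Qed.

Section ZariskiLower.
Variables (R : realType) (n k : nat).
Hypothesis n0 : (0 < n)%N.
Hypothesis k2 : (2 <= k)%N.
Hypothesis kn : (k < n)%N.
Notation sh := (fun l => rot_ord l n0).
Implicit Types theta : 'I_n -> R.

Lemma mem_carc_set (p q : 'I_n) : reflect (exists2 c, (c < k)%N & p = sh c q) (p \in carc_set k n0 q).
Proof.
apply: (iffP imsetP) => [[c _ ->]|[c ck ->]]; first by exists c.
by exists (Ordinal ck); rewrite ?finset.in_setT.
Qed.

(** As [k < n], the start of an arc is its only element whose cyclic predecessor lies outside. *)
Lemma carc_set_inj : injective (carc_set k n0).
Proof.
move=> q q' e.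
have : q \in carc_set k n0 q' by rewrite -e; apply/mem_carc_set; exists 0%N; rewrite ?(ltn_trans _ k2) //; apply/val_inj; rewrite /= addn0 modn_small.
case/mem_carc_set=> -[|c] ck eq; first by rewrite eq; apply/val_inj; rewrite /= addn0 modn_small.
have : sh n.-1 q \in carc_set k n0 q.
  rewrite e; apply/mem_carc_set; exists c; first exact: ltnW.
  by rewrite eq shD addSn -addnS prednK // -shD sh_full.
case/mem_carc_set=> d dk ed; have : (d < n.-1)%N by rewrite (leq_trans dk) // -ltnS prednK.
move/(@rot_ord_neq n n0 q) => /(_ _)/eqP []; last by rewrite ed.
by rewrite prednK //; apply: leq_trans (leq_addl _ _).
Qed.

Definition carc_sets : {set {set 'I_n}} := carc_set k n0 @: [set: 'I_n].

Lemma complex_linear_indep (T : Type) (s : seq T) (c : T -> R[i]) (r : T -> R) :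
  \sum_(x <- s) c x * (r x)%:C%C = 0 ->
  \sum_(x <- s) complex.Re (c x) * r x = 0 /\ \sum_(x <- s) complex.Im (c x) * r x = 0.
Proof.
have e : \sum_(x <- s) c x * (r x)%:C%C = Complex (\sum_(x <- s) complex.Re (c x) * r x) (\sum_(x <- s) complex.Im (c x) * r x).
  elim: s => [|x s IH]; first by rewrite !big_nil.
  rewrite !big_cons IH; case: (c x) => a b.
  by apply/eqP; rewrite eq_complex /= !mulr0 subr0 add0r !eqxx.
by rewrite e => -[-> ->].
Qed.

(** Homogeneity extracts the scale [C ^+ d], and a complex relation on real values splits into two
    real ones, to which [arc_mon_indep] applies. *)
Lemma zar_indep_carc_sets : zar_indep (@Crit R n k (fkn k)) carc_sets.
Proof.
move=> d c hc hv; apply/ffunP => mon0; rewrite ffunE; apply/eqP; apply: contraT => c0.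
(* [M] and [N] translate between exponents indexed by sets and exponents indexed by the starts of
   intervals; on the support of [c] no information is lost. *)
pose M (mon : {ffun {set 'I_n} -> 'I_d.+1}) : {ffun 'I_n -> nat} := [ffun q => mon (carc_set k n0 q) : nat].
pose N (m : {ffun 'I_n -> nat}) : {ffun {set 'I_n} -> 'I_d.+1} :=
  [ffun I => if [pick q | carc_set k n0 q == I] is Some q then inord (m q) else ord0].
pose s0 := enum [pred mon | c mon != 0].
have s0P mon : (mon \in s0) = (c mon != 0) by rewrite mem_enum.
have out mon I : mon \in s0 -> I \notin carc_sets -> mon I = 0%N :> nat.
  rewrite s0P => /hc /andP[_ /forallP /(_ I)]; case: eqP => //= _ -> //.
have NK : {in s0, cancel M N}.
  move=> mon ms; apply/ffunP => I; rewrite ffunE; case: pickP => [q /eqP <-|h].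
    by rewrite ffunE inord_val.
  apply/val_inj; rewrite [RHS](out _ _ ms) //; apply/negP => /imsetP[q _ e].
  by have := h q; rewrite e eqxx.
have MI : {in s0 &, injective M} by exact: can_in_inj NK.
have deg m : m \in map M s0 -> (\sum_q m q = d)%N.
  case/mapP => mon ms ->; have := ms; rewrite s0P => /hc /andP[/eqP hd _]; rewrite -[RHS]hd.
  rewrite [RHS](big_inj_support _ carc_set_inj); last by move=> I; exact: out.
  by apply: eq_bigr => q _; rewrite ffunE.
have rel theta : increasing_arc theta -> \sum_(mon <- s0) c mon * (arc_mon k n0 theta (M mon))%:C%C = 0.
  move=> inc; have [P hP] := IsMeas_exists n0 (ltnW k2) kn inc.
  have [C C0 hC] := IsMeas_arc n0 (ltnW k2) kn inc hP.
  have cr : @Crit R n k (fkn k) P by exists theta; split=> //; exact: increasing_admissible.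
  have prodE mon : mon \in s0 -> \prod_I (toC P I) ^+ (mon I : nat) = (C ^+ d)%:C%C * (arc_mon k n0 theta (M mon))%:C%C.
    move=> ms; rewrite [LHS](big_inj_support _ carc_set_inj); last by move=> I /(out _ _ ms) ->; rewrite expr0.
    have -> : C ^+ d = \prod_q C ^+ M mon q by rewrite prodrXr deg ?map_f.
    rewrite -rmorphM /arc_mon expR_sum -big_split rmorph_prod; apply: eq_bigr => q _ /=.
    by rewrite /toC hC -rmorphXn exprMn ffunE expRM_natl.
  have := hv P cr; rewrite (bigID [pred mon | c mon != 0]) /= [X in _ + X]big1 ?addr0; last first.
    by move=> mon /negPn /eqP ->; rewrite mul0r.
  rewrite -big_enum /= -/s0 big_seq (eq_bigr (fun mon => (C ^+ d)%:C%C * (c mon * (arc_mon k n0 theta (M mon))%:C%C))); last first.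
    by move=> mon ms; rewrite prodE // mulrCA.
  rewrite -big_seq -mulr_sumr => /eqP; rewrite mulf_eq0 => /orP[|/eqP //].
  by rewrite (fmorph_eq0 (real_complex R)) expf_eq0 gt_eqF ?andbF.
have ex := increasing_arc_exists R n0.
have us : uniq (map M s0) by rewrite map_inj_in_uniq ?enum_uniq.
have ms0 : mon0 \in s0 by rewrite s0P.
have re : complex.Re (c mon0) = 0.
  rewrite -(NK _ ms0); apply: (arc_mon_indep k2 kn (c := fun m => complex.Re (c (N m))) us deg _ ex (map_f M ms0)) => theta inc.
  rewrite big_map big_seq; have [h _] := complex_linear_indep (rel theta inc); rewrite -[RHS]h [RHS]big_seq.
  by apply: eq_bigr => mon ms; rewrite NK.
have im : complex.Im (c mon0) = 0.
  rewrite -(NK _ ms0); apply: (arc_mon_indep k2 kn (c := fun m => complex.Im (c (N m))) us deg _ ex (map_f M ms0)) => theta inc.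
  rewrite big_map big_seq; have [_ h] := complex_linear_indep (rel theta inc); rewrite -[RHS]h [RHS]big_seq.
  by apply: eq_bigr => mon ms; rewrite NK.
by move: c0; rewrite eq_complex re im eqxx.
Qed.

Lemma zariski_lower : exists J : {set {set 'I_n}},
  [/\ J \subset ksubsets n k, #|J| = n.-1.+1 & zar_indep (@Crit R n k (fkn k)) J].
Proof.
exists carc_sets; split; last exact: zar_indep_carc_sets.
  apply/fintype.subsetP => I /imsetP[q _ ->]; rewrite finset.in_set; apply/eqP.
  exact: card_carc_set.
by rewrite card_imset ?cardsT ?card_ord ?prednK //; exact: carc_set_inj.
Qed.
End ZariskiLower.

(** * Trigonometric polynomials and the upper bound *)

Section TrigPolynomials.
Variables (R : realType) (n : nat).
Implicit Types (theta : 'I_n -> R) (f g : ('I_n -> R) -> R[i]) (m : {ffun 'I_n -> nat}).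

Definition cis (t : R) : R[i] := Complex (cos t) (sin t).

Definition cis_mon theta m : R[i] := \prod_p cis (theta p) ^+ m p.

Definition cis_prod theta : R[i] := \prod_p cis (theta p).

(* A function is a trigonometric polynomial of degree at most [D] in each angle
   when its product with [\prod_p e^(i D theta_p)] is a polynomial in the
   [e^(i theta_p)]. *)
Definition trig_poly (D : nat) f := exists s : seq (R[i] * {ffun 'I_n -> nat}),
  (forall x, x \in s -> forall p, x.2 p <= D.*2)%N /\
  forall theta, f theta * cis_prod theta ^+ D = \sum_(x <- s) x.1 * cis_mon theta x.2.

Lemma cis_neq0 t : cis t != 0.
Proof.
rewrite eq_complex /=; apply/negP => /andP[/eqP c /eqP s].
by have := cos2Dsin2 t; rewrite c s !expr0n addr0 => /esym/eqP; rewrite oner_eq0.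
Qed.

Lemma cis_prod_neq0 theta : cis_prod theta != 0.
Proof. by apply/prodf_neq0 => p _; exact: cis_neq0. Qed.

Lemma trig_poly_ext D f g : f =1 g -> trig_poly D f -> trig_poly D g.
Proof. by move=> e [s [h1 h2]]; exists s; split=> // theta; rewrite -e. Qed.

Lemma trig_poly_const D c : trig_poly D (fun _ => c).
Proof.
exists [:: (c, [ffun _ => D])]; split=> [x|theta].
  by rewrite inE => /eqP -> p; rewrite ffunE -addnn leq_addr.
by rewrite big_seq1 /cis_mon /cis_prod -prodrXl; congr (_ * _); apply: eq_bigr => p _; rewrite ffunE.
Qed.

Lemma trig_poly_add D f g : trig_poly D f -> trig_poly D g -> trig_poly D (fun theta => f theta + g theta).
Proof.
move=> [s [h1 h2]] [t [g1 g2]]; exists (s ++ t); split=> [x|theta].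
  by rewrite mem_cat => /orP[/h1|/g1].
by rewrite mulrDl h2 g2 big_cat.
Qed.

Lemma trig_poly_mul D E f g : trig_poly D f -> trig_poly E g ->
  trig_poly (D + E) (fun theta => f theta * g theta).
Proof.
move=> [s [h1 h2]] [t [g1 g2]].
pose mul (x y : R[i] * {ffun 'I_n -> nat}) : R[i] * {ffun 'I_n -> nat} :=
  (x.1 * y.1, [ffun p => x.2 p + y.2 p]%N).
exists [seq mul x y | x <- s, y <- t]; split=> [x|theta].
  by case/allpairsP => [[y z] [/= ys zt ->]] p /=; rewrite ffunE doubleD leq_add ?h1 ?g1.
rewrite exprD mulrACA h2 g2 big_allpairs_dep mulr_suml; apply: eq_bigr => x _.
rewrite mulr_sumr; apply: eq_bigr => y _ /=; rewrite mulrACA; congr (_ * _).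
by rewrite /cis_mon -big_split; apply: eq_bigr => p _ /=; rewrite ffunE exprD.
Qed.

Lemma trig_poly_sum D (I : Type) (r : seq I) (P : pred I) (f : I -> ('I_n -> R) -> R[i]) :
  (forall i, trig_poly D (f i)) -> trig_poly D (fun theta => \sum_(i <- r | P i) f i theta).
Proof.
move=> h; elim: r => [|i r IH].
  by apply: (trig_poly_ext _ (trig_poly_const D 0)) => theta; rewrite big_nil.
case Pi: (P i); last by apply: (trig_poly_ext _ IH) => theta; rewrite big_cons Pi.
by apply: (trig_poly_ext _ (trig_poly_add (h i) IH)) => theta; rewrite big_cons Pi.
Qed.

Lemma trig_poly_prod (I : Type) (r : seq I) (D : I -> nat) (f : I -> ('I_n -> R) -> R[i]) :
  (forall i, trig_poly (D i) (f i)) ->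
  trig_poly (\sum_(i <- r) D i) (fun theta => \prod_(i <- r) f i theta).
Proof.
move=> h; elim: r => [|i r IH].
  by rewrite big_nil; apply: (trig_poly_ext _ (trig_poly_const 0 1)) => theta; rewrite big_nil.
by rewrite big_cons; apply: (trig_poly_ext _ (trig_poly_mul (h i) IH)) => theta; rewrite big_cons.
Qed.

Lemma trig_poly_exp D f e : trig_poly D f -> trig_poly (e * D) (fun theta => f theta ^+ e).
Proof.
move=> h; elim: e => [|e IH]; first exact: trig_poly_const.
by rewrite mulSn; apply: (trig_poly_ext _ (trig_poly_mul h IH)) => theta; rewrite exprS.
Qed.

Lemma trig_poly_linear (q : 'I_n) (a b : R[i]) (h : R -> R) :
  (forall t, (h t)%:C%C * cis t = a * cis t ^+ 2 + b) -> trig_poly 1 (fun theta => (h (theta q))%:C%C).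
Proof.
move=> e; exists [:: (a, [ffun p => if p == q then 2 else 1]%N); (b, [ffun p => if p == q then 0 else 1]%N)].
split=> [x|theta].
  by rewrite !inE => /orP[] /eqP -> p; rewrite ffunE; case: ifP.
pose rest := \prod_(p | p != q) cis (theta p).
have e1 : cis_prod theta = cis (theta q) * rest by rewrite /cis_prod (bigD1 q).
have e2 c : cis_mon theta [ffun p => if p == q then c else 1%N] = cis (theta q) ^+ c * rest.
  rewrite /cis_mon (bigD1 q) //= ffunE eqxx; congr (_ * _).
  by apply: eq_bigr => p /negbTE pq; rewrite ffunE pq expr1.
by rewrite big_cons big_seq1 /= !e2 expr0 mul1r expr1 e1 mulrA e mulrDl -mulrA.
Qed.

Lemma trig_poly_cos (q : 'I_n) : trig_poly 1 (fun theta => (cos (theta q))%:C%C).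
Proof.
apply: (@trig_poly_linear q (2^-1)%:C%C (2^-1)%:C%C) => t.
have := cos2Dsin2 t; rewrite /cis expr2 => h; apply/eqP; rewrite eq_complex /=.
by apply/andP; split; apply/eqP; move: h; rewrite !expr2; [move=> h; lra|lra].
Qed.

Lemma trig_poly_sin (q : 'I_n) : trig_poly 1 (fun theta => (sin (theta q))%:C%C).
Proof.
apply: (@trig_poly_linear q (Complex 0 (- 2^-1)) (Complex 0 (2^-1))) => t.
have := cos2Dsin2 t; rewrite /cis expr2 => h; apply/eqP; rewrite eq_complex /=.
by apply/andP; split; apply/eqP; move: h; rewrite !expr2; [move=> h; lra|lra].
Qed.

Lemma trig_poly_coef_prod (I : Type) (r : seq I) (P : I -> ('I_n -> R) -> {poly R}) :
  (forall i j, trig_poly 1 (fun theta => ((P i theta)`_j)%:C%C)) ->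
  forall j, trig_poly (size r) (fun theta => ((\prod_(i <- r) P i theta)`_j)%:C%C).
Proof.
move=> h; elim: r => [|i r IH] j.
  by apply: (trig_poly_ext _ (trig_poly_const 0 ((j == 0)%N%:R)%:C%C)) => theta; rewrite big_nil coef1.
apply: (@trig_poly_ext _ (fun theta => \sum_(l < j.+1) ((P i theta)`_l)%:C%C * ((\prod_(i <- r) P i theta)`_(j - l))%:C%C)).
  by move=> theta; rewrite big_cons coefM rmorph_sum; apply: eq_bigr => l _; rewrite rmorphM.
by apply: trig_poly_sum => l; exact: trig_poly_mul (h i l) (IH _).
Qed.

Lemma trig_poly_det (k D : nat) (A : ('I_n -> R) -> 'M[R]_k) :
  (forall i j, trig_poly D (fun theta => (A theta i j)%:C%C)) ->
  trig_poly (k * D) (fun theta => (\det (A theta))%:C%C).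
Proof.
move=> h; apply: (@trig_poly_ext _ (fun theta => \sum_(s : 'S_k) ((-1) ^+ s)%:C%C * \prod_i (A theta i (s i))%:C%C)).
  by move=> theta; rewrite /determinant rmorph_sum; apply: eq_bigr => s _; rewrite rmorphM rmorph_prod.
apply: trig_poly_sum => s; rewrite -[(k * D)%N]add0n; apply: trig_poly_mul; first exact: trig_poly_const.
have := trig_poly_prod (index_enum 'I_k) (fun i => h i (s i)).
by rewrite sum_nat_const card_ord.
Qed.

Hypothesis n0 : (0 < n)%N.

(** Fixing the first angle at [0] makes its exponential [1], so only [n - 1] angles count, each with
    an exponent of at most twice the degree. *)
Lemma trig_poly_expand D f : trig_poly D f ->
  exists a : {ffun 'I_n.-1 -> 'I_D.*2.+1} -> R[i], forall theta, theta (Ordinal n0) = 0 ->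
    f theta * cis_prod theta ^+ D =
    \sum_m a m * \prod_i cis (theta (lift (Ordinal n0) i)) ^+ (m i : nat).
Proof.
move=> [s [h1 h2]].
pose r (x : R[i] * {ffun 'I_n -> nat}) : {ffun 'I_n.-1 -> 'I_D.*2.+1} :=
  [ffun i => inord (x.2 (lift (Ordinal n0) i))].
pose a (m : {ffun 'I_n.-1 -> 'I_D.*2.+1}) : R[i] := \sum_(x <- s | r x == m) x.1.
exists a => theta t0; rewrite {}/a.
have split0 (F : 'I_n -> R[i]) : \prod_p F p = F (Ordinal n0) * \prod_i F (lift (Ordinal n0) i).
  by move: n0 F; case: (n) => // n' n0' F; rewrite big_ord_recl (_ : Ordinal n0' = ord0) //; exact: val_inj.
rewrite h2; under [RHS]eq_bigr => m _ do rewrite mulr_suml.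
rewrite big_seq (partition_big r predT) //=; apply: eq_bigr => m _.
rewrite [RHS]big_mkcond [RHS]big_seq_cond -[RHS]big_mkcondr /=.
rewrite [RHS](eq_bigl (fun x => (x \in s) && (r x == m))); last by move=> x; rewrite andbT.
apply: eq_bigr => x /andP[xs /eqP <-]; congr (_ * _); rewrite /cis_mon split0 t0 /cis cos0 sin0.
rewrite (_ : Complex 1 0 = 1) // expr1n mul1r; apply: eq_bigr => i _.
by rewrite ffunE inordK // ltnS h1.
Qed.
End TrigPolynomials.

Lemma linear_dependence (F : fieldType) (S T : finType) (A : S -> T -> F) : (#|T| < #|S|)%N ->
  exists2 v : S -> F, (exists x, v x != 0) & forall y, \sum_x v x * A x y = 0.
Proof.
move=> TS; pose M := \matrix_(i < #|S|, j < #|T|) A (enum_val i) (enum_val j).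
have : kermx M != 0.
  rewrite -mxrank_eq0 mxrank_ker subn_eq0 -ltnNge; exact: leq_ltn_trans (rank_leq_col M) TS.
case/rowV0Pn => w /sub_kermxP wM w0.
have [i wi] : exists i, w 0 i != 0 by apply/rV0Pn.
exists (fun x => w 0 (enum_rank x)); first by exists (enum_val i); rewrite enum_valK.
move=> y; have := congr1 (fun B : 'rV_#|T| => B 0 (enum_rank y)) wM; rewrite !mxE => e; apply: etrans e.
rewrite (reindex (@enum_val S predT)); last by apply: onW_bij; exact: enum_val_bij.
by apply: eq_bigr => j _; rewrite enum_valK mxE enum_rankK.
Qed.

Section ZariskiUpper.
Variables (R : realType) (n k : nat).
Hypothesis n0 : (0 < n)%N.
Hypothesis k2 : (2 <= k)%N.
Hypothesis kn : (k < n)%N.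
Implicit Types theta : 'I_n -> R.

(** Squaring removes the absolute value. The degree comes from [k] columns of products of [k - 1]
    linear factors, doubled by the square. *)
Lemma trig_poly_form_val (I : {set 'I_n}) : #|I| = k ->
  trig_poly (2 * (k * k.-1)) (fun theta => ((form_val k n0 theta I) ^+ 2)%:C%C).
Proof.
move=> cI; rewrite /form_val; case: pselect => // h.
pose A theta := form_mx n0 theta 0 (fun i => enum_val (cast_ord (esym h) i)).
apply: (@trig_poly_ext _ _ _ (fun theta => (\det (A theta))%:C%C ^+ 2)).
  by move=> theta; rewrite -rmorphXn /= real_normK // num_real.
apply: trig_poly_exp; apply: trig_poly_det => i j.
set r := enum_val (cast_ord (esym h) j).
have := @trig_poly_coef_prod R n _ (index_enum 'I_k.-1) (fun (l : 'I_k.-1) theta =>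
  (cos (theta (rot_ord l.+1 n0 r)))%:P - sin (theta (rot_ord l.+1 n0 r)) *: 'X) _ i.
rewrite -sum1_size sum_nat_const card_ord muln1 => H; apply: trig_poly_ext (H _) => [theta|l c].
  rewrite /A mxE /form_poly -/r; congr (((polyseq _)`_i)%:C%C).
  by apply: eq_bigr => l _; rewrite subr0.
apply: (@trig_poly_ext _ _ _ (fun theta => ((c == 0)%N%:R)%:C%C * (cos (theta (rot_ord l.+1 n0 r)))%:C%C
   + (- (c == 1)%N%:R)%:C%C * (sin (theta (rot_ord l.+1 n0 r)))%:C%C)).
  move=> theta; rewrite -!rmorphM -rmorphD; congr (_%:C%C).
  by rewrite coefB coefC coefZ coefX; case: (c == 0)%N; case: (c == 1)%N => /=; ring.
apply: trig_poly_add; apply: (@trig_poly_mul _ _ 0 1); try exact: trig_poly_const.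
  exact: trig_poly_cos.
exact: trig_poly_sin.
Qed.

Lemma zariski_upper (J : {set {set 'I_n}}) : J \subset ksubsets n k ->
  zar_indep (@Crit R n k (fkn k)) J -> (#|J| <= n.-1.+1)%N.
Proof.
move=> Jk ind; rewrite prednK // leqNgt; apply/negP => nJ.
pose iota (i : 'I_n.+1) : {set 'I_n} := enum_val (widen_ord nJ i).
have iota_inj : injective iota by move=> i j /enum_val_inj /(congr1 val) /= /val_inj.
have iotaJ i : iota i \in J by exact: enum_valP.
have iotak i : #|iota i| = k.
  by apply/eqP; move: (fintype.subsetP Jk _ (iotaJ i)); rewrite finset.in_set.
pose D0 := (2 * (k * k.-1))%N.
(* There are [e.+1 ^ n] monomials in [n.+1] variables, and the trigonometric
   polynomials which they define span at most [(D0 * d).*2.+1 ^ n.-1 < e.+1 ^ n]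
   dimensions. *)
pose e := ((D0 * n).*2.+1 ^ n.-1)%N; pose d := (n * e)%N.
pose MU := {ffun 'I_n -> 'I_e.+1}.
have sumle (mu : MU) : (\sum_i mu i <= d)%N.
  rewrite (_ : d = \sum_(i < n) e)%N; last by rewrite sum_nat_const card_ord.
  by apply: leq_sum => i _; rewrite -ltnS ltn_ord.
(* The first [n] exponents are free up to [e], and the last variable fills up the total degree [d];
   this makes the relation homogeneous. *)
pose w (mu : MU) (i : 'I_n.+1) : nat := if unlift ord_max i is Some j then mu j else (d - \sum_j mu j)%N.
have sumw mu : (\sum_i w mu i = d)%N.
  rewrite big_ord_recr /= {2}/w unlift_none -[RHS](subnKC (sumle mu)); congr (_ + _)%N.
  apply: eq_bigr => i _; rewrite /w (_ : widen_ord _ i = lift ord_max i) ?liftK //.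
  by apply: val_inj; rewrite /= /bump leqNgt ltn_ord.
have sumw2 mu : (\sum_i (w mu i).*2 = d.*2)%N.
  transitivity (\sum_i w mu i).*2; last by rewrite sumw.
  by rewrite -mul2n big_distrr /=; apply: eq_bigr => i _; rewrite mul2n.
pose h i theta : R[i] := ((form_val k n0 theta (iota i)) ^+ 2)%:C%C.
have hT mu : trig_poly (D0 * d) (fun theta => \prod_i h i theta ^+ w mu i).
  have -> : (D0 * d = \sum_i w mu i * D0)%N by rewrite -big_distrl /= sumw mulnC.
  exact: (trig_poly_prod (index_enum 'I_n.+1) (fun i => trig_poly_exp (w mu i) (trig_poly_form_val (iotak i)))).
have [A hA] := boolp.choice (fun mu => trig_poly_expand n0 (hT mu)).
have [|v [mu0 v0] hv] := linear_dependence (S := MU) (T := {ffun 'I_n.-1 -> 'I_(D0 * d).*2.+1}) A.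
  rewrite !card_ffun !card_ord -[n in X in (_ < _ ^ X)%N](prednK n0) expnS.
  apply: (@leq_ltn_trans (e * e.+1 ^ n.-1)); last by rewrite ltn_pmul2r ?expn_gt0.
  rewrite /e -expnMn leq_exp2r; last by have := k2; have := kn; lia.
  rewrite -/e /d mulnA; move: (D0 * n)%N (e) => x y; nia.
(* The exponents are doubled because only the squares of the coordinates are trigonometric
   polynomials. *)
pose mon (mu : MU) : {ffun {set 'I_n} -> 'I_d.*2.+1} :=
  [ffun I => inord (if [pick i | iota i == I] is Some i then (w mu i).*2 else 0%N)].
have wle mu i : (w mu i <= d)%N by rewrite -(sumw mu) (bigD1 i) //= leq_addr.
have monE mu i : mon mu (iota i) = (w mu i).*2 :> nat.
  rewrite ffunE; case: pickP => [j /eqP /iota_inj -> |/(_ i)]; last by rewrite eqxx.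
  by rewrite inordK // ltnS leq_double.
have mon0 mu I : I \notin iota @: [set: 'I_n.+1] -> mon mu I = 0%N :> nat.
  move=> hI; rewrite ffunE; case: pickP => [j /eqP ej|_]; last by rewrite inordK.
  by case/negP: hI; rewrite -ej imset_f ?finset.in_setT.
have mon_inj : injective mon.
  move=> mu nu emn; apply/ffunP => j; apply: ord_inj.
  by have := monE mu (lift ord_max j); rewrite emn monE /w liftK => /double_inj ->.
pose c : {ffun {ffun {set 'I_n} -> 'I_d.*2.+1} -> R[i]} := [ffun m => \sum_(mu | mon mu == m) v mu].
have cmon mu : c (mon mu) = v mu by rewrite ffunE (big_pred1 mu) // => nu; rewrite (inj_eq mon_inj).
case/eqP: v0; rewrite -cmon (ind d.*2 c) ?ffunE // => [m|P].
  rewrite ffunE => cm; have [mu /eqP <-] : exists mu, mon mu == m.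
    apply/existsP; apply: contraNT cm; rewrite negb_exists => /forallP hm.
    by rewrite big_pred0 // => mu; apply/negbTE.
  apply/andP; split.
    rewrite (big_inj_support _ iota_inj); last by move=> I; exact: mon0.
    by apply/eqP; apply: etrans (sumw2 mu); apply: eq_bigr => i _; rewrite monE.
  apply/forallP => I; apply/implyP; apply: contraNT => hI; rewrite mon0 //.
  by apply: contra hI => /imsetP[i _ ->]; exact: iotaJ.
move=> /(Crit_rep n0 k2 kn) [theta [inc t0] hP].
have [C C0 hC] := IsMeas_val k2 kn inc t0 hP.
have prodE mu : \prod_I toC P I ^+ (mon mu I : nat) = (C ^+ d.*2)%:C%C * \prod_i h i theta ^+ w mu i.
  rewrite (big_inj_support _ iota_inj); last by move=> I /mon0 ->; rewrite expr0.
  have -> : C ^+ d.*2 = \prod_i C ^+ (w mu i).*2 by rewrite prodrXr sumw2.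
  rewrite rmorph_prod -big_split; apply: eq_bigr => i _ /=.
  by rewrite /h /toC hC monE -!rmorphXn -rmorphM /= exprMn -exprM mul2n.
transitivity ((C ^+ d.*2)%:C%C * \sum_mu v mu * \prod_i h i theta ^+ w mu i).
  rewrite mulr_sumr (partition_big mon predT) //=; apply: eq_bigr => m _.
  by rewrite ffunE mulr_suml; apply: eq_bigr => mu /eqP <-; rewrite prodE mulrCA.
apply/eqP; rewrite mulf_eq0; apply/orP; right.
(* Multiplication by a nonzero power of [cis_prod theta] turns the sum into a polynomial in the
   exponentials, whose coefficients vanish by the choice of [v]. *)
rewrite -(mulIr_eq0 _ (mulIf (expf_neq0 (D0 * d) (cis_prod_neq0 theta)))) mulr_suml.
apply/eqP; transitivity (\sum_mu \sum_m v mu * A mu m * \prod_i cis (theta (lift (Ordinal n0) i)) ^+ (m i : nat)).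
  by apply: eq_bigr => mu _; rewrite -mulrA hA // mulr_sumr; apply: eq_bigr => m _; rewrite mulrA.
rewrite exchange_big big1 // => m _ /=; rewrite -mulr_suml hv mul0r //.
Qed.
End ZariskiUpper.

Theorem mainTheorem1 (R : realType) (k n : nat) :
  (0 < n)%N ->
  ((2 <= k <= n.-1)%N ->
     (* theta |-> Meas(f_{k,n}, theta) is a homeomorphism Theta ~ Crit *)
     gr_homeo
       [set theta : 'I_n -> R | admissible (fkn k) theta /\
                                (forall i : 'I_n, val i = 0%N -> theta i = 0)]
       (fun theta P => IsMeas k (fkn k) theta P)
       (@Crit R n k (fkn k))
     (* Crit_{f_{k,n}} is homeomorphic to R_{>0}^{n-1} *)
     /\ (exists g : ('I_n.-1 -> R) -> ({set 'I_n} -> R),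
           gr_homeo [set x : 'I_n.-1 -> R | forall i, 0 < x i]
             (fun x P => P = g x) (@Crit R n k (fkn k)))
     (* its Zariski closure in Gr(k,n) has complex dimension n-1 *)
     /\ zariski_closure_dim k (@Crit R n k (fkn k)) n.-1)
  /\
  ((k = 1 \/ k = n)%N ->
     (* Crit_{f_{k,n}} is a single point of Gr(k,n) *)
     (exists P, @Crit R n k (fkn k) P) /\
     (forall P Q, @Crit R n k (fkn k) P -> @Crit R n k (fkn k) Q ->
        projeq (toC P) (toC Q))).
Proof.
move=> n0; split=> [/andP[k2 kn1]|].
  have kn : (k < n)%N by rewrite -(prednK n0) ltnS.
  split; first exact: Crit_homeo.
  split; first exact: Crit_orthant.
  by split; [exact: (zariski_lower R n0 k2 kn)|move=> J; exact: (zariski_upper n0 k2 kn)].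
case=> ->; last exact: Crit_full_point.
(* For [n = 1] the two extreme ranks coincide and the case [k = n] applies. *)
by have [n1|] := ltnP 1 n; [exact: Crit_one_point|case: n n0 => [|[|//]] // n0 _; exact: Crit_full_point].
Qed.
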